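(* Let $d\ge 0$, $N\ge1$ and $n_1,\dots,n_N\ge1$ be integers, and set $\nu:=d+n_1+\dots+n_N$. Let $m=(m_1,\dots,m_d)$ be positive integers, $(a_1,\dots,a_d)\in\mathbb{R}^d\setminus\{0\}$ (no $m$, $a$ being prescribed if $d=0$), $s=(s_1,\dots,s_N)\in(0,1)^N$ and $A=(A_1,\dots,A_N)\in\mathbb{R}^N\setminus\{0\}$. Let $$\Lambda:=\sum_{j=1}^d a_j\,\partial_{x_j}^{m_j}+\sum_{j=1}^N A_j\,(-\Delta_{X_j})^{s_j}$$ (the first sum being absent if $d=0$). Let $k\in\mathbb{N}$ and $f:\mathbb{R}^\nu\to\mathbb{R}$ with $f\in C^k(\overline{B_1^\nu})$. Fix $\varepsilon>0$. Then there exist $u\in C^\infty(B_1^\nu)\cap C(\mathbb{R}^\nu)$ and $R>1$ such that $$\Lambda u=0\ \text{ in } B_1^\nu,\qquad \|u-f\|_{C^k(B_1^\nu)}\le\varepsilon\qquad\text{and}\qquad u=0\ \text{ in }\mathbb{R}^\nu\setminus B_R^\nu.$$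
   Context: Points of $\mathbb{R}^\nu$ are written $(x,X)$ with $x=(x_1,\dots,x_d)\in\mathbb{R}^d$ and $X=(X_1,\dots,X_N)\in\mathbb{R}^{n_1}\times\dots\times\mathbb{R}^{n_N}$. $B_r^k$ denotes the open ball of radius $r$ centered at the origin in $\mathbb{R}^k$. The operator $(-\Delta_{X_j})^{s_j}$ is the fractional Laplacian of order $s_j$ in the variables $X_j\in\mathbb{R}^{n_j}$: $$(-\Delta_{X_j})^{s_j}u(x,X):=C(n_j,s_j)\lim_{\varrho\searrow0}\int_{\mathbb{R}^{n_j}\setminus B_\varrho^{n_j}}\frac{u(x,X_1,\dots,X_j,\dots,X_N)-u(x,X_1,\dots,X_j+Y,\dots,X_N)}{|Y|^{n_j+2s_j}}\,dY,$$ $$C(n_j,s_j):=\frac{4^{s_j}\,s_j\,\Gamma\left(\frac{n_j}2+s_j\right)}{\pi^{n_j/2}\,\Gamma(1-s_j)},$$ with $\Gamma$ Euler's Gamma function. $C^k(\overline{B_1^\nu})$ means that all derivatives of order at most $k$ in $B_1^\nu$ exist and extend continuously to $\overline{B_1^\nu}$; $\|\cdot\|_{C^k}$ is the usual norm given by the suprema of all partial derivatives of order at most $k$. *)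

(* Defs.v *)
From HB Require Import structures.
From mathcomp Require Import all_boot all_order all_algebra.
From mathcomp Require Import all_classical all_reals all_analysis.

Set Implicit Arguments.
Unset Strict Implicit.
Unset Printing Implicit Defensive.

Import Order.TTheory GRing.Theory Num.Theory.
Import numFieldNormedType.Exports.

Local Open Scope classical_set_scope.
Local Open Scope ring_scope.

(* The library's norm on ['rV[R]_n] is the sup norm, hence the explicit
   Euclidean norm. *)
Definition enorm (R : realType) (n : nat) (p : 'rV[R]_n) : R :=
  Num.sqrt (\sum_(i < n) p 0 i ^+ 2).

Definition eball (R : realType) (n : nat) (r : R) : set 'rV[R]_n :=
  [set p | enorm p < r].

Arguments eball {R} n r.

(* Lebesgue measure on R^n, carried by [n.-tuple R] (whose sigma-algebra is the
   product one): R^0 is a point of mass 1, and R^(n+1) is R * R^n. *)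
Section cons_measure.
Context (R : realType) (n : nat).
Local Notation RT := (measurableTypeR R).
Variable mu : {sigma_finite_measure set (n.-tuple RT) -> \bar R}.

Definition cons_pair (z : RT * n.-tuple RT) : n.+1.-tuple RT :=
  [the n.+1.-tuple RT of z.1 :: z.2].

Let measurable_cons_pair : measurable_fun [set: RT * n.-tuple RT] cons_pair.
Proof. exact: measurable_cons. Qed.

Definition cons_measure : set (n.+1.-tuple RT) -> \bar R :=
  pushforward (@lebesgue_measure R \x mu)%E cons_pair.

Let cons_measure0 : cons_measure set0 = 0%E.
Proof. exact: measure0. Qed.

Let cons_measure_ge0 A : (0 <= cons_measure A)%E.
Proof. exact: measure_ge0. Qed.

Let cons_measure_sigma_additive : semi_sigma_additive cons_measure.
Proof. exact: measure_semi_sigma_additive. Qed.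

HB.instance Definition _ := isMeasure.Build _ _ _ cons_measure
  cons_measure0 cons_measure_ge0 cons_measure_sigma_additive.

Let cons_measure_sigma_finite : sigma_finite setT cons_measure.
Proof.
have /sigma_finiteP[F [FT ndF Foo]] := sigma_finiteT (@lebesgue_measure R).
have /sigma_finiteP[G [GT ndG Goo]] := sigma_finiteT mu.
pose uncons (t : n.+1.-tuple RT) : RT * n.-tuple RT :=
  (thead t, [tuple of behead t]).
have uncons_cons z : uncons (cons_pair z) = z.
  by case: z => x t; congr pair; apply/val_inj.
have measurable_uncons : measurable_fun [set: n.+1.-tuple RT] uncons.
  by apply/measurable_fun_pair; [exact: measurable_tnth|exact: measurable_behead].
exists (fun k => uncons @^-1` (F k `*` G k)).
  apply/esym; rewrite -preimage_bigcup -subTset => t _ /=.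
  have [i _ Fi] : (\bigcup_i F i) (uncons t).1 by rewrite -FT.
  have [j _ Gj] : (\bigcup_i G i) (uncons t).2 by rewrite -GT.
  exists (maxn i j) => //; split.
    by move: Fi; exact/subsetPset/ndF/leq_maxl.
  by move: Gj; exact/subsetPset/ndG/leq_maxr.
move=> k; have [mF ooF] := Foo k; have [mG ooG] := Goo k.
have mFG : measurable (F k `*` G k) by exact: measurableX.
split; first by rewrite -[X in measurable X]setTI; exact: measurable_uncons.
rewrite /cons_measure /pushforward -comp_preimage.
rewrite (_ : uncons \o cons_pair = id) ?preimage_id; last first.
  by apply/funext => z /=; rewrite uncons_cons.
by rewrite product_measure1E// lte_mul_pinfty// ge0_fin_numE.
Qed.

HB.instance Definition _ := Measure_isSigmaFinite.Build _ _ _ cons_measure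
  cons_measure_sigma_finite.

End cons_measure.

Fixpoint lebesgue_tuple (R : realType) (n : nat) :
    {sigma_finite_measure set (n.-tuple (measurableTypeR R)) -> \bar R} :=
  match n with
  | 0 => (\d_ [tuple] : {sigma_finite_measure set (0.-tuple (measurableTypeR R)) -> \bar R})
  | n'.+1 => cons_measure (lebesgue_tuple R n')
  end.

Definition Gamma (R : realType) (x : R) : R :=
  \int[lebesgue_measure]_(t in `]0, +oo[) (t `^ (x - 1) * expR (- t)).

Section regularity.
Context (R : realType) (n : nat).
Implicit Types (U : set 'rV[R]_n) (g : 'rV[R]_n -> R) (l : seq 'I_n).

(* [pderiv [:: i_1; ...; i_k] g] is d_{i_1} ... d_{i_k} g. *)
Definition pderiv l g : 'rV[R]_n -> R :=
  foldr (fun i h p => 'D_(delta_mx 0 i) h p) g l.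

(* All partial derivatives of g of order at most k, in any order of
   differentiation, exist in U ('D is a total operator). *)
Definition has_pderivs U k g :=
  forall l i p, (size l < k)%N -> U p -> derivable (pderiv l g) p (delta_mx 0 i).

(* g belongs to C^k of the closure of U *)
Definition Ck_closure U k g :=
  has_pderivs U k g /\
  forall l, (size l <= k)%N ->
    exists h : 'rV[R]_n -> R,
      {within closure U, continuous h} /\ forall p, U p -> h p = pderiv l g p.

Definition Cinfty U g :=
  (forall k, has_pderivs U k g) /\
  forall l p, U p -> {for p, continuous (pderiv l g)}.

Definition mpderiv (alpha : 'I_n -> nat) g : 'rV[R]_n -> R :=
  pderiv (flatten [seq nseq (alpha i) i | i <- enum 'I_n]) g.

(* sum over the multi-indices alpha with |alpha| <= k of sup_U |d^alpha g| *)
Definition Ck_norm U (k : nat) g : \bar R :=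
  (\sum_(alpha : {ffun 'I_n -> 'I_k.+1} | (\sum_(i < n) alpha i <= k)%N)
     ereal_sup [set `|mpderiv (fun i => alpha i : nat) g p|%:E | p in U])%E.

End regularity.

(* R^nu with nu = d + n_1 + ... + n_N is ['rV[R]_(nu d n)]; the first d
   coordinates are x, and the remaining ones are X_1, ..., X_N in this order. *)
Definition nu (d N : nat) (n : 'I_N -> nat) : nat := (d + \sum_(j < N) n j)%N.

Section operator.
Context (R : realType) (d N : nat) (n : 'I_N -> nat).
Implicit Types (u : 'rV[R]_(nu d n) -> R) (p : 'rV[R]_(nu d n)).

Definition xcoord (j : 'I_d) : 'I_(nu d n) := lshift _ j.
Definition Xcoord (j : 'I_N) (i : 'I_(n j)) : 'I_(nu d n) :=
  rshift d (@tagnat.Rank N n j i).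

(* (x, X_1, ..., X_j + Y, ..., X_N) *)
Definition Xshift (j : 'I_N) p (Y : 'rV[R]_(n j)) : 'rV[R]_(nu d n) :=
  p + \sum_(i < n j) Y 0 i *: delta_mx 0 (Xcoord i).

Definition row_of_tuple k (Y : k.-tuple R) : 'rV[R]_k := \row_i tnth Y i.

Definition fracLap_const (k : nat) (s : R) : R :=
  (4 `^ s * s * Gamma (k%:R / 2 + s)) / (pi `^ (k%:R / 2) * Gamma (1 - s)).

Definition fracLap_integrand (j : 'I_N) (s : R) u p (Y : (n j).-tuple R) : R :=
  (u p - u (Xshift p (row_of_tuple Y)))
    / enorm (row_of_tuple Y) `^ ((n j)%:R + 2 * s).

Definition outside (k : nat) (rho : R) : set (k.-tuple R) :=
  [set Y | ~ eball k rho (row_of_tuple Y)].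

Definition fracLap_trunc (j : 'I_N) (s : R) u p (rho : R) : R :=
  \int[lebesgue_tuple R (n j)]_(Y in @outside (n j) rho)
    fracLap_integrand s u p Y.

(* [Rintegral] and [lim] are total: that the integrals and their limit are
   genuine is recorded by [fracLap_defined]. *)
Definition fracLap_defined (j : 'I_N) (s : R) u p : Prop :=
  (forall rho : R, 0 < rho ->
     (lebesgue_tuple R (n j)).-integrable (@outside (n j) rho)
       (EFin \o @fracLap_integrand j s u p)) /\
  cvg (@fracLap_trunc j s u p rho @[rho --> 0^'+]).

Definition fracLap (j : 'I_N) (s : R) u p : R :=
  fracLap_const (n j) s * lim (@fracLap_trunc j s u p rho @[rho --> 0^'+]).

Definition Lambda (a : 'rV[R]_d) (m : 'I_d -> nat) (A : 'rV[R]_N)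
    (s : 'I_N -> R) u p : R :=
  \sum_(j < d) a 0 j * pderiv (nseq (m j) (xcoord j)) u p
  + \sum_(j < N) A 0 j * @fracLap j (s j) u p.

End operator.

(* Main.v *)
From HB Require Import structures.
Require Import Defs.
From mathcomp Require Import all_boot all_order all_algebra.
From mathcomp Require Import all_classical all_reals all_analysis.
From mathcomp Require Import measurable_realfun ring lra zify.
Set Implicit Arguments.
Unset Strict Implicit.
Unset Printing Implicit Defensive.
Import Order.TTheory GRing.Theory Num.Theory.
Import numFieldNormedType.Exports.
Local Open Scope classical_set_scope.
Local Open Scope ring_scope.

(** Write [L] for the operator [symlap s]: a fractional Laplacian without its
    normalizing constant, as an integral of second differences.

    Reduction. Polynomials are dense in the functions that are [C^k] up to the
    boundary ([polynomial_density_closure]), so that by linearity it is enough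
    to approximate a monomial. A monomial is a monomial [x^w] in the local
    variables times a product of monomials in the blocks [X_j]. On a product
    [x^w * \prod_j h_j(X_j)], cut off in [x], the operator [Lambda] acts factor
    by factor ([sol_cut_prod]): a fractional Laplacian replaces one factor [h_j]
    by a multiple of [L h_j], and a derivative in [x] shortens the word [w]. If
    the [h_j] are harmonic and close to the monomials, then all that is left of
    [Lambda] are terms with shorter words. These are removed by induction on the
    length of [w] ([small_solution]): choose a block [J] with [A_J != 0]; when
    [f] has enough iterated preimages under [L], the equation with right-hand side
    [x^w * f(X_J) * \prod_(j != J) h_j(X_j)] has solutions that are arbitrarily
    small in [C^k]. Indeed [f = ka * L chi] for some [chi], where [chi] can be made
    small by subtracting a harmonic function close to it; the product with [chi]
    in the place of [f] is then small and solves the equation up to terms with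
    shorter words.

    All this rests on the density of [L]-harmonic functions having any number of
    preimages ([harmonic_density]), which is obtained in three steps.

    - The function [(a - |X|^2)_+ ^ s] has a constant positive image under [L]
      in the ball where it is positive ([symlap_pp_const]). On the line this is
      an explicit substitution; in several dimensions, integrating over the lines
      through [X] reduces the statement to the line.

    - Differentiating in [a] and using homogeneity, certain combinations [v_i] of
      the functions [(1 - |X|^2)_+ ^ (s + k)], [k <= i], satisfy
      [L v_i = d_i |X|^(2 i)] ([symlap_balldiff]). The maximum principle, with
      [(1 - |X|^2)_+ ^ s] as a barrier, bounds [|d_i|] from below, so that power
      series in [|X|^2] are images of convergent series in the [v_i], which are
      again analytic in [|X|^2] near [0] ([radial_preimage]): preimages exist to
      all orders.

    - The functions [(1 + eta b.X - eta^2 |X|^2)_+ ^ s] are dilated translates of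
      those above, and their image under [L] is a constant independent of [b].
      Hence their differences in [b] are harmonic. A difference of order [m],
      divided by [eta ^ m], converges to a multiple of a monomial of degree [m]
      as [eta] tends to [0], by the binomial series ([harmonic_monomial]).

    Polynomial approximation with derivatives is Bernstein's, one coordinate after
    the other: a derivative of a Bernstein polynomial is the Bernstein polynomial
    of a difference quotient ([bern_close]). *)

(** * Lebesgue measure under shifts, dilations, shears and projections *)

Section lebesgue1.
Context (R : realType).
Local Notation RT := (measurableTypeR R).
Local Notation leb := (@lebesgue_measure R).
Local Open Scope ereal_scope.

(** It suffices to compare the two measures on bounded intervals; likewise for
    the dilations below. *)
Lemma lebesgue_measure_shift (a : R) (A : set RT) : measurable A ->
  pushforward leb (fun x : RT => (x + a)%R : RT) A = leb A.
Proof.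
have ma : measurable_fun [set: RT] (fun x : RT => (x + a)%R : RT).
  exact: measurable_funD.
pose mu0 : {measure set RT -> \bar R} :=
  pushforward leb (fun x : RT => (x + a)%R : RT).
pose mu' := mu0 ma.
move=> mA; apply/esym; apply: (@lebesgue_measure_unique R mu') => //= _ [[b c]] _ <-.
rewrite /mu' /mu0 /pushforward/=.
rewrite (_ : _ @^-1` _ = `](b - a)%R, (c - a)%R]%classic).
  rewrite !lebesgue_measure_itv/= !lte_fin ltrD2r; case: ifP => // _.
  by rewrite -!EFinB; congr (_%:E); ring.
by apply/seteqP; split => x /=; rewrite !in_itv/= ltrBlDr lerBrDr.
Qed.

Lemma lebesgue_measure_scale (l : R) (A : set RT) : (0 < l)%R -> measurable A ->
  pushforward leb (fun x : RT => (l * x)%R : RT) A = (l^-1)%:E * leb A.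
Proof.
move=> l0.
have ma : measurable_fun [set: RT] (fun x : RT => (l * x)%R : RT).
  exact: measurable_funM.
pose mu0 : {measure set RT -> \bar R} :=
  pushforward leb (fun x : RT => (l * x)%R : RT).
pose mu' : {measure set RT -> \bar R} := mscale (NngNum (ltW l0)) (mu0 ma).
have mu'E B : mu' B = l%:E * pushforward leb (fun x : RT => (l * x)%R : RT) B.
  by [].
move=> mA.
suff -> : leb A = mu' A.
  by rewrite mu'E muleA -EFinM mulVf ?gt_eqF// mul1e.
apply: (@lebesgue_measure_unique R mu') => //= _ [[b c]] _ <-.
rewrite mu'E /pushforward.
rewrite (_ : _ @^-1` _ = `](l^-1 * b)%R, (l^-1 * c)%R]%classic).
  rewrite !lebesgue_measure_itv/= !lte_fin ltr_pM2l ?invr_gt0//.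
  case: ifP => _; last by rewrite mule0.
  rewrite -!EFinB -EFinM; congr (_%:E).
  by rewrite -mulrBr mulrA mulfV ?gt_eqF// mul1r.
by apply/seteqP; split => x /=; rewrite !in_itv/= ltr_pdivrMl// ler_pdivlMl.
Qed.

Lemma ge0_integral_shift (a : R) (f : RT -> \bar R) :
  measurable_fun setT f -> (forall x, 0 <= f x) ->
  \int[leb]_x f (x + a)%R = \int[leb]_x f x.
Proof.
move=> mf f0.
have ma : measurable_fun [set: RT] (fun x : RT => (x + a)%R : RT).
  exact: measurable_funD.
have := ge0_integral_pushforward ma leb measurableT mf (fun x _ => f0 x).
rewrite preimage_setT => <-.
by apply: eq_measure_integral => A mA _; exact: lebesgue_measure_shift.
Qed.

Lemma ge0_integral_scale (l : R) (f : RT -> \bar R) : l != 0%R ->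
  measurable_fun setT f -> (forall x, 0 <= f x) ->
  \int[leb]_x f (l * x)%R = (`|l|^-1)%:E * \int[leb]_x f x.
Proof.
move=> l0.
have pos (k : R) (g : RT -> \bar R) : (0 < k)%R ->
    measurable_fun setT g -> (forall x, 0 <= g x) ->
    \int[leb]_x g (k * x)%R = (k^-1)%:E * \int[leb]_x g x.
  move=> k0 mg g0.
  have ma : measurable_fun [set: RT] (fun x : RT => (k * x)%R : RT).
    exact: measurable_funM.
  have := ge0_integral_pushforward ma leb measurableT mg (fun x _ => g0 x).
  rewrite preimage_setT => <-.
  have k1 : (0 <= k^-1)%R by rewrite invr_ge0 ltW.
  rewrite -(@ge0_integral_mscale _ _ _ leb _ measurableT (NngNum k1))//.
  by apply: eq_measure_integral => A mA _; exact: lebesgue_measure_scale.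
move=> mf f0; case: (ltgtP l 0%R) l0 => // l0 _; last first.
  by rewrite pos// gtr0_norm.
have mN : measurable_fun [set: RT] (fun x : RT => (- x)%R : RT).
  exact: measurableT_comp.
have mfN : measurable_fun [set: RT] (fun x : RT => f (- x)%R).
  exact: measurableT_comp.
under eq_integral => x _ do rewrite -[(l * x)%R]opprK -mulNr.
rewrite (pos (- l)%R (fun x => f (- x)%R)) ?oppr_gt0// (ltr0_norm l0).
congr (_ * _).
have := ge0_integral_pushforward mN leb measurableT mf (fun x _ => f0 x).
rewrite preimage_setT => <-.
by apply: eq_measure_integral => A mA _; exact: lebesgue_measureN.
Qed.

End lebesgue1.

Section lebesgue_tuple.
Context (R : realType).
Local Notation RT := (measurableTypeR R).
Local Notation leb := (@lebesgue_measure R).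
Local Notation mu n := (lebesgue_tuple R n).
Local Open Scope ereal_scope.

Lemma measurable_cons_pair n :
  measurable_fun [set: RT * n.-tuple RT] (@cons_pair R n).
Proof. exact: measurable_cons. Qed.

Lemma ge0_integral_cons n (f : n.+1.-tuple RT -> \bar R) :
  measurable_fun setT f -> (forall x, 0 <= f x) ->
  \int[mu n.+1]_t f t = \int[leb]_x \int[mu n]_t f (cons_pair (x, t)).
Proof.
move=> mf f0.
have := ge0_integral_pushforward (@measurable_cons_pair n) (leb \x mu n)
  measurableT mf (fun x _ => f0 x).
rewrite preimage_setT => e.
transitivity (\int[(leb \x mu n)]_z (f \o @cons_pair R n) z).
  rewrite -e; apply: eq_measure_integral => [|?]//.
  exact: measurable_cons_pair.
rewrite fubini_tonelli1//.
  by apply: measurableT_comp => //; exact: measurable_cons_pair.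
by move=> z; exact: f0.
Qed.

Lemma ge0_integral_cons2 n (f : n.+1.-tuple RT -> \bar R) :
  measurable_fun setT f -> (forall x, 0 <= f x) ->
  \int[mu n.+1]_t f t = \int[mu n]_t \int[leb]_x f (cons_pair (x, t)).
Proof.
move=> mf f0; rewrite ge0_integral_cons//.
apply: (@fubini_tonelli _ _ _ _ _ leb (mu n) (f \o @cons_pair R n)).
  by apply: measurableT_comp => //; exact: measurable_cons_pair.
by move=> z; exact: f0.
Qed.

End lebesgue_tuple.

Section tuple_maps.
Context (R : realType).
Local Notation RT := (measurableTypeR R).
Local Notation leb := (@lebesgue_measure R).
Local Notation mu n := (lebesgue_tuple R n).

Definition tadd n (t : n.-tuple RT) (v : 'I_n -> R) : n.-tuple RT :=
  [tuple tnth t i + v i | i < n].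
Definition tscale n (l : R) (t : n.-tuple RT) : n.-tuple RT :=
  [tuple l * tnth t i | i < n].

Lemma measurable_tadd d (T : measurableType d) n (h : T -> n.-tuple RT)
    (v : T -> 'I_n -> R) :
  measurable_fun setT h -> (forall i, measurable_fun setT (v ^~ i)) ->
  measurable_fun setT (fun x => tadd (h x) (v x)).
Proof.
move=> mh mv; apply/measurable_fun_tnthP => i.
rewrite (_ : _ \o _ = fun x => tnth (h x) i + v x i); last first.
  by apply/funext => x /=; rewrite tnth_mktuple.
apply: measurable_funD => //.
by apply: (measurableT_comp (measurable_tnth i)).
Qed.

Lemma measurable_tscale d (T : measurableType d) n (l : T -> R)
    (h : T -> n.-tuple RT) :
  measurable_fun setT l -> measurable_fun setT h ->
  measurable_fun setT (fun x => tscale (l x) (h x)).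
Proof.
move=> ml mh; apply/measurable_fun_tnthP => i.
rewrite (_ : _ \o _ = fun x => l x * tnth (h x) i); last first.
  by apply/funext => x /=; rewrite tnth_mktuple.
apply: measurable_funM => //.
by apply: (measurableT_comp (measurable_tnth i)).
Qed.

Lemma tadd_cons n x (t : n.-tuple RT) v :
  tadd (cons_pair (x, t)) v =
  cons_pair (x + v ord0, tadd t (fun i => v (lift ord0 i))).
Proof.
apply: eq_from_tnth => i; rewrite tnth_mktuple.
case: (unliftP ord0 i) => [j ->|->]; last by rewrite !tnth0.
by rewrite !tnthS tnth_mktuple.
Qed.

Lemma tscale_cons n l x (t : n.-tuple RT) :
  tscale l (cons_pair (x, t)) = cons_pair (l * x, tscale l t).
Proof.
apply: eq_from_tnth => i; rewrite tnth_mktuple.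
case: (unliftP ord0 i) => [j ->|->]; last by rewrite !tnth0.
by rewrite !tnthS tnth_mktuple.
Qed.

Local Open Scope ereal_scope.

Lemma measurable_cons_comp d (T : measurableType d) n (g : T -> RT)
    (h : T -> n.-tuple RT) (f : n.+1.-tuple RT -> \bar R) :
  measurable_fun setT f -> measurable_fun setT g -> measurable_fun setT h ->
  measurable_fun setT (fun x => f (cons_pair (g x, h x))).
Proof.
move=> mf mg mh; apply: (measurableT_comp mf).
exact: (@measurable_cons _ _ T RT g n h).
Qed.

Lemma measurable_inner n (f : n.+1.-tuple RT -> \bar R) :
  measurable_fun setT f -> (forall x, 0 <= f x) ->
  measurable_fun setT (fun x : RT => \int[mu n]_t f (cons_pair (x, t))).
Proof.
move=> mf f0.
apply: (@measurable_fun_fubini_tonelli_F _ _ _ _ _ (mu n)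
  (f \o @cons_pair R n)) => //.
  by apply: measurableT_comp => //; exact: measurable_cons_pair.
by move=> z; exact: f0.
Qed.

Lemma ge0_integral_tadd n (v : 'I_n -> R) (f : n.-tuple RT -> \bar R) :
  measurable_fun setT f -> (forall x, 0 <= f x) ->
  \int[mu n]_t f (tadd t v) = \int[mu n]_t f t.
Proof.
elim: n v f => [|n IH] v f mf f0.
  by apply: eq_integral => t _; congr f; apply: eq_from_tnth => -[].
rewrite ge0_integral_cons//; last first.
  by apply: (measurableT_comp mf); exact: measurable_tadd.
under eq_integral => x _.
  under eq_integral => t _ do rewrite tadd_cons.
  rewrite (IH _ (fun t => f (cons_pair ((x + v ord0)%R, t))))//; last first.
    exact: measurable_cons_comp.
  over.
rewrite (ge0_integral_cons mf f0).
rewrite (@ge0_integral_shift _ _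
  (fun x => \int[mu n]_t f (cons_pair (x, t)))) => [//||x].
  exact: measurable_inner.
by apply: integral_ge0 => t _.
Qed.

Lemma ge0_integral_tscale n (l : R) (f : n.-tuple RT -> \bar R) : l != 0%R ->
  measurable_fun setT f -> (forall x, 0 <= f x) ->
  \int[mu n]_t f (tscale l t) = ((`|l| ^+ n)^-1)%:E * \int[mu n]_t f t.
Proof.
move=> l0; elim: n f => [|n IH] f mf f0.
  rewrite expr0 invr1 mul1e.
  by apply: eq_integral => t _; congr f; apply: eq_from_tnth => -[].
rewrite ge0_integral_cons//; last first.
  by apply: (measurableT_comp mf); exact: measurable_tscale.
under eq_integral => x _.
  under eq_integral => t _ do rewrite tscale_cons.
  rewrite (IH (fun t => f (cons_pair ((l * x)%R, t))))//; last first.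
    exact: measurable_cons_comp.
  over.
have mI := measurable_inner mf f0.
have I0 x : 0 <= \int[mu n]_t f (cons_pair (x, t)).
  by apply: integral_ge0 => t _.
have ml : measurable_fun [set: RT] (fun x : RT => (l * x)%R : RT).
  exact: measurable_funM.
rewrite ge0_integralZl//; last exact: (measurableT_comp mI ml).
rewrite (ge0_integral_scale l0 mI I0) ge0_integral_cons// muleA -EFinM.
by rewrite -invfM -exprSr.
Qed.

Lemma ge0_integral_shear1 n (l : n.-tuple RT -> R) (f : n.+1.-tuple RT -> \bar R) :
  measurable_fun setT l ->
  measurable_fun setT f -> (forall x, 0 <= f x) ->
  \int[mu n.+1]_t f (cons_pair ((thead t + l (behead_tuple t))%R, behead_tuple t))
   = \int[mu n.+1]_t f t.
Proof.
move=> ml mf f0.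
rewrite ge0_integral_cons2//; last first.
  apply: measurable_cons_comp => //; last exact: measurable_behead.
  apply: measurable_funD; first exact: measurable_tnth.
  apply: measurableT_comp => //; exact: measurable_behead.
rewrite (ge0_integral_cons2 mf f0); apply: eq_integral => t _.
rewrite -(@ge0_integral_shift _ (l t) (fun x => f (cons_pair (x, t))))//; last first.
  exact: measurable_cons_comp.
apply: eq_integral => x _.
have -> : behead_tuple (cons_pair (x, t)) = t by exact/val_inj.
by [].
Qed.

Lemma ge0_integral_shear2 n (c : 'I_n -> R) (f : n.+1.-tuple RT -> \bar R) :
  measurable_fun setT f -> (forall x, 0 <= f x) ->
  \int[mu n.+1]_t f (cons_pair (thead t,
      tadd (behead_tuple t) (fun i => thead t * c i)%R))
   = \int[mu n.+1]_t f t.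
Proof.
move=> mf f0.
rewrite ge0_integral_cons//; last first.
  apply: measurable_cons_comp => //; first exact: measurable_tnth.
  apply: measurable_tadd; first exact: measurable_behead.
  by move=> i; apply: measurable_funM => //; exact: measurable_tnth.
rewrite (ge0_integral_cons mf f0); apply: eq_integral => x _.
rewrite -(@ge0_integral_tadd _ (fun i => x * c i)%R (fun t => f (cons_pair (x, t))))//; last first.
  exact: measurable_cons_comp.
apply: eq_integral => t _.
have -> : behead_tuple (cons_pair (x, t)) = t by exact/val_inj.
by [].
Qed.

(** For fixed [t != 0] the substitution [y = t z] in the last [n] coordinates
    has Jacobian [|t| ^ n]: [z] parametrizes the lines through the origin. *)
Lemma ge0_integral_projective n (f : n.+1.-tuple RT -> \bar R) :
  measurable_fun setT f -> (forall x, 0 <= f x) ->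
  \int[mu n.+1]_t f t =
  \int[mu n]_z \int[leb]_t ((`|t| ^+ n)%:E * f (cons_pair (t, tscale t z))).
Proof.
move=> mf f0; rewrite ge0_integral_cons//.
have mg : measurable_fun setT (fun p : RT * n.-tuple RT =>
    (`|p.1| ^+ n)%:E * f (cons_pair (p.1, tscale p.1 p.2))).
  apply: emeasurable_funM.
    apply/measurable_EFinP; apply: measurable_funX.
    by apply: measurableT_comp => //; exact: measurable_fst.
  apply: measurable_cons_comp => //.
  by apply: measurable_tscale.
have g0 (p : RT * n.-tuple RT) :
    0 <= (`|p.1| ^+ n)%:E * f (cons_pair (p.1, tscale p.1 p.2)).
  by rewrite mule_ge0// lee_fin exprn_ge0.
rewrite -(@fubini_tonelli _ _ _ _ _ leb (mu n) _ mg g0).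
apply: ge0_ae_eq_integral => //.
- exact: measurable_inner.
- exact: (@measurable_fun_fubini_tonelli_F _ _ _ _ _ (mu n) _ mg).
- by move=> x _; apply: integral_ge0.
- by move=> x _; apply: integral_ge0.
exists [set 0%R]; split; [exact: measurable_set1|exact: lebesgue_measure_set1|].
move=> x /= H; apply: contrapT => /eqP x0; apply: H => _.
rewrite ge0_integralZl//; last first.
  by apply: measurable_cons_comp => //; exact: measurable_tscale.
rewrite (@ge0_integral_tscale _ _ (fun z => f (cons_pair (x, z))))//; last first.
  exact: measurable_cons_comp.
rewrite muleA -EFinM divff ?mul1e//.
by rewrite expf_neq0// normr_eq0.
Qed.

End tuple_maps.

(** * Euclidean structure and rotations *)

Section dot.
Context (R : realType) (n : nat).
Implicit Types X Y Z : 'rV[R]_n.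

Definition dotr X Y : R := \sum_(i < n) X 0 i * Y 0 i.
Definition nsq X : R := dotr X X.

Lemma dotrC X Y : dotr X Y = dotr Y X.
Proof. by apply: eq_bigr => i _; rewrite mulrC. Qed.
Lemma dotrDl X Y Z : dotr (X + Y) Z = dotr X Z + dotr Y Z.
Proof. by rewrite -big_split; apply: eq_bigr => i _; rewrite mxE mulrDl. Qed.
Lemma dotrDr X Y Z : dotr Z (X + Y) = dotr Z X + dotr Z Y.
Proof. by rewrite dotrC dotrDl !(dotrC _ Z). Qed.
Lemma dotrZl c X Y : dotr (c *: X) Y = c * dotr X Y.
Proof. by rewrite mulr_sumr; apply: eq_bigr => i _; rewrite mxE mulrA. Qed.
Lemma dotrZr c X Y : dotr X (c *: Y) = c * dotr X Y.
Proof. by rewrite dotrC dotrZl dotrC. Qed.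
Lemma dotrNr X Y : dotr X (- Y) = - dotr X Y.
Proof. by rewrite -scaleN1r dotrZr mulN1r. Qed.
Lemma dotrNl X Y : dotr (- X) Y = - dotr X Y.
Proof. by rewrite dotrC dotrNr dotrC. Qed.
Lemma dot0r X : dotr 0 X = 0.
Proof. by rewrite -(scale0r X) dotrZl mul0r. Qed.
Lemma nsqE X : nsq X = \sum_(i < n) X 0 i ^+ 2.
Proof. by apply: eq_bigr => i _; rewrite expr2. Qed.
Lemma nsq_ge0 X : 0 <= nsq X.
Proof. by rewrite nsqE; apply: sumr_ge0 => i _; rewrite sqr_ge0. Qed.
Lemma enormE X : enorm X = Num.sqrt (nsq X).
Proof. by rewrite nsqE. Qed.
Lemma enorm_ge0 X : 0 <= enorm X.
Proof. by rewrite sqrtr_ge0. Qed.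
Lemma enorm_sq X : enorm X ^+ 2 = nsq X.
Proof. by rewrite enormE sqr_sqrtr// nsq_ge0. Qed.
Lemma nsqD X Y : nsq (X + Y) = nsq X + 2 * dotr X Y + nsq Y.
Proof. by rewrite /nsq dotrDl !dotrDr (dotrC Y X); ring. Qed.
Lemma nsqN X : nsq (- X) = nsq X.
Proof. by rewrite /nsq dotrNl dotrNr opprK. Qed.
Lemma nsqB X Y : nsq (X - Y) = nsq X - 2 * dotr X Y + nsq Y.
Proof. by rewrite nsqD dotrNr nsqN; ring. Qed.
Lemma nsqZ c X : nsq (c *: X) = c ^+ 2 * nsq X.
Proof. by rewrite /nsq dotrZl dotrZr; ring. Qed.
Lemma nsq0 : nsq 0 = 0.
Proof. by rewrite /nsq dot0r. Qed.
Lemma nsq_eq0 X : (nsq X == 0) = (X == 0).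
Proof.
apply/idP/eqP => [|->]; last by rewrite nsq0.
rewrite nsqE psumr_eq0 => [/allP h|i _]; last exact: sqr_ge0.
apply/rowP => i; have := h i (mem_index_enum _).
by rewrite sqrf_eq0 mxE => /eqP.
Qed.
Lemma nsq_coord X i : X 0 i ^+ 2 <= nsq X.
Proof. by rewrite nsqE (bigD1 i)//= lerDl sumr_ge0// => j _; rewrite sqr_ge0. Qed.
Lemma coord_enorm X i : `|X 0 i| <= enorm X.
Proof. by rewrite enormE -sqrtr_sqr ler_sqrt ?nsq_coord// nsq_ge0. Qed.
Lemma enormN X : enorm (- X) = enorm X.
Proof. by rewrite !enormE nsqN. Qed.
Lemma enormZ c X : enorm (c *: X) = `|c| * enorm X.
Proof. by rewrite !enormE nsqZ sqrtrM ?sqr_ge0// sqrtr_sqr. Qed.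
Lemma enorm0 : enorm (0 : 'rV[R]_n) = 0.
Proof. by rewrite enormE nsq0 sqrtr0. Qed.

Lemma cauchy_schwarz X Y : dotr X Y ^+ 2 <= nsq X * nsq Y.
Proof.
have [->|Y0] := eqVneq Y 0; first by rewrite dotrC dot0r nsq0 mulr0 expr0n.
have Yp : 0 < nsq Y by rewrite lt_neqAle eq_sym nsq_eq0 Y0 nsq_ge0.
have := nsq_ge0 (nsq Y *: X - dotr X Y *: Y).
rewrite nsqB !nsqZ dotrZl dotrZr => h.
have {}h : 0 <= nsq Y * (nsq X * nsq Y - dotr X Y ^+ 2).
  by apply: le_trans h _; rewrite le_eqVlt; apply/orP; left; apply/eqP; ring.
by move: h; rewrite pmulr_rge0// subr_ge0.
Qed.

Lemma dotr_enorm X Y : `|dotr X Y| <= enorm X * enorm Y.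
Proof.
rewrite -sqrtr_sqr !enormE -sqrtrM ?nsq_ge0// ler_sqrt ?mulr_ge0 ?nsq_ge0//.
exact: cauchy_schwarz.
Qed.

Lemma enormD X Y : enorm (X + Y) <= enorm X + enorm Y.
Proof.
rewrite -(@ler_pXn2r _ 2)// ?nnegrE ?addr_ge0 ?enorm_ge0//.
rewrite enorm_sq nsqD sqrrD !enorm_sq.
have := dotr_enorm X Y; rewrite ler_norml => /andP[_ h]; lra.
Qed.

End dot.

Section rotation.
Context (R : realType).
Local Notation RT := (measurableTypeR R).
Local Notation mu n := (lebesgue_tuple R n).

Lemma row_of_tadd n (t : n.-tuple RT) v :
  row_of_tuple (tadd t v) = row_of_tuple t + \row_i v i.
Proof. by apply/rowP => i; rewrite !mxE tnth_mktuple. Qed.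

Lemma row_of_tscale n l (t : n.-tuple RT) :
  row_of_tuple (tscale l t) = l *: row_of_tuple t.
Proof. by apply/rowP => i; rewrite !mxE tnth_mktuple. Qed.

Lemma dotr_cons n (X : 'rV[R]_n.+1) x (t : n.-tuple RT) :
  dotr X (row_of_tuple (cons_pair (x, t))) =
  X 0 ord0 * x + dotr (\row_i X 0 (lift ord0 i)) (row_of_tuple t).
Proof.
rewrite /dotr big_ord_recl !mxE tnth0; congr (_ + _).
by apply: eq_bigr => i _; rewrite !mxE tnthS.
Qed.

Lemma nsq_cons n x (t : n.-tuple RT) :
  nsq (row_of_tuple (cons_pair (x, t))) = x ^+ 2 + nsq (row_of_tuple t).
Proof.
rewrite {1}/nsq dotr_cons mxE tnth0 expr2; congr (_ + dotr _ _).
by apply/rowP => i; rewrite !mxE tnthS.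
Qed.

Lemma nsq_recl n (X : 'rV[R]_n.+1) :
  nsq X = X 0 ord0 ^+ 2 + nsq (\row_i X 0 (lift ord0 i)).
Proof.
rewrite !nsqE big_ord_recl; congr (_ + _).
by apply: eq_bigr => i _; rewrite mxE.
Qed.

Lemma measurable_dotr n (X : 'rV[R]_n) :
  measurable_fun setT (fun t : n.-tuple RT => dotr X (row_of_tuple t)).
Proof.
rewrite /dotr; apply: measurable_sum => i; apply: measurable_funM => //.
by under eq_fun do rewrite mxE; exact: measurable_tnth.
Qed.

Definition preserving n (O : n.-tuple RT -> n.-tuple RT) :=
  measurable_fun setT O /\
  forall f : n.-tuple RT -> \bar R, measurable_fun setT f ->
    (forall x, 0 <= f x)%E ->
    (\int[mu n]_t f (O t) = \int[mu n]_t f t)%E.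

Lemma preserving_comp n (O P : n.-tuple RT -> n.-tuple RT) :
  preserving O -> preserving P -> preserving (O \o P).
Proof.
move=> [mO iO] [mP iP]; split; first exact: measurableT_comp.
move=> f mf f0 /=; rewrite (iP (f \o O))//=; first exact: iO.
exact: measurableT_comp.
Qed.

Lemma preserving_shear1 n (v : 'rV[R]_n) : preserving (fun t : n.+1.-tuple RT =>
  cons_pair (thead t + dotr v (row_of_tuple (behead_tuple t)), behead_tuple t)).
Proof.
split; last first.
  by move=> f mf f0; apply: (ge0_integral_shear1 (measurable_dotr v)).
apply: (@measurable_cons _ _ _ RT); last exact: measurable_behead.
apply: measurable_funD; first exact: measurable_tnth.
by apply: (measurableT_comp (measurable_dotr v)); exact: measurable_behead.
Qed.

Lemma preserving_shear2 n (v : 'rV[R]_n) : preserving (fun t : n.+1.-tuple RT =>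
  cons_pair (thead t, tadd (behead_tuple t) (fun i => thead t * v 0 i))).
Proof.
split; last first.
  by move=> f mf f0; apply: (ge0_integral_shear2 (fun i => v 0 i)).
apply: (@measurable_cons _ _ _ RT); first exact: measurable_tnth.
apply: measurable_tadd; first exact: measurable_behead.
by move=> i; apply: measurable_funM => //; exact: measurable_tnth.
Qed.

(** A rotation in the plane of [e_0] and a unit vector is a product of three
    shears, and a shear preserves Lebesgue measure by Fubini. *)
Lemma rotation_exists n (X : 'rV[R]_n.+1) : exists O : n.+1.-tuple RT -> n.+1.-tuple RT,
  [/\ preserving O,
      forall t, nsq (row_of_tuple (O t)) = nsq (row_of_tuple t) &
      forall t, dotr X (row_of_tuple t) = enorm X * tnth (O t) ord0].
Proof.
set X' : 'rV[R]_n := \row_i X 0 (lift ord0 i).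
have consE (t : n.+1.-tuple RT) : t = cons_pair (thead t, behead_tuple t).
  exact: tuple_eta.
have [X'0|X'0] := eqVneq X' 0.
  have dX t : dotr X (row_of_tuple t) = X 0 ord0 * tnth t ord0.
    by rewrite {1}(consE t) dotr_cons -/X' X'0 dot0r addr0.
  have eX : enorm X = `|X 0 ord0|.
    by rewrite enormE nsq_recl -/X' X'0 nsq0 addr0 sqrtr_sqr.
  have [x0|x0] := leP 0 (X 0 ord0).
    by exists id; split => // t; rewrite dX eX ger0_norm.
  exists (tscale (-1)); split.
  - split; first exact: measurable_tscale.
    move=> f mf f0; rewrite ge0_integral_tscale ?oppr_eq0 ?oner_eq0//.
    by rewrite normrN1 expr1n invr1 mul1e.
  - by move=> t; rewrite row_of_tscale scaleN1r nsqN.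
  - by move=> t; rewrite dX eX ltr0_norm// tnth_mktuple; ring.
set r := enorm X; set b := enorm X'; set x := X 0 ord0.
have r2 : r ^+ 2 = x ^+ 2 + b ^+ 2 by rewrite !enorm_sq nsq_recl.
have b0 : 0 < b.
  rewrite lt_neqAle enorm_ge0 andbT eq_sym -sqrf_eq0 enorm_sq nsq_eq0//.
have r0 : 0 < r.
  rewrite lt_neqAle enorm_ge0 andbT eq_sym -sqrf_eq0 r2.
  by rewrite paddr_eq0 ?sqr_ge0// negb_and orbC sqrf_eq0 gt_eqF.
pose w := b^-1 *: X'.
have w1 : nsq w = 1.
  by rewrite nsqZ -enorm_sq -exprMn mulVf ?expr1n ?gt_eqF.
(* the cosine and sine of the angle; [al] is minus the tangent of its half *)
pose c := x / r; pose s := - (b / r); pose al := - (1 - c) / s.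
have s0 : s != 0 by rewrite oppr_eq0 mulf_neq0 ?invr_eq0 ?gt_eqF.
have cs : c ^+ 2 + s ^+ 2 = 1.
  by rewrite sqrrN !exprMn -mulrDl -r2 exprVn divff// sqrf_eq0 gt_eqF.
pose S1 (t : n.+1.-tuple RT) : n.+1.-tuple RT :=
  cons_pair (thead t + dotr (al *: w) (row_of_tuple (behead_tuple t)), behead_tuple t).
pose S2 (t : n.+1.-tuple RT) : n.+1.-tuple RT :=
  cons_pair (thead t, tadd (behead_tuple t) (fun i => thead t * (s *: w) 0 i)).
have bE y (t : n.-tuple RT) : behead_tuple (cons_pair (y, t)) = t.
  exact: val_inj.
have S1E y t : S1 (cons_pair (y, t)) =
    cons_pair (y + al * dotr w (row_of_tuple t), t).
  by rewrite /S1 bE dotrZl.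
have rowS y : \row_i (y * (s *: w) 0 i) = (y * s) *: w.
  by apply/rowP => i; rewrite !mxE; ring.
have S2E y t : S2 (cons_pair (y, t)) =
    cons_pair (y, tadd t (fun i => y * (s *: w) 0 i)).
  by rewrite /S2 bE.
have OE y t : S1 (S2 (S1 (cons_pair (y, t)))) = cons_pair
    (c * y - s * dotr w (row_of_tuple t),
     tadd t (fun i => (y + al * dotr w (row_of_tuple t)) * (s *: w) 0 i)).
  rewrite S1E S2E S1E row_of_tadd rowS dotrDr dotrZr -/(nsq w) w1.
  congr cons_pair; congr (_, _); set d := dotr _ _.
  have h : al * s = c - 1 by rewrite /al divfK//; ring.
  have h2 : al * (1 + c) = - s.
    apply: (mulIf s0); rewrite mulrAC h.
    transitivity (c ^+ 2 - 1); first by ring.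
    by rewrite -[X in _ - X]cs; ring.
  transitivity ((1 + al * s) * y + al * (2 + al * s) * d); first by ring.
  have -> : al * (2 + al * s) = - s by rewrite h -h2; ring.
  by rewrite h; ring.
exists (S1 \o S2 \o S1); split.
- have p1 : preserving S1 by exact: preserving_shear1.
  have p2 : preserving S2 by exact: preserving_shear2.
  by apply: preserving_comp => //; apply: preserving_comp.
- move=> t; rewrite (consE t) /= OE !nsq_cons row_of_tadd rowS nsqD nsqZ w1.
  rewrite dotrZr (dotrC _ w); set d := dotr _ _; set y := thead t.
  have h : al * s = c - 1 by rewrite /al divfK//; ring.
  have -> : (y + al * d) * s = y * s + (c - 1) * d by rewrite -h; ring.
  set N := nsq _.
  transitivity (y ^+ 2 * (c ^+ 2 + s ^+ 2) + d ^+ 2 * (c ^+ 2 + s ^+ 2 - 1) + N).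
    by ring.
  by rewrite cs; ring.
- move=> t; rewrite (consE t) /= OE tnth0 dotr_cons -/X' -/x.
  have -> : X' = b *: w by rewrite scalerA divff ?gt_eqF// scale1r.
  rewrite dotrZl; set d := dotr _ _.
  have rc : r * c = x by rewrite mulrC divfK// gt_eqF.
  have rs : r * s = - b by rewrite mulrN mulrC divfK// gt_eqF.
  by rewrite -/r mulrBr (mulrA r c) (mulrA r s) rc rs mulNr opprK.
Qed.

End rotation.

(** * Integrals of powers and integrability of the kernel *)

Section power_integrals.
Context (R : realType).
Local Notation leb := (@lebesgue_measure R).

Lemma is_derive_powR (a x : R) : 0 < x ->
  is_derive x 1 (fun y : R => y `^ a) (a * x `^ (a - 1)).
Proof.
move=> x0; apply: DeriveDef.
  by apply: derivable_powR; rewrite in_itv/= x0.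
by rewrite -derive1E powR_derive1// in_itv/= x0.
Qed.

Lemma continuous_powR_pos (a x : R) : 0 < x -> {for x, continuous (fun y : R => y `^ a)}.
Proof.
move=> x0; apply: differentiable_continuous; apply/derivable1_diffP.
by apply: derivable_powR; rewrite in_itv/= x0.
Qed.

Lemma cvgy_powRN (a : R) : 0 < a -> x `^ (- a) @[x --> +oo] --> (0 : R).
Proof.
move=> a0; apply/cvgrPdist_le => e e0; near=> x.
have x0 : 0 < x by near: x; exact: nbhs_pinfty_gt.
rewrite sub0r normrN ger0_norm ?powR_ge0// powRN.
rewrite -[e]invrK lef_pV2 ?posrE ?invr_gt0// ?powR_gt0//.
have -> : e^-1 = (e^-1 `^ a^-1) `^ a.
  by rewrite -powRrM mulVf ?gt_eqF// powRr1// invr_ge0 ltW.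
apply: ge0_ler_powR; [exact: ltW|exact: powR_ge0|exact: ltW|].
by apply: ltW; near: x; exact: nbhs_pinfty_gt.
Unshelve. all: by end_near. Qed.

Lemma integral_powR_ray (a e : R) : 0 < a -> 0 < e ->
  (\int[leb]_(t in `[e, +oo[) (t `^ (- 1 - a))%:E = (e `^ (- a) / a)%:E)%E.
Proof.
move=> a0 e0; pose F (x : R) := - (a^-1 * x `^ (- a)).
have dF (x : R) : 0 < x -> is_derive x 1 F (x `^ (- 1 - a)).
  move=> x0; have h := is_derive_powR (- a) x0.
  rewrite /F; apply: is_derive_eq.
  rewrite /GRing.scale/= (_ : - a - 1 = - 1 - a); last by ring.
  by field; rewrite gt_eqF.
rewrite (@ge0_continuous_FTC2y R _ F e 0) => [||||x ex||x]; last 1 first.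
- rewrite in_itv/= andbT => ex; rewrite derive1E.
  by have h := dF x (lt_trans e0 ex); rewrite derive_val.
- by rewrite /F -EFinB sub0r opprK mulrC.
- by move=> x _; rewrite powR_ge0.
- apply/continuous_within_itvcyP; split => [x|].
    rewrite in_itv/= andbT => ex.
    by apply: continuous_powR_pos; rewrite (lt_trans e0).
  by apply: cvg_at_right_filter; exact: continuous_powR_pos.
- rewrite -[X in _ --> X]oppr0 -[X in - X](mulr0 a^-1).
  by apply: cvgN; apply: cvgMr; exact: cvgy_powRN.
- by have h := dF x (lt_trans e0 ex); exact: ex_derive.
- apply: cvg_at_right_filter; have h := dF e e0.
  by apply: differentiable_continuous; apply/derivable1_diffP; exact: ex_derive.
Qed.

Lemma integral_powR_unit (b : R) : 0 < b ->
  (\int[leb]_(t in `]0%R, 1%R]) (t `^ (b - 1))%:E <= (b^-1)%:E)%E.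
Proof.
move=> b0; pose F (x : R) := b^-1 * x `^ b.
have dF (x : R) : 0 < x -> is_derive x 1 F (x `^ (b - 1)).
  move=> x0; have h := is_derive_powR b x0.
  rewrite /F; apply: is_derive_eq.
  by rewrite /GRing.scale/= mulrA mulVf ?mul1r// gt_eqF.
pose A (k : nat) : set R := `[k.+2%:R^-1, 1%R]%classic.
have mA k : measurable (A k) by exact: measurable_itv.
have mf D : measurable_fun D (fun t : R => (t `^ (b - 1))%:E).
  by apply/measurable_EFinP; apply: measurable_funTS; exact: measurable_powR.
have -> : `]0%R, 1%R]%classic = \bigcup_k A k.
  apply/seteqP; split => x /=.
    rewrite in_itv/= => /andP[x0 x1].
    exists (Num.bound x^-1) => //; rewrite /A/= in_itv/= x1 andbT.
    rewrite invf_ple ?posrE//.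
    have h : x^-1 < (Num.bound x^-1)%:R.
      by apply: archi_boundP; rewrite invr_ge0 ltW.
    apply: ltW; apply: lt_le_trans h _.
    by rewrite ler_nat; do 2 apply: leqW.
  move=> [k _]; rewrite /A/= !in_itv/= => /andP[kx x1].
  by rewrite x1 (lt_le_trans _ kx).
have ndA : {homo A : n m / (n <= m)%N >-> (n <= m)%O}.
  move=> k l kl; apply/subsetPset => x; rewrite /A/= !in_itv/= => /andP[kx ->].
  by rewrite andbT (le_trans _ kx)// lef_pV2 ?posrE// ler_nat !ltnS.
have : ((\int[leb]_(t in A k) (t `^ (b - 1))%:E) @[k --> \oo] -->
    \int[leb]_(t in \bigcup_k A k) (t `^ (b - 1))%:E)%E.
  apply: ge0_nondecreasing_set_cvg_integral => //.
    by move=> k; exact: mf.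
  by move=> k x _; rewrite lee_fin powR_ge0.
move=> /cvg_lim <-//; apply: lime_le.
  apply: ereal_nondecreasing_is_cvgn.
  apply: ge0_nondecreasing_set_nondecreasing_integral => //.
    by move=> k; exact: mf.
  by move=> k x _; rewrite lee_fin powR_ge0.
apply: nearW => k.
have k0 : (0 : R) < k.+2%:R^-1 by [].
have k1 : k.+2%:R^-1 < (1 : R) by rewrite invf_lt1// ltr1n.
rewrite (@continuous_FTC2 _ _ F)//.
- rewrite -EFinB lee_fin /F powR1 mulr1 gerBl mulr_ge0 ?powR_ge0// invr_ge0 ltW//.
- apply/continuous_within_itvP => //; split => [x||].
  + rewrite in_itv/= => /andP[kx _]; apply: continuous_powR_pos.
    exact: lt_trans kx.
  + by apply: cvg_at_right_filter; exact: continuous_powR_pos.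
  + by apply: cvg_at_left_filter; exact: continuous_powR_pos.
- have cF x : 0 < x -> {for x, continuous F}.
    move=> x0; have h := dF x x0.
    by apply: differentiable_continuous; apply/derivable1_diffP; exact: ex_derive.
  split => [x||].
  + rewrite in_itv/= => /andP[kx _].
    by have h := dF x (lt_trans k0 kx); exact: ex_derive.
  + by apply: cvg_at_right_filter; exact: cF.
  + by apply: cvg_at_left_filter; exact: cF.
- move=> x; rewrite in_itv/= => /andP[kx _]; rewrite derive1E.
  by have h := dF x (lt_trans k0 kx); rewrite derive_val.
Qed.

Local Open Scope ereal_scope.

Lemma ge0_integral_even (f : R -> \bar R) : measurable_fun setT f ->
  (forall x, 0 <= f x) -> (forall x, f (- x)%R = f x) ->
  \int[leb]_x f x = \int[leb]_(x in `[0%R, +oo[) f x + \int[leb]_(x in `[0%R, +oo[) f x.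
Proof.
move=> mf f0 fN.
have -> : [set: R] = `]-oo, 0%R]%classic `|` `]0%R, +oo[%classic.
  by rewrite -setCitvl setUv.
rewrite ge0_integral_setU//=.
- rewrite integral_itv_obnd_cbnd//; last exact: measurable_funTS.
  rewrite [X in _ = X + _]ge0_integration_by_substitution0//.
  by under [in RHS]eq_integral do rewrite fN.
- exact: measurable_funTS.
- by apply/disj_setPS => x; rewrite /= !in_itv/= => -[a]; rewrite ltNge a.
Qed.

(** The minimum [min 1 x ^ 2] is the size of second differences: the
    integral converges at [0] since [s < 1] and at infinity since [0 < s]. *)
Lemma integral_min_powR_lty (s : R) : (0 < s < 1)%R ->
  \int[leb]_x (Num.min 1 (x ^+ 2) * (`|x| `^ (1 + 2 * s))^-1)%:E < +oo.
Proof.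
move=> /andP[s0 s1].
have mF D : measurable_fun D
    (fun x : R => (Num.min 1 (x ^+ 2) * (`|x| `^ (1 + 2 * s))^-1)%:E).
  apply/measurable_EFinP; apply: measurable_funTS; apply: measurable_funM.
    by apply: measurable_minr => //; exact: measurable_funX.
  under eq_fun do rewrite -powRN.
  by apply: (measurableT_comp (measurable_powR _)).
have F0 (x : R) : 0 <= (Num.min 1 (x ^+ 2) * (`|x| `^ (1 + 2 * s))^-1)%:E.
  by rewrite lee_fin mulr_ge0 ?invr_ge0 ?powR_ge0// le_min ler01 sqr_ge0.
rewrite ge0_integral_even//; last by move=> x; rewrite sqrrN normrN.
suff h : \int[leb]_(x in `[0%R, +oo[)
    (Num.min 1 (x ^+ 2) * (`|x| `^ (1 + 2 * s))^-1)%:E < +oo.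
  by apply: lte_add_pinfty; exact: h.
rewrite -integral_itv_obnd_cbnd//.
have -> : `]0%R, +oo[%classic = `]0%R, 1%R]%classic `|` `]1%R, +oo[%classic :> set R.
  by apply: itv_bndbnd_setU; rewrite bnd_simp.
rewrite ge0_integral_setU//; last 2 first.
- exact: mF.
- by apply/disj_setPS => x; rewrite /= !in_itv/= => -[/andP[_ a]]; rewrite andbT ltNge a.
apply: lte_add_pinfty.
  apply: (@le_lt_trans _ _ (((2 - 2 * s)^-1)%:E)); last by rewrite ltry.
  have b0 : (0 < 2 - 2 * s)%R by lra.
  apply: le_trans (integral_powR_unit b0).
  apply: ge0_le_integral => //=.
  - exact: mF.
  - by apply/measurable_EFinP; apply: measurable_funTS; exact: measurable_powR.
  - move=> x; rewrite in_itv/= => /andP[x0 x1]; rewrite lee_fin.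
    rewrite ger0_norm; last exact: ltW.
    apply: (@le_trans _ _ (x ^+ 2 * (x `^ (1 + 2 * s))^-1)%R).
      by rewrite ler_wpM2r ?invr_ge0 ?powR_ge0// ge_min lexx orbT.
    rewrite -powRN -(powR_mulrn 2 (ltW x0)) -powRD; last first.
      by apply/implyP => _; rewrite gt_eqF.
    by rewrite le_eqVlt; apply/orP; left; apply/eqP; congr (_ `^ _)%R; ring.
apply: (@le_lt_trans _ _ ((1 `^ (- (2 * s)) / (2 * s))%:E)); last by rewrite ltry.
rewrite -integral_powR_ray//; last by rewrite mulr_gt0.
rewrite -integral_itv_obnd_cbnd; last first.
  by apply/measurable_EFinP; apply: measurable_funTS; exact: measurable_powR.
apply: ge0_le_integral => //=.
- exact: mF.
- by apply/measurable_EFinP; apply: measurable_funTS; exact: measurable_powR.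
- move=> x; rewrite in_itv/= andbT => x1; rewrite lee_fin.
  rewrite ger0_norm; last by rewrite ltW// (lt_trans _ x1).
  apply: (@le_trans _ _ (1 * (x `^ (1 + 2 * s))^-1)%R).
    by rewrite ler_wpM2r ?invr_ge0 ?powR_ge0// ge_min lexx.
  by rewrite mul1r -powRN opprD.
Qed.

End power_integrals.

Section kernel.
Context (R : realType).
Local Notation RT := (measurableTypeR R).
Local Notation leb := (@lebesgue_measure R).
Local Notation mu n := (lebesgue_tuple R n).

Lemma measurable_comp_scale (l : R) (f : RT -> \bar R) : measurable_fun setT f ->
  measurable_fun setT (fun x : RT => f (l * x)%R).
Proof.
move=> mf; have ml : measurable_fun [set: RT] (fun x : RT => (l * x)%R : RT).
  exact: measurable_funM.
exact: (measurableT_comp mf ml).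
Qed.

Definition kern n (s : R) (t : n.-tuple RT) : R :=
  (enorm (row_of_tuple t) `^ (n%:R + 2 * s))^-1.
(** The dominating function of all the integrals of second differences below. *)
Definition dom n (s : R) (t : n.-tuple RT) : R :=
  Num.min 1 (nsq (row_of_tuple t)) * kern s t.

Lemma kern_ge0 n s (t : n.-tuple RT) : 0 <= kern s t.
Proof. by rewrite invr_ge0 powR_ge0. Qed.

Lemma dom_ge0 n s (t : n.-tuple RT) : 0 <= dom s t.
Proof. by rewrite mulr_ge0 ?kern_ge0// le_min ler01 nsq_ge0. Qed.

Lemma measurable_nsqD n (X : 'rV[R]_n) :
  measurable_fun setT (fun t : n.-tuple RT => nsq (X + row_of_tuple t)).
Proof.
rewrite /nsq /dotr; apply: measurable_sum => i.
under eq_fun do rewrite !mxE -expr2.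
apply: measurable_funX; apply: measurable_funD => //; exact: measurable_tnth.
Qed.

Lemma measurable_nsq n : measurable_fun setT (fun t : n.-tuple RT => nsq (row_of_tuple t)).
Proof. by have := measurable_nsqD (0 : 'rV[R]_n); under eq_fun do rewrite add0r. Qed.

Lemma measurable_enorm n : measurable_fun setT (fun t : n.-tuple RT => enorm (row_of_tuple t)).
Proof.
rewrite (_ : (fun _ => _) = fun t : n.-tuple RT => Num.sqrt (nsq (row_of_tuple t))).
  by apply: (measurableT_comp _ (@measurable_nsq n)); apply: continuous_measurable_fun;
     exact: sqrt_continuous.
by apply/funext => t; rewrite enormE.
Qed.

Lemma measurable_kern n s : measurable_fun setT (@kern n s).
Proof.
rewrite /kern; under eq_fun do rewrite -powRN.
by apply: (measurableT_comp (measurable_powR _)); exact: measurable_enorm.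
Qed.

Lemma measurable_dom n s : measurable_fun setT (@dom n s).
Proof.
apply: measurable_funM; last exact: measurable_kern.
by apply: measurable_minr => //; exact: measurable_nsq.
Qed.

Let mjap0 (c : R) (k : nat) :
  measurable_fun setT (fun x : R => (Num.sqrt (c + x) ^+ k)^-1).
Proof.
under eq_fun do rewrite -exprVn.
apply: measurable_funX.
rewrite (_ : (fun _ => _) = (fun y : R => y `^ (- 1)) \o (fun x : R => Num.sqrt (c + x))); last first.
  by apply/funext => x /=; rewrite powR_inv1// sqrtr_ge0.
apply: (measurableT_comp (measurable_powR _)).
apply: (measurableT_comp (f := @Num.sqrt R)).
  by apply: continuous_measurable_fun; exact: sqrt_continuous.
exact: measurable_funD.
Qed.

Let mjap n (c : R) (k : nat) : measurable_fun setT
  (fun z : n.-tuple RT => ((Num.sqrt (c + nsq (row_of_tuple z)) ^+ k)^-1)%:E).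
Proof.
by apply/measurable_EFinP; apply: (measurableT_comp (mjap0 c k)); exact: measurable_nsq.
Qed.

Lemma japanese_line (k : nat) (c : R) : 0 < c ->
  (\int[leb]_x ((Num.sqrt (c + x ^+ 2) ^+ k.+2)^-1)%:E <=
   (pi * (Num.sqrt c ^+ k.+1)^-1)%:E)%E.
Proof.
move=> c0; set r := Num.sqrt c.
have r0 : 0 < r by rewrite sqrtr_gt0.
have r2 : r ^+ 2 = c by rewrite sqr_sqrtr// ltW.
have mc : measurable_fun setT (fun x : R => ((oneDsqr x)^-1)%:E).
  by apply/measurable_EFinP; apply: continuous_measurable_fun; exact: continuous_oneDsqrV.
have o0 (x : R) : (0 <= ((oneDsqr x)^-1)%:E)%E.
  by rewrite lee_fin invr_ge0 ltW// oneDsqr_gt0.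
have Ipi : (\int[leb]_x ((oneDsqr x)^-1)%:E = pi%:E)%E.
  rewrite ge0_integral_even// => [|x]; last by rewrite /oneDsqr sqrrN.
  have -> := @integral0y_oneDsqr R.
  by rewrite -EFinD -splitr.
rewrite EFinM -Ipi muleC.
have rV0 : r^-1 != 0 by rewrite invr_eq0 gt_eqF.
have := ge0_integral_scale rV0 mc o0.
rewrite normrV ?unitfE ?gt_eqF// invrK gtr0_norm// => e.
have -> : ((r ^+ k.+1)^-1)%:E = (((r ^+ k.+2)^-1)%:E * r%:E)%E.
  by rewrite -EFinM [r ^+ k.+2]exprSr invfM mulfVK// gt_eqF.
rewrite -muleA -e -ge0_integralZl//; last 2 first.
- exact: (measurable_comp_scale _ mc).
- by rewrite lee_fin invr_ge0 exprn_ge0// ltW.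
apply: ge0_le_integral => //=.
- apply/measurable_EFinP; apply: (measurableT_comp (mjap0 c k.+2)).
  exact: measurable_funX.
- by apply: emeasurable_funM => //; exact: (measurable_comp_scale _ mc).
- move=> x _; rewrite -EFinM lee_fin -invfM lef_pV2 ?posrE; last 2 first.
  + by rewrite exprn_gt0// sqrtr_gt0 ltr_wpDr ?sqr_ge0.
  + by rewrite mulr_gt0 ?exprn_gt0 ?oneDsqr_gt0.
  have -> : Num.sqrt (c + x ^+ 2) = r * Num.sqrt (oneDsqr (r^-1 * x)).
    rewrite -{1}(gtr0_norm r0) -sqrtr_sqr -sqrtrM ?sqr_ge0// /oneDsqr.
    by congr Num.sqrt; rewrite -r2; field; rewrite gt_eqF.
  rewrite exprMn ler_pM2l ?exprn_gt0//.
  set o := oneDsqr _; have o1 : 1 <= o by exact: oneDsqr_ge1.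
  have so : 1 <= Num.sqrt o by rewrite -sqrtr1 ler_sqrt ?(le_trans ler01).
  rewrite -[leLHS]sqr_sqrtr ?(le_trans ler01)//.
  by rewrite ler_weXn2l.
Qed.

(** Integrating out one coordinate lowers the exponent by one
    ([japanese_line]) and leaves the same integral with [c + z ^ 2] for [c].
    It bounds the measure of the space of lines. *)
Lemma japanese_lty n : exists2 K : R, 0 <= K & forall c, 0 < c ->
  (\int[mu n]_z ((Num.sqrt (c + nsq (row_of_tuple z)) ^+ n.+1)^-1)%:E <=
   (K * (Num.sqrt c)^-1)%:E)%E.
Proof.
elim: n => [|n [K K0 IH]].
  exists 1 => // c c0; rewrite /= integral_dirac//; last exact: mjap.
  by rewrite diracT mul1e mul1r /nsq /dotr big_ord0 addr0 expr1.
exists (pi * K) => [|c c0]; first by rewrite mulr_ge0// pi_ge0.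
rewrite ge0_integral_cons2//.
have cp (t : n.-tuple RT) : 0 < c + nsq (row_of_tuple t).
  by rewrite ltr_wpDr ?nsq_ge0.
apply: (@le_trans _ _ (\int[mu n]_t (pi%:E *
    ((Num.sqrt (c + nsq (row_of_tuple t)) ^+ n.+1)^-1)%:E))%E).
  apply: ge0_le_integral => //.
  - by move=> t _; apply: integral_ge0 => x _; rewrite lee_fin invr_ge0 exprn_ge0// sqrtr_ge0.
  - apply: (@measurable_fun_fubini_tonelli_G _ _ _ _ _ leb
      ((fun z : n.+1.-tuple RT =>
        ((Num.sqrt (c + nsq (row_of_tuple z)) ^+ n.+2)^-1)%:E) \o @cons_pair R n)).
      by apply: measurableT_comp; [exact: mjap|exact: measurable_cons_pair].
    by move=> z; rewrite lee_fin invr_ge0 exprn_ge0// sqrtr_ge0.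
  - by apply: emeasurable_funM => //; exact: mjap.
  - move=> t _; rewrite -EFinM.
    under eq_integral => x _ do rewrite nsq_cons [_ ^+ 2 + _]addrC addrA.
    exact: japanese_line.
rewrite ge0_integralZl//; last 2 first.
- exact: mjap.
- by rewrite lee_fin pi_ge0.
rewrite -mulrA EFinM; apply: lee_wpmul2l; first by rewrite lee_fin pi_ge0.
exact: IH.
Qed.

Lemma kern_cons m s t (z : m.-tuple RT) :
  kern s (cons_pair (t, tscale t z)) =
  (`|Num.sqrt (1 + nsq (row_of_tuple z)) * t| `^ (m.+1%:R + 2 * s))^-1.
Proof.
rewrite /kern enormE nsq_cons row_of_tscale nsqZ; congr ((_ `^ _)^-1).
rewrite -sqrtr_sqr exprMn sqr_sqrtr; first by congr Num.sqrt; ring.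
by rewrite addr_ge0// nsq_ge0.
Qed.

Lemma nsq_cons_scale m t (z : m.-tuple RT) :
  nsq (row_of_tuple (cons_pair (t, tscale t z))) =
  (Num.sqrt (1 + nsq (row_of_tuple z)) * t) ^+ 2.
Proof.
rewrite nsq_cons row_of_tscale nsqZ exprMn sqr_sqrtr; first by ring.
by rewrite addr_ge0// nsq_ge0.
Qed.

(** The Jacobian of projective coordinates turns the kernel in dimension
    [m.+1] into the one-dimensional kernel of the same order on each line. *)
Lemma kern_line m s (r t : R) : 0 < r -> 0 < s ->
  `|t| ^+ m * (`|r * t| `^ (m.+1%:R + 2 * s))^-1 =
  (r ^+ m)^-1 * (`|r * t| `^ (1 + 2 * s))^-1.
Proof.
move=> r0 s0; have [->|t0] := eqVneq t 0.
  have p0 (p : R) : 0 < p -> `|r * 0| `^ p = 0.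
    by move=> pp; rewrite mulr0 normr0 powR0// gt_eqF.
  rewrite !p0 ?invr0 ?mulr0// ?addr_gt0 ?mulr_gt0//.
have rt : 0 < `|r * t| by rewrite normr_gt0 mulf_neq0// gt_eqF.
have -> : m.+1%:R + 2 * s = m%:R + (1 + 2 * s) by rewrite -natr1; ring.
rewrite [_ `^ (m%:R + _)]powRD; last by apply/implyP => _; rewrite gt_eqF.
rewrite powR_mulrn// normrM (gtr0_norm r0) exprMn !invfM !mulrA.
congr (_ * _).
by rewrite mulrC mulrA mulVf ?mul1r// expf_neq0// normr_eq0.
Qed.

(** On each line the integral reduces to the one-dimensional one, with a scaling
    factor that is integrable over the lines. *)
Lemma dom_lty n s : (0 < n)%N -> 0 < s < 1 -> (\int[mu n]_t (dom s t)%:E < +oo)%E.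
Proof.
case: n => // m _ s01; have /andP[s0 s1] := s01.
rewrite ge0_integral_projective; last 2 first.
- by apply/measurable_EFinP; exact: measurable_dom.
- by move=> x; rewrite lee_fin dom_ge0.
pose g (x : R) : R := Num.min 1 (x ^+ 2) * (`|x| `^ (1 + 2 * s))^-1.
have g0 x : (0 <= (g x)%:E)%E.
  by rewrite lee_fin mulr_ge0 ?invr_ge0 ?powR_ge0// le_min ler01 sqr_ge0.
have mg : measurable_fun setT (fun x : R => (g x)%:E).
  apply/measurable_EFinP; apply: measurable_funM.
    by apply: measurable_minr => //; exact: measurable_funX.
  under eq_fun do rewrite -powRN.
  by apply: (measurableT_comp (measurable_powR _)).
have := integral_min_powR_lty s01; rewrite -/g.
have : (0 <= \int[leb]_x (g x)%:E)%E by apply: integral_ge0 => x _.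
case E : (\int[leb]_x (g x)%:E)%E => [C| |]// C0 _.
have [K K0 HK] := japanese_lty m.
have inner (z : m.-tuple RT) :
    (\int[leb]_t ((`|t| ^+ m)%:E * (dom s (cons_pair (t, tscale t z)))%:E) =
     C%:E * ((Num.sqrt (1 + nsq (row_of_tuple z)) ^+ m.+1)^-1)%:E)%E.
  set r := Num.sqrt _.
  have r0 : 0 < r by rewrite sqrtr_gt0 ltr_wpDr ?nsq_ge0.
  transitivity (\int[leb]_t (((r ^+ m)^-1)%:E * (g (r * t))%:E))%E.
    apply: eq_integral => t _; rewrite -!EFinM; congr EFin.
    by rewrite /dom kern_cons nsq_cons_scale -/r mulrCA kern_line// /g mulrCA.
  rewrite ge0_integralZl//; last 2 first.
  - exact: (measurable_comp_scale _ mg).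
  - by rewrite lee_fin invr_ge0 exprn_ge0// ltW.
  rewrite (ge0_integral_scale _ mg g0) ?gt_eqF// E gtr0_norm// -!EFinM.
  by rewrite exprSr invfM; congr EFin; ring.
under eq_integral => z _ do rewrite inner.
rewrite ge0_integralZl//; last exact: mjap.
apply: (@le_lt_trans _ _ (C%:E * (K * (Num.sqrt 1)^-1)%:E)%E).
  by apply: lee_wpmul2l => //; exact: HK.
by rewrite -EFinM ltry.
Qed.

Lemma dom_integrable n s : (0 < n)%N -> 0 < s < 1 ->
  (mu n).-integrable setT (EFin \o @dom n s).
Proof.
move=> n0 s01; apply/integrableP; split.
  by apply/measurable_EFinP; exact: measurable_dom.
under eq_integral => t _ do rewrite /= ger0_norm ?dom_ge0//.
exact: dom_lty.
Qed.

End kernel.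

(** * The operator on second differences *)

Section general_integrals.
Context (R : realType).
Local Notation RT := (measurableTypeR R).
Local Notation mu n := (lebesgue_tuple R n).
Local Open Scope ereal_scope.

Lemma integral_preserving n (O : n.-tuple RT -> n.-tuple RT)
    (f : n.-tuple RT -> \bar R) :
  preserving O -> measurable_fun setT f ->
  \int[mu n]_t f (O t) = \int[mu n]_t f t.
Proof.
move=> [mO iO] mf; rewrite integralE [RHS]integralE.
congr (_ - _).
  rewrite -[RHS]iO//; last exact: measurable_funepos.
  by apply: eq_integral => t _; rewrite -[LHS]/((f \o O)^\+ t) funepos_comp.
rewrite -[RHS]iO//; last exact: measurable_funeneg.
by apply: eq_integral => t _; rewrite -[LHS]/((f \o O)^\- t) funeneg_comp.
Qed.

Lemma integral_tscale n (l : R) (f : n.-tuple RT -> \bar R) : l != 0%R ->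
  (mu n).-integrable setT f ->
  \int[mu n]_t f (tscale l t) = ((`|l| ^+ n)^-1)%:E * \int[mu n]_t f t.
Proof.
move=> l0 intf; have mf := measurable_int _ intf.
rewrite integralE [X in _ = _ * X]integralE.
have fp := integrable_fin_num measurableT (integrable_funepos measurableT intf).
have fn := integrable_fin_num measurableT (integrable_funeneg measurableT intf).
rewrite muleBr//; last exact: fin_num_adde_defr.
congr (_ - _).
  rewrite -ge0_integral_tscale//; last exact: measurable_funepos.
  by apply: eq_integral => t _; rewrite -[LHS]/((f \o tscale l)^\+ t) funepos_comp.
rewrite -ge0_integral_tscale//; last exact: measurable_funeneg.
by apply: eq_integral => t _; rewrite -[LHS]/((f \o tscale l)^\- t) funeneg_comp.
Qed.

Lemma integrable_tscale n (l : R) (f : n.-tuple RT -> \bar R) : l != 0%R ->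
  (mu n).-integrable setT f ->
  (mu n).-integrable setT (fun t => f (tscale l t)).
Proof.
move=> l0 /integrableP[mf intf]; apply/integrableP; split.
  by apply: (measurableT_comp mf); exact: measurable_tscale.
rewrite (@ge0_integral_tscale _ _ _ (fun t => `|f t|))//; last exact: measurableT_comp.
by rewrite lte_mul_pinfty// lee_fin invr_ge0 exprn_ge0.
Qed.

Lemma preserving_opp n : preserving (@tscale R n (-1)).
Proof.
split; first exact: measurable_tscale.
move=> f mf f0; rewrite ge0_integral_tscale ?oppr_eq0 ?oner_eq0//.
by rewrite normrN1 expr1n invr1 mul1e.
Qed.

End general_integrals.

Section operator_L.
Context (R : realType) (n : nat) (s : R).
Local Notation RT := (measurableTypeR R).
Local Notation mu := (lebesgue_tuple R n).
Implicit Types (phi psi : 'rV[R]_n -> R) (X Y Z : 'rV[R]_n).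

(** The measurability required by integrals over translates of [phi]. *)
Definition mfn phi :=
  forall X, measurable_fun setT (fun t : n.-tuple RT => phi (X + row_of_tuple t)).

Definition dif2 phi X (t : n.-tuple RT) : R :=
  2 * phi X - phi (X + row_of_tuple t) - phi (X - row_of_tuple t).

(** The condition under which [symlap] is an absolutely convergent integral;
    it holds at the points where [phi] is bounded and of class [C^2] nearby. *)
Definition dif2_le C phi X :=
  forall t : n.-tuple RT, `|dif2 phi X t| <= C * Num.min 1 (nsq (row_of_tuple t)).

(** The fractional Laplacian without its constant, in its absolutely convergent
    form. It agrees with the principal value by [pv_cvg]. *)
Definition symlap phi X : R := 2^-1 * \int[mu]_t (dif2 phi X t * kern s t).

Hypothesis n0 : (0 < n)%N.
Hypothesis s01 : 0 < s < 1.

Lemma row_of_opp (t : n.-tuple RT) : row_of_tuple (tscale (-1) t) = - row_of_tuple t.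
Proof. by rewrite row_of_tscale scaleN1r. Qed.

Lemma mfnN phi X : mfn phi ->
  measurable_fun setT (fun t : n.-tuple RT => phi (X - row_of_tuple t)).
Proof.
move=> mf; under eq_fun do rewrite -row_of_opp.
apply: (measurableT_comp (f := fun t : n.-tuple RT => phi (X + row_of_tuple t))) => //.
exact: measurable_tscale.
Qed.

Lemma measurable_dif2 phi X : mfn phi ->
  measurable_fun setT (fun t => dif2 phi X t * kern s t).
Proof.
move=> mf; apply: measurable_funM; last exact: measurable_kern.
by apply: measurable_funB; [apply: measurable_funB|exact: mfnN].
Qed.

Lemma dif2_le_dom C phi X t : dif2_le C phi X ->
  `|dif2 phi X t * kern s t| <= C * dom s t.
Proof.
move=> h; rewrite normrM (ger0_norm (kern_ge0 _ _)) /dom mulrA.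
by rewrite ler_wpM2r ?kern_ge0.
Qed.

Lemma integrableC C : mu.-integrable setT (EFin \o (fun t => C * dom s t)).
Proof.
rewrite (_ : _ \o _ = fun t => (C%:E * (EFin \o dom s) t)%E) //.
by apply: integrableZl => //; exact: dom_integrable.
Qed.

Lemma integrable_dif2 C phi X : mfn phi -> dif2_le C phi X ->
  mu.-integrable setT (EFin \o (fun t => dif2 phi X t * kern s t)).
Proof.
move=> mf h; apply: le_integrable (integrableC C) => //.
  by apply/measurable_EFinP; exact: measurable_dif2.
move=> t _ /=; rewrite lee_fin (le_trans (dif2_le_dom t h))//.
by rewrite ler_norm.
Qed.

Lemma mfn_lin c phi psi : mfn phi -> mfn psi -> mfn (fun X => c * phi X + psi X).
Proof.
by move=> mf mg X; apply: measurable_funD => //; apply: measurable_funM.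
Qed.

Lemma dif2_le_lin c C1 C2 phi psi X : dif2_le C1 phi X -> dif2_le C2 psi X ->
  dif2_le (`|c| * C1 + C2) (fun X => c * phi X + psi X) X.
Proof.
move=> h1 h2 t.
have -> : dif2 (fun X => c * phi X + psi X) X t = c * dif2 phi X t + dif2 psi X t.
  by rewrite /dif2; ring.
rewrite (le_trans (ler_normD _ _))// mulrDl lerD ?h2//.
by rewrite normrM -mulrA ler_wpM2l// h1.
Qed.

Lemma symlap_lin c C1 C2 phi psi X : mfn phi -> mfn psi ->
  dif2_le C1 phi X -> dif2_le C2 psi X ->
  symlap (fun X => c * phi X + psi X) X = c * symlap phi X + symlap psi X.
Proof.
move=> mf mg h1 h2; rewrite /symlap.
rewrite (_ : \int[mu]_t _ = c * \int[mu]_t (dif2 phi X t * kern s t)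
   + \int[mu]_t (dif2 psi X t * kern s t)); first by ring.
have i1 := integrable_dif2 mf h1; have i2 := integrable_dif2 mg h2.
rewrite -RintegralZl// -RintegralD//; last first.
  by apply: (integrableZl measurableT c i1).
by apply: eq_Rintegral => t _; rewrite /dif2; ring.
Qed.

Lemma dif2_translate phi X Z t : dif2 (fun Y => phi (Y - Z)) X t = dif2 phi (X - Z) t.
Proof. by rewrite /dif2 [X + _ - Z]addrAC [X - _ - Z]addrAC. Qed.

Lemma symlap_translate phi X Z : symlap (fun Y => phi (Y - Z)) X = symlap phi (X - Z).
Proof.
by rewrite /symlap; congr (_ * _); apply: eq_Rintegral => t _; rewrite dif2_translate.
Qed.

Lemma mfn_translate phi Z : mfn phi -> mfn (fun Y => phi (Y - Z)).
Proof. by move=> mf X; under eq_fun do rewrite addrAC; exact: mf. Qed.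

Lemma dif2_dilate l phi X t :
  dif2 (fun Y => phi (l *: Y)) X t = dif2 phi (l *: X) (tscale l t).
Proof. by rewrite /dif2 row_of_tscale scalerDr scalerBr. Qed.

Lemma dif2_le_dilate l C phi X : dif2_le C phi (l *: X) ->
  dif2_le (`|C| * (1 + l ^+ 2)) (fun Y => phi (l *: Y)) X.
Proof.
move=> h t; rewrite dif2_dilate (le_trans (h _))// row_of_tscale nsqZ.
apply: (@le_trans _ _ (`|C| * Num.min 1 (l ^+ 2 * nsq (row_of_tuple t)))).
  rewrite ler_wpM2r ?ler_norm// le_min ler01 mulr_ge0 ?sqr_ge0 ?nsq_ge0//.
rewrite -[leRHS]mulrA ler_wpM2l//.
have l2 := sqr_ge0 l; have N0 := nsq_ge0 (row_of_tuple t).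
case: (leP 1 (nsq (row_of_tuple t))) => N1.
  by rewrite mulr1 ge_min lerDl l2.
by rewrite ge_min mulrDl mul1r lerDr N0 orbT.
Qed.

Lemma mfn_dilate l phi : mfn phi -> mfn (fun Y => phi (l *: Y)).
Proof.
move=> mf X; under eq_fun do rewrite scalerDr -row_of_tscale.
apply: (measurableT_comp (f := fun t : n.-tuple RT => phi (l *: X + row_of_tuple t))) => //.
exact: measurable_tscale.
Qed.

Lemma symlap_dilate l C phi X : 0 < l -> mfn phi -> dif2_le C phi (l *: X) ->
  symlap (fun Y => phi (l *: Y)) X = l `^ (2 * s) * symlap phi (l *: X).
Proof.
move=> l0 mf h; rewrite /symlap mulrCA; congr (_ * _).
have i1 := integrable_dif2 mf h.
have kE (t : n.-tuple RT) : kern s t = l `^ (n%:R + 2 * s) * kern s (tscale l t).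
  rewrite /kern row_of_tscale enormZ (gtr0_norm l0) powRM ?enorm_ge0 ?ltW// invfM.
  by rewrite mulrA divff ?mul1r// gt_eqF// powR_gt0.
transitivity (\int[mu]_t (l `^ (n%:R + 2 * s) *
    (dif2 phi (l *: X) (tscale l t) * kern s (tscale l t)))).
  by apply: eq_Rintegral => t _; rewrite dif2_dilate (kE t); ring.
have lN0 : l != 0 by rewrite gt_eqF.
have e := integral_tscale lN0 i1.
have i2 := integrable_tscale lN0 i1.
rewrite (@RintegralZl _ _ _ _ setT (fun t : n.-tuple RT =>
  dif2 phi (l *: X) (tscale l t) * kern s (tscale l t)) _ measurableT i2).
have -> : \int[mu]_t (dif2 phi (l *: X) (tscale l t) * kern s (tscale l t)) =
    (`|l| ^+ n)^-1 * \int[mu]_t (dif2 phi (l *: X) t * kern s t).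
  rewrite {1}/Rintegral; have -> := e.
  by rewrite fineM//; exact: integrable_fin_num.
rewrite mulrA; congr (_ * _) => /=.
rewrite (gtr0_norm l0) powRD; last by apply/implyP => _.
by rewrite powR_mulrn ?ltW// mulrAC divff ?mul1r// expf_neq0.
Qed.

(** At a global minimum all second differences have the same sign: the nonlocal
    form of the second derivative test. *)
Lemma symlap_le0 phi X : (forall Y, phi X <= phi Y) -> symlap phi X <= 0.
Proof.
move=> h; rewrite /symlap pmulr_rle0//.
rewrite /Rintegral fine_le0//.
have := @integral_ge0N _ _ _ mu setT
  (fun t => (- (dif2 phi X t) * kern s t)%:E).
under eq_integral => t _ do rewrite -EFinN mulNr opprK.
move=> ->; last first.
  move=> t _; rewrite lee_fin mulr_ge0 ?kern_ge0// oppr_ge0.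
  by rewrite /dif2; have := h (X + row_of_tuple t); have := h (X - row_of_tuple t); lra.
rewrite oppe_le0; apply: integral_ge0 => t _.
rewrite lee_fin mulr_ge0 ?kern_ge0// oppr_ge0.
by rewrite /dif2; have := h (X + row_of_tuple t); have := h (X - row_of_tuple t); lra.
Qed.

Lemma symlap_cvg C (phi_ : nat -> 'rV[R]_n -> R) phi X :
  (forall k, mfn (phi_ k)) -> mfn phi ->
  (forall k, dif2_le C (phi_ k) X) ->
  (forall Y, phi_ k Y @[k --> \oo] --> phi Y) ->
  symlap (phi_ k) X @[k --> \oo] --> symlap phi X.
Proof.
move=> mf_ mf h cv.
apply: cvgMr.
have D2phi : dif2_le C phi X.
  move=> t.
  have : `|dif2 (phi_ k) X t| @[k --> \oo] --> `|dif2 phi X t|.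
    apply: cvg_norm; apply: cvgB; last exact: cv.
    by apply: cvgB; [apply: cvgMr; exact: cv|exact: cv].
  move=> /cvg_lim <-//; apply: limr_le.
    apply/cvg_ex; exists `|dif2 phi X t|.
    apply: cvg_norm; apply: cvgB; last exact: cv.
    by apply: cvgB; [apply: cvgMr; exact: cv|exact: cv].
  by apply: nearW => k; exact: h.
have [] := @dominated_convergence _ _ _ mu setT measurableT
  (fun k t => (dif2 (phi_ k) X t * kern s t)%:E)
  (fun t => (dif2 phi X t * kern s t)%:E) (fun t => (C * dom s t)%:E).
- by move=> k; apply/measurable_EFinP; exact: measurable_dif2.
- by apply/measurable_EFinP; exact: measurable_dif2.
- apply: aeW => t _; apply: cvg_EFin; first exact: nearW.
  apply: cvgMl; apply: cvgB; last exact: cv.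
  by apply: cvgB; [apply: cvgMr; exact: cv|exact: cv].
- exact: integrableC.
- by apply: aeW => t k _; rewrite lee_fin; exact: dif2_le_dom.
move=> i _ h1; apply: fine_cvg; rewrite /Rintegral fineK//.
exact: (integrable_fin_num measurableT i).
Qed.

End operator_L.

(** Rotating the integration variable moves [X] to [enorm X *: e_0]. *)
Lemma symlap_radial (R : realType) n (s : R) (g : R -> R) (X Y : 'rV[R]_n) :
  (0 < n)%N -> mfn (fun Z : 'rV[R]_n => g (nsq Z)) ->
  nsq X = nsq Y -> symlap s (fun Z => g (nsq Z)) X = symlap s (fun Z => g (nsq Z)) Y.
Proof.
case: n X Y => // m X Y _ mf XY.
pose h r2 r (t : m.+1.-tuple (measurableTypeR R)) :=
  (2 * g r2 - g (r2 + 2 * (r * tnth t ord0) + nsq (row_of_tuple t))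
   - g (r2 - 2 * (r * tnth t ord0) + nsq (row_of_tuple t))) * kern s t.
suff rad Z : \int[lebesgue_tuple R m.+1]_t (dif2 (fun Z => g (nsq Z)) Z t * kern s t) =
    \int[lebesgue_tuple R m.+1]_t h (nsq Z) (enorm Z) t.
  by rewrite /symlap !rad !enormE XY.
have [Q [pO O1 O2]] := rotation_exists Z.
pose E0 : 'rV[R]_m.+1 := enorm Z *: delta_mx 0 ord0.
have d0 (W : 'rV[R]_m.+1) : dotr (delta_mx 0 ord0) W = W 0 ord0.
  rewrite /dotr (bigD1 ord0)//= mxE !eqxx mul1r.
  by rewrite big1 ?addr0// => i i0; rewrite !mxE (negbTE i0) andbF mul0r.
have dE (t : m.+1.-tuple R) : dotr E0 (row_of_tuple t) = enorm Z * tnth t ord0.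
  by rewrite dotrZl d0 mxE.
have nE0 : nsq E0 = nsq Z.
  by rewrite nsqZ enorm_sq /nsq d0 mxE !eqxx mulr1.
have mh : measurable_fun setT (fun t => (h (nsq Z) (enorm Z) t)%:E).
  have : measurable_fun setT (fun t => (dif2 (fun Z => g (nsq Z)) E0 t * kern s t)%:E).
    by apply/measurable_EFinP; exact: measurable_dif2.
  apply: eq_measurable_fun => t _.
  by rewrite /h /dif2 nsqD nsqB nE0 dE.
rewrite /Rintegral; congr fine.
rewrite -(integral_preserving pO mh).
apply: eq_integral => t _; congr EFin.
by rewrite /h /dif2 nsqD nsqB /kern !enormE O1 O2 -!enormE.
Qed.

(** * Second differences of radial functions and of powers *)

Section taylor2.
Context (R : realType).

Lemma taylor2_bound (g g1 g2 : R -> R) (lo hi M2 : R) :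
  (forall y, lo <= y <= hi -> is_derive y 1 g (g1 y)) ->
  (forall y, lo <= y <= hi -> is_derive y 1 g1 (g2 y)) ->
  (forall y, lo <= y <= hi -> `|g2 y| <= M2) ->
  forall x y, lo <= x <= hi -> lo <= y <= hi ->
    `|g y - g x - g1 x * (y - x)| <= M2 * (y - x) ^+ 2.
Proof.
move=> d1 d2 b2 x y hx hy.
have M20 : 0 <= M2 by apply: le_trans (b2 x hx).
have cont (f f1 : R -> R) a b : lo <= a <= hi -> lo <= b <= hi ->
    (forall y, lo <= y <= hi -> is_derive y 1 f (f1 y)) ->
    {within `[a, b], continuous f}.
  move=> ha hb df; apply: derivable_within_continuous => z.
  rewrite in_itv/= => /andP[az zb].
  have zz : lo <= z <= hi by apply/andP; split; lra.
  have h := df z zz; exact: ex_derive.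
have mvt (f f1 : R -> R) a b : lo <= a <= hi -> lo <= b <= hi ->
    (forall y, lo <= y <= hi -> is_derive y 1 f (f1 y)) ->
    exists c, [/\ lo <= c <= hi, `|c - a| <= `|b - a| & f b - f a = f1 c * (b - a)].
  move=> ha hb df; have [ab|ba|<-] := ltgtP a b; last first.
  - by exists a; split => //; rewrite !subrr mulr0.
  - have [||c] := @MVT _ f f1 b a ba.
    + move=> z; rewrite in_itv/= => /andP[az zb]; apply: df; apply/andP; split; lra.
    + exact: cont.
    rewrite in_itv/= => /andP[bc ca] e; exists c; split.
    + by apply/andP; split; lra.
    + by rewrite !ltr0_norm ?subr_lt0//; lra.
    + by rewrite -opprB e; ring.
  - have [||c] := @MVT _ f f1 a b ab.
    + move=> z; rewrite in_itv/= => /andP[az zb]; apply: df; apply/andP; split; lra.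
    + exact: cont.
    rewrite in_itv/= => /andP[bc ca] e; exists c; split => //.
    + by apply/andP; split; lra.
    + by rewrite !gtr0_norm ?subr_gt0//; lra.
have [c [hc cx ->]] := mvt g g1 x y hx hy d1.
have [e [he _ e2]] := mvt g1 g2 x c hx hc d2.
rewrite -mulrBl e2 normrM -real_normK ?num_real// expr2 mulrA.
rewrite ler_wpM2r// normrM; apply: ler_pM => //; exact: b2.
Qed.

(** Second differences of a function of the squared distance: the first order
    terms cancel up to [q], the second order ones are [O(q)] by Cauchy-Schwarz. *)
Lemma radial_dif2_bound (g g1 g2 : R -> R) (tau hi r M M1 M2 : R) :
  0 <= tau -> 0 < r <= 1 -> tau + 2 * Num.sqrt tau * r + r ^+ 2 <= hi ->
  (forall y, 0 <= y <= hi -> is_derive y 1 g (g1 y)) ->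
  (forall y, 0 <= y <= hi -> is_derive y 1 g1 (g2 y)) ->
  (forall y, 0 <= y -> `|g y| <= M) ->
  (forall y, 0 <= y <= hi -> `|g1 y| <= M1) ->
  (forall y, 0 <= y <= hi -> `|g2 y| <= M2) ->
  forall P q, P ^+ 2 <= tau * q -> 0 <= q ->
  `|2 * g tau - g (tau + 2 * P + q) - g (tau - 2 * P + q)| <=
    (2 * M1 + M2 * (8 * tau + 2) + 4 * M * r ^- 2) * Num.min 1 q.
Proof.
move=> t0 /andP[r0 r1] hhi d1 d2 b0 b1 b2 P q Pq q0.
have st0 := sqrtr_ge0 tau; have st2 : Num.sqrt tau ^+ 2 = tau by exact: sqr_sqrtr.
set st := Num.sqrt tau in hhi st0 st2.
have htau : 0 <= tau <= hi.
  rewrite t0/= (le_trans _ hhi)// -addrA lerDl addr_ge0 ?sqr_ge0// !mulr_ge0// ltW//.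
have M0 : 0 <= M by apply: le_trans (b0 tau t0).
have M10 : 0 <= M1 by apply: le_trans (b1 tau htau).
have M20 : 0 <= M2 by apply: le_trans (b2 tau htau).
have sq0 := sqrtr_ge0 q; have sq2 : Num.sqrt q ^+ 2 = q by exact: sqr_sqrtr.
set sq := Num.sqrt q in sq0 sq2.
have Pst : `|P| <= st * sq.
  rewrite -(@ler_pXn2r _ 2)// ?nnegrE ?mulr_ge0//.
  by rewrite exprMn st2 sq2 -normrX ger0_norm ?sqr_ge0.
have P1 : P <= st * sq := le_trans (ler_norm _) Pst.
have P2 : - P <= st * sq by rewrite (le_trans _ Pst)// -normrN ler_norm.
have y1 : 0 <= tau + 2 * P + q.
  by rewrite -st2 -sq2; apply: le_trans (sqr_ge0 (st - sq)) _; rewrite sqrrB; lra.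
have y2 : 0 <= tau - 2 * P + q.
  by rewrite -st2 -sq2; apply: le_trans (sqr_ge0 (st - sq)) _; rewrite sqrrB; lra.
have rr : 0 < r ^- 2 by rewrite invr_gt0 exprn_gt0.
have [qr|qr] := leP q (r ^+ 2); last first.
  apply: (@le_trans _ _ (4 * M * r ^- 2 * Num.min 1 q)); last first.
    rewrite ler_wpM2r ?le_min ?ler01// lerDr addr_ge0// mulr_ge0//.
    by rewrite addr_ge0// mulr_ge0.
  apply: (@le_trans _ _ (4 * M)).
    have := b0 _ t0; have := b0 _ y1; have := b0 _ y2.
    rewrite !ler_norml => /andP[? ?] /andP[? ?] /andP[? ?]; apply/andP; split; lra.
  rewrite -mulrA -[leLHS]mulr1 ler_wpM2l// ?mulr_ge0//.
  rewrite ler_pdivlMl ?exprn_gt0// mulr1 le_min (ltW qr) andbT.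
  by rewrite expr_le1// ltW.
have q1 : q <= 1 by rewrite (le_trans qr)// expr_le1// ltW.
have -> : Num.min 1 q = q by apply/min_idPr.
have sqr : sq <= r by rewrite -(@ler_pXn2r _ 2)// ?nnegrE ?(ltW r0)// sq2.
have stsq : st * sq <= st * r by rewrite ler_wpM2l.
have h1 : 0 <= tau + 2 * P + q <= hi by apply/andP; split => //; lra.
have h2 : 0 <= tau - 2 * P + q <= hi by apply/andP; split => //; lra.
have e1 := taylor2_bound d1 d2 b2 htau h1.
have e2 := taylor2_bound d1 d2 b2 htau h2.
set A := g _ - g _ - _ in e1; set B := g _ - g _ - _ in e2.
have -> : 2 * g tau - g (tau + 2 * P + q) - g (tau - 2 * P + q) =
   - (A + B + 2 * g1 tau * q) by rewrite /A /B; ring.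
rewrite normrN (le_trans (ler_normD _ _))//.
rewrite (le_trans (lerD (ler_normD _ _) (lexx _)))//.
rewrite (le_trans (lerD (lerD e1 e2) (lexx _)))//.
rewrite !normrM (ger0_norm q0) (@ger0_norm _ 2)//.
have g1b := b1 _ htau.
apply: (@le_trans _ _ (M2 * (8 * (tau * q) + 2 * q) + 2 * M1 * q)).
  rewrite lerD//; last by rewrite ler_wpM2r// ler_wpM2l.
  rewrite -mulrDr ler_wpM2l//.
  have qq : q ^+ 2 <= q by rewrite expr2 -[leRHS]mul1r ler_wpM2r.
  rewrite (_ : _ + _ = 8 * P ^+ 2 + 2 * q ^+ 2); first by lra.
  ring.
have : 0 <= 4 * M * r ^- 2 * q by rewrite !mulr_ge0// ltW.
lra.
Qed.

End taylor2.

Section pospower.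
Context (R : realType).

(** The power [y_+ ^ p], so that [pp p (a - nsq X)] vanishes outside a ball. *)
Definition pp (p y : R) : R := Num.max 0 y `^ p.

Lemma pp_pos p y : 0 <= y -> pp p y = y `^ p.
Proof. by move=> y0; rewrite /pp max_r. Qed.

Lemma pp_neg p y : 0 < p -> y <= 0 -> pp p y = 0.
Proof. by move=> p0 y0; rewrite /pp max_l// powR0// gt_eqF. Qed.

Lemma pp_ge0 p y : 0 <= pp p y.
Proof. exact: powR_ge0. Qed.

Lemma pp_le p y a : 0 <= p -> 0 <= a -> y <= a -> pp p y <= a `^ p.
Proof.
move=> p0 a0 ya; apply: ge0_ler_powR => //; rewrite ?nnegrE//.
  by rewrite le_max lexx.
by rewrite ge_max a0.
Qed.

Lemma ppS p y : 0 < p -> pp (p + 1) y = y * pp p y.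
Proof.
move=> p0; have [y0|y0] := leP y 0.
  by rewrite !pp_neg ?mulr0// ?addr_gt0.
rewrite !(pp_pos _ (ltW y0)) powRD; last by apply/implyP => _; rewrite gt_eqF.
by rewrite (powRr1 (ltW y0)) mulrC.
Qed.

Lemma measurable_pp p : measurable_fun setT (pp p).
Proof.
apply: (measurableT_comp (measurable_powR p)).
exact: measurable_maxr.
Qed.

Lemma is_derive_pp (p y : R) : 0 < y ->
  is_derive y 1 (pp p) (p * pp (p - 1) y).
Proof.
move=> y0; rewrite pp_pos ?ltW//; have h := is_derive_powR p y0.
apply: DeriveDef.
  apply: (@near_eq_derivable _ _ _ (fun x : R => x `^ p)); last exact: ex_derive.
  by near=> x; rewrite pp_pos// ltW//; near: x; exact: lt_nbhsr.
rewrite (@near_eq_derive _ _ _ _ (fun x : R => x `^ p)) ?derive_val//.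
by near=> x; rewrite pp_pos// ltW//; near: x; exact: lt_nbhsr.
Unshelve. all: by end_near. Qed.

Lemma continuous_pp (p : R) : 0 < p -> continuous (pp p).
Proof.
move=> p0 y; have [y0|y0|->] := ltgtP y 0.
- apply: (@near_cst_continuous _ _ 0); near=> x; apply: pp_neg => //.
  by apply: ltW; near: x; exact: lt_nbhsl.
- have h := is_derive_pp p y0.
  by apply: differentiable_continuous; apply/derivable1_diffP; exact: ex_derive.
apply/cvgrPdist_le => e e0; rewrite pp_neg//; near=> x.
rewrite sub0r normrN ger0_norm ?pp_ge0//.
have -> : e = (e `^ p^-1) `^ p.
  by rewrite -powRrM mulVf ?gt_eqF// powRr1// ltW.
apply: pp_le; [exact: ltW|exact: powR_ge0|].
rewrite ltW// (le_lt_trans (ler_norm _))//.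
near: x; have d0 : 0 < e `^ p^-1 by exact: powR_gt0.
exists (e `^ p^-1) => //= z; rewrite /ball_/= sub0r normrN.
Unshelve. all: by end_near. Qed.

Lemma is_derive_ppB (p a y : R) : y < a ->
  is_derive y 1 (fun x => pp p (a - x)) (- p * pp (p - 1) (a - y)).
Proof.
move=> ya; have ay : 0 < a - y by rewrite subr_gt0.
have h := is_derive_pp p ay.
have h2 : is_derive y 1 (fun x : R => a - x) (-1).
  have := @is_deriveB _ _ _ (cst a) id y 1 _ _ (is_derive_cst _ _ _) (is_derive_id _ _).
  by rewrite sub0r.
have := @is_derive1_comp _ (pp p) (fun x : R => a - x) y _ _ h h2.
by move=> h3; apply: is_derive_eq; rewrite mulrN1 mulNr.
Qed.

Lemma powR_subn1 (p y e a : R) : 0 <= p -> 0 < e <= y -> y <= a ->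
  y `^ (p - 1) <= a `^ p / e.
Proof.
move=> p0 /andP[e0 ey] ya; have y0 := lt_le_trans e0 ey.
rewrite powRD; last by apply/implyP => _; rewrite gt_eqF.
rewrite (powR_inv1 (ltW y0)) ler_pM ?powR_ge0 ?invr_ge0 ?(ltW y0)//.
  by apply: ge0_ler_powR => //; rewrite nnegrE ltW// (lt_le_trans y0).
by rewrite lef_pV2.
Qed.

(** The bound grows only polynomially with the exponent [p] (for bounded [a]),
    so that it is beaten by geometric decay in series of such powers. *)
Lemma pp_dif2_bound (tau a0 : R) : 0 <= tau < a0 -> exists2 K, 0 <= K &
  forall p a P q, 0 < p -> a0 <= a -> P ^+ 2 <= tau * q -> 0 <= q ->
  `|2 * pp p (a - tau) - pp p (a - (tau + 2 * P + q)) - pp p (a - (tau - 2 * P + q))|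
   <= K * ((p + 1) ^+ 2 * a `^ p) * Num.min 1 q.
Proof.
move=> /andP[t0 ta].
set st := Num.sqrt tau; have st0 : 0 <= st by exact: sqrtr_ge0.
pose r := Num.min 1 ((a0 - tau) / (2 * (2 * st + 1))).
have d0 : 0 < 2 * (2 * st + 1) by lra.
have r0 : 0 < r by rewrite lt_min ltr01 divr_gt0// subr_gt0.
have r1 : r <= 1 by rewrite ge_min lexx.
have rd : r * (2 * (2 * st + 1)) <= a0 - tau.
  by rewrite -ler_pdivlMr// ge_min lexx orbT.
pose hi := (a0 + tau) / 2; pose e := (a0 - tau) / 2.
have e0 : 0 < e by rewrite /e; lra.
have hhi : tau + 2 * st * r + r ^+ 2 <= hi.
  have : r ^+ 2 <= r by rewrite expr2 -[leRHS]mul1r ler_wpM2r// ltW.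
  rewrite /hi; nra.
exists (2 * e^-1 + (e ^- 2) * (8 * tau + 2) + 4 * r ^- 2).
  have rr : 0 <= r ^- 2 by rewrite invr_ge0 exprn_ge0// ltW.
  have ee : 0 <= e^-1 by rewrite invr_ge0 ltW.
  have ee2 : 0 <= e ^- 2 by rewrite invr_ge0 exprn_ge0// ltW.
  by rewrite !addr_ge0 ?mulr_ge0// addr_ge0// mulr_ge0.
move=> p a P q p0 aa Pq q0.
pose C := (p + 1) ^+ 2 * a `^ p.
have a00 : 0 < a by lra.
have ap0 : 0 <= a `^ p by exact: powR_ge0.
have C0 : 0 <= C by rewrite mulr_ge0 ?sqr_ge0.
have pC c : 0 <= c -> c <= (p + 1) ^+ 2 -> c * a `^ p <= C.
  by move=> c0 cp; rewrite ler_wpM2r.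
have ye y : 0 <= y <= hi -> 0 < e <= a - y /\ a - y <= a.
  by move=> /andP[y0 yh]; split; [apply/andP; split => //|]; rewrite /e /hi in yh *; lra.
have := @radial_dif2_bound _ (fun y => pp p (a - y))
  (fun y => - p * pp (p - 1) (a - y))
  (fun y => p * (p - 1) * pp (p - 1 - 1) (a - y)) tau hi r C (C / e) (C / e ^+ 2)
  t0 _ hhi.
rewrite r0 r1 => /(_ isT) h.
have -> : (2 / e + e ^- 2 * (8 * tau + 2) + 4 * r ^- 2) * C =
  2 * (C / e) + C / e ^+ 2 * (8 * tau + 2) + 4 * C * r ^- 2 by ring.
apply: h => //.
- move=> y hy; apply: is_derive_ppB; move: hy (ta); rewrite /hi; lra.
- move=> y hy.
  have ya : y < a by move: hy (ta); rewrite /hi; lra.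
  have h := is_derive_ppB (p - 1) ya.
  have := @is_deriveZ _ _ _ _ (- p) _ _ _ h.
  by move=> h2; apply: (is_derive_eq h2); rewrite /GRing.scale/=; ring.
- move=> y y0; rewrite ger0_norm ?pp_ge0// (le_trans (pp_le (a := a) _ _ _))//; try lra.
  by rewrite -[leLHS]mul1r pC// expr_ge1//; lra.
- move=> y hy; have [ey ya] := ye y hy.
  rewrite normrM normrN (gtr0_norm p0) ger0_norm ?pp_ge0//.
  rewrite pp_pos; last by move/andP: ey; lra.
  apply: (@le_trans _ _ (p * (a `^ p / e))).
    by rewrite ler_pM2l// powR_subn1// ltW.
  by rewrite mulrA ler_pM2r ?invr_gt0// pC ?ltW//; nra.
- move=> y hy; have [ey ya] := ye y hy.
  rewrite !normrM (gtr0_norm p0) (ger0_norm (pp_ge0 _ _)).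
  rewrite pp_pos; last by move/andP: ey; lra.
  have h1 : `|p - 1| <= p + 1 by rewrite ler_norml; apply/andP; split; lra.
  have y0 : 0 < a - y by move/andP: ey; lra.
  have h2 : (a - y) `^ (p - 1 - 1) <= a `^ p / e ^+ 2.
    rewrite powRD; last by apply/implyP => _; rewrite gt_eqF.
    rewrite (powR_inv1 (ltW y0)) expr2 invfM mulrA.
    rewrite ler_pM ?powR_ge0 ?invr_ge0 ?(ltW y0)//.
      by rewrite powR_subn1// ltW.
    by rewrite lef_pV2 ?posrE//; move/andP: ey; lra.
  apply: (@le_trans _ _ (p * (p + 1) * (a `^ p / e ^+ 2))).
    by apply: ler_pM => //; rewrite ?mulr_ge0 ?powR_ge0 ?ler_pM2l// ltW.
  rewrite mulrA ler_pM2r ?invr_gt0 ?exprn_gt0// pC//; nra.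
Qed.

End pospower.

(** * The solution attached to an interval *)

Section line_profile.
Context (R : realType) (s : R).
Hypothesis s01 : 0 < s < 1.
Local Notation leb := (@lebesgue_measure R).

Let s0 : 0 < s. Proof. by case/andP: s01. Qed.
Let s1 : s < 1. Proof. by case/andP: s01. Qed.
Let s20 : 0 < 2 * s. Proof. by rewrite mulr_gt0. Qed.

Let v (y : R) : R := pp s (1 - y ^+ 2).
Let k (t : R) : R := t `^ (- 1 - 2 * s).

Let v_ge0 y : 0 <= v y. Proof. exact: pp_ge0. Qed.
Let v_le1 y : v y <= 1.
Proof.
rewrite /v (le_trans (pp_le (a := 1) (ltW s0) ler01 _)) ?powR1//.
by rewrite gerBl sqr_ge0.
Qed.
Let vN y : v (- y) = v y. Proof. by rewrite /v sqrrN. Qed.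
Let k_ge0 t : 0 <= k t. Proof. exact: powR_ge0. Qed.

Let mk (D : set R) : measurable_fun D k.
Proof. by apply: measurable_funTS; exact: measurable_powR. Qed.

Let mv (D : set R) x : measurable_fun D (fun t : R => v (x + t)).
Proof.
apply: measurable_funTS; apply: (measurableT_comp (measurable_pp s)).
by apply: measurable_funB => //; apply: measurable_funX; exact: measurable_funD.
Qed.

Let int_k (d : R) : 0 < d -> leb.-integrable `[d, +oo[ (EFin \o k).
Proof.
move=> d0; apply/integrableP; split; first by apply/measurable_EFinP; exact: mk.
under eq_integral => t _ do rewrite /= ger0_norm ?k_ge0//.
by rewrite /k (integral_powR_ray s20 d0) ltry.
Qed.

Let int_bk (d : R) (f : R -> R) (M : R) : 0 < d -> measurable_fun `[d, +oo[ f ->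
  (forall t, d <= t -> `|f t| <= M) ->
  leb.-integrable `[d, +oo[ (EFin \o (fun t => f t * k t)).
Proof.
move=> d0 mf fM.
have h : leb.-integrable `[d, +oo[ (fun t => M%:E * (EFin \o k) t)%E.
  by apply: integrableZl => //; exact: int_k.
apply: le_integrable h => //.
  by apply/measurable_EFinP; apply: measurable_funM => //; exact: mk.
move=> t /=; rewrite in_itv/= andbT => dt; rewrite lee_fin !normrM.
by rewrite ler_wpM2r// (le_trans (fM _ dt))// ler_norm.
Qed.

(** The integral splits into the two half-lines at a positive distance from [x],
    the left one being the right one seen from [- x]; on each of them the
    integrand is merely a first difference, whose integral may diverge at distance [0]. *)
Let E (x d : R) : R := \int[leb]_(t in `[d, +oo[) ((v x - v (x + t)) * k t).
Let Rr (x d : R) : R := \int[leb]_(t in `[d, +oo[) (v (x + t) * k t).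

Let mE (D : set R) x : measurable_fun D (fun t : R => v x - v (x + t)).
Proof. by apply: measurable_funB => //; exact: mv. Qed.

Let E_le (x t : R) : `|v x - v (x + t)| <= 1.
Proof.
have := v_ge0 x; have := v_ge0 (x + t); have := v_le1 x; have := v_le1 (x + t).
by rewrite ler_norml => *; apply/andP; split; lra.
Qed.

Let int_E (x d : R) : 0 < d ->
  leb.-integrable `[d, +oo[ (EFin \o (fun t => (v x - v (x + t)) * k t)).
Proof. by move=> d0; apply: (int_bk (M := 1)) => //; exact: mE. Qed.

Let EE (x d : R) : 0 < d -> E x d = v x * (d `^ (- (2 * s)) / (2 * s)) - Rr x d.
Proof.
move=> d0; rewrite /E.
under eq_Rintegral do rewrite mulrBl.
rewrite RintegralB//.
- congr (_ - _); rewrite RintegralZl//; last exact: int_k.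
  by congr (_ * _); rewrite /Rintegral (integral_powR_ray s20 d0).
- apply: (int_bk (f := cst (v x)) (M := 1)) => // t _.
  by rewrite /= ger0_norm ?v_ge0// v_le1.
- apply: (int_bk (M := 1)) => // t _.
  by rewrite ger0_norm ?v_ge0// v_le1.
Qed.

Let tail (x d : R) : R := \int[leb]_(t in `[d, +oo[) ((2 * v x - v (x + t) - v (x - t)) * k t).

Let tailE (x d : R) : 0 < d -> tail x d = E x d + E (- x) d.
Proof.
move=> d0; rewrite /tail /E -RintegralD//; [|exact: int_E..].
apply: eq_Rintegral => t _.
have -> : v (x - t) = v (- x + t) by rewrite -vN opprB addrC.
by rewrite vN; ring.
Qed.

(** The substitution [t = w (S - x w)], [S ^ 2 = 1 - x ^ 2 + x ^ 2 w ^ 2],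
    turns the kernel seen from [x] into the kernel seen from [0] up to the factor
    [1 - x w / S], whose odd part cancels against the one coming from [- x]. *)
Let S (x w : R) : R := Num.sqrt (1 - x ^+ 2 + x ^+ 2 * w ^+ 2).

Section fixed_x.
Variable x : R.
Hypothesis x1 : `|x| < 1.

Let b : R := 1 - x ^+ 2.
Let b0 : 0 < b.
Proof. by rewrite subr_gt0 -real_normK ?num_real// expr_lt1. Qed.

Let arg w : 0 < 1 - x ^+ 2 + x ^+ 2 * w ^+ 2.
Proof. by rewrite ltr_wpDr// mulr_ge0// sqr_ge0. Qed.

Let S0 w : 0 < S x w. Proof. by rewrite sqrtr_gt0. Qed.
Let S2 w : S x w ^+ 2 = 1 - x ^+ 2 + x ^+ 2 * w ^+ 2.
Proof. by rewrite sqr_sqrtr// ltW. Qed.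

Let Sx w : `|x * w| < S x w.
Proof.
rewrite -(@ltr_pXn2r _ 2)// ?nnegrE ?ltW// S2 -normrX ger0_norm ?sqr_ge0//.
by rewrite exprMn ltrDr.
Qed.

Let Sm w : 0 < S x w - x * w.
Proof. by rewrite subr_gt0 (le_lt_trans (ler_norm _))// Sx. Qed.
Let Sp w : 0 < S x w + x * w.
Proof. by have := Sx w; rewrite ltr_norml => /andP[? ?]; lra. Qed.
Let SmSp w : (S x w - x * w) * (S x w + x * w) = b.
Proof. by rewrite -subr_sqr S2 /b; ring. Qed.

Let T (w : R) : R := w * (S x w - x * w).

Let dS (w : R) : is_derive w 1 (S x) (x ^+ 2 * w / S x w).
Proof.
have h := is_derive1_sqrt (arg w).
have h2 : is_derive w 1 (fun y : R => 1 - x ^+ 2 + x ^+ 2 * y ^+ 2) (x ^+ 2 * (2 * w)).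
  by apply: is_derive_eq; rewrite /GRing.scale/=; ring.
have h3 := @is_derive1_comp _ Num.sqrt _ w _ _ h h2.
apply: (is_derive_eq h3); rewrite -/(S x w).
by have := S0 w; move=> /lt0r_neq0 S00; field.
Qed.

Let dT (w : R) : is_derive w 1 T ((S x w - x * w) ^+ 2 / S x w).
Proof.
have h := dS w; rewrite /T; apply: is_derive_eq; rewrite /GRing.scale/=.
by have := S0 w; move=> /lt0r_neq0 S00; field.
Qed.

Let one_m w : 1 - (x + T w) ^+ 2 = (1 - w ^+ 2) * (S x w - x * w) ^+ 2.
Proof.
have := S2 w; rewrite /T; set S' := S x w => h.
have e : S' ^+ 2 - (1 - x ^+ 2 + x ^+ 2 * w ^+ 2) = 0 by rewrite h subrr.
apply/eqP; rewrite -subr_eq0; apply/eqP.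
transitivity (- (S' ^+ 2 - (1 - x ^+ 2 + x ^+ 2 * w ^+ 2))); last by rewrite e oppr0.
by ring.
Qed.

Let cT (w : R) : {for w, continuous T}.
Proof.
have h := dT w.
by apply: differentiable_continuous; apply/derivable1_diffP; exact: ex_derive.
Qed.

Let DTE : derive1 T = fun w => (S x w - x * w) ^+ 2 / S x w.
Proof. by apply/funext => w; rewrite derive1E; have h := dT w; rewrite derive_val. Qed.

Let cDT : continuous (derive1 T).
Proof.
rewrite DTE => w; apply: differentiable_continuous; apply/derivable1_diffP.
have h := dS w; have S00 := lt0r_neq0 (S0 w).
apply: derivableM; last by apply: derivableV => //; exact: ex_derive.
have h2 : is_derive w 1 (fun w => S x w - x * w) (x ^+ 2 * w / S x w - x).
  by apply: is_derive_eq; rewrite /GRing.scale/=; ring.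
exact: ex_derive.
Qed.

Let T1 : T 1 = 1 - x.
Proof.
rewrite /T /S expr1n !mulr1 subrK sqrtr1 mul1r//.
Qed.

Let Rr_subst0 w : 0 < w < 1 -> Rr x (T w) =
  \int[leb]_(y in `[w, 1]) ((1 - y ^+ 2) `^ s * y `^ (- 1 - 2 * s) * (1 - x * y / S x y)).
Proof.
move=> /andP[w0 w1].
have Tw0 : 0 < T w by rewrite mulr_gt0.
have incr : {in `[w, 1] &, {homo T : y z / y < z}}.
  apply: gtr0_derive1_lt_cc.
  - by move=> y _; have h := dT y; exact: ex_derive.
  - by move=> y _; rewrite DTE divr_gt0// exprn_gt0.
  - by apply: continuous_subspaceT => y; exact: cT.
have Tw1 : T w < T 1 by apply: incr; rewrite ?in_itv/= ?lexx ?(ltW w1).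
have -> : Rr x (T w) = \int[leb]_(t in `[T w, T 1]) (v (x + t) * k t).
  rewrite /Rr /Rintegral; congr fine.
  rewrite (@itv_bndbnd_setU _ _ (BLeft (T w)) (BRight (T 1)) +oo%O) ?bnd_simp//; last exact: ltW.
  rewrite ge0_integral_setU//=.
  - rewrite [X in (_ + X)%E](_ : _ = 0%E) ?adde0//.
    rewrite integral0_eq// => t /=; rewrite in_itv/= andbT T1 => t1.
    rewrite /v pp_neg ?mul0r//.
    have : 1 < x + t by lra.
    by move=> xt; rewrite subr_le0 expr_ge1// ltW// (lt_trans _ xt).
  - apply/measurable_EFinP; apply: measurable_funM; [exact: mv|exact: mk].
  - by move=> t _; rewrite lee_fin mulr_ge0.
  - by apply/disj_setPS => t; rewrite /= !in_itv/= => -[/andP[_ a]]; rewrite andbT ltNge a.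
rewrite /Rintegral (@integration_by_substitution_increasing _ T
  (fun t => v (x + t) * k t) w 1 (ltW w1) incr).
- congr fine; apply: eq_integral => y; rewrite inE/= in_itv/= => /andP[wy y1].
  congr EFin; rewrite !fctE DTE /v one_m /k.
  have y0 : 0 < y by rewrite (lt_le_trans w0).
  have y2 : 0 <= 1 - y ^+ 2 by rewrite subr_ge0 expr_le1// ltW.
  have pos : 0 <= (1 - y ^+ 2) * (S x y - x * y) ^+ 2 by rewrite mulr_ge0 ?sqr_ge0.
  rewrite (pp_pos _ pos) powRM ?sqr_ge0//.
  rewrite -(powR_mulrn 2 (ltW (Sm y))) -powRrM /T (powRM _ (ltW y0) (ltW (Sm y))).
  set A := S x y - x * y; have A0 : 0 < A by exact: Sm.
  have -> : A `^ (- 1 - 2 * s) = (A * A `^ (2 * s))^-1.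
    rewrite powRD; last by apply/implyP => _; rewrite gt_eqF.
    rewrite (powR_inv1 (ltW A0)) powRN.
    by rewrite invfM.
  have AE : A = S x y * (1 - x * y / S x y).
    by rewrite /A; field; rewrite gt_eqF.
  have p0 : A `^ (2 * s) != 0 by rewrite gt_eqF// powR_gt0.
  rewrite powR_mulrn ?(ltW A0)//.
  rewrite [RHS](_ : _ = (1 - y ^+ 2) `^ s * y `^ (-1 - 2 * s) * (A / S x y)).
    by have S00 := S0 y; field; rewrite p0 ?andbT !lt0r_neq0.
  by rewrite AE; field; rewrite gt_eqF.
- by move=> y _; exact: cDT.
- by apply: cvgP; apply: cvg_at_right_filter; exact: cDT.
- by apply: cvgP; apply: cvg_at_left_filter; exact: cDT.
- split => [y _||].
  + by have h := dT y; exact: ex_derive.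
  + by apply: cvg_at_right_filter; exact: cT.
  + by apply: cvg_at_left_filter; exact: cT.
- have cont t : 0 < t -> {for t, continuous (fun t => v (x + t) * k t)}.
    move=> t0; apply: (@continuousM _ _ (fun t => v (x + t)) k); last exact: continuous_powR_pos.
    apply: (@continuous_comp _ _ _ (fun t : R => 1 - (x + t) ^+ 2) (pp s)); last exact: continuous_pp.
    by apply: differentiable_continuous; apply/derivable1_diffP; exact: ex_derive.
  apply/continuous_within_itvP => //; split => [y||].
  + by rewrite in_itv/= => /andP[yw _]; apply: cont; rewrite (lt_trans Tw0).
  + by apply: cvg_at_right_filter; exact: cont.
  + by apply: cvg_at_left_filter; apply: cont; rewrite (lt_trans Tw0).
Qed.

Lemma Rr_subst w : 0 < w < 1 -> Rr x (w * (S x w - x * w)) =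
  \int[leb]_(y in `[w, 1]) ((1 - y ^+ 2) `^ s * y `^ (- 1 - 2 * s) * (1 - x * y / S x y)).
Proof. exact: Rr_subst0. Qed.

Lemma S_gt0 w : 0 < S x w.
Proof. exact: S0. Qed.
Lemma SB_gt0 w : 0 < S x w - x * w.
Proof. exact: Sm. Qed.
Lemma SD_gt0 w : 0 < S x w + x * w.
Proof. exact: Sp. Qed.
Lemma SB_SD w : (S x w - x * w) * (S x w + x * w) = 1 - x ^+ 2.
Proof. exact: SmSp. Qed.
Lemma b_gt0 : 0 < 1 - x ^+ 2.
Proof. exact: b0. Qed.
Lemma S_le1 w : 0 < w < 1 -> S x w <= 1.
Proof.
move=> /andP[w0 w1]; rewrite -(@ler_pXn2r _ 2) ?nnegrE ?(ltW (S0 w))// S2 expr1n.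
have h : x ^+ 2 * w ^+ 2 <= x ^+ 2.
  by rewrite -[leRHS]mulr1 ler_wpM2l ?sqr_ge0// expr_le1// ltW.
lra.
Qed.

Lemma measurable_S : measurable_fun setT (fun y => x * y / S x y).
Proof.
apply: continuous_measurable_fun => y.
apply: differentiable_continuous; apply/derivable1_diffP.
have h := dS y; have S00 := lt0r_neq0 (S0 y).
apply: derivableM; last by apply: derivableV => //; exact: ex_derive.
exact: ex_derive.
Qed.

Lemma v_lipschitz : exists2 M, 0 <= M & exists2 t0, 0 < t0 &
  forall t, 0 < t <= t0 -> `|v x - v (x + t)| <= M * t.
Proof.
have dv (y : R) : `|y| < 1 -> is_derive y 1 v (- (2 * y) * (s * pp (s - 1) (1 - y ^+ 2))).
  move=> y1; have y2 : 0 < 1 - y ^+ 2.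
    by rewrite subr_gt0 -real_normK ?num_real// expr_lt1.
  have h := is_derive_pp s y2.
  have h2 : is_derive y 1 (fun y : R => 1 - y ^+ 2) (- (2 * y)).
    by apply: is_derive_eq; rewrite /GRing.scale/=; ring.
  have h3 := @is_derive1_comp _ (pp s) _ y _ _ h h2.
  by apply: (is_derive_eq h3); rewrite mulrC.
have dvx := dv x x1.
have : derivable v x 1 by exact: ex_derive.
move=> /cvg_ex[l /cvgrPdist_le /(_ 1 ltr01)].
move=> /nbhs_ballP[e /= e0 he].
exists (`|l| + 1) => //; exists (e / 2); first by rewrite divr_gt0.
move=> t /andP[t0 te].
have te' : ball 0 e t.
  by rewrite /ball/= sub0r normrN gtr0_norm// (le_lt_trans te)// ltr_pdivrMr// ltr_pMr// ltr1n.
have tN0 : t != 0 by rewrite gt_eqF.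
have := he _ te' tN0.
rewrite /= [_%:A]mulr1 (addrC t) => h.
have : `|t^-1 * (v (x + t) - v x)| <= `|l| + 1.
  rewrite -[X in `|X|](subrK l) (le_trans (ler_normD _ _))// addrC lerD2l.
  by rewrite distrC.
rewrite normrM normfV (gtr0_norm t0) distrC mulrC ler_pdivrMr//.
Qed.

End fixed_x.

Let SN (x w : R) : S (- x) w = S x w. Proof. by rewrite /S sqrrN. Qed.

Let W (w : R) : R := \int[leb]_(y in `[w, 1]) ((1 - y ^+ 2) `^ s * y `^ (- 1 - 2 * s)).

Let int_W (x w : R) : `|x| < 1 -> 0 < w < 1 -> leb.-integrable `[w, 1]
  (EFin \o (fun y => (1 - y ^+ 2) `^ s * y `^ (- 1 - 2 * s) * (1 - x * y / S x y))).
Proof.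
move=> x1 /andP[w0 w1].
have h : leb.-integrable `[w, 1] (fun t => 2%:E * (EFin \o k) t)%E.
  apply: integrableZl => //.
  apply: (integrableS _ _ _ (int_k w0)) => //.
  by move=> y; rewrite /= !in_itv/= andbT => /andP[].
apply: le_integrable h => //.
  apply/measurable_EFinP; apply: measurable_funTS.
  apply: measurable_funM.
    apply: measurable_funM; last exact: measurable_powR.
    apply: (measurableT_comp (measurable_powR s)).
    by apply: measurable_funB => //; exact: measurable_funX.
  by apply: measurable_funB => //; exact: measurable_S.
move=> y /=; rewrite in_itv/= => /andP[wy y1]; rewrite lee_fin !normrM.
rewrite (@ger0_norm _ (_ `^ s)) ?powR_ge0// (@ger0_norm _ (y `^ _)) ?powR_ge0//.
rewrite (@ger0_norm _ 2)// mulrAC -/(k y).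
rewrite ler_wpM2r// -[leRHS]mul1r; apply: ler_pM; rewrite ?powR_ge0//.
  have y0 : 0 < y by rewrite (lt_le_trans w0).
  have e1 : 1 = 1 `^ s :> R by rewrite powR1.
  rewrite [leRHS]e1; apply: ge0_ler_powR; rewrite ?nnegrE ?(ltW s0)//.
    by rewrite subr_ge0 expr_le1// ltW.
  by rewrite gerBl sqr_ge0.
rewrite (le_trans (ler_normB _ _))// normr1 -[leRHS]/(1 + 1) lerD2l.
have S0 := S_gt0 x1 y; rewrite normf_div (gtr0_norm S0) ler_pdivrMr// mul1r.
have := SB_gt0 x1 y; have := SD_gt0 x1 y.
by rewrite ler_norml => *; apply/andP; split; lra.
Qed.

Let Rr_sum (x w : R) : `|x| < 1 -> 0 < w < 1 ->
  Rr x (w * (S x w - x * w)) + Rr (- x) (w * (S x w + x * w)) = 2 * W w.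
Proof.
move=> x1 w01; have x1' : `|- x| < 1 by rewrite normrN.
have -> : S x w + x * w = S (- x) w - (- x) * w by rewrite SN mulNr opprK.
rewrite (Rr_subst x1 w01) (Rr_subst x1' w01) /W.
rewrite -RintegralD//; [|exact: int_W..].
have x0 : `|0 : R| < 1 by rewrite normr0.
rewrite -RintegralZl//.
  apply: eq_Rintegral => y _; rewrite SN mulNr mulNr; ring.
have := int_W x0 w01; apply: eq_integrable => // y _ /=.
by rewrite !mul0r subr0 mulr1.
Qed.

Let E_lipschitz (x M t0 d d' : R) : 0 <= M ->
  (forall t, 0 < t <= t0 -> `|v x - v (x + t)| <= M * t) ->
  0 < d -> d <= d' -> d' <= t0 ->
  `|E x d - E x d'| <= M * d `^ (- (2 * s)) * (d' - d).
Proof.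
move=> M0 hM d0 dd' dt.
have d'0 := lt_le_trans d0 dd'.
have iE := int_E x d0.
have iE1 : leb.-integrable `[d, d'[ (EFin \o (fun t => (v x - v (x + t)) * k t)).
  apply: integrableS iE => //.
  by move=> y; rewrite /= !in_itv/= andbT => /andP[].
have -> : E x d - E x d' = \int[leb]_(t in `[d, d'[) ((v x - v (x + t)) * k t).
  rewrite {1}/E (@itv_bndbnd_setU _ _ (BLeft d) (BLeft d') +oo%O) ?bnd_simp//.
  rewrite Rintegral_setU//= ?addrK//.
    by rewrite -itv_bndbnd_setU ?bnd_simp.
  by apply/disj_setPS => t; rewrite /= !in_itv/= => -[/andP[_ a]]; rewrite andbT leNgt a.
rewrite (le_trans (le_normr_Rintegral _ iE1))//.
have -> : M * d `^ (- (2 * s)) * (d' - d) =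
    \int[leb]_(t in `[d, d'[) (M * d `^ (- (2 * s))).
  rewrite Rintegral_cst//; congr (_ * _).
  have e : fine (lebesgue_measure (`[d, d'[%classic : set R)) = d' - d.
    rewrite lebesgue_measure_itv/= lte_fin; case: ifP => // /negbT.
    rewrite -leNgt => h; have -> : d = d' by apply/eqP; rewrite eq_le dd' h.
    by rewrite subrr.
  by rewrite -e.
apply: le_Rintegral => //.
- exact: integrable_norm.
- apply/integrableP; split; first exact: measurable_cst.
  have e : (lebesgue_measure (`[d, d'[%classic : set R) < +oo)%E.
    by rewrite lebesgue_measure_itv/=; case: ifP => _; rewrite ltry.
  by rewrite integral_cst// lte_mul_pinfty.
- move=> t; rewrite /= in_itv/= => /andP[dt' td'].
  have t0' : 0 < t by rewrite (lt_le_trans d0).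
  rewrite normrM (@ger0_norm _ (k t))//.
  apply: (@le_trans _ _ (M * t * k t)).
    by rewrite ler_wpM2r// hM// t0'/= (le_trans (ltW td')).
  rewrite -mulrA ler_wpM2l// /k powRD; last by apply/implyP => _; rewrite gt_eqF.
  rewrite powR_inv1 ?(ltW t0')// mulrA divff ?gt_eqF// mul1r !powRN.
  rewrite lef_pV2 ?posrE ?powR_gt0//.
  by apply: ge0_ler_powR; rewrite ?nnegrE ?(ltW s20) ?(ltW d0) ?(ltW t0').
Qed.

(** The middle term is the square of [2 sinh (s ln m)], the right-hand side that
    of [2 sinh (ln m)]. *)
Let cosh_bound (m : R) : 0 < m ->
  0 <= m `^ (2 * s) + m `^ (- (2 * s)) - 2 <= (m - m^-1) ^+ 2.
Proof.
move=> m0.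
have a0 : 0 < m `^ s by exact: powR_gt0.
have e : m `^ (2 * s) + m `^ (- (2 * s)) - 2 = (m `^ s - (m `^ s)^-1) ^+ 2.
  rewrite powRN mulrC powRrM powR_mulrn ?powR_ge0//.
  by field; rewrite gt_eqF.
rewrite e sqr_ge0/=.
have main (x : R) : 1 <= x -> (x `^ s - (x `^ s)^-1) ^+ 2 <= (x - x^-1) ^+ 2.
  move=> x1; have x0 : 0 < x by rewrite (lt_le_trans _ x1).
  have y0 : 0 < x `^ s by exact: powR_gt0.
  have xs : x `^ s <= x.
    by rewrite -[leRHS]powRr1 ?(ltW x0)// ler_powR// ltW.
  have xs1 : 1 <= x `^ s by rewrite -(powRr0 x) ler_powR// ltW.
  have i1 : x^-1 <= (x `^ s)^-1 by rewrite lef_pV2.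
  have i2 : (x `^ s)^-1 <= 1 by rewrite invf_le1.
  rewrite ler_pXn2r ?nnegrE//; lra.
have [m1|m1] := leP 1 m; first exact: main.
have mi1 : 1 <= m^-1 by rewrite invf_ge1// ltW.
have := main _ mi1; rewrite -powR_inv1 ?(ltW m0)// -powRrM mulN1r powRN invrK.
by rewrite powR_inv1 ?(ltW m0)// invrK -sqrrN opprB -[leRHS]sqrrN opprB.
Qed.

(** The substitution gives distances [w (S - x w)] to the right of [x] and
    [w (S + x w)] to its left. Moving both to the mean [w S] costs
    [O(w ^ (2 - 2 s))], as first differences are Lipschitz. What is left over,
    besides [tail 0 w], comes from the boundary terms and is a
    multiple of [w ^ (- 2 s)] times [m ^ (2 s) + m ^ (- 2 s) - 2] with [m - 1 = O(w)]. *)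
Let tail_cmp (x : R) : `|x| < 1 -> exists C, exists2 w0, 0 < w0 &
  forall w, 0 < w < w0 -> `|tail x (w * S x w) - tail 0 w| <= C * w `^ (2 - 2 * s).
Proof.
move=> x1; have x1' : `|- x| < 1 by rewrite normrN.
have b0 := b_gt0 x1; set b := 1 - x ^+ 2 in b0.
have [M M0 [t1 t10 hM]] := v_lipschitz x1.
have [M' M'0 [t2 t20 hM']] := v_lipschitz x1'.
exists ((M + M') * (b / 2) `^ (- (2 * s)) + (2 * s)^-1 * (4 * x ^+ 2 / b)).
exists (Num.min 2^-1 (Num.min (t1 / 2) (t2 / 2))).
  by rewrite !lt_min; apply/and3P; split; [rewrite invr_gt0|exact: divr_gt0|exact: divr_gt0].
move=> w /andP[w0]; rewrite !lt_min => /and3P[w1 wt1 wt2].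
have w01 : 0 < w < 1 by rewrite w0 (lt_trans w1)// invf_lt1// ltr1n.
set S' := S x w; have S0 : 0 < S' by exact: S_gt0.
have Sm0 : 0 < S' - x * w by exact: SB_gt0.
have Sp0 : 0 < S' + x * w by exact: SD_gt0.
have SS : (S' - x * w) * (S' + x * w) = b by exact: SB_SD.
have Sle : S' <= 1 by exact: S_le1.
have xw1 : `|x * w| <= 1.
  by rewrite normrM mulr_ile1// ?normr_ge0// ?ltW// gtr0_norm// (lt_trans w1)// invf_lt1// ltr1n.
have xwl : - 1 <= x * w <= 1 by rewrite -ler_norml.
have [dm2 dp2] : S' - x * w <= 2 /\ S' + x * w <= 2 by split; lra.
have lo (c : R) : 0 < c -> c <= 2 -> forall c' : R, 0 < c' -> c' * c = b -> b / 2 <= c'.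
  by move=> c0 c2 c' c'0 e; rewrite ler_pdivrMr// -e ler_pM2l.
have lom : b / 2 <= S' - x * w by apply: (lo (S' + x * w)).
have lop : b / 2 <= S' + x * w by apply: (lo (S' - x * w)) => //; rewrite mulrC.
have lo0 : b / 2 <= S' by lra.
pose dm := w * (S' - x * w); pose dp := w * (S' + x * w); pose r := w * S'.
have dm0 : 0 < dm by rewrite mulr_gt0.
have dp0 : 0 < dp by rewrite mulr_gt0.
have r0 : 0 < r by rewrite mulr_gt0.
have up (t c : R) : w < t / 2 -> 0 < c -> c <= 2 -> w * c <= t.
  move=> wt c0 c2; rewrite (@le_trans _ _ (w * 2))//; first by rewrite ler_pM2l.
  by rewrite -ler_pdivlMr// ltW.
have powb (c : R) : b / 2 <= c -> (w * c) `^ (- (2 * s)) <= w `^ (- (2 * s)) * (b / 2) `^ (- (2 * s)).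
  move=> bc; have b20 : 0 < b / 2 by rewrite divr_gt0.
  have c0 := lt_le_trans b20 bc.
  rewrite powRM ?(ltW w0) ?(ltW c0)// ler_pM2l ?powR_gt0// !powRN lef_pV2 ?posrE ?powR_gt0//.
  by apply: ge0_ler_powR; rewrite ?nnegrE ?(ltW s20) ?(ltW b20) ?(ltW c0).
have w2 : w `^ (- (2 * s)) * w ^+ 2 = w `^ (2 - 2 * s).
  rewrite -(powR_mulrn 2 (ltW w0)) -powRD; last by apply/implyP => _; rewrite gt_eqF.
  by congr (_ `^ _); ring.
have x_1 : `|x| <= 1 by exact: ltW.
have step (y N t c c' : R) : 0 <= N ->
    (forall u, 0 < u <= t -> `|v y - v (y + u)| <= N * u) -> w < t / 2 ->
    b / 2 <= c -> b / 2 <= c' -> c <= 2 -> c' <= 2 -> `|c - c'| <= w ->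
    `|E y (w * c) - E y (w * c')| <= N * (b / 2) `^ (- (2 * s)) * w `^ (2 - 2 * s).
  move=> N0 hN wt.
  have b20 : 0 < b / 2 by rewrite divr_gt0.
  have wlog0 (e e' : R) : b / 2 <= e -> b / 2 <= e' -> e <= 2 -> e' <= 2 ->
      e <= e' -> `|e - e'| <= w ->
    `|E y (w * e) - E y (w * e')| <= N * (b / 2) `^ (- (2 * s)) * w `^ (2 - 2 * s).
    move=> be be' e2 e'2 ee ew.
    have e0 := lt_le_trans b20 be; have e'0 := lt_le_trans b20 be'.
    have ee' : w * e <= w * e' by rewrite ler_pM2l.
    rewrite (le_trans (E_lipschitz N0 hN (mulr_gt0 w0 e0) ee' (up _ _ wt e'0 e'2)))//.
    apply: (@le_trans _ _ (N * (w `^ (- (2 * s)) * (b / 2) `^ (- (2 * s))) * (w * w))).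
      apply: ler_pM; rewrite ?mulr_ge0 ?powR_ge0//.
      + by rewrite subr_ge0 ler_pM2l.
      + by rewrite ler_wpM2l// powb.
      + by rewrite -mulrBr ler_pM2l// (le_trans _ ew)// distrC ler_norm.
    by rewrite -w2 le_eqVlt; apply/orP; left; apply/eqP; ring.
  move=> bc bc' c2 c'2 cc; have [le|le] := leP c c'; first exact: wlog0.
  by rewrite distrC; apply: wlog0 => //; [exact: ltW|rewrite distrC].
have Ex : `|E x r - E x dm| <= M * (b / 2) `^ (- (2 * s)) * w `^ (2 - 2 * s).
  apply: (step x M t1) => //; first lra.
  by rewrite opprB addrC subrK normrM (gtr0_norm w0) ler_piMl// ltW.
have Ex' : `|E (- x) r - E (- x) dp| <= M' * (b / 2) `^ (- (2 * s)) * w `^ (2 - 2 * s).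
  apply: (step (- x) M' t2) => //; first lra.
  by rewrite opprD addNKr normrN normrM (gtr0_norm w0) ler_piMl// ltW.
have z1 : `|0 : R| < 1 by rewrite normr0.
have v01 : v 0 = 1 by rewrite /v expr0n subr0 pp_pos// powR1.
have S0w : S 0 w = 1 by rewrite /S expr0n mul0r subr0 addr0 sqrtr1.
have t0E : tail 0 w = w `^ (- (2 * s)) / s - 2 * W w.
  rewrite tailE// oppr0 EE// v01 mul1r.
  have := Rr_sum z1 w01; rewrite S0w mul0r subr0 addr0 mulr1 oppr0 => <-.
  by field; rewrite gt_eqF.
have vb : v x = b `^ s by rewrite /v pp_pos// ltW.
pose sb := Num.sqrt b; have sb0 : 0 < sb by rewrite sqrtr_gt0.
have sb2 : sb ^+ 2 = b by rewrite sqr_sqrtr// ltW.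
pose m := (S' + x * w) / sb.
have m0 : 0 < m by rewrite divr_gt0.
have SpE : S' + x * w = sb * m by rewrite /m; field; rewrite gt_eqF.
have SmE : S' - x * w = sb * m^-1.
  apply: (mulIf (lt0r_neq0 Sp0)); rewrite SS {1}SpE -sb2.
  by field; rewrite gt_eqF.
have dpow (c : R) : 0 < c -> v x * (w * (sb * c)) `^ (- (2 * s)) = w `^ (- (2 * s)) * c `^ (- (2 * s)).
  move=> c0; have -> : v x = sb `^ (2 * s).
    by rewrite vb -sb2 -(powR_mulrn 2 (ltW sb0)) -powRrM.
  rewrite !powRM ?mulr_ge0 ?(ltW w0) ?(ltW sb0) ?(ltW c0)// mulrCA.
  rewrite [sb `^ (- (2 * s))]powRN (mulrA (sb `^ _)) divff ?mul1r//.
  by rewrite gt_eqF// powR_gt0.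
have mid : E x dm + E (- x) dp - tail 0 w =
    w `^ (- (2 * s)) / (2 * s) * (m `^ (2 * s) + m `^ (- (2 * s)) - 2).
  rewrite t0E (EE _ dm0) (EE _ dp0) vN.
  have := Rr_sum x1 w01; rewrite -/S' -/dm -/dp => <-.
  have e1 : v x * dm `^ (- (2 * s)) = w `^ (- (2 * s)) * m `^ (2 * s).
    rewrite /dm SmE dpow ?invr_gt0//; congr (_ * _).
    by rewrite -powR_inv1 ?(ltW m0)// -powRrM mulN1r opprK.
  have e2 : v x * dp `^ (- (2 * s)) = w `^ (- (2 * s)) * m `^ (- (2 * s)).
    by rewrite /dp SpE dpow.
  rewrite !mulrA e1 e2.
  move: (Rr x dm) (Rr (- x) dp) (w `^ _) (m `^ _) (m `^ _) => z1' z2 z3 z4 z5.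
  by field; rewrite gt_eqF.
have midb : `|E x dm + E (- x) dp - tail 0 w| <=
    (2 * s)^-1 * (4 * x ^+ 2 / b) * w `^ (2 - 2 * s).
  rewrite mid; have /andP[c1 c2] := cosh_bound m0.
  rewrite ger0_norm; last by rewrite mulr_ge0// mulr_ge0 ?powR_ge0// invr_ge0 ltW.
  have e : m - m^-1 = 2 * (x * w) / sb.
    apply: (mulfI (lt0r_neq0 sb0)); rewrite mulrBr -SpE -SmE.
    by field; rewrite gt_eqF.
  rewrite [leRHS](_ : _ = w `^ (- (2 * s)) / (2 * s) * (m - m^-1) ^+ 2).
    by rewrite ler_wpM2l// mulr_ge0 ?powR_ge0// invr_ge0 ltW.
  by rewrite e -w2 -sb2; field; rewrite !gt_eqF.
have split3 (a1 a2 a3 a4 a5 : R) :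
    a1 + a2 - a5 = (a1 - a3) + (a2 - a4) + (a3 + a4 - a5) by ring.
have tE : tail x (w * S') = E x r + E (- x) r by exact: tailE.
rewrite tE (split3 _ _ (E x dm) (E (- x) dp)).
rewrite (le_trans (ler_normD _ _))// (le_trans (lerD (ler_normD _ _) midb))//.
rewrite (le_trans (lerD (lerD Ex Ex') (lexx _)))//.
by rewrite le_eqVlt; apply/orP; left; apply/eqP; ring.
Qed.

Let G (x t : R) : R := (2 * v x - v (x + t) - v (x - t)) * (`|t| `^ (1 + 2 * s))^-1.

Let int_G (x : R) : `|x| < 1 -> leb.-integrable setT (EFin \o G x).
Proof.
move=> x1.
have h : 0 <= x ^+ 2 < 1.
  by rewrite sqr_ge0/= -real_normK ?num_real// expr_lt1.
have [K K0 hK] := pp_dif2_bound h.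
pose F (t : R) := Num.min 1 (t ^+ 2) * (`|t| `^ (1 + 2 * s))^-1.
have m2 : measurable_fun setT (fun t : R => (`|t| `^ (1 + 2 * s))^-1).
  rewrite (_ : (fun _ => _) = (fun y : R => y `^ (- (1 + 2 * s))) \o (fun t : R => `|t|)).
    by apply: measurableT_comp; [exact: measurable_powR|exact: normr_measurable].
  by apply/funext => t /=; rewrite powRN.
have mF : measurable_fun setT F.
  apply: measurable_funM => //.
  by apply: measurable_minr => //; exact: measurable_funX.
have F0 t : 0 <= F t.
  by rewrite mulr_ge0 ?invr_ge0 ?powR_ge0// le_min ler01 sqr_ge0.
have iF : leb.-integrable setT (EFin \o F).
  apply/integrableP; split; first exact/measurable_EFinP.
  under eq_integral => t _ do rewrite /= ger0_norm//.
  exact: integral_min_powR_lty.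
have hi : leb.-integrable setT (fun t => (K * ((s + 1) ^+ 2 * 1 `^ s))%:E * (EFin \o F) t)%E.
  exact: integrableZl.
apply: le_integrable hi => //.
  apply/measurable_EFinP; apply: measurable_funM => //.
  have -> : (fun t => 2 * v x - v (x + t) - v (x - t)) = (fun t => 2 * v x - v (x + t) - v (- x + t)).
    by apply/funext => t; congr (_ - _); rewrite -(vN (x - t)); congr v; ring.
  by apply: measurable_funB; [apply: measurable_funB|] => //; exact: mv.
move=> t _; rewrite /= lee_fin /G /F mulrA !normrM.
rewrite (@ger0_norm _ (_^-1)) ?invr_ge0 ?powR_ge0// ler_wpM2r ?invr_ge0 ?powR_ge0//.
have := hK s 1 (x * t) (t ^+ 2) s0 (lexx _) _ (sqr_ge0 _).
rewrite exprMn => /(_ (lexx _)).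
have -> : x ^+ 2 + 2 * (x * t) + t ^+ 2 = (x + t) ^+ 2 by ring.
have -> : x ^+ 2 - 2 * (x * t) + t ^+ 2 = (x - t) ^+ 2 by ring.
move=> /le_trans; apply; rewrite -!normrM; exact: ler_norm.
Qed.

Let J (x : R) : R := \int[leb]_(t in `[0, +oo[) G x t.

Let tailG (x d : R) : 0 < d -> tail x d = \int[leb]_(t in `[d, +oo[) G x t.
Proof.
move=> d0; apply: eq_Rintegral => t; rewrite inE/= in_itv/= andbT => dt.
rewrite /G /k gtr0_norm ?(lt_le_trans d0)//; congr (_ * _).
by rewrite -powRN; congr (_ `^ _); ring.
Qed.

Let tail_cvg (x e : R) : `|x| < 1 -> 0 < e -> exists2 r0, 0 < r0 &
  forall r, 0 < r < r0 -> `|J x - tail x r| < e.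
Proof.
move=> x1 e0; have iG := int_G x1.
have iG01 : leb.-integrable `[0, 1] (EFin \o G x) by exact: integrableS iG.
have := parameterized_integral_near_left ltr01 e0 iG01.
move=> /nbhs_ballP[r0 /= r00 h]; exists r0 => // r /andP[rp rr].
have br : ball 0 r0 r by rewrite /ball/= sub0r normrN gtr0_norm.
rewrite tailG//.
suff -> : J x = \int[leb]_(t in `[0, r]) G x t + \int[leb]_(t in `[r, +oo[) G x t.
  by rewrite addrK; exact: (h r br (ltW rp)).
rewrite -(@Rintegral_itv_obnd_cbnd _ r); last first.
  exact: integrableS iG.
rewrite /J (@itv_bndbnd_setU _ _ (BLeft 0) (BRight r) +oo%O) ?bnd_simp//; last exact: ltW.
rewrite Rintegral_setU//=.
  by apply: (integrableS _ _ _ iG) => //; exact: measurableU.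
by apply/disj_setPS => t; rewrite /= !in_itv/= => -[/andP[_ a]]; rewrite andbT ltNge a.
Qed.

(** Let [w] tend to [0] in [tail_cmp]. *)
Let J_const (x : R) : `|x| < 1 -> J x = J 0.
Proof.
move=> x1; have z1 : `|0 : R| < 1 by rewrite normr0.
have tri (a : R) : a / 3 + a / 3 + a / 3 = a by field.
apply/eqP; rewrite -subr_eq0 -normr_le0; apply/ler_addgt0Pr => e e0; rewrite add0r.
have e3 : 0 < e / 3 by rewrite divr_gt0.
have [r1 r10 h1] := tail_cvg x1 e3.
have [r2 r20 h2] := tail_cvg z1 e3.
have [C [w0 w00 hw]] := tail_cmp x1.
have p0 : 0 < 2 - 2 * s by have := s1; lra.
have hC : 0 < `|C| + 1 by rewrite ltr_wpDl.
pose w3 := (e / 3 / (`|C| + 1)) `^ (2 - 2 * s)^-1.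
have w30 : 0 < w3 by rewrite powR_gt0// divr_gt0.
pose w := Num.min 1 (Num.min w0 (Num.min r1 (Num.min r2 w3))) / 2.
have m0 : 0 < Num.min 1 (Num.min w0 (Num.min r1 (Num.min r2 w3))).
  by rewrite !lt_min ltr01 w00 r10 r20.
have wp : 0 < w by rewrite divr_gt0.
have wm : w < Num.min 1 (Num.min w0 (Num.min r1 (Num.min r2 w3))).
  by rewrite ltr_pdivrMr// ltr_pMr// ltr1n.
move: wm; rewrite !lt_min => /and5P[w1 ww0 wr1 wr2 ww3].
have ws : 0 < w < 1 by rewrite wp.
have S0 := S_gt0 x1 w; have Sle := S_le1 x1 ws.
have c1 : `|J x - tail x (w * S x w)| < e / 3.
  apply: h1; rewrite mulr_gt0//= (le_lt_trans _ wr1)//.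
  by rewrite ler_piMr// ltW.
have c2 : `|J 0 - tail 0 w| < e / 3 by apply: h2; rewrite wp.
have c3 : `|tail x (w * S x w) - tail 0 w| <= e / 3.
  rewrite (le_trans (hw w _)) ?wp//.
  apply: (@le_trans _ _ ((`|C| + 1) * w `^ (2 - 2 * s))).
    by rewrite ler_wpM2r ?powR_ge0// (le_trans (ler_norm _))// lerDl.
  rewrite mulrC -ler_pdivlMr//.
  have -> : e / 3 / (`|C| + 1) = w3 `^ (2 - 2 * s).
    rewrite /w3 -powRrM mulVf ?gt_eqF// powRr1// ltW// divr_gt0//.
  by apply: ge0_ler_powR; rewrite ?nnegrE ?(ltW p0) ?(ltW wp) ?(ltW w30) ?(ltW ww3).
have split3 (a1 a2 a3 a4 : R) :
   a1 - a2 = (a1 - a3) - (a2 - a4) + (a3 - a4) by ring.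
rewrite (split3 _ _ (tail x (w * S x w)) (tail 0 w)).
rewrite (le_trans (ler_normD _ _))// (le_trans (lerD (ler_normB _ _) (lexx _)))//.
rewrite -(tri e).
exact: (lerD (lerD (ltW c1) (ltW c2)) c3).
Qed.

Let J0_gt0 : 0 < J 0.
Proof.
have z1 : `|0 : R| < 1 by rewrite normr0.
have iG := int_G z1.
have v01 : v 0 = 1 by rewrite /v expr0n subr0 pp_pos// powR1.
have G0 t : 0 <= G 0 t.
  rewrite mulr_ge0 ?invr_ge0 ?powR_ge0// v01.
  by have := v_le1 (0 + t); have := v_le1 (0 - t); lra.
have i1 : leb.-integrable `[1, +oo[ (EFin \o k) by exact: int_k.
apply: (@lt_le_trans _ _ (\int[leb]_(t in `[1, +oo[) (2 * k t))).
  rewrite RintegralZl// mulr_gt0// /Rintegral (integral_powR_ray s20 ltr01)/=.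
  by rewrite divr_gt0// powR_gt0.
have -> : \int[leb]_(t in `[1, +oo[) (2 * k t) = \int[leb]_(t in `[1, +oo[) G 0 t.
  rewrite -(tailG 0 ltr01); apply: eq_Rintegral => t; rewrite inE/= in_itv/= andbT => t1.
  have vt : v (0 + t) = 0 by rewrite /v add0r pp_neg// subr_le0 expr_ge1// (le_trans _ t1).
  by rewrite v01 (_ : 0 - t = - (0 + t)) ?vN ?vt ?subr0 ?mulr1//; ring.
rewrite /J /Rintegral fine_le//.
- apply: integrable_fin_num => //; exact: integrableS iG.
- apply: integrable_fin_num => //; exact: integrableS iG.
- apply: ge0_subset_integral => //.
  + by have /integrableP[h1 _] := iG; exact: (measurable_funTS h1).
  + by move=> t _; rewrite lee_fin.
  + by move=> t; rewrite /= !in_itv/= !andbT; apply: le_trans.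
Qed.

Let int_G_even (x : R) : `|x| < 1 -> \int[leb]_t G x t = J x + J x.
Proof.
move=> x1; have iG := int_G x1.
have iGp : leb.-integrable `[0, +oo[ (EFin \o G x) by exact: integrableS iG.
have GN t : G x (- t) = G x t by rewrite /G normrN opprK; congr (_ * _); ring.
have mG : measurable_fun setT (EFin \o G x) by have /integrableP[] := iG.
have ip := integrable_pos_fin_num measurableT iG.
have iN := integrable_neg_fin_num measurableT iG.
have ip' : (\int[leb]_(y in `[0%R, +oo[) ((EFin \o G x)^\+ y))%E \is a fin_num.
  exact: integrable_pos_fin_num iGp.
have iN' : (\int[leb]_(y in `[0%R, +oo[) ((EFin \o G x)^\- y))%E \is a fin_num.
  exact: integrable_neg_fin_num iGp.
have -> : J x = fine (\int[leb]_(y in `[0%R, +oo[) ((EFin \o G x)^\+ y)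
   - \int[leb]_(y in `[0%R, +oo[) ((EFin \o G x)^\- y))%E.
  by rewrite /J /Rintegral integralE.
rewrite /Rintegral integralE.
rewrite (ge0_integral_even (f := (EFin \o G x)^\+%E))//; last 2 first.
- exact: measurable_funepos.
- by move=> t; rewrite !funeposE /= GN.
rewrite (ge0_integral_even (f := (EFin \o G x)^\-%E))//; last 2 first.
- exact: measurable_funeneg.
- by move=> t; rewrite !funenegE /= GN.
move: ip' iN'.
move: (\int[leb]_(y in `[0%R, +oo[) ((EFin \o G x)^\+ y))%E => P.
move: (\int[leb]_(y in `[0%R, +oo[) ((EFin \o G x)^\- y))%E => Q.
by case: P => // p _; case: Q => // q _ /=; ring.
Qed.

Lemma line_operator_const : exists2 c : R, 0 < c & forall x : R, `|x| < 1 ->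
  \int[leb]_t ((2 * pp s (1 - x ^+ 2) - pp s (1 - (x + t) ^+ 2) - pp s (1 - (x - t) ^+ 2))
     * (`|t| `^ (1 + 2 * s))^-1) = c.
Proof.
exists (J 0 + J 0); first by rewrite addr_gt0.
by move=> x x1; rewrite -(J_const x1) -(int_G_even x1).
Qed.

Lemma line_operator_integrable (x : R) : `|x| < 1 -> leb.-integrable setT
  (EFin \o (fun t : R => ((2 * pp s (1 - x ^+ 2) - pp s (1 - (x + t) ^+ 2) - pp s (1 - (x - t) ^+ 2))
     * (`|t| `^ (1 + 2 * s))^-1))).
Proof. exact: int_G. Qed.

End line_profile.

(** * The solution attached to a ball *)

Section projective_lines.
Context (R : realType).
Local Notation RT := (measurableTypeR R).
Local Notation leb := (@lebesgue_measure R).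
Local Notation mu n := (lebesgue_tuple R n).

Lemma lebesgue_integral_gt0 (g : RT -> \bar R) : measurable_fun setT g ->
  (forall x, 0 < g x)%E -> (0 < \int[leb]_x g x)%E.
Proof.
move=> mg g0; rewrite lt_neqAle integral_ge0 ?andbT; last by move=> x _; exact: ltW.
apply/negP => /eqP e.
have : (\int[leb]_x `|g x| = 0)%E.
  by rewrite e; apply: eq_integral => x _; rewrite gee0_abs// ltW.
move=> /(ae_eq_integral_abs leb measurableT mg)[N [mN N0 hN]].
have NT : N = setT.
  rewrite -subTset => x _; apply: hN => /= /(_ I) gx.
  by have := g0 x; rewrite gx ltxx.
by move: N0; rewrite NT -set_itvNyy => h; have := lebesgue_measure_itv (`]-oo, +oo[%R : interval R); rewrite h.
Qed.

Lemma tuple_integral_gt0 n (f : n.-tuple RT -> \bar R) : measurable_fun setT f ->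
  (forall x, 0 < f x)%E -> (0 < \int[mu n]_x f x)%E.
Proof.
elim: n f => [|n IH] f mf f0.
  by rewrite /= integral_dirac// diracT mul1e.
rewrite ge0_integral_cons//; last by move=> x; exact: ltW.
apply: lebesgue_integral_gt0; first by apply: measurable_inner => // x; exact: ltW.
by move=> x; apply: IH => //; exact: measurable_cons_comp.
Qed.

(** Applies [ge0_integral_projective] to the positive and negative parts. *)
Lemma integral_projective m (f : m.+1.-tuple RT -> R) (w : m.-tuple RT -> R) :
  (mu m.+1).-integrable setT (EFin \o f) ->
  (forall z, leb.-integrable setT
     (EFin \o (fun t : RT => `|t| ^+ m * f (cons_pair (t, tscale t z))))) ->
  (forall z, \int[leb]_t (`|t| ^+ m * f (cons_pair (t, tscale t z))) = w z) ->
  \int[mu m.+1]_t f t = \int[mu m]_z w z.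
Proof.
move=> iF il ew; have mF := measurable_int _ iF.
pose part (g : m.+1.-tuple RT -> \bar R) (z : m.-tuple RT) : \bar R :=
  (\int[leb]_t ((`|t| ^+ m)%:E * g (cons_pair (t, tscale t z))))%E.
have mpart g : measurable_fun setT g -> (forall x, 0 <= g x)%E -> measurable_fun setT (part g).
  move=> mg g0.
  apply: (@measurable_fun_fubini_tonelli_G _ _ _ _ _ leb
    (fun p : RT * m.-tuple RT => (`|p.1| ^+ m)%:E * g (cons_pair (p.1, tscale p.1 p.2)))%E).
    apply: emeasurable_funM.
      apply/measurable_EFinP; apply: measurable_funX.
      by apply: measurableT_comp => //; exact: measurable_fst.
    by apply: measurable_cons_comp => //; apply: measurable_tscale.
  by move=> p; rewrite mule_ge0// lee_fin exprn_ge0.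
have part0 g : (forall x, 0 <= g x)%E -> forall z, (0 <= part g z)%E.
  by move=> g0 z; apply: integral_ge0 => t _; rewrite mule_ge0// lee_fin exprn_ge0.
have mP := measurable_funepos mF; have mN := measurable_funeneg mF.
have P0 : forall x, (0 <= (EFin \o f)^\+ x)%E by move=> x; exact: funepos_ge0.
have N0 : forall x, (0 <= (EFin \o f)^\- x)%E by move=> x; exact: funeneg_ge0.
have ip : (mu m).-integrable setT (part (EFin \o f)^\+%E).
  apply/integrableP; split; first exact: mpart.
  under eq_integral => z _ do rewrite gee0_abs ?part0//.
  rewrite -ge0_integral_projective//.
  exact: (integral_funepos_lt_pinfty measurableT iF).
have iN : (mu m).-integrable setT (part (EFin \o f)^\-%E).
  apply/integrableP; split; first exact: mpart.
  under eq_integral => z _ do rewrite gee0_abs ?part0//.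
  rewrite -ge0_integral_projective//.
  exact: (integral_funeneg_lt_pinfty measurableT iF).
rewrite /Rintegral integralE ge0_integral_projective// ge0_integral_projective//.
rewrite -/(part _) -(integralB measurableT ip iN).
congr fine; apply: eq_integral => z _ /=.
rewrite -ew /Rintegral.
have fin : (\int[leb]_t (`|t| ^+ m * f (cons_pair (t, tscale t z)))%:E)%E \is a fin_num.
  exact: (integrable_fin_num measurableT (il z)).
rewrite fineK// integralE /part; congr (_ - _)%E; apply: eq_integral => t _.
  rewrite !funeposE/= EFinM maxeMr ?mule0// lee_fin exprn_ge0//.
rewrite !funenegE/= -mulrN EFinM maxeMr ?mule0// lee_fin exprn_ge0//.
Qed.

End projective_lines.

Section ball_profile.
Context (R : realType) (n : nat).
Local Notation RT := (measurableTypeR R).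
Implicit Types (X Y : 'rV[R]_n).

Lemma mfn_pp p (a : R) : mfn (fun Z : 'rV[R]_n => pp p (a - nsq Z)).
Proof.
move=> X; apply: (measurableT_comp (measurable_pp p)).
by apply: measurable_funB => //; exact: measurable_nsqD.
Qed.

(** Second differences only see [nsq X], [dotr X Y] and [nsq Y]; the dot product is
    controlled by Cauchy-Schwarz. *)
Lemma dif2_le_pp (tau a0 : R) : 0 <= tau < a0 -> exists2 K, 0 <= K &
  forall p a X, 0 < p -> a0 <= a -> nsq X = tau ->
    dif2_le (K * ((p + 1) ^+ 2 * a `^ p)) (fun Z : 'rV[R]_n => pp p (a - nsq Z)) X.
Proof.
move=> h; have [K K0 hK] := pp_dif2_bound h; exists K => // p a X p0 aa nX t.
rewrite /dif2 nsqD nsqB nX; apply: hK => //; last exact: nsq_ge0.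
by rewrite -nX cauchy_schwarz.
Qed.

End ball_profile.

(** On the line [X + t E], [E = (1, z)], the function is, up to an affine change of
    [t] and a factor, the profile [(1 - y ^ 2)_+ ^ s], for which the line operator
    is constant. The factors depending on [X] cancel, and the integral over the
    directions [z] does not depend on [X]. *)
Lemma symlap_pp_const_unit (R : realType) m (s : R) : 0 < s < 1 -> exists2 c : R, 0 < c &
  forall X : 'rV[R]_m.+1, nsq X < 1 -> symlap s (fun Z => pp s (1 - nsq Z)) X = c.
Proof.
move=> s01; have [c1 c10 hc1] := line_operator_const s01.
have s0 : 0 < s by case/andP: s01.
pose q (z : m.-tuple (measurableTypeR R)) : R := 1 + nsq (row_of_tuple z).
have q0 z : 0 < q z by rewrite ltr_pwDl// nsq_ge0.
pose w (z : m.-tuple (measurableTypeR R)) : R := c1 * (Num.sqrt (q z) ^+ m.+1)^-1.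
have mw : measurable_fun setT w.
  apply: measurable_funM => //.
  have -> : (fun x => (Num.sqrt (q x) ^+ m.+1)^-1) =
     (fun y : R => y `^ (- m.+1%:R)) \o (fun y : R => y `^ 2^-1) \o q.
    by apply/funext => z /=; rewrite powRN powR12_sqrt ?powR_mulrn ?sqrtr_ge0// ltW.
  apply: measurableT_comp; last by apply: measurable_funD => //; exact: measurable_nsq.
  by apply: measurableT_comp; exact: measurable_powR.
have w0 z : 0 < w z by rewrite mulr_gt0// invr_gt0 exprn_gt0// sqrtr_gt0.
have Iw0 : (0 < \int[lebesgue_tuple R m]_z (w z)%:E)%E.
  by apply: tuple_integral_gt0 => [|z]; [exact/measurable_EFinP|rewrite lte_fin].
have Iwoo : (\int[lebesgue_tuple R m]_z (w z)%:E < +oo)%E.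
  have [K K0 hK] := japanese_lty R m.
  have mw' : measurable_fun setT (fun z => ((Num.sqrt (q z) ^+ m.+1)^-1)%:E).
    have -> : (fun z => ((Num.sqrt (q z) ^+ m.+1)^-1)%:E) = (fun z => (c1^-1 * w z)%:E).
      by apply/funext => z; rewrite /w mulrA mulVf ?mul1r// gt_eqF.
    by apply/measurable_EFinP; exact: measurable_funM.
  under eq_integral do rewrite /w EFinM.
  rewrite ge0_integralZl_EFin ?(ltW c10)//.
  by apply: lte_mul_pinfty; rewrite ?lee_fin ?(ltW c10)// (le_lt_trans (hK 1 ltr01))// ltry.
exists (2^-1 * \int[lebesgue_tuple R m]_z w z).
  by rewrite mulr_gt0// ?invr_gt0// fine_gt0// Iw0.
move=> X X1; rewrite /symlap; congr (_ * _).
have hX : 0 <= nsq X < 1 by rewrite nsq_ge0.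
have [K K0 hK] := @dif2_le_pp R m.+1 _ _ hX.
have hD := hK s 1 X s0 (lexx _) erefl.
have mphi := @mfn_pp R m.+1 s 1.
pose E (z : m.-tuple (measurableTypeR R)) : 'rV[R]_m.+1 := row_of_tuple (cons_pair (1, z)).
have nE z : nsq (E z) = q z by rewrite nsq_cons expr1n.
have lineE t z : row_of_tuple (cons_pair (t, tscale t z)) = t *: E z.
  by rewrite /E -row_of_tscale tscale_cons mulr1.
(* the chord cut out by the unit ball on the line is centred at [t = - b] and has
   half-length [sqrt (rho / q)] in the parameter [t] *)
pose b z : R := dotr X (E z) / q z.
pose rho z : R := 1 - nsq X + q z * b z ^+ 2.
have rho0 z : 0 < rho z.
  by rewrite ltr_pwDl ?subr_gt0// mulr_ge0 ?sqr_ge0// ltW.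
pose al z : R := Num.sqrt (q z / rho z).
have al0 z : 0 < al z by rewrite sqrtr_gt0 divr_gt0.
have al2 z : al z ^+ 2 = q z / rho z by rewrite sqr_sqrtr// ltW// divr_gt0.
pose x z : R := al z * b z.
have x1 z : `|x z| < 1.
  rewrite -(@ltr_pXn2r _ 2)// ?nnegrE// expr1n -normrX ger0_norm ?sqr_ge0//.
  rewrite /x exprMn al2 mulrAC ltr_pdivrMr// mul1r /rho ltrDr subr_gt0//.
have phiE z t : pp s (1 - nsq (X + t *: E z)) = rho z `^ s * pp s (1 - (x z + al z * t) ^+ 2).
  have -> : 1 - nsq (X + t *: E z) = rho z * (1 - (x z + al z * t) ^+ 2).
    have -> : (x z + al z * t) ^+ 2 = q z / rho z * (b z + t) ^+ 2.
      by rewrite /x -mulrDr exprMn al2.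
    rewrite nsqD nsqZ nE dotrZr.
    have -> : dotr X (E z) = q z * b z by rewrite /b mulrCA divff ?mulr1// gt_eqF.
    have -> : rho z * (1 - q z / rho z * (b z + t) ^+ 2) = rho z - q z * (b z + t) ^+ 2.
      by field; rewrite gt_eqF.
    by rewrite /rho; ring.
  have [h|h] := leP 0 (1 - (x z + al z * t) ^+ 2).
    by rewrite !pp_pos ?mulr_ge0 ?powRM ?(ltW (rho0 z)).
  by rewrite !pp_neg ?mulr0 ?(ltW h)// nmulr_lle0// ltW.
have phiX z : pp s (1 - nsq X) = rho z `^ s * pp s (1 - x z ^+ 2).
  by have := phiE z 0; rewrite scale0r addr0 mulr0 addr0.
pose g z (t : R) : R := (2 * pp s (1 - x z ^+ 2) - pp s (1 - (x z + t) ^+ 2) - pp s (1 - (x z - t) ^+ 2))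
     * (`|t| `^ (1 + 2 * s))^-1.
have lineq (z : m.-tuple (measurableTypeR R)) t :
    `|t| ^+ m * (dif2 (fun Z => pp s (1 - nsq Z)) X (cons_pair (t, tscale t z)) *
       kern s (cons_pair (t, tscale t z)))
    = (Num.sqrt (q z) ^+ m.+1)^-1 * al z * g z (al z * t).
  rewrite mulrCA kern_cons -/(q z) kern_line//; last by rewrite sqrtr_gt0.
  rewrite /dif2 lineE -scaleNr !phiE (phiX z) /g mulrN.
  have -> : (`|Num.sqrt (q z) * t| `^ (1 + 2 * s)) =
     Num.sqrt (rho z) `^ (1 + 2 * s) * `|al z * t| `^ (1 + 2 * s).
    rewrite -powRM ?sqrtr_ge0// -[X in X * `|_|]ger0_norm ?sqrtr_ge0//.
    rewrite -normrM mulrA /al -sqrtrM ?(ltW (rho0 z))//.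
    by rewrite [_ * (_ / _)]mulrC divfK// gt_eqF.
  have r0 : 0 < Num.sqrt (rho z) by rewrite sqrtr_gt0.
  have sq : Num.sqrt (q z) = al z * Num.sqrt (rho z).
    by rewrite /al -sqrtrM ?divr_ge0 ?(ltW (q0 z)) ?(ltW (rho0 z))// divfK// gt_eqF.
  have -> : rho z `^ s = Num.sqrt (rho z) `^ (2 * s).
    by rewrite powRrM powR_mulrn ?sqrtr_ge0// sqr_sqrtr// ltW.
  rewrite powRD ?powRr1 ?sqrtr_ge0//; last by rewrite (gt_eqF r0) implybT.
  rewrite [in RHS]exprS {2}sq.
  have p0 : 0 < Num.sqrt (rho z) `^ (2 * s) by exact: powR_gt0.
  have := lt0r_neq0 p0; have := lt0r_neq0 r0; have := lt0r_neq0 (al0 z).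
  move: (Num.sqrt (q z) ^+ m) => a0.
  move: (pp s _) (pp s _) (pp s _) => y1 y2 y3.
  move: (`|_| `^ (1 + 2 * s)) => y7.
  move: (Num.sqrt (rho z) `^ (2 * s)) (Num.sqrt (rho z)) (al z) => y4 y5 y6 ? ? ?.
  rewrite !invfM; move: (a0^-1) (y7^-1) => y8 y9.
  by field; do ?[apply/andP; split].
have ig z : (@lebesgue_measure R).-integrable setT (EFin \o g z).
  exact: line_operator_integrable.
have mal z : measurable_fun [set: measurableTypeR R] (fun t : measurableTypeR R => (al z * t)%R : measurableTypeR R).
  exact: measurable_funM.
have igs z : (@lebesgue_measure R).-integrable setT (EFin \o (fun t : measurableTypeR R => g z (al z * t))).
  have /integrableP[mg oog] := ig z; apply/integrableP; split.
    exact: (measurableT_comp mg (mal z)).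
  rewrite (ge0_integral_scale (f := fun t => `|(EFin \o g z) t|%E))//.
  - by apply: lte_mul_pinfty => //; rewrite lee_fin invr_ge0.
  - by rewrite gt_eqF.
  - by apply: measurableT_comp mg.
have egs z : \int[@lebesgue_measure R]_t g z (al z * t) = (al z)^-1 * c1.
  have /integrableP[mg _] := ig z.
  rewrite -(hc1 _ (x1 z)) -/(g z) /Rintegral integralE [X in _ = _ * fine X]integralE.
  have aN0 : al z != 0 by rewrite gt_eqF.
  have := ge0_integral_scale (f := (EFin \o g z)^\+%E) aN0 (measurable_funepos mg) (fun x => funepos_ge0 _ x).
  have := ge0_integral_scale (f := (EFin \o g z)^\-%E) aN0 (measurable_funeneg mg) (fun x => funeneg_ge0 _ x).
  have -> : (fun x => (EFin \o g z)^\+ (al z * x)%R)%E = ((EFin \o (fun t => g z (al z * t)%R))^\+)%E.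
    by apply/funext => t; rewrite !funeposE.
  have -> : (fun x => (EFin \o g z)^\- (al z * x)%R)%E = ((EFin \o (fun t => g z (al z * t)%R))^\-)%E.
    by apply/funext => t; rewrite !funenegE.
  move=> -> ->.
  have := integrable_pos_fin_num measurableT (ig z).
  have := integrable_neg_fin_num measurableT (ig z).
  move: (\int[_]_t _)%E => Q; move: (\int[_]_t _)%E => P.
  by case: P => // p _; case: Q => // r _ /=; rewrite gtr0_norm//; ring.
have := integrable_dif2 (isT : (0 < m.+1)%N) s01 mphi hD.
move=> iF.
rewrite (@integral_projective R m _ w iF)//.
- move=> z; rewrite (_ : _ \o _ =
    (fun t => ((Num.sqrt (q z) ^+ m.+1)^-1 * al z)%R%:E * (EFin \o (fun t : measurableTypeR R => g z (al z * t)%R)) t)%E).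
    exact: integrableZl.
  by apply/funext => t /=; rewrite lineq EFinM.
- move=> z; under eq_Rintegral => t _ do rewrite lineq.
  rewrite RintegralZl// egs /w.
  by rewrite -mulrA mulVKf ?gt_eqF// mulrC.
Qed.

Lemma symlap_pp_const (R : realType) n (s : R) : (0 < n)%N -> 0 < s < 1 -> exists2 c : R, 0 < c &
  forall a (X : 'rV[R]_n), nsq X < a -> symlap s (fun Z => pp s (a - nsq Z)) X = c.
Proof.
case: n => // m _ s01; have [c c0 hc] := @symlap_pp_const_unit R m s s01; exists c => // a X Xa.
have s0 : 0 < s by case/andP: s01.
have a0 : 0 < a by rewrite (le_lt_trans _ Xa) ?nsq_ge0.
pose l := (Num.sqrt a)^-1.
have l0 : 0 < l by rewrite invr_gt0 sqrtr_gt0.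
have l2 : l ^+ 2 = a^-1 by rewrite exprVn sqr_sqrtr// ltW.
have lX : nsq (l *: X) < 1 by rewrite nsqZ l2 mulrC ltr_pdivrMr// mul1r.
have -> : (fun Z : 'rV[R]_m.+1 => pp s (a - nsq Z)) = (fun Z => a `^ s * pp s (1 - nsq (l *: Z)) + 0).
  apply/funext => Z; rewrite addr0 nsqZ l2.
  have e : a - nsq Z = a * (1 - a^-1 * nsq Z) by field; rewrite gt_eqF.
  rewrite e; have [h|h] := leP 0 (1 - a^-1 * nsq Z).
    by rewrite !pp_pos ?mulr_ge0 ?powRM ?(ltW a0).
  by rewrite !pp_neg ?mulr0 ?(ltW h)// nmulr_lle0// ltW.
have hX : 0 <= nsq (l *: X) < 1 by rewrite nsq_ge0.
have [K K0 hK] := @dif2_le_pp R m.+1 _ _ hX.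
have hD := hK s 1 (l *: X) s0 (lexx _) erefl.
have mphi := @mfn_pp R m.+1 s 1.
have z2 : dif2_le 0 (fun _ : 'rV[R]_m.+1 => 0 : R) X.
  by move=> t; rewrite /dif2 mul0r mulr0 !subr0 normr0.
have mz : mfn (fun _ : 'rV[R]_m.+1 => 0 : R) by move=> Z; exact: measurable_cst.
rewrite (symlap_lin (isT : (0 < m.+1)%N) s01 _ (mfn_dilate l mphi) mz (dif2_le_dilate hD) z2).
rewrite (symlap_dilate (isT : (0 < m.+1)%N) s01 l0 mphi hD) hc//.
have -> : symlap s (fun _ : 'rV[R]_m.+1 => 0 : R) X = 0.
  rewrite /symlap /Rintegral integral0_eq ?mulr0// => t _.
  by rewrite /dif2 mulr0 !subr0 mul0r.
rewrite addr0 mulrA; have -> : a `^ s * l `^ (2 * s) = 1; last by rewrite mul1r.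
rewrite powRrM powR_mulrn ?(ltW l0)// l2 -powRM ?invr_ge0 ?(ltW a0)//.
by rewrite divff ?powR1// gt_eqF.
Qed.

(** * Generalized binomial coefficients and power series *)

Section generalized_binomial.
Context (R : realType).
Implicit Types (p s : R) (k j : nat).

Definition gbin p k : R := (\prod_(j < k) (p - j%:R)) / k`!%:R.

Lemma gbin0 p : gbin p 0 = 1.
Proof. by rewrite /gbin big_ord0 fact0 divr1. Qed.

Lemma gbinS p k : k.+1%:R * gbin p k.+1 = (p - k%:R) * gbin p k.
Proof.
rewrite /gbin big_ord_recr/= factS natrM invfM.
have k0 : (k.+1%:R : R) != 0 by rewrite pnatr_eq0.
have f0 : (k`!%:R : R) != 0 by rewrite pnatr_eq0 -lt0n fact_gt0.
move: k0 f0; move: (\prod_(_ < _) _) (k.+1%:R : R) (k`!%:R : R) => y a b a0 b0.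
by field; rewrite a0 b0.
Qed.

Lemma gbin_shift p k : k.+1%:R * gbin (p + 1) k.+1 = (p + 1) * gbin p k.
Proof.
rewrite /gbin big_ord_recl/= factS natrM invfM subr0.
have k0 : (k.+1%:R : R) != 0 by rewrite pnatr_eq0.
have f0 : (k`!%:R : R) != 0 by rewrite pnatr_eq0 -lt0n fact_gt0.
have -> : \prod_(i < k) (p + 1 - (bump 0 i)%:R) = \prod_(i < k) (p - i%:R).
  by apply: eq_bigr => i _; rewrite /bump/= add1n -natr1; ring.
move: k0 f0; move: (\prod_(_ < _) _) (k.+1%:R : R) (k`!%:R : R) => y a b a0 b0.
by field; rewrite a0 b0.
Qed.

Lemma gbin_pascal p k : gbin (p + 1) k.+1 = gbin p k.+1 + gbin p k.
Proof.
have k0 : (k.+1%:R : R) != 0 by rewrite pnatr_eq0.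
apply: (mulfI k0); rewrite gbin_shift mulrDr gbinS -natr1; ring.
Qed.

Lemma gbin_le1 p k : 0 <= p <= 1 -> `|gbin p k| <= 1.
Proof.
move=> /andP[p0 p1]; elim: k => [|k IH]; first by rewrite gbin0 normr1.
have k0 : 0 < (k.+1%:R : R) by rewrite ltr0n.
rewrite -(ler_pM2l k0) mulr1 -[X in X * _]gtr0_norm// -normrM gbinS normrM.
rewrite -[leRHS]mulr1 ler_pM// -natr1 ler_norml; apply/andP; split; last first.
  by rewrite lerBlDr; have := ler0n R k; lra.
by have := ler0n R k; lra.
Qed.

Lemma gbin_bound s k j : 0 <= s <= 1 -> `|gbin (s + k%:R) j| <= 2 ^+ k.
Proof.
move=> s01; elim: k j => [|k IH] j; first by rewrite addr0 expr0 gbin_le1.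
case: j => [|j]; first by rewrite gbin0 normr1 exprn_ege1// ler1n.
rewrite -natr1 addrA gbin_pascal exprS mulrDl mul1r.
by rewrite (le_trans (ler_normD _ _))// lerD.
Qed.

(** Partial sums of the alternating row: this evaluates [balldiff] at [0]. *)
Lemma gbin_alt p i : \sum_(j < i.+1) (-1) ^+ j * gbin (p + 1) j = (-1) ^+ i * gbin p i.
Proof.
elim: i => [|i IH]; first by rewrite big_ord1 !gbin0.
by rewrite big_ord_recr/= IH gbin_pascal exprS; ring.
Qed.

End generalized_binomial.

Section analytic_coefficients.
Context (R : realType).
Implicit Types (c : nat -> R) (x : R).

(** The radius of convergence is at least [1], in Abel's form: boundedness of the
    terms, a condition that is stable under differentiation. *)
Definition disc_coef c := forall x, 0 < x < 1 -> exists M, forall j, `|c j| * x ^+ j <= M.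

Lemma bounded_disc_coef c M : (forall j, `|c j| <= M) -> disc_coef c.
Proof.
move=> h x /andP[x0 x1]; exists M => j.
by rewrite (le_trans _ (h j))// ler_piMr// exprn_ile1 ?(ltW x0) ?(ltW x1).
Qed.

Lemma succ_geometric_le x j : 0 <= x < 1 -> j.+1%:R * x ^+ j <= (1 - x)^-1.
Proof.
move=> /andP[x0 x1]; have x10 : 0 < 1 - x by rewrite subr_gt0.
rewrite -[leRHS]mul1r ler_pdivlMr//.
have h : (\sum_(i < j.+1) x ^+ i) * (1 - x) <= 1.
  by rewrite mulrC -opprB mulNr -subrX1 opprB gerBl exprn_ge0.
apply: le_trans h; rewrite ler_wpM2r ?(ltW x10)//.
rewrite mulr_natl -[in leLHS](card_ord j.+1) -sumr_const; apply: ler_sum => i _.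
by rewrite ler_wiXn2l// ?(ltW x1)// -ltnS.
Qed.

Lemma disc_coef_diffs c : disc_coef c -> disc_coef (pseries_diffs c).
Proof.
move=> hc x /andP[x0 x1]; pose y := (x + 1) / 2.
have y0 : 0 < y by rewrite /y; lra.
have xy : x < y by rewrite /y; lra.
have y1 : y < 1 by rewrite /y; lra.
have [M hM] := hc y (introT andP (conj y0 y1)).
have q01 : 0 <= x / y < 1 by rewrite divr_ge0 ?(ltW x0) ?(ltW y0)//= ltr_pdivrMr// mul1r.
clearbody y; exists (M / y * (1 - x / y)^-1) => j.
have -> : `|pseries_diffs c j| * x ^+ j = `|c j.+1| * y ^+ j.+1 / y * (j.+1%:R * (x / y) ^+ j).
  rewrite /pseries_diffs normrM normr_nat expr_div_n exprS.
  by field; rewrite expf_neq0 gt_eqF.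
apply: ler_pM.
- by rewrite !mulr_ge0 ?invr_ge0 ?exprn_ge0 ?(ltW y0).
- by rewrite mulr_ge0// exprn_ge0//; case/andP: q01.
- by rewrite ler_wpM2r ?invr_ge0 ?(ltW y0).
- exact: succ_geometric_le.
Qed.

Lemma disc_coef_cvg c x : disc_coef c -> `|x| < 1 -> cvgn (pseries c x).
Proof.
move=> hc x1; pose y := (`|x| + 1) / 2; have x0 := normr_ge0 x.
have y0 : 0 < y by rewrite /y; lra.
have xy : `|x| < y by rewrite /y; lra.
have y1 : y < 1 by rewrite /y; lra.
have [M hM] := hc y (introT andP (conj y0 y1)).
apply: normed_cvg; apply: (@series_le_cvg _ _ (geometric M (`|x| / y))).
- by move=> j; exact: normr_ge0.
- move=> j /=; rewrite mulr_ge0 ?exprn_ge0 ?divr_ge0 ?(ltW y0)//.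
  by rewrite (le_trans _ (hM 0%N))// mulr_ge0.
- move=> j /=; rewrite normrM normrX expr_div_n mulrA ler_pdivlMr ?exprn_gt0// mulrAC.
  by rewrite ler_wpM2r ?exprn_ge0//.
- apply: is_cvg_geometric_series; rewrite ger0_norm ?divr_ge0 ?(ltW y0)//.
  by rewrite ltr_pdivrMr// mul1r.
Qed.

Definition pfun c x : R := limn (pseries c x).

Lemma pfun_cvg c x : disc_coef c -> `|x| < 1 -> pseries c x @ \oo --> pfun c x.
Proof. by move=> hc x1; exact: disc_coef_cvg. Qed.

Lemma is_derive_pfun c x : disc_coef c -> `|x| < 1 ->
  is_derive x (1 : R) (pfun c) (pfun (pseries_diffs c) x).
Proof.
move=> hc x1; pose y := (`|x| + 1) / 2; have x0 := normr_ge0 x.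
have y0 : 0 < y by rewrite /y; lra.
have xy : `|x| < y by rewrite /y; lra.
have y1 : y < 1 by rewrite /y; lra.
have ny1 : `|y| < 1 by rewrite gtr0_norm.
apply: (@pseries_snd_diffs _ c y).
- exact: disc_coef_cvg.
- by apply: disc_coef_cvg => //; exact: disc_coef_diffs.
- by apply: disc_coef_cvg => //; apply: disc_coef_diffs; exact: disc_coef_diffs.
- by rewrite (gtr0_norm y0).
Qed.

Definition bcoef (p : R) (j : nat) : R := (-1) ^+ j * gbin p j.

Lemma bcoef_diffs p j : pseries_diffs (bcoef p) j = (j%:R - p) * bcoef p j.
Proof.
rewrite /pseries_diffs /bcoef exprS mulrCA (mulrC (-1)) -mulrA (mulrCA _ (-1)) gbinS; ring.
Qed.

Lemma bcoef_ode p x : disc_coef (bcoef p) -> `|x| < 1 ->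
  (1 - x) * pfun (pseries_diffs (bcoef p)) x = - p * pfun (bcoef p) x.
Proof.
move=> hc x1; set f' := pfun (pseries_diffs _) x; set f := pfun _ x.
have c1 := pfun_cvg (disc_coef_diffs hc) x1; have c0 := pfun_cvg hc x1.
have rel N : pseries (pseries_diffs (bcoef p)) x N.+1 =
    x * pseries (pseries_diffs (bcoef p)) x N - p * pseries (bcoef p) x N.+1.
  rewrite /pseries !seriesEnat/=.
  under eq_bigr do rewrite bcoef_diffs mulrBl mulrBl.
  rewrite sumrB; congr (_ - _); last by rewrite mulr_sumr; apply: eq_bigr => j _; rewrite mulrA.
  rewrite big_nat_recl// !mul0r add0r mulr_sumr; apply: eq_bigr => j _.
  by rewrite /pseries_diffs exprS mulrCA.
have c1' : pseries (pseries_diffs (bcoef p)) x n.+1 @[n --> \oo] --> f' by rewrite cvg_shiftS.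
have c0' : pseries (bcoef p) x n.+1 @[n --> \oo] --> f by rewrite cvg_shiftS.
have c2 : pseries (pseries_diffs (bcoef p)) x n.+1 @[n --> \oo] --> x * f' - p * f.
  under eq_fun do rewrite rel.
  by apply: cvgB; apply: cvgM => //; exact: cvg_cst.
have e : f' = x * f' - p * f by apply: (cvg_unique _ c1' c2).
by rewrite mulrBl mul1r {1}e; ring.
Qed.

(** By [bcoef_ode] the sum [f] of the series satisfies [(1 - x) f' = - p f],
    so that [f x * (1 - x) ^ (- p)] is constant. *)
Lemma binomial_series p x : disc_coef (bcoef p) -> 0 <= x < 1 ->
  pseries (bcoef p) x @ \oo --> (1 - x) `^ p.
Proof.
move=> hc /andP[x0 x1]; have nx1 : `|x| < 1 by rewrite ger0_norm.
suff <- : pfun (bcoef p) x = (1 - x) `^ p by exact: pfun_cvg.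
pose g (y : R) := pfun (bcoef p) y * (1 - y) `^ (- p).
have dg (y : R) : `|y| < 1 -> is_derive y 1 g 0.
  move=> y1; have y10 : 0 < 1 - y by have := ler_norm y; lra.
  have h1 := is_derive_pfun hc y1.
  have h2 := is_derive_powR (- p) y10.
  have h3 : is_derive y 1 (fun y : R => 1 - y) (-1).
    by apply: is_derive_eq; rewrite /GRing.scale/=; ring.
  have h4 := @is_derive1_comp _ (fun z => z `^ (- p)) _ y _ _ h2 h3.
  apply: (is_derive_eq (is_deriveM h1 h4)); rewrite /GRing.scale/=.
  have e := bcoef_ode hc y1.
  rewrite powRD; last by rewrite (gt_eqF y10) implybT.
  rewrite (powR_inv1 (ltW y10)).
  have -> : pfun (pseries_diffs (bcoef p)) y = - p * pfun (bcoef p) y / (1 - y).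
    by rewrite -e mulrC mulKf// gt_eqF.
  by field; rewrite gt_eqF.
have gx : g x = g 0.
  apply/eqP; rewrite -subr_eq0; apply/eqP.
  have [z _ ->] : exists2 z, z \in `[0, x] & g x - g 0 = 0 * (x - 0).
    apply: (@MVT_segment _ g (fun=> 0)) => //.
      by move=> y; rewrite in_itv/= => /andP[y0 yx]; apply: dg; rewrite gtr0_norm// (lt_trans yx).
    apply: derivable_within_continuous => y; rewrite in_itv/= => /andP[y0 yx].
    have h : `|y| < 1 by rewrite ger0_norm// (le_lt_trans yx).
    by have := dg y h => h'; exact: ex_derive.
  by rewrite mul0r.
have g0 : g 0 = 1.
  rewrite /g subr0 powR1 mulr1.
  apply/(cvg_lim (@Rhausdorff _)); rewrite -cvg_shiftS.
  apply: cvg_near_cst; apply: nearW => N.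
  rewrite /pseries seriesEnat/= big_nat_recl// expr0 mulr1 /bcoef expr0 mul1r gbin0.
  by rewrite big1 ?addr0// => i _; rewrite expr0n/= mulr0.
have x10 : 0 < 1 - x by rewrite subr_gt0.
have p0 : (1 - x) `^ p != 0 by rewrite gt_eqF// powR_gt0.
by apply: (mulIf (invr_neq0 p0)); rewrite -powRN -/(g x) gx g0 powRN divff.
Qed.

Lemma bcoef_bound (s : R) k j : 0 <= s <= 1 -> `|bcoef (s + k%:R) j| <= 2 ^+ k.
Proof. by move=> h; rewrite normrM normrX normrN1 expr1n mul1r gbin_bound. Qed.

Lemma geometric_majorant (u : nat -> R) M : (forall i, `|u i| <= M * 2^-1 ^+ i) ->
  exists l, series u @ \oo --> l /\ forall N, `|l - series u N| <= 2 * M * 2^-1 ^+ N.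
Proof.
move=> h.
have M0 : 0 <= M by have := h 0%N; rewrite expr0 mulr1; exact: le_trans.
have cv : cvgn (series u).
  apply: normed_cvg; apply: (@series_le_cvg _ _ (geometric M 2^-1)).
  - by move=> j; exact: normr_ge0.
  - by move=> j /=; rewrite mulr_ge0// exprn_ge0.
  - exact: h.
  - by apply: is_cvg_geometric_series; rewrite ger0_norm// invf_lt1// ltr1n.
exists (limn (series u)); split => // N.
have d k : `|series u (N + k)%N - series u N| <= 2 * M * 2^-1 ^+ N.
  have : `|series u (N + k)%N - series u N| <= M * 2^-1 ^+ N * (2 - 2 * 2^-1 ^+ k).
    elim: k => [|k IH]; first by rewrite addn0 subrr normr0 expr0 mulr1 subrr mulr0.
    rewrite addnS seriesSr.
    rewrite addrAC (le_trans (ler_normD _ _))// (le_trans (lerD IH (h _)))//.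
    by rewrite exprD exprS le_eqVlt; apply/orP; left; apply/eqP; field.
  move=> /le_trans; apply; rewrite [leRHS](_ : _ = M * 2^-1 ^+ N * 2); last by ring.
  by rewrite ler_wpM2l ?mulr_ge0 ?exprn_ge0// gerBl mulr_ge0// exprn_ge0.
have c : `|series u (k + N)%N - series u N| @[k --> \oo] --> `|limn (series u) - series u N|.
  by apply: cvg_norm; apply: cvgB; [rewrite (cvg_shiftn N)|exact: cvg_cst].
by apply: (cvgr_to_le c); apply: nearW => k; rewrite addnC.
Qed.

End analytic_coefficients.

Lemma is_derive_pp_gt1 (R : realType) (p y : R) : 1 < p ->
  is_derive y 1 (pp p) (p * pp (p - 1) y).
Proof.
move=> p1; have p0 : 0 < p - 1 by rewrite subr_gt0.
have [y0|y0|->] := ltgtP y 0.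
- rewrite (pp_neg p0 (ltW y0)) mulr0.
  have h : is_derive y (1 : R) (fun _ : R => 0 : R) 0 by exact: is_derive_cst.
  apply: (near_eq_is_derive _ h).
  near=> x; rewrite pp_neg//; first by rewrite (lt_trans ltr01).
  by apply: ltW; near: x; exact: lt_nbhsl.
- exact: is_derive_pp.
rewrite (pp_neg p0 (lexx _)) mulr0.
have e : pp p = fun x => x * pp (p - 1) x.
  by apply/funext => x; rewrite -(ppS _ p0) subrK.
have cv : h^-1 *: (pp p (h + 0) - pp p 0) @[h --> 0^'] --> (0 : R).
  have c0 : pp (p - 1) x @[x --> (0 : R)^'] --> pp (p - 1) 0.
    by apply: cvg_within_filter; exact: continuous_pp.
  rewrite (pp_neg p0 (lexx _)) in c0.
  apply: cvg_trans c0; apply: near_eq_cvg; near=> h.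
  have h0 : h != 0 by near: h; exact: nbhs_dnbhs_neq.
  by rewrite e mul0r subr0 addr0 /GRing.scale/= mulKf.
apply: DeriveDef.
  by apply/cvg_ex; exists 0; under eq_fun do rewrite scaler1.
by rewrite -derive1E; apply/cvg_lim.
Unshelve. all: by end_near. Qed.

(** * Powers of the radius in the range of the operator *)

Section symlap_sums.
Context (R : realType) (n : nat) (s : R).
Hypothesis n0 : (0 < n)%N.
Hypothesis s01 : 0 < s < 1.
Implicit Types (phi psi : 'rV[R]_n -> R) (X : 'rV[R]_n).

Lemma mfn0 : mfn (fun _ : 'rV[R]_n => 0 : R).
Proof. by move=> X; exact: measurable_cst. Qed.

Lemma dif2_le0 X : dif2_le 0 (fun _ => 0) X.
Proof. by move=> t; rewrite /dif2 mul0r mulr0 !subr0 normr0. Qed.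

Lemma symlap0 X : symlap s (fun _ => 0) X = 0.
Proof.
by rewrite /symlap /Rintegral integral0_eq ?mulr0// => t _; rewrite /dif2 mulr0 !subr0 mul0r.
Qed.

Lemma mfnZ c phi : mfn phi -> mfn (fun Z => c * phi Z).
Proof.
move=> mf; rewrite (_ : (fun Z => _) = fun Z => c * phi Z + 0); last by apply/funext => Z; rewrite addr0.
exact: (mfn_lin c mf mfn0).
Qed.

Lemma dif2_leZ c C phi X : dif2_le C phi X -> dif2_le (`|c| * C) (fun Z => c * phi Z) X.
Proof.
move=> h; rewrite (_ : (fun Z => _) = fun Z => c * phi Z + 0); last by apply/funext => Z; rewrite addr0.
by rewrite -[_ * C]addr0; exact: (dif2_le_lin c h (@dif2_le0 X)).
Qed.

Lemma symlapZ c C phi X : mfn phi -> dif2_le C phi X ->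
  symlap s (fun Z => c * phi Z) X = c * symlap s phi X.
Proof.
move=> mf h; rewrite (_ : (fun Z => _) = fun Z => c * phi Z + 0); last by apply/funext => Z; rewrite addr0.
by rewrite (symlap_lin n0 s01 c mf mfn0 h (@dif2_le0 X)) symlap0 addr0.
Qed.

Lemma dif2_le_mono C C' phi X : C <= C' -> dif2_le C phi X -> dif2_le C' phi X.
Proof.
move=> CC h t; rewrite (le_trans (h t))// ler_wpM2r// le_min ler01/= nsq_ge0//.
Qed.

Lemma symlap_sum N (c C : nat -> R) (phi : nat -> 'rV[R]_n -> R) X :
  (forall k, mfn (phi k)) -> (forall k, (k < N)%N -> dif2_le (C k) (phi k) X) ->
  [/\ mfn (fun Z => \sum_(k < N) c k * phi k Z),
      dif2_le (\sum_(k < N) `|c k| * C k) (fun Z => \sum_(k < N) c k * phi k Z) X &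
      symlap s (fun Z => \sum_(k < N) c k * phi k Z) X = \sum_(k < N) c k * symlap s (phi k) X].
Proof.
move=> mf; elim: N => [|N IH] h.
  have e : (fun Z => \sum_(k < 0) c k * phi k Z) = (fun _ => 0).
    by apply/funext => Z; rewrite big_ord0.
  by rewrite !big_ord0 e symlap0; split; [exact: mfn0|exact: dif2_le0|].
have [m1 d1 l1] := IH (fun k kN => h k (leqW kN)).
have dN := h N (ltnSn N).
have e : (fun Z => \sum_(k < N.+1) c k * phi k Z) =
    (fun Z => c N * phi N Z + \sum_(k < N) c k * phi k Z).
  by apply/funext => Z; rewrite big_ord_recr addrC.
have e2 (g : nat -> R) : \sum_(k < N.+1) g k = g N + \sum_(k < N) g k.
  by rewrite big_ord_recr addrC.
rewrite e (e2 (fun k => `|c k| * C k)) (e2 (fun k => c k * symlap s (phi k) X)).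
rewrite (symlap_lin n0 s01 (c N) (mf N) m1 dN d1) l1.
by split; [exact: mfn_lin|exact: dif2_le_lin|].
Qed.

End symlap_sums.

Section powers_of_the_ball.
Context (R : realType) (n : nat) (s : R).
Hypothesis n0 : (0 < n)%N.
Hypothesis s01 : 0 < s < 1.
Local Notation RT := (measurableTypeR R).
Implicit Types (X Y Z : 'rV[R]_n).

Let s0 : 0 < s. Proof. by case/andP: s01. Qed.
Let sk0 k : 0 < s + k%:R. Proof. by rewrite ltr_wpDr. Qed.

Definition ballpow k (a : R) Z : R := pp (s + k%:R) (a - nsq Z).

Lemma mfn_ballpow k a : mfn (ballpow k a).
Proof. exact: mfn_pp. Qed.

Lemma dif2_le_ballpow k a X : nsq X < a -> exists C, dif2_le C (ballpow k a) X.
Proof.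
move=> Xa; have h : 0 <= nsq X < a by rewrite nsq_ge0.
have [K K0 hK] := @dif2_le_pp R n _ _ h.
by eexists; exact: (hK _ a X (sk0 k) (lexx _) erefl).
Qed.

(** Differentiation under the integral sign. *)
Lemma symlap_ballpow_derive k (a : R) X : nsq X < a ->
  is_derive a 1 (fun b : R => symlap s (ballpow k.+1 b) X) ((s + k.+1%:R) * symlap s (ballpow k a) X).
Proof.
move=> Xa; pose u := (nsq X + a) / 2; pose v := a + 1.
have Xu : nsq X < u by rewrite /u; lra.
have ua : u < a by rewrite /u; lra.
have av : a < v by rewrite /v; lra.
have h : 0 <= nsq X < u by rewrite nsq_ge0.
have [K K0 hK] := @dif2_le_pp R n _ _ h.
pose f (b : R) (t : n.-tuple RT) : R := dif2 (ballpow k.+1 b) X t * kern s t.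
have df (b : R) (t : n.-tuple RT) : is_derive b 1 (f ^~ t) ((s + k.+1%:R) * (dif2 (ballpow k b) X t * kern s t)).
  have p1 : 1 < s + k.+1%:R by rewrite -natr1 addrA ltrDr.
  have dp (c : R) : is_derive b 1 (fun b : R => pp (s + k.+1%:R) (b - c)) ((s + k.+1%:R) * pp (s + k%:R) (b - c)).
    have h1 := is_derive_pp_gt1 (b - c) p1.
    have h2 : is_derive b 1 (fun b : R => b - c) 1.
      by apply: is_derive_eq; rewrite /GRing.scale/=; ring.
    have h3 := @is_derive1_comp _ (pp _) (fun b : R => b - c) b _ _ h1 h2.
    apply: (is_derive_eq h3); rewrite mulr1; congr (_ * pp _ _).
    by rewrite -natr1 addrA addrK.
  have d1 := dp (nsq X); have d2 := dp (nsq (X + row_of_tuple t)).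
  have d3 := dp (nsq (X - row_of_tuple t)).
  have e : f ^~ t = (fun b : R => kern s t * ((2 * pp (s + k.+1%:R) (b - nsq X)
      - pp (s + k.+1%:R) (b - nsq (X + row_of_tuple t)))
      - pp (s + k.+1%:R) (b - nsq (X - row_of_tuple t)))).
    by apply/funext => y; rewrite /f mulrC.
  have hd := is_deriveZ (kern s t) (is_deriveB (is_deriveB (is_deriveZ (2 : R) d1) d2) d3).
  rewrite e; apply: (is_derive_eq hd); rewrite /GRing.scale/= /dif2 /ballpow.
  move: (pp _ _) (pp _ _) (pp _ _) (kern s t) (k.+1%:R : R) => y1 y2 y3 y4 y5; ring.
have Ia : `]u, v[%classic a by rewrite /= in_itv/= ua av.
have int_f b : `]u, v[%classic b -> (lebesgue_tuple R n).-integrable setT (EFin \o f b).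
  rewrite /= in_itv/= => /andP[ub bv].
  apply: (integrable_dif2 n0 s01 (C := K * ((s + k.+1%:R + 1) ^+ 2 * b `^ (s + k.+1%:R)))).
    exact: mfn_ballpow.
  exact: (hK _ b X (sk0 k.+1) (ltW ub) erefl).
pose M := (s + k.+1%:R) * (K * ((s + k%:R + 1) ^+ 2 * v `^ (s + k%:R))).
have v0 : 0 <= v by rewrite (le_trans (nsq_ge0 X))// ltW// (lt_trans Xa).
have M0 : 0 <= M.
  exact: (mulr_ge0 (ltW (sk0 k.+1)) (mulr_ge0 K0 (mulr_ge0 (sqr_ge0 _) (powR_ge0 _ _)))).
have intG : (lebesgue_tuple R n).-integrable setT (EFin \o (fun t => M * dom s t)).
  exact: integrableC.
have G0 (t : n.-tuple RT) : 0 <= M * dom s t by rewrite mulr_ge0// dom_ge0.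
have pE b t : partial1of2 f b t = (s + k.+1%:R) * (dif2 (ballpow k b) X t * kern s t).
  by rewrite partial1of2E; have h1 := df b t; rewrite derive_val.
have ubG b t : `]u, v[%classic b -> setT t -> `|partial1of2 f b t| <= M * dom s t.
  rewrite /= in_itv/= => /andP[ub bv] _; rewrite pE.
  rewrite normrM gtr0_norm ?sk0// /M -mulrA ler_wpM2l ?(ltW (sk0 _))//.
  apply: dif2_le_dom; apply: dif2_le_mono (hK _ b X (sk0 k) (ltW ub) erefl).
  rewrite ler_wpM2l// ler_wpM2l ?sqr_ge0//.
  apply: ge0_ler_powR; rewrite ?nnegrE ?(ltW (sk0 _)) ?(ltW bv)//.
  by rewrite (le_trans (nsq_ge0 X))// ltW// (lt_trans Xu).
have der b t : `]u, v[%classic b -> setT t -> derivable (f ^~ t) b 1.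
  by move=> _ _; have h1 := df b t; exact: ex_derive.
have D := derivable_under_integral measurableT Ia int_f der G0 intG ubG.
have E := differentiation_under_integral measurableT Ia int_f der G0 intG ubG.
have FD : is_derive a 1 (fun b => \int[lebesgue_tuple R n]_t f b t)
    ((s + k.+1%:R) * \int[lebesgue_tuple R n]_t (dif2 (ballpow k a) X t * kern s t)).
  apply: DeriveDef => //; rewrite -derive1E E.
  under eq_Rintegral do rewrite pE.
  rewrite RintegralZl//; apply: (integrable_dif2 n0 s01 (mfn_ballpow k a)).
  exact: (hK _ a X (sk0 k) (ltW ua) erefl).
have h2 : is_derive a 1 (fun b : R => 2^-1 * \int[lebesgue_tuple R n]_t f b t)
    (2^-1 * ((s + k.+1%:R) * \int[lebesgue_tuple R n]_t (dif2 (ballpow k a) X t * kern s t))).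
  exact: (is_deriveZ (2^-1 : R)).
by apply: (is_derive_eq h2); rewrite /symlap mulrCA.
Qed.

Lemma symlap_ballpow_scale k (a l : R) X : 0 < l -> nsq X < a ->
  symlap s (ballpow k (l ^+ 2 * a)) (l *: X) = l ^+ (2 * k) * symlap s (ballpow k a) X.
Proof.
move=> l0.
have alg (p q A L1 L2 : R) : p != 0 -> A = p * q -> A * L1 = p * L2 -> L2 = q * L1.
  by move=> p0 -> h; apply: (mulfI p0); rewrite -h mulrA.
have p0 : 0 < l `^ (2 * s) by exact: powR_gt0.
have pE : (l ^+ 2) `^ (s + k%:R) = l `^ (2 * s) * l ^+ (2 * k).
  rewrite -(powR_mulrn 2 (ltW l0)) -powRrM mulrDr powRD; last by rewrite (gt_eqF l0) implybT.
  by rewrite -[2 * k%:R]natrM powR_mulrn// ltW.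
have l20 : 0 < l ^+ 2 by rewrite exprn_gt0.
move=> Xa.
have lXa : nsq (l *: X) < l ^+ 2 * a by rewrite nsqZ ltr_pM2l.
have [C hC] := dif2_le_ballpow k lXa; have [C' hC'] := dif2_le_ballpow k Xa.
have h1 := symlap_dilate n0 s01 l0 (mfn_ballpow k (l ^+ 2 * a)) hC.
have e : (fun Y => ballpow k (l ^+ 2 * a) (l *: Y)) =
    (fun Y => (l ^+ 2) `^ (s + k%:R) * ballpow k a Y).
  apply/funext => Y; rewrite /ballpow nsqZ -mulrBr.
  have [h|h] := leP 0 (a - nsq Y).
    by rewrite (pp_pos _ h) (pp_pos _ (mulr_ge0 (ltW l20) h)) (powRM _ (ltW l20) h).
  by rewrite !pp_neg ?mulr0 ?(ltW h)// pmulr_rle0// ltW.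
rewrite e (symlapZ n0 s01 _ (mfn_ballpow k a) hC') in h1.
exact: (alg (l `^ (2 * s)) (l ^+ (2 * k)) ((l ^+ 2) `^ (s + k%:R)) (symlap s (ballpow k a) X) (symlap s (ballpow k (l ^+ 2 * a)) (l *: X)) (lt0r_neq0 p0) pE h1).
Qed.

Lemma symlap_ballpow_radial k a X Y : nsq X = nsq Y -> symlap s (ballpow k a) X = symlap s (ballpow k a) Y.
Proof.
move=> h; apply: (@symlap_radial R n s (fun y => pp (s + k%:R) (a - y)) X Y n0 _ h).
exact: mfn_pp.
Qed.

End powers_of_the_ball.

Section ladder.
Context (R : realType) (n : nat) (s : R).
Hypothesis n0 : (0 < n)%N.
Variable G : nat -> R -> 'rV[R]_n -> R.
Implicit Types (X Y Z : 'rV[R]_n).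
Hypothesis G_derive : forall k (a : R) X, nsq X < a ->
  is_derive a 1 (fun b : R => G k.+1 b X) ((s + k.+1%:R) * G k a X).
Hypothesis G_scale : forall k (a l : R) X, 0 < l -> nsq X < a ->
  G k (l ^+ 2 * a) (l *: X) = l ^+ (2 * k) * G k a X.
Hypothesis G_radial : forall k a X Y, nsq X = nsq Y -> G k a X = G k a Y.
Variable c0 : R.
Hypothesis G0E : forall a X, nsq X < a -> G 0 a X = c0.

(** By [G_derive] each derivation in [a] lowers [k], and [E i a X] is the Taylor
    polynomial at [a], evaluated at [0], of [b |-> G i b X]; its derivative in [a]
    telescopes to zero since [G 0] is constant. *)
Let E i (a : R) X : R := \sum_(k < i.+1) (-1) ^+ (i - k) * gbin (s + i%:R) (i - k) * (a ^+ (i - k) * G k a X).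

Let dG k (a : R) X : R := if k is k'.+1 then (s + k%:R) * G k' a X else 0.

Let is_derive_G k (a : R) X : nsq X < a -> is_derive a 1 (fun b : R => G k b X) (dG k a X).
Proof.
case: k => [|k] Xa /=; last exact: G_derive.
have h : is_derive a (1 : R) (fun _ : R => c0) 0 by exact: is_derive_cst.
apply: (near_eq_is_derive _ h).
by near=> b; rewrite G0E//; near: b; exact: lt_nbhsr.
Unshelve. all: by end_near. Qed.

Let is_derive_E i (a : R) X : nsq X < a -> is_derive a 1 (fun b : R => E i b X) 0.
Proof.
move=> Xa.
pose c k : R := (-1) ^+ (i - k) * gbin (s + i%:R) (i - k).
pose t k : R := c k * ((i - k)%:R * a ^+ (i - k).-1) * G k a X.
pose r k : R := c k * a ^+ (i - k) * dG k a X.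
have dterm (k : 'I_i.+1) : is_derive a 1 (fun b : R => c k * (b ^+ (i - k) * G k b X)) (t k + r k).
  have h := is_derive_G k Xa.
  have h2 : is_derive a 1 (fun b : R => b ^+ (i - k)) ((i - k)%:R * a ^+ (i - k).-1).
    have h2 := is_deriveX (i - k)%N (is_derive_id a (1 : R)).
    rewrite (_ : (fun b : R => b ^+ (i - k)) = (@id R) ^+ (i - k)).
      by apply: (is_derive_eq h2); rewrite /GRing.scale/= mulr1.
    by apply/funext => b; rewrite exprfctE.
  have h3 := is_deriveZ (c k) (is_deriveM h2 h).
  by apply: (is_derive_eq h3); rewrite /GRing.scale/= /t /r; ring.
have e : (fun b => E i b X) = \sum_(k < i.+1) (fun b : R => c k * (b ^+ (i - k) * G k b X)).
  by apply/funext => b; rewrite fct_sumE.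
rewrite e; apply: is_derive_eq.
rewrite big_split/= big_ord_recr/= [X in _ + X]big_ord_recl/=.
have -> : t i = 0 by rewrite /t subnn mul0r mulr0 mul0r.
have -> : r (ord0 : 'I_i.+1) = 0 by rewrite /r/= mulr0.
rewrite addr0 add0r -big_split/= big1// => k _.
rewrite /t /r /bump/= add1n /c; have ki := ltn_ord k.
have -> : (i - k = (i - k.+1).+1)%N by rewrite -subSn// subSS.
set l := (i - k.+1)%N.
have kl : s + i%:R - l%:R = s + k.+1%:R.
  by rewrite /l natrB//; ring.
have h := gbinS (s + i%:R) l; rewrite kl in h.
have e1 (x y z w : R) : x * y * (z * w) = x * (z * y) * w by ring.
by rewrite (e1 ((-1) ^+ l.+1) (gbin (s + i%:R) l.+1) l.+1%:R) h exprS /= add0n; ring.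
Qed.

Let E_cst i a b X : nsq X < a -> nsq X < b -> E i a X = E i b X.
Proof.
wlog ab : a b / a <= b.
  by move=> h Xa Xb; have [ab|/ltW ba] := leP a b; [exact: h|apply/esym; exact: h].
move=> Xa Xb; apply/esym/eqP; rewrite -subr_eq0; apply/eqP.
have [z _ ->] : exists2 z, z \in `[a, b] & E i b X - E i a X = 0 * (b - a).
  apply: (@MVT_segment _ (fun b => E i b X) (fun=> 0)) => //.
    move=> y; rewrite in_itv/= => /andP[ay _]; apply: is_derive_E.
    by rewrite (lt_trans Xa).
  apply: derivable_within_continuous => y; rewrite in_itv/= => /andP[ay _].
  by have h := is_derive_E i (lt_le_trans Xa ay); exact: ex_derive.
by rewrite mul0r.
Qed.

Let E_scale i (a l : R) X : 0 < l -> nsq X < a -> E i (l ^+ 2 * a) (l *: X) = l ^+ (2 * i) * E i a X.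
Proof.
move=> l0 Xa; rewrite /E mulr_sumr; apply: eq_bigr => k _.
rewrite G_scale// exprMn -exprM.
have ki : (k <= i)%N by rewrite -ltnS.
have -> : l ^+ (2 * i) = l ^+ (2 * (i - k)) * l ^+ (2 * k).
  by rewrite -exprD -mulnDr subnK.
ring.
Qed.

Let E_radial i a X Y : nsq X = nsq Y -> E i a X = E i a Y.
Proof. by move=> h; apply: eq_bigr => k _; rewrite (G_radial _ _ h). Qed.

(** The quantity [E i a X] does not depend on [a], so that letting [a] and [X] scale
    together shows that it is homogeneous of degree [2 i] in [X]. *)
Lemma ladder_monomial : exists d : nat -> R, d 0%N = c0 /\
  forall i X, nsq X < 1 -> E i 1 X = d i * nsq X ^+ i.
Proof.
pose e : 'rV[R]_n := delta_mx 0 (Ordinal n0).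
have ne : nsq e = 1.
  rewrite nsqE (bigD1 (Ordinal n0))//= mxE !eqxx expr1n big1 ?addr0// => j /negbTE jn.
  by rewrite mxE jn andbF expr0n.
have E00 a X : nsq X < a -> E 0 a X = c0.
  by move=> h; rewrite /E big_ord1 subn0 gbin0 !expr0 !mul1r G0E.
exists (fun i => E i 2 e); split; first by rewrite E00// ne ltr1n.
move=> i X X1.
have [X0|X0] := eqVneq (nsq X) 0.
  have E0 : E i 1 X = 2 ^+ (2 * i) * E i 1 X.
    have two : (0 : R) < 2 by [].
    rewrite -(E_scale _ two X1).
    rewrite (@E_radial i _ (2 *: X) X); last by rewrite nsqZ X0 mulr0.
    by apply: E_cst; rewrite X0// mulr1 exprn_gt0.
  case: i E0 => [|i] E0.
    by rewrite expr0 mulr1 !E00// ne ltr1n.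
  rewrite X0 expr0n mulr0; apply/eqP; move/eqP: E0.
  rewrite -subr_eq0 -{1}(mul1r (E _ _ _)) -mulrBl mulf_eq0 => /orP[|//].
  by rewrite subr_eq0 lt_eqF// exprn_egt1// ltr1n.
have t0 : 0 < nsq X by rewrite lt_neqAle eq_sym X0 nsq_ge0.
pose l := Num.sqrt (nsq X).
have l0 : 0 < l by rewrite sqrtr_gt0.
have l2 : l ^+ 2 = nsq X by rewrite sqr_sqrtr// ltW.
have nl : nsq (l *: e) = nsq X by rewrite nsqZ ne mulr1.
rewrite (@E_radial i _ X (l *: e))//.
have e2 : nsq e < 2 by rewrite ne ltr1n.
rewrite (@E_cst i 1 (l ^+ 2 * 2)) ?nl//; last by rewrite l2 ltr_pMr// ltr1n.
by rewrite E_scale// exprM l2 mulrC.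
Qed.

End ladder.

Section ball_differences.
Context (R : realType) (n : nat) (s : R).
Hypothesis n0 : (0 < n)%N.
Hypothesis s01 : 0 < s < 1.
Implicit Types (X Y Z : 'rV[R]_n).

(** The Taylor polynomial at [1], evaluated at [0], of [b |-> ballpow i b Z]: the
    combination singled out by [ladder_monomial]. *)
Definition balldiff i Z : R :=
  \sum_(k < i.+1) (-1) ^+ (i - k) * gbin (s + i%:R) (i - k) * ballpow s k 1 Z.

Variable c0 : R.
Hypothesis symlap_c0 : forall a X, nsq X < a -> symlap s (fun Z => pp s (a - nsq Z)) X = c0.

Lemma symlap_balldiff : exists d : nat -> R, d 0%N = c0 /\
  forall i X, nsq X < 1 -> symlap s (balldiff i) X = d i * nsq X ^+ i.
Proof.
have G0E a X : nsq X < a -> symlap s (ballpow s 0 a) X = c0.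
  by move=> h; rewrite /ballpow addr0 symlap_c0.
have [d [d0 hd]] := ladder_monomial n0 (symlap_ballpow_derive n0 s01)
  (symlap_ballpow_scale n0 s01) (symlap_ballpow_radial s n0) G0E.
exists d; split => // i X X1; rewrite -hd//.
pose C k := sval (cid (dif2_le_ballpow s01 k X1)).
have hC k : (k < i.+1)%N -> dif2_le (C k) (ballpow s k 1) X by move=> _; rewrite /C; case: cid.
have [_ _ ->] := symlap_sum n0 s01 (fun k => (-1) ^+ (i - k) * gbin (s + i%:R) (i - k))
  (fun k => mfn_ballpow s k 1) hC.
by apply: eq_bigr => k _; rewrite expr1n mul1r.
Qed.

End ball_differences.

(** * Maximum principle and preimages of radial analytic functions *)

Section sums_and_limits.
Context (R : realType).

Lemma continuous_sum_fin (T : topologicalType) (I : Type) (r : seq I) (P : pred I) (F : I -> T -> R) x :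
  (forall i, P i -> {for x, continuous (F i)}) ->
  {for x, continuous (fun y => \sum_(i <- r | P i) F i y)}.
Proof. by move=> h; apply: cvg_big => //; exact: add_continuous. Qed.

Lemma continuous_scale (T : topologicalType) (c : R) (f : T -> R) x :
  {for x, continuous f} -> {for x, continuous (fun y => c * f y)}.
Proof.
move=> h; have := @continuousM R T (fun=> c) f x; apply => //; exact: cvg_cst.
Qed.

Lemma continuous_add2 (T : topologicalType) (f g : T -> R) x :
  {for x, continuous f} -> {for x, continuous g} -> {for x, continuous (fun y => f y + g y)}.
Proof. by move=> hf hg; have := @continuousD R R^o T f g x; exact. Qed.

Lemma continuous_nsq n : continuous (@nsq R n).
Proof.
move=> X; apply: continuous_sum_fin => i _.
by apply: continuousM; exact: coord_continuous.
Qed.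

Lemma compact_nsq n (r : R) : compact [set X : 'rV[R]_n | nsq X <= r].
Proof.
apply: bounded_closed_compact; last first.
  apply: (@closed_comp _ _ (@nsq R n) [set y | y <= r]); last exact: closed_le.
  by move=> X _; exact: continuous_nsq.
exists (Num.sqrt r); split; first exact: num_real.
move=> x rx X /= Xr; rewrite /Num.norm/= mx_normrE; apply/bigmax_leP; split.
  by rewrite ltW// (le_lt_trans _ rx)// sqrtr_ge0.
move=> [i j] _ /=; rewrite (ord1 i) (le_trans (coord_enorm _ _))//.
by rewrite ltW// (le_lt_trans _ rx)// enormE ler_wsqrtr.
Qed.

Lemma continuous_uniform_limit (T : topologicalType) (f : T -> R) (g : nat -> T -> R) :
  (forall k, continuous (g k)) ->
  (forall e, 0 < e -> exists k, forall x, `|f x - g k x| <= e) -> continuous f.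
Proof.
move=> cg h x; apply/cvgrPdist_le => e e0.
have e3 : 0 < e / 3 by rewrite divr_gt0.
have [k hk] := h _ e3.
have tri (a : R) : a / 3 + a / 3 + a / 3 = a by field.
have /cvgrPdist_le /(_ _ e3) := cg k x; apply: filterS => y hy.
have -> : f x - f y = (f x - g k x) + (g k x - g k y) - (f y - g k y) by ring.
rewrite -(tri e) (le_trans (ler_normB _ _))// lerD// (le_trans (ler_normD _ _))// lerD//.
Qed.

Lemma succ_le_pow2 i : i.+1%:R <= 2 ^+ i :> R.
Proof. by rewrite -natrX ler_nat ltn_expl. Qed.

Lemma geometric_half_le2 N : \sum_(i < N) 2^-1 ^+ i <= 2 :> R.
Proof.
suff -> : \sum_(i < N) 2^-1 ^+ i = 2 - 2 * 2^-1 ^+ N :> R.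
  by rewrite gerBl mulr_ge0// exprn_ge0.
elim: N => [|N IH]; first by rewrite big_ord0 expr0 mulr1 subrr.
by rewrite big_ord_recr/= IH exprS; field.
Qed.

Lemma pow_half_small (e : R) : 0 < e -> exists N, 2^-1 ^+ N <= e.
Proof.
move=> e0; have h : `|2^-1 : R| < 1 by rewrite ger0_norm// invf_lt1// ltr1n.
have /cvgrPdist_le /(_ _ e0) [N _ hN] := cvg_expr h.
exists N; have := hN N (leqnn N); rewrite sub0r normrN ger0_norm// exprn_ge0//.
Qed.

End sums_and_limits.

Section maximum_principle.
Context (R : realType) (n : nat) (s : R).
Hypothesis n0 : (0 < n)%N.
Hypothesis s01 : 0 < s < 1.

(** At a positive interior maximum the operator would be nonnegative. *)
Lemma maximum_principle (w : 'rV[R]_n -> R) : continuous w -> mfn w ->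
  (forall X, 1 <= nsq X -> w X = 0) ->
  (forall X, nsq X < 1 -> exists C, dif2_le C w X) ->
  (forall X, nsq X < 1 -> symlap s w X < 0) -> w 0 <= 0.
Proof.
move=> cw mw w0 dw lw; rewrite leNgt; apply/negP => w00.
have ne : [set X : 'rV[R]_n | nsq X <= 1] !=set0 by exists 0; rewrite /= nsq0.
have cA : {within [set X : 'rV[R]_n | nsq X <= 1], continuous w}.
  by apply: continuous_subspaceT.
have [c _ hc] := EVT_max_rV ne (@compact_nsq R n 1) cA.
have wc : 0 < w c.
  by rewrite (lt_le_trans w00)// hc// inE/= nsq0.
have c1 : nsq c < 1.
  by rewrite ltNge; apply/negP => /w0 e; rewrite e ltxx in wc.
have hmax Y : w Y <= w c.
  have [Y1|Y1] := leP (nsq Y) 1; first by rewrite hc// inE.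
  by rewrite w0 ?(ltW wc)// ltW.
have [C hC] := dw c c1.
have h1 : symlap s (fun Y => -1 * w Y) c <= 0.
  by apply: symlap_le0 => Y; rewrite !mulN1r lerN2.
by move: h1; rewrite (symlapZ n0 s01 (-1) mw hC) mulN1r oppr_le0 leNgt lw.
Qed.

End maximum_principle.

Lemma expr4_2_8 (R : realType) (x : R) i : ((x ^+ 4) ^+ 2) ^+ i = (x ^+ i) ^+ 8.
Proof. by rewrite -!exprM; congr (_ ^+ _); lia. Qed.

Section preimages.
Context (R : realType) (n : nat) (s : R).
Hypothesis n0 : (0 < n)%N.
Hypothesis s01 : 0 < s < 1.
Local Notation RT := (measurableTypeR R).
Implicit Types (X Y Z : 'rV[R]_n) (phi psi : 'rV[R]_n -> R).

Let s0 : 0 < s. Proof. by case/andP: s01. Qed.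
Let sw : 0 <= s <= 1. Proof. by case/andP: s01 => *; rewrite !ltW. Qed.
Let sk0 k : 0 < s + k%:R. Proof. by rewrite ltr_wpDr. Qed.

Lemma continuous_ballpow k a : continuous (ballpow s k a : 'rV[R]_n -> R).
Proof.
move=> X; apply: (@continuous_comp _ _ _ (fun Z : 'rV[R]_n => a - nsq Z) (pp (s + k%:R))).
  have e : (fun Z : 'rV[R]_n => a - nsq Z) = (fun Z => a + -1 * nsq Z).
    by apply/funext => Z; rewrite mulN1r.
  rewrite e; apply: continuous_add2; first exact: cst_continuous.
  by apply: continuous_scale; exact: continuous_nsq.
exact: continuous_pp.
Qed.

Lemma ballpow_le1 k X : `|ballpow s k 1 X| <= 1.
Proof.
rewrite ger0_norm ?pp_ge0// /ballpow (le_trans (pp_le (a := 1) (ltW (sk0 k)) ler01 _)) ?powR1//.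
by rewrite gerBl nsq_ge0.
Qed.

Lemma ballpow_out k X : 1 <= nsq X -> ballpow s k 1 X = 0.
Proof. by move=> h; rewrite /ballpow pp_neg// subr_le0. Qed.

Let w i k : R := (-1) ^+ (i - k) * gbin (s + i%:R) (i - k).

Let w_le i k : `|w i k| <= 2 ^+ i.
Proof. by rewrite normrM normrX normrN1 expr1n mul1r gbin_bound. Qed.

Let v i := balldiff s i : 'rV[R]_n -> R.

Let sum_le i (f : nat -> R) M : (forall k, (k < i.+1)%N -> `|f k| <= M) ->
  `|\sum_(k < i.+1) w i k * f k| <= 2 ^+ i * 2 ^+ i * M.
Proof.
move=> h; have M0 : 0 <= M by have := h 0%N isT; apply: le_trans.
rewrite (le_trans (ler_norm_sum _ _ _))//.
apply: (@le_trans _ _ (\sum_(k < i.+1) 2 ^+ i * M)).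
  by apply: ler_sum => k _; rewrite normrM ler_pM// h.
rewrite sumr_const card_ord -[_ *+ _]mulr_natl -mulrA ler_wpM2r ?mulr_ge0 ?exprn_ge0//.
exact: succ_le_pow2.
Qed.

Let v_le i X : `|v i X| <= 2 ^+ i * 2 ^+ i.
Proof.
rewrite -[leRHS]mulr1; apply: (sum_le (f := fun k => ballpow s k 1 X)) => k _.
exact: ballpow_le1.
Qed.

Let v_out i X : 1 <= nsq X -> v i X = 0.
Proof. by move=> h; rewrite /v /balldiff big1// => k _; rewrite ballpow_out ?mulr0. Qed.

Let cv i : continuous (v i).
Proof.
move=> X; apply: continuous_sum_fin => k _.
by apply: continuous_scale; exact: continuous_ballpow.
Qed.

Let mv i : mfn (v i).
Proof.
move=> X; apply: measurable_sum => k; apply: measurable_funM => //.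
exact: mfn_ballpow.
Qed.

Let D2v X : nsq X < 1 -> exists2 K, 0 <= K & forall i, dif2_le (K * (2 ^+ i) ^+ 4) (v i) X.
Proof.
move=> X1; have h : 0 <= nsq X < 1 by rewrite nsq_ge0.
have [K K0 hK] := @dif2_le_pp R n _ _ h; exists (4 * K) => [|i]; first exact: mulr_ge0.
have hD k : (k < i.+1)%N -> dif2_le (K * (2 * 2 ^+ i) ^+ 2) (ballpow s k 1 : 'rV[R]_n -> R) X.
  move=> ki; apply: dif2_le_mono (hK _ 1 X (sk0 k) (lexx _) erefl).
  rewrite powR1 mulr1 ler_wpM2l// ler_pXn2r ?nnegrE ?addr_ge0 ?(ltW s0)//.
  have := succ_le_pow2 R i; have : (k%:R : R) <= i%:R by rewrite ler_nat -ltnS.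
  by case/andP: sw => _ s1; have := ler0n R i; rewrite -natr1; lra.
have [_ + _] := symlap_sum n0 s01 (w i) (fun k => mfn_ballpow s k 1) hD.
apply: dif2_le_mono.
apply: (@le_trans _ _ (\sum_(k < i.+1) 2 ^+ i * (K * (2 * 2 ^+ i) ^+ 2))).
  by apply: ler_sum => k _; rewrite ler_wpM2r ?w_le// mulr_ge0 ?sqr_ge0.
rewrite sumr_const card_ord -[_ *+ _]mulr_natl.
rewrite [leRHS](_ : _ = 2 ^+ i * (2 ^+ i * (K * (2 * 2 ^+ i) ^+ 2))); last by ring.
by rewrite ler_wpM2r ?succ_le_pow2// !mulr_ge0 ?sqr_ge0 ?exprn_ge0.
Qed.

Let e i j : R := \sum_(k < i.+1) w i k * bcoef (s + k%:R) j.

Let e_le i j : `|e i j| <= 2 ^+ i * 2 ^+ i * 2 ^+ i.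
Proof.
apply: (sum_le (f := fun k => bcoef (s + k%:R) j)) => k ki.
by rewrite (le_trans (bcoef_bound _ _ sw))// ler_weXn2l ?ler1n// -ltnS.
Qed.

Let bc k : disc_coef (bcoef (s + k%:R)).
Proof. by apply: (@bounded_disc_coef _ _ (2 ^+ k)) => j; exact: bcoef_bound. Qed.

Let v_series i X : nsq X < 1 -> pseries (e i) (nsq X) @ \oo --> v i X.
Proof.
move=> X1; have h : 0 <= nsq X < 1 by rewrite nsq_ge0.
have -> : pseries (e i) (nsq X) = fun N => \sum_(k < i.+1) w i k * pseries (bcoef (s + k%:R)) (nsq X) N.
  apply/funext => N; rewrite /pseries seriesEnat/=.
  under [RHS]eq_bigr do rewrite seriesEnat mulr_sumr.
  rewrite exchange_big/=; apply: eq_bigr => j _.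
  by rewrite /e mulr_suml; apply: eq_bigr => k _; rewrite mulrA.
apply: cvg_big; first exact: add_continuous.
move=> k _; apply: cvgMr; rewrite /ballpow pp_pos ?subr_ge0 ?(ltW X1)//.
exact: binomial_series.
Qed.

Let v0E i : v i.+1 0 = (-1) ^+ i.+1 * gbin (s + i%:R) i.+1.
Proof.
rewrite -gbin_alt /v /balldiff.
have b0 k : ballpow s k 1 (0 : 'rV[R]_n) = 1.
  by rewrite /ballpow nsq0 subr0 pp_pos// powR1.
under eq_bigr do rewrite b0 mulr1.
rewrite (reindex_inj rev_ord_inj)/=; apply: eq_bigr => k _.
have ki : (k <= i.+1)%N by rewrite -ltnS.
by rewrite subSS subKn// -natr1 addrA.
Qed.

Let gbin_low i : s / i.+1%:R <= gbin (s + i%:R) i.+1.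
Proof.
elim: i => [|i IH].
  by have := gbinS s 0; rewrite !mul1r gbin0 subr0 mulr1 addr0 divr1 => ->.
have a0 : 0 < (i.+2%:R : R) by rewrite ltr0n.
have a1 : 0 < (i.+1%:R : R) by rewrite ltr0n.
rewrite -(ler_pM2l a0) mulrCA divff ?gt_eqF// mulr1.
have -> : s + i.+1%:R = s + i%:R + 1 by rewrite -natr1 addrA.
rewrite gbin_shift.
apply: (@le_trans _ _ (i.+1%:R * (s / i.+1%:R))).
  by rewrite mulrCA divff ?gt_eqF// mulr1.
apply: ler_pM => //; first by rewrite divr_ge0// ltW.
by rewrite -natr1 -addrA addrC lerDl ltW.
Qed.

Variables (c0 : R) (d : nat -> R).
Hypothesis c00 : 0 < c0.
Hypothesis symlap_c0 : forall a X, nsq X < a -> symlap s (fun Z => pp s (a - nsq Z)) X = c0.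
Hypothesis d0 : d 0%N = c0.
Hypothesis symlap_v : forall i X, nsq X < 1 -> symlap s (balldiff s i) X = d i * nsq X ^+ i.

(** Where [|d i|] bounds the right-hand side, [(|d i| / c0) (1 - |X| ^ 2)_+ ^ s]
    is a barrier for [v i] on both sides. *)
Let v0_le i : `|v i 0| <= `|d i| / c0.
Proof.
suff h t : `|t| = 1 -> t * v i 0 <= `|d i| / c0.
  rewrite ler_norml; apply/andP; split.
    by rewrite lerNl -mulN1r h// normrN1.
  by rewrite -[leLHS]mul1r h// normr1.
move=> t1; apply/ler_addgt0Pr => ep e0.
(* the slack [ep] gives the strict inequality of the maximum principle *)
pose c : R := - (`|d i| / c0 + ep).
pose W Z := t * v i Z + c * ballpow s 0 1 Z.
suff : W 0 <= 0.
  rewrite /W /ballpow nsq0 subr0 pp_pos// powR1 mulr1 /c; lra.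
have mW : mfn W by apply: mfn_lin; [exact: mv|apply: mfnZ; exact: mfn_ballpow].
have dif2_leW X : nsq X < 1 -> exists C C', dif2_le C (v i) X /\ dif2_le C' (ballpow s 0 1 : 'rV[R]_n -> R) X.
  move=> X1; have [K _ hK] := D2v X1; have [C hC] := dif2_le_ballpow s01 0 X1.
  by exists (K * (2 ^+ i) ^+ 4), C; split => //; exact: hK.
apply: (@maximum_principle R n s n0 s01) => //.
- move=> X; apply: (continuous_add2 (f := fun Z => t * v i Z) (g := fun Z => c * ballpow s 0 1 Z));
    apply: continuous_scale; first exact: cv.
  exact: continuous_ballpow.
- by move=> X X1; rewrite /W v_out// ballpow_out// !mulr0 addr0.
- move=> X X1; have [C [C' [h1 h2]]] := dif2_leW X X1.
  by exists (`|t| * C + `|c| * C'); exact: (dif2_le_lin t h1 (dif2_leZ c h2)).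
move=> X X1; have [C [C' [h1 h2]]] := dif2_leW X X1.
rewrite (symlap_lin n0 s01 t (mv i) (mfnZ c (mfn_ballpow s 0 1)) h1 (dif2_leZ c h2)).
rewrite (symlapZ n0 s01 c (mfn_ballpow s 0 1) h2) symlap_v//.
have -> : symlap s (ballpow s 0 1) X = c0 by rewrite /ballpow addr0 symlap_c0.
have tau1 : 0 <= nsq X ^+ i <= 1.
  by rewrite exprn_ge0 ?nsq_ge0//= exprn_ile1 ?nsq_ge0 ?(ltW X1).
have h3 : t * (d i * nsq X ^+ i) <= `|d i|.
  rewrite (le_trans (ler_norm _))// !normrM t1 mul1r ler_piMr//.
  by rewrite ger0_norm; case/andP: tau1.
have h4 : c * c0 = - `|d i| - ep * c0.
  by rewrite /c mulNr mulrDl divfK ?opprD// gt_eqF.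
rewrite h4; have : 0 < ep * c0 by exact: mulr_gt0.
lra.
Qed.

(** A quantitative form of [d i != 0]: together with the explicit value of [v i] at
    the centre, the barrier forbids [d i] to be small. *)
Let d_low i : c0 * s / i.+1%:R <= `|d i|.
Proof.
case: i => [|i].
  by rewrite divr1 d0 gtr0_norm// ler_piMr ?(ltW c00)//; case/andP: sw.
have := v0_le i.+1; rewrite v0E normrM normrX normrN1 expr1n mul1r ler_pdivlMr// => h.
apply: le_trans h; rewrite mulrAC -mulrA mulrC ler_wpM2r ?(ltW c00)//.
rewrite (le_trans _ (ler_norm _))// (le_trans _ (gbin_low i))//.
by rewrite [leLHS]mulrC ler_wpM2l ?(ltW s0)// lef_pV2 ?posrE ?ltr0n// ler_nat.
Qed.

(** What is required from a function for [symlap] to be defined and computed on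
    a ball, and for its products to be admissible competitors. *)
Definition regular (r : R) phi := [/\ continuous phi,
  exists rho, forall X, rho <= nsq X -> phi X = 0, mfn phi &
  forall X, nsq X < r -> exists C, dif2_le C phi X].

Definition radial_germ phi := regular 1 phi /\
  exists2 c, disc_coef c & forall X, nsq X < 1 -> pseries c (nsq X) @ \oo --> phi X.

Let l : R := 2^-1 ^+ 4.

(** If [phi] is the sum of [h i |X| ^ (2 i)], then the sum of [(h i / d i) v i] is a
    preimage. The functions [v i] grow geometrically with [i], whereas [phi] is only
    known on the unit ball; dilating [phi] by the small factor [l] makes the
    coefficients decay fast enough, and the sum is again analytic in [|X| ^ 2]. *)
Lemma radial_preimage phi : radial_germ phi ->
  exists2 psi, radial_germ psi & forall X, nsq X < 1 -> symlap s psi X = phi (l *: X).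
Proof.
move=> [_ [h hc hphi]].
have half : 0 < (2^-1 : R) < 1 by rewrite invr_gt0 ltr0n invf_lt1// ltr1n.
have [M hM] := hc _ half.
have M0 : 0 <= M by have := hM 0%N; apply: le_trans; rewrite mulr_ge0// exprn_ge0.
pose a i : R := 2^-1 ^+ i; pose b i : R := 2 ^+ i.
have a0 i : 0 < a i by rewrite exprn_gt0.
have b0 i : 0 < b i by rewrite exprn_gt0.
have ab i : a i * b i = 1 by rewrite /a /b -exprMn mulVf// expr1n.
(* [a i ^ 8] is the factor [l ^ (2 i)] of the dilation; six powers of [a i] remain
   after the bounds for [h i] and [d i], four are lost to the growth of [v i] *)
pose beta i := h i * (a i) ^+ 8 / d i.
pose M' := M / (c0 * s).
have M'0 : 0 <= M' by rewrite divr_ge0// mulr_ge0// ltW.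
have cs0 : 0 < c0 * s by rewrite mulr_gt0.
have dn i : 0 < `|d i|.
  by rewrite (lt_le_trans _ (d_low i))// divr_gt0// ltr0n.
have dN0 i : d i != 0 by rewrite -normr_gt0.
have beta_le i : `|beta i| <= M' * (a i) ^+ 6.
  rewrite /beta normf_div (normrM (h i)) (ger0_norm (exprn_ge0 8 (ltW (a0 i)))).
  rewrite ler_pdivrMr//.
  have h1 : `|h i| <= M * b i.
    have := hM i; rewrite -/(a i) -(ler_pM2r (b0 i)) -mulrA ab mulr1//.
  have h2 : a i <= `|d i| / (c0 * s).
    rewrite ler_pdivlMr// (le_trans _ (d_low i))// mulrC ler_wpM2l ?(ltW cs0)//.
    rewrite /a exprVn lef_pV2 ?posrE ?ltr0n ?exprn_gt0//; exact: succ_le_pow2.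
  apply: (@le_trans _ _ (M * b i * (a i) ^+ 8)).
    by rewrite ler_wpM2r// exprn_ge0// ltW.
  rewrite [leLHS](_ : _ = M * (a i * b i) * (a i) ^+ 6 * a i); last by ring.
  rewrite ab mulr1 [leRHS](_ : _ = M * a i ^+ 6 * (`|d i| / (c0 * s))); last first.
    by rewrite /M'; field; rewrite !gt_eqF.
  by rewrite ler_wpM2l// mulr_ge0// exprn_ge0// ltW.
clearbody M'.
have a1 i : a i <= 1 by rewrite exprn_ile1// ?invf_le1// ler1n.
have prod_le i (y C : R) : 0 <= C -> `|y| <= C * (b i) ^+ 4 -> `|beta i * y| <= C * M' * a i.
  move=> C0 hy; rewrite normrM.
  apply: (@le_trans _ _ (M' * (a i) ^+ 6 * (C * (b i) ^+ 4))); first by rewrite ler_pM.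
  rewrite [leLHS](_ : _ = C * M' * (a i * b i) ^+ 4 * (a i * a i)); last by ring.
  rewrite ab expr1n mulr1; apply: ler_wpM2l; first exact: mulr_ge0.
  by rewrite -[leRHS]mulr1 ler_wpM2l ?a1 ?(ltW (a0 i)).
have b1 i : 1 <= b i by rewrite exprn_ege1// ler1n.
have bpow i k : (k <= 4)%N -> (b i) ^+ k <= 1 * (b i) ^+ 4.
  by move=> k4; rewrite mul1r ler_weXn2l.
pose u X i := beta i * v i X.
have u_le X i : `|u X i| <= M' * a i.
  rewrite -[M']mul1r; apply: prod_le => //; rewrite (le_trans (v_le i X))//.
  by rewrite -expr2; exact: (bpow i 2).
pose psi X := sval (cid (geometric_majorant (u_le X))).
have psiP X : series (u X) @ \oo --> psi X /\ forall N, `|psi X - series (u X) N| <= 2 * M' * 2^-1 ^+ N.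
  by rewrite /psi; case: cid.
have uc_le j i : `|beta i * e i j| <= M' * a i.
  rewrite -[M']mul1r; apply: prod_le => //; rewrite (le_trans (e_le i j))//.
  by rewrite -expr2 -exprSr; exact: (bpow i 3).
pose h' j := sval (cid (geometric_majorant (uc_le j))).
have h'P j : forall N, `|h' j - series (fun i => beta i * e i j) N| <= 2 * M' * 2^-1 ^+ N.
  by rewrite /h'; case: cid => ? [].
have serE X N : series (u X) N = \sum_(i < N) beta i * v i X by rewrite /series/= big_mkord.
have serF X : series (u X) = (fun N => \sum_(i < N) beta i * v i X) by apply/funext => N; exact: serE.
have mS N : mfn (fun X => \sum_(i < N) beta i * v i X).
  by move=> X; apply: measurable_sum => k; apply: measurable_funM => //; exact: mv.
have mpsi : mfn psi.
  move=> X; apply: (measurable_fun_cvg (h := fun N (t : n.-tuple RT) => \sum_(i < N) beta i * v i (X + row_of_tuple t))).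
    by move=> N; exact: mS.
  by move=> t _; have [+ _] := psiP (X + row_of_tuple t); rewrite serF.
have cpsi : continuous psi.
  apply: (continuous_uniform_limit (g := fun N X => \sum_(i < N) beta i * v i X)).
    move=> N X; apply: continuous_sum_fin => k _.
    by apply: continuous_scale; exact: cv.
  move=> ep e0; have p0 : 0 < ep / (2 * M' + 1) by rewrite divr_gt0// ltr_wpDl// mulr_ge0.
  have [N hN] := pow_half_small p0; exists N => X; rewrite -serE.
  have [_ /(_ N)] := psiP X; move=> /le_trans; apply.
  apply: (@le_trans _ _ ((2 * M' + 1) * (2^-1 ^+ N))).
    by rewrite ler_wpM2r ?exprn_ge0// lerDl.
  by rewrite mulrC -ler_pdivlMr// ltr_wpDl// mulr_ge0.
have D2psi X : nsq X < 1 -> exists C, forall N, dif2_le C (fun X => \sum_(i < N) beta i * v i X) X.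
  move=> X1; have [K K0 hK] := D2v X1; exists (2 * (K * M')) => N.
  have [_ + _] := symlap_sum n0 s01 beta mv (fun i (_ : (i < N)%N) => hK i).
  apply: dif2_le_mono.
  apply: (@le_trans _ _ (\sum_(i < N) K * M' * a i)).
    apply: ler_sum => i _; rewrite -[X in _ * X]ger0_norm ?mulr_ge0 ?exprn_ge0// -normrM.
    by apply: prod_le => //; rewrite ger0_norm ?mulr_ge0 ?exprn_ge0.
  rewrite -mulr_sumr [leRHS]mulrC; apply: ler_wpM2l; first exact: mulr_ge0.
  exact: geometric_half_le2.
have cvpsi X : (fun N => \sum_(i < N) beta i * v i X) @ \oo --> psi X.
  by have [+ _] := psiP X; rewrite serF.
exists psi; last first.
  move=> X X1; have [C hC] := D2psi X X1.
  have c1 := symlap_cvg n0 s01 mS mpsi hC cvpsi.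
  have [K K0 hK] := D2v X1.
  have c2 : symlap s (fun X => \sum_(i < N) beta i * v i X) X @[N --> \oo] --> phi (l *: X).
    have lX : nsq (l *: X) < 1.
      rewrite nsqZ (le_lt_trans _ X1)// ler_piMl ?nsq_ge0//.
      by rewrite /l -exprM exprn_ile1 ?invr_ge0 ?invf_le1 ?ler1n.
    have := hphi _ lX; rewrite (_ : pseries _ _ = fun N => symlap s (fun X => \sum_(i < N) beta i * v i X) X)//.
    apply/funext => N.
    have [_ _ ->] := symlap_sum n0 s01 beta mv (fun i (_ : (i < N)%N) => hK i).
    rewrite /pseries seriesEnat/= big_mkord; apply: eq_bigr => i _.
    rewrite /v symlap_v// nsqZ /beta exprMn mulrA divfK//.
    have -> : (l ^+ 2) ^+ i = a i ^+ 8.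
      by rewrite /l /a expr4_2_8.
    by rewrite mulrA.
  exact: (cvg_unique _ c1 c2).
split.
  split => //.
    exists 1 => X X1; have h1 := cvpsi X.
    have e1 : (fun N => \sum_(i < N) beta i * v i X) = (fun=> 0).
      by apply/funext => N; rewrite big1// => i _; rewrite v_out// mulr0.
    have h2 : (fun N => \sum_(i < N) beta i * v i X) @ \oo --> (0 : R).
      by rewrite e1; exact: cvg_cst.
    exact: (cvg_unique _ h1 h2).
  move=> X X1; have [C hC] := D2psi X X1; exists C => t.
  have cd : `|dif2 (fun X => \sum_(i < N) beta i * v i X) X t| @[N --> \oo] --> `|dif2 psi X t|.
    apply: cvg_norm; apply: cvgB; last exact: cvpsi.
    by apply: cvgB; [apply: cvgMr; exact: cvpsi|exact: cvpsi].
  by apply: (cvgr_to_le cd); apply: nearW => N; exact: hC.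
have h'b : disc_coef h'.
  apply: (@bounded_disc_coef _ _ (2 * M')) => j.
  by have := h'P j 0%N; rewrite /series/= big_geq// subr0 expr0 mulr1.
exists h' => // X X1; set tau := nsq X.
have tau1 : 0 <= tau < 1 by rewrite nsq_ge0.
have tn : `|tau| < 1 by rewrite ger0_norm; case/andP: tau1.
apply/cvgrPdist_le => ep e0.
pose Q : R := 2 * M' / (1 - tau) + 2 * M' + 1.
have t10 : 0 < 1 - tau by rewrite subr_gt0.
have Q0 : 0 < Q.
  have : 0 <= 2 * M' / (1 - tau) by rewrite divr_ge0 ?mulr_ge0// ltW.
  by rewrite /Q; move: (2 * M' / (1 - tau)) => y; lra.
have p0 : 0 < ep / 2 / Q by rewrite !divr_gt0.
have [N hN] := pow_half_small p0.
have cN : (fun J => \sum_(i < N) beta i * pseries (e i) tau J) @ \oo --> \sum_(i < N) beta i * v i X.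
  apply: cvg_big; first exact: add_continuous.
  by move=> i _; apply: cvgMr; exact: v_series.
have e2 : 0 < ep / 2 by rewrite divr_gt0.
have /cvgrPdist_le /(_ _ e2) := cN; apply: filterS => J hJ.
have pE : pseries h' tau J - \sum_(i < N) beta i * pseries (e i) tau J =
    \sum_(j < J) (h' j - series (fun i => beta i * e i j) N) * tau ^+ j.
  rewrite /pseries seriesEnat/= big_mkord.
  have -> : \sum_(i < N) beta i * (series (fun j => e i j * tau ^+ j) J) =
     \sum_(j < J) series (fun i => beta i * e i j) N * tau ^+ j.
    under eq_bigr do rewrite /series/= big_mkord mulr_sumr.
    rewrite exchange_big/=; apply: eq_bigr => j _.
    by rewrite /series/= big_mkord mulr_suml; apply: eq_bigr => i _; rewrite mulrA.
  by rewrite -sumrB; apply: eq_bigr => j _; rewrite mulrBl.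
have geo : \sum_(j < J) tau ^+ j <= (1 - tau)^-1.
  rewrite -[leRHS]mul1r ler_pdivlMr// mulrC -opprB mulNr -subrX1 opprB gerBl exprn_ge0//.
  by case/andP: tau1.
have b1' : `|pseries h' tau J - \sum_(i < N) beta i * pseries (e i) tau J| <= 2 * M' * 2^-1 ^+ N / (1 - tau).
  rewrite pE (le_trans (ler_norm_sum _ _ _))//.
  apply: (@le_trans _ _ (\sum_(j < J) 2 * M' * 2^-1 ^+ N * tau ^+ j)).
    apply: ler_sum => j _; rewrite normrM ler_pM//.
    by rewrite ger0_norm// exprn_ge0//; case/andP: tau1.
  rewrite -mulr_sumr; apply: ler_wpM2l => //.
  by rewrite !mulr_ge0// exprn_ge0.
have b2' : `|psi X - \sum_(i < N) beta i * v i X| <= 2 * M' * 2^-1 ^+ N.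
  by rewrite -serE; have [_] := psiP X; exact.
set A := \sum_(i < N) beta i * v i X in hJ b2'.
set B := \sum_(i < N) beta i * pseries (e i) tau J in hJ b1'.
have -> : psi X - pseries h' tau J = (psi X - A) + (A - B) - (pseries h' tau J - B) by ring.
rewrite (le_trans (ler_normB _ _))// (le_trans (lerD (ler_normD _ _) (lexx _)))//.
rewrite (le_trans (lerD (lerD b2' hJ) b1'))//.
have -> : 2 * M' * 2^-1 ^+ N + ep / 2 + 2 * M' * 2^-1 ^+ N / (1 - tau) =
   (Q - 1) * 2^-1 ^+ N + ep / 2 by rewrite /Q; ring.
have hQ : (Q - 1) * 2^-1 ^+ N <= ep / 2.
  apply: (@le_trans _ _ (Q * 2^-1 ^+ N)).
    by rewrite ler_wpM2r ?exprn_ge0// gerBl.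
  by rewrite mulrC -ler_pdivlMr.
rewrite (le_trans (lerD hQ (lexx _)))//; lra.
Qed.

End preimages.

Lemma continuous_near_eq (R : realType) (T : topologicalType) (f g : T -> R) (x : T) :
  (\forall y \near x, f y = g y) -> {for x, continuous f} -> {for x, continuous g}.
Proof.
move=> h c; have e := nbhs_singleton h; rewrite /prop_for/continuous_at -e.
by apply: cvg_trans c; apply: near_eq_cvg; apply: filterS h => y ->.
Qed.

(** * Functions with bounded derivatives up to a given order *)

Section directional.
Context (R : realType) (n : nat).
Implicit Types (p v : 'rV[R]_n) (F G : 'rV[R]_n -> R).

Lemma is_derive_lineP p v F (d : R) :
  is_derive p v F d <-> is_derive (0 : R) 1 (fun t : R => F (t *: v + p)) d.
Proof.
have e : (fun h : R => h^-1 *: (F (h *: v + p) - F p)) =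
   (fun h : R => h^-1 *: ((fun t : R => F (t *: v + p)) (h *: 1 + 0) - (fun t : R => F (t *: v + p)) 0)).
  apply/funext => h /=; rewrite scale0r add0r addr0.
  by rewrite (_ : h *: (1 : R) = h)// /GRing.scale/= mulr1.
split=> [[D E]|[D E]]; apply: DeriveDef.
- by rewrite /derivable -e.
- by rewrite -E /derive e.
- by rewrite /derivable e.
- by rewrite -E /derive e.
Qed.

Lemma is_derive_scale p v F (d l : R) :
  is_derive p v F d -> is_derive p (l *: v) F (l * d).
Proof.
move=> /is_derive_lineP h; apply/is_derive_lineP.
have h2 : is_derive (0 : R) 1 (fun t : R => l * t) l.
  by apply: is_derive_eq; rewrite /GRing.scale/= mulr1.
have h1 : is_derive (l * 0) 1 (fun t : R => F (t *: v + p)) d by rewrite mulr0.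
have := @is_derive1_comp _ (fun t : R => F (t *: v + p)) (fun t : R => l * t) 0 _ _ h1 h2.
rewrite mulrC; rewrite (_ : _ \o _ = fun t : R => F (t *: (l *: v) + p))//.
by apply/funext => t /=; rewrite scalerA mulrC.
Qed.

Lemma is_derive_comp1 p v F (d d' : R) (f : R -> R) :
  is_derive (F p) (1 : R) f d' -> is_derive p v F d -> is_derive p v (fun q => f (F q)) (d' * d).
Proof.
move=> hf /is_derive_lineP h; apply/is_derive_lineP.
have hf' : is_derive (F (0 *: v + p)) (1 : R) f d' by rewrite scale0r add0r.
exact: (@is_derive1_comp _ f (fun t : R => F (t *: v + p)) 0 _ _ hf' h).
Qed.

End directional.

Lemma is_derive_affine (R : realType) n N (A : 'rV[R]_N -> 'rV[R]_n) (p : 'rV[R]_N) v u (F : 'rV[R]_n -> R) d :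
  (forall t : R, A (t *: v + p) = t *: u + A p) ->
  is_derive (A p) u F d -> is_derive p v (fun q => F (A q)) d.
Proof.
move=> h /is_derive_lineP hd; apply/is_derive_lineP.
by under [X in is_derive _ _ X]eq_fun do rewrite h.
Qed.

Section bounded_derivatives.
Context (R : realType) (n : nat).
Implicit Types (p : 'rV[R]_n) (F G : 'rV[R]_n -> R) (U V : set 'rV[R]_n) (M : R).
Local Notation dir i := (delta_mx 0 i : 'rV[R]_n).

(** The conjunction of [C^k] regularity on [U] and of the bound [M] for the
    derivatives of all orders up to [k]. It is defined by recursion on [k], with
    existential derivatives, so that the rules for sums, products and
    compositions are proved by induction without computing iterated partial
    derivatives; [ckb_pderiv] and [pderiv_ckb] relate it to [pderiv]. *)
Fixpoint ckb k U M F : Prop :=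
  (forall p, U p -> {for p, continuous F} /\ `|F p| <= M) /\
  if k is k'.+1 then
    forall i, exists2 G, (forall p, U p -> is_derive p (dir i) F (G p)) & ckb k' U M G
  else True.

Lemma ckb_base k U M F : ckb k U M F -> forall p, U p -> {for p, continuous F} /\ `|F p| <= M.
Proof. by case: k => [|k] []. Qed.

Lemma ckb_mono k k' U V M M' F : (k' <= k)%N -> (forall p, V p -> U p) -> M <= M' ->
  ckb k U M F -> ckb k' V M' F.
Proof.
move=> + VU MM; elim: k k' F => [|k IH] [|k'] F //= kk.
- move=> [h _]; split => // p Vp; have [h1 h2] := h p (VU p Vp).
  by split => //; exact: le_trans h2 MM.
- move=> [h _]; split => // p Vp; have [h1 h2] := h p (VU p Vp).
  by split => //; exact: le_trans h2 MM.
- move=> [h hd]; split => [p Vp|i].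
    by have [h1 h2] := h p (VU p Vp); split => //; exact: le_trans h2 MM.
  have [G hG1 hG2] := hd i; exists G; first by move=> p Vp; exact/hG1/VU.
  exact: IH hG2.
Qed.

Lemma ckb_local k U M F G : open U -> (forall p, U p -> F p = G p) -> ckb k U M F -> ckb k U M G.
Proof.
move=> oU e; have nE p : U p -> \forall q \near p, F q = G q.
  move=> Up; near=> q; apply: e; near: q; exact: open_nbhs_nbhs.
have b p : U p -> {for p, continuous F} /\ `|F p| <= M -> {for p, continuous G} /\ `|G p| <= M.
  move=> Up [h1 h2]; split; last by rewrite -e.
  exact: (continuous_near_eq (nE p Up) h1).
case: k => [|k] /= [h hd]; split => //.
- by move=> p Up; apply: b => //; exact: h.
- by move=> p Up; apply: b => //; exact: h.
- move=> i; have [H h1 h2] := hd i; exists H => // p Up.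
  exact: (near_eq_is_derive (nE p Up) (h1 p Up)).
Unshelve. all: by end_near. Qed.

Lemma ckb_cst k U (c M : R) : `|c| <= M -> ckb k U M (fun=> c).
Proof.
elim: k c => [|k IH] c cM /=.
  by split => // p _; split => //; exact: cst_continuous.
split => [p _|i]; first by split => //; exact: cst_continuous.
exists (fun=> 0); first by move=> p _; exact: is_derive_cst.
by apply: IH; rewrite normr0; exact: le_trans cM.
Qed.

Lemma ckb_coord k U (M : R) j : 1 <= M -> (forall p, U p -> `|p 0 j| <= M) -> ckb k U M (fun p => p 0 j).
Proof.
move=> M1 h; have b p : U p -> {for p, continuous (fun p : 'rV[R]_n => p 0 j)} /\ `|p 0 j| <= M.
  by move=> Up; split; [exact: coord_continuous|exact: h].
case: k => [|k] /=; split => // i.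
exists (fun=> (dir i) 0 j); last first.
  by apply: ckb_cst; rewrite mxE; case: eqP; case: eqP; rewrite ?normr0 ?normr1 ?(le_trans ler01 M1).
move=> p _; apply/is_derive_lineP.
have -> : (fun t : R => (t *: dir i + p) 0 j) = (fun t : R => t * (dir i) 0 j + p 0 j).
  by apply/funext => t; rewrite !mxE.
by apply: is_derive_eq; rewrite /GRing.scale/=; ring.
Qed.

Lemma ckb_lin k U (c M1 M2 : R) F G : ckb k U M1 F -> ckb k U M2 G ->
  ckb k U (`|c| * M1 + M2) (fun p => c * F p + G p).
Proof.
elim: k F G => [|k IH] F G /= [hF dF] [hG dG].
  split => // p Up; have [c1 b1] := hF p Up; have [c2 b2] := hG p Up; split.
    by apply: continuous_add2 => //; exact: continuous_scale.
  by rewrite (le_trans (ler_normD _ _))// lerD// normrM ler_wpM2l.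
split => [p Up|i].
  have [c1 b1] := hF p Up; have [c2 b2] := hG p Up; split.
    by apply: continuous_add2 => //; exact: continuous_scale.
  by rewrite (le_trans (ler_normD _ _))// lerD// normrM ler_wpM2l.
have [F' dF1 dF2] := dF i; have [G' dG1 dG2] := dG i.
exists (fun p => c * F' p + G' p); last exact: IH.
move=> p Up; have h1 := dF1 p Up; have h2 := dG1 p Up.
exact: (is_deriveD (is_deriveZ c h1) h2).
Qed.

Lemma ckb_scale k U (c M : R) F : ckb k U M F -> ckb k U (`|c| * M) (fun p => c * F p).
Proof.
move=> h; have h0 := @ckb_cst k U 0 0; rewrite normr0 in h0.
have := ckb_lin c h (h0 (lexx _)); rewrite addr0.
by under eq_fun do rewrite addr0.
Qed.

Lemma ckb_mul k U (M1 M2 : R) F G : ckb k U M1 F -> ckb k U M2 G ->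
  ckb k U (2 ^+ k * (M1 * M2)) (fun p => F p * G p).
Proof.
have base F' G' p N1 N2 : {for p, continuous F'} /\ `|F' p| <= N1 ->
    {for p, continuous G'} /\ `|G' p| <= N2 ->
    {for p, continuous (fun p => F' p * G' p)} /\ `|F' p * G' p| <= N1 * N2.
  move=> [c1 b1] [c2 b2]; split; last by rewrite normrM ler_pM.
  by have := @continuousM R _ F' G' p; exact.
elim: k F G => [|k IH] F G hF hG.
  case: hF => hF _; case: hG => hG _; split => // p Up.
  by rewrite expr0 mul1r; apply: base; [exact: hF|exact: hG].
have hF1 := ckb_mono (leqnSn k) (fun p Up => Up) (lexx _) hF.
have hG1 := ckb_mono (leqnSn k) (fun p Up => Up) (lexx _) hG.
case: hF => hF dF; case: hG => hG dG; split => [p Up|i].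
  have [h1 h2] := base F G p M1 M2 (hF p Up) (hG p Up); split => //.
  rewrite (le_trans h2)// ler_peMl ?exprn_ege1 ?ler1n//.
  by rewrite (le_trans _ h2).
have [F' dF1 dF2] := dF i; have [G' dG1 dG2] := dG i.
exists (fun p => 1 * (F' p * G p) + F p * G' p).
  move=> p Up; have h1 := dF1 p Up; have h2 := dG1 p Up.
  apply: (is_derive_eq (is_deriveM h1 h2)); rewrite /GRing.scale/=; ring.
have := ckb_lin 1 (IH _ _ dF2 hG1) (IH _ _ hF1 dG2).
by rewrite normr1 mul1r exprS -mulrA mulrDl mul1r.
Qed.

Fixpoint comp_const k (M : R) : R := if k is k'.+1 then 2 ^+ k' * (comp_const k' M * M) + 1 else 1.

Lemma comp_const_ge1 k M : 0 <= M -> 1 <= comp_const k M.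
Proof.
move=> M0; elim: k => [|k IH] //=.
by rewrite lerDr !mulr_ge0 ?exprn_ge0// (le_trans ler01 IH).
Qed.

(** What matters is that the bound is linear in the size [A] of the derivatives
    of the outer function: a small outer function has a small composite. *)
Lemma ckb_comp k U M A F (f : nat -> R -> R) : 0 <= M -> 0 <= A -> ckb k U M F ->
  (forall j p, U p -> (j < k)%N -> is_derive (F p) (1 : R) (f j) (f j.+1 (F p))) ->
  (forall p, U p -> {for F p, continuous (f k)}) ->
  (forall j p, U p -> (j <= k)%N -> `|f j (F p)| <= A) ->
  ckb k U (comp_const k M * A) (fun p => f 0%N (F p)).
Proof.
move=> M0 A0; elim: k f => [|k IH] f hF df cf bf.
  case: hF => hF _; split => // p Up; rewrite mul1r; split; last exact: bf.
  apply: continuous_comp; [by case: (hF p Up)|exact: cf].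
have hF1 := ckb_mono (leqnSn k) (fun p Up => Up) (lexx _) hF.
have [hF0 dF] := hF.
have c1 : 1 <= comp_const k.+1 M by exact: comp_const_ge1.
have der0 p : U p -> {for F p, continuous (f 0%N)}.
  move=> Up; have h := df 0%N p Up isT.
  by apply: differentiable_continuous; apply/derivable1_diffP; exact: ex_derive.
split => [p Up|i].
  have [cF _] := hF0 p Up; split.
    by apply: continuous_comp => //; exact: der0.
  have bp := bf 0%N p Up isT.
  by rewrite (le_trans bp)// ler_peMl// (le_trans _ bp).
have [F' dF1 dF2] := dF i.
exists (fun p => f 1%N (F p) * F' p).
  by move=> p Up; apply: is_derive_comp1; [exact: df|exact: dF1].
have h1 : ckb k U (comp_const k M * A) (fun p => f 1%N (F p)).
  apply: (IH (fun j => f j.+1)) => //.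
  - by move=> j p Up jk; exact: df.
  - by move=> j p Up jk; exact: bf.
apply: ckb_mono (ckb_mul h1 dF2) => //=.
by rewrite mulrDl mul1r -mulrA -!mulrA [A * M]mulrC lerDl.
Qed.

Lemma pderiv_eq_on U l F G : open U -> (forall p, U p -> F p = G p) ->
  forall p, U p -> pderiv l F p = pderiv l G p.
Proof.
move=> oU; elim: l F G => [|i l IH] F G e p Up /=; first exact: e.
apply: near_eq_derive; near=> q; apply: IH => //; near: q; exact: open_nbhs_nbhs.
Unshelve. all: by end_near. Qed.

Lemma pderiv_rcons l i F : pderiv (rcons l i) F = pderiv l (fun p => 'D_(dir i) F p).
Proof. by rewrite /pderiv -cats1 foldr_cat. Qed.

Lemma ckb_pderiv k U M F : open U -> ckb k U M F ->
  forall l p, (size l <= k)%N -> U p ->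
    [/\ {for p, continuous (pderiv l F)}, `|pderiv l F p| <= M &
       (size l < k)%N -> forall i, derivable (pderiv l F) p (dir i)].
Proof.
move=> oU; elim: k F => [|k IH] F hF l p.
  rewrite leqn0 => /nilP -> Up; have [? ?] := ckb_base hF Up; by split.
have [h0 hd] := hF.
elim/last_ind: l => [_ Up|l i _].
  have [? ?] := h0 p Up; split => // _ i.
  by have [G hG _] := hd i; have := hG p Up => h; exact: ex_derive.
rewrite size_rcons ltnS => lk Up; have [G hG1 hG2] := hd i.
have e q : U q -> 'D_(dir i) F q = G q by move=> Uq; have h := hG1 q Uq; rewrite derive_val.
have eq q : U q -> pderiv (rcons l i) F q = pderiv l G q.
  by move=> Uq; rewrite pderiv_rcons; exact: (pderiv_eq_on l oU e).
have nE : \forall q \near p, pderiv l G q = pderiv (rcons l i) F q.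
  near=> q; rewrite eq//; near: q; exact: open_nbhs_nbhs.
have [c b d] := IH G hG2 l p lk Up; split.
- exact: (continuous_near_eq nE c).
- by rewrite eq.
- move=> lk1 j; have /derivableP h := d lk1 j.
  by have h2 := near_eq_is_derive nE h; exact: ex_derive.
Unshelve. all: by end_near. Qed.

Lemma pderiv_ckb k U M F :
  (forall l p, (size l <= k)%N -> U p ->
    [/\ {for p, continuous (pderiv l F)}, `|pderiv l F p| <= M &
       (size l < k)%N -> forall i, derivable (pderiv l F) p (dir i)]) -> ckb k U M F.
Proof.
move=> h; suff H j l : (size l + j <= k)%N -> ckb j U M (pderiv l F).
  exact: (H k [::]).
elim: j l => [|j IH] l lj /=; (split; last first) => //.
- by move=> p Up; have [] := h l p _ Up => //; rewrite addn0 in lj.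
- move=> i; exists (pderiv (i :: l) F); last by apply: IH; rewrite /= addSnnS.
  move=> p Up; have [_ _ d] := h l p (leq_trans (leq_addr _ _) lj) Up.
  have lk : (size l < k)%N by rewrite (leq_trans _ lj)// addnS ltnS leq_addr.
  exact/derivableP/d.
- by move=> p Up; have [] := h l p (leq_trans (leq_addr _ _) lj) Up.
Qed.

Lemma ckb_Cinfty U F : open U -> (forall k, exists M, ckb k U M F) -> Cinfty U F.
Proof.
move=> oU h; split.
  move=> k l i p lk Up; have [M hM] := h k.
  by have [_ _ d] := ckb_pderiv oU hM (ltnW lk) Up; exact: d.
move=> l p Up; have [M hM] := h (size l).
by have [] := ckb_pderiv oU hM (leqnn _) Up.
Qed.

End bounded_derivatives.

Lemma ckb_affine (R : realType) n N (sg : 'I_n -> option 'I_N) (inj : forall i j k, sg i = Some k -> sg j = Some k -> i = j)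
  (A : 'rV[R]_N -> 'rV[R]_n) (l : R) k U V M (F : 'rV[R]_n -> R) :
  continuous A ->
  (forall (t : R) p i, A (t *: delta_mx 0 i + p) =
     t *: (\sum_(j | sg j == Some i) l *: delta_mx 0 j) + A p) ->
  (forall p, V p -> U (A p)) -> 0 <= M ->
  ckb k U M F -> ckb k V ((1 + `|l|) ^+ k * M) (fun p => F (A p)).
Proof.
move=> cA hA VU M0; have L1 j : 1 <= (1 + `|l|) ^+ j by rewrite exprn_ege1// lerDl.
have L0 j : 0 <= (1 + `|l|) ^+ j by rewrite (le_trans ler01).
 elim: k F => [|k IH] F /= [hF dF]; (split; last first) => //.
- move=> p Vp; have [c b] := hF _ (VU p Vp); split; last by rewrite (le_trans b)// ler_peMl.
  by apply: continuous_comp => //; exact: cA.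
- move=> i; case: (pickP [pred j | sg j == Some i]) => [j /= /eqP ji|none].
    have [G hG1 hG2] := dF j; exists (fun p => l * G (A p)); last first.
      have := @ckb_scale R N k V l _ _ (IH _ hG2) => h.
      apply: ckb_mono h => //; rewrite exprS -mulrA ler_wpM2r ?mulr_ge0//.
      by rewrite lerDr.
    move=> p Vp; apply: (is_derive_affine (A := A) (u := l *: delta_mx 0 j)).
      move=> t; rewrite hA (bigD1 j) ?ji//= big1 ?addr0// => j' /andP[/eqP h1 /eqP h2].
      by exfalso; apply: h2; exact: inj h1 ji.
    exact/is_derive_scale/hG1/VU.
  exists (fun=> 0); last by apply: ckb_cst; rewrite normr0 mulr_ge0.
  move=> p Vp; apply: (is_derive_affine (A := A) (u := 0)).
    move=> t; rewrite hA big1 ?scaler0// => j h; by have := none j; rewrite /= h.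
  by apply/is_derive_lineP; under [X in is_derive _ _ X]eq_fun do rewrite scaler0 add0r; exact: is_derive_cst.
- move=> p Vp; have [c b] := hF _ (VU p Vp); split; last by rewrite (le_trans b)// ler_peMl.
  by apply: continuous_comp => //; exact: cA.
Qed.

Lemma continuous_scale_shift (R : realType) (V : normedModType R) (l : R) (Z : V) :
  continuous (fun X : V => l *: (X - Z)).
Proof.
move=> X.
have h : (Y - Z) @[Y --> X] --> X - Z by apply: cvgB; [exact: cvg_id|exact: cvg_cst].
by apply: cvgZ; [exact: cvg_cst|exact: h].
Qed.

(** * Functions with iterated preimages *)

Section good_functions.
Context (R : realType) (n : nat) (s : R).
Hypothesis n0 : (0 < n)%N.
Hypothesis s01 : 0 < s < 1.
Implicit Types (X Y Z : 'rV[R]_n) (phi psi : 'rV[R]_n -> R).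

Let s0 : 0 < s. Proof. by case/andP: s01. Qed.

Definition nball (r : R) : set 'rV[R]_n := [set X | nsq X < r].

Lemma open_nball r : open (nball r).
Proof.
have := @open_comp _ _ (@nsq R n) [set y | y < r] (fun X _ => @continuous_nsq R n X) (@open_lt R r).
by [].
Qed.

Definition smooth r phi := forall k, exists2 M, 0 <= M & ckb k (nball r) M phi.

(** The functions that are [K] times in the range of [symlap s] on a ball; the
    induction on the degree in [x] uses up one preimage at each step. *)
Fixpoint good K r phi : Prop :=
  [/\ regular r phi, smooth r phi &
      if K is K'.+1 then exists2 psi, good K' r psi & forall X, nball r X -> symlap s psi X = phi X
      else True].

Lemma good_base K r phi : good K r phi -> regular r phi /\ smooth r phi.
Proof. by case: K => [|K] [? ? _]. Qed.

Lemma smooth_lin r c phi psi : smooth r phi -> smooth r psi -> smooth r (fun X => c * phi X + psi X).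
Proof.
move=> h1 h2 k; have [M1 M10 b1] := h1 k; have [M2 M20 b2] := h2 k.
by exists (`|c| * M1 + M2); [rewrite addr_ge0// mulr_ge0|exact: ckb_lin].
Qed.

Lemma regular_lin r c phi psi : regular r phi -> regular r psi -> regular r (fun X => c * phi X + psi X).
Proof.
move=> [c1 [r1 h1] m1 d1] [c2 [r2 h2] m2 d2]; split.
- move=> X; apply: (continuous_add2 (f := fun X => c * phi X) (g := psi)); last exact: c2.
  by apply: continuous_scale; exact: c1.
- exists (Num.max r1 r2) => X; rewrite ge_max => /andP[X1 X2].
  by rewrite h1// h2// mulr0 addr0.
- exact: mfn_lin.
- move=> X Xr; have [C1 h3] := d1 X Xr; have [C2 h4] := d2 X Xr.
  by exists (`|c| * C1 + C2); exact: dif2_le_lin.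
Qed.

Lemma good_lin K r c phi psi : good K r phi -> good K r psi -> good K r (fun X => c * phi X + psi X).
Proof.
elim: K phi psi => [|K IH] phi psi /= [r1 s1 h1] [r2 s2 h2].
  by split => //; [exact: regular_lin|exact: smooth_lin].
have [p1 g1 l1] := h1; have [p2 g2 l2] := h2; split; [exact: regular_lin|exact: smooth_lin|].
exists (fun X => c * p1 X + p2 X); first exact: IH.
move=> X Xr; rewrite -l1// -l2//.
have [[_ _ m1 d1] _] := good_base g1; have [[_ _ m2 d2] _] := good_base g2.
have [C1 h3] := d1 X Xr; have [C2 h4] := d2 X Xr.
exact: (symlap_lin n0 s01 c m1 m2 h3 h4).
Qed.

Lemma good_zero K r : good K r (fun _ => 0).
Proof.
have rz : regular r (fun _ : 'rV[R]_n => 0 : R).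
  split => //; first by move=> X; exact: cst_continuous.
  - by exists 0.
  - by move=> X _; exists 0; exact: dif2_le0.
have sz : smooth r (fun _ => 0) by move=> k; exists 0 => //; apply: ckb_cst; rewrite normr0.
elim: K => [|K IH] /=; split => //; exists (fun _ => 0) => // X _; exact: symlap0.
Qed.

Lemma good_scale K r c phi : good K r phi -> good K r (fun X => c * phi X).
Proof. by move=> h; have := good_lin c h (good_zero K r); under eq_fun do rewrite addr0. Qed.

Lemma good_mono K r r' phi : r' <= r -> good K r phi -> good K r' phi.
Proof.
move=> rr; have sub X : nball r' X -> nball r X by move=> h; exact: lt_le_trans h rr.
elim: K phi => [|K IH] phi /= [[c u m d] sm h].
  split => //; first by split => // X Xr; apply: d; exact: sub.
  by move=> k; have [M M0 hM] := sm k; exists M => //; exact: ckb_mono hM.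
split; first by split => // X Xr; apply: d; exact: sub.
  by move=> k; have [M M0 hM] := sm k; exists M => //; exact: ckb_mono hM.
by have [psi g l] := h; exists psi; [exact: IH|move=> X Xr; apply: l; exact: sub].
Qed.

Let aff (l : R) Z X : 'rV[R]_n := l *: (X - Z).

Let continuous_aff l Z : continuous (aff l Z).
Proof.
exact: continuous_scale_shift.
Qed.

Lemma nsq_le_shift X Z : nsq X <= 2 * nsq (X - Z) + 2 * nsq Z.
Proof.
have := nsq_ge0 (X - 2 *: Z); rewrite !nsqB dotrZr nsqZ; lra.
Qed.

Lemma regular_affine r r' l Z phi : 0 < l -> (forall X, nball r' X -> nball r (l *: (X - Z))) ->
  regular r phi -> regular r' (fun X => phi (l *: (X - Z))).
Proof.
move=> l0 sub [c [rho h] m d]; split.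
- by move=> X; apply: (@continuous_comp _ _ _ (aff l Z) phi); [exact: continuous_aff|exact: c].
- exists (2 * (`|rho| / l ^+ 2) + 2 * nsq Z) => X hX; apply: h.
  rewrite nsqZ (le_trans (ler_norm _))// -ler_pdivrMl ?exprn_gt0// mulrC.
  by have := nsq_le_shift X Z; lra.
- by apply: (mfn_translate (phi := fun Y => phi (l *: Y))); exact: mfn_dilate.
- move=> X Xr; have [C hC] := d _ (sub X Xr).
  have := dif2_le_dilate hC; exists (`|C| * (1 + l ^+ 2)) => t.
  by rewrite (dif2_translate (fun Y => phi (l *: Y))).
Qed.

Lemma smooth_affine r r' l Z phi : (forall X, nball r' X -> nball r (l *: (X - Z))) ->
  smooth r phi -> smooth r' (fun X => phi (l *: (X - Z))).
Proof.
move=> sub sm k; have [M M0 hM] := sm k; exists ((1 + `|l|) ^+ k * M).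
  by rewrite mulr_ge0// exprn_ge0// addr_ge0.
apply: (@ckb_affine R n n Some _ (aff l Z) l k (nball r) _ M phi) => //.
- by move=> i j k' [->] [->].
- move=> t p i; rewrite (bigD1 i)//= big1 ?addr0; last first.
    by move=> j /andP[/eqP[->]]; rewrite eqxx.
  by rewrite /aff -addrA scalerDr !scalerA mulrC.
Qed.

Lemma good_affine K r r' l Z phi : 0 < l -> (forall X, nball r' X -> nball r (l *: (X - Z))) ->
  good K r phi -> good K r' (fun X => phi (l *: (X - Z))).
Proof.
move=> l0 sub; elim: K phi => [|K IH] phi /= [rg sm h].
  by split => //; [exact: regular_affine rg|exact: smooth_affine sm].
split; [exact: regular_affine rg|exact: smooth_affine sm|].
have [psi g L] := h; have p0 : 0 < l `^ (2 * s) by exact: powR_gt0.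
exists (fun X => (l `^ (2 * s))^-1 * psi (l *: (X - Z))); first by apply: good_scale; exact: IH.
move=> X Xr; rewrite -L; last exact: sub.
have [[_ _ m d] _] := good_base g; have [C hC] := d _ (sub X Xr).
have md := mfn_dilate l m.
rewrite (symlapZ n0 s01 (C := `|C| * (1 + l ^+ 2)) _ (mfn_translate Z md)); last first.
  by move=> t; rewrite (dif2_translate (fun Y => psi (l *: Y))); exact: (dif2_le_dilate hC).
by rewrite (symlap_translate s (fun Y => psi (l *: Y))) (symlap_dilate n0 s01 l0 m hC) mulKf// gt_eqF.
Qed.

Lemma ckb_nsq k r (M : R) : 1 <= M -> (forall X, nball r X -> forall i, `|X 0 i| <= M) ->
  exists2 C, 0 <= C & ckb k (nball r) C (@nsq R n).
Proof.
move=> M1 h; have M0 := le_trans ler01 M1.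
suff H (l : seq 'I_n) : exists2 C, 0 <= C & ckb k (nball r) C (fun X => \sum_(i <- l) X 0 i * X 0 i).
  exact: H.
elim: l => [|i l [C C0 hC]].
  by exists 0 => //; under eq_fun do rewrite big_nil; apply: ckb_cst; rewrite normr0.
have hi : ckb k (nball r) M (fun X => X 0 i) by apply: ckb_coord => // X Xr; exact: h.
exists (`|1| * (2 ^+ k * (M * M)) + C); first by rewrite addr_ge0// !mulr_ge0// exprn_ge0.
have := ckb_lin 1 (ckb_mul hi hi) hC.
by under eq_fun do rewrite mul1r -(big_cons _ _ i l xpredT (fun i => _ 0 i * _ 0 i)).
Qed.

Lemma pfun_bound (c : nat -> R) : disc_coef c -> exists2 A, 0 <= A & forall y, `|y| <= 2^-1 ^+ 2 -> `|pfun c y| <= A.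
Proof.
move=> hc; have half : 0 < (2^-1 : R) < 1 by rewrite invr_gt0 ltr0n invf_lt1// ltr1n.
have [M hM] := hc _ half; have M0 : 0 <= M by have := hM 0%N; rewrite expr0 mulr1; exact: le_trans.
exists (2 * M) => [|y hy]; first exact: mulr_ge0.
have b i : `|c i * y ^+ i| <= M * 2^-1 ^+ i.
  rewrite normrM normrX (le_trans (y := `|c i| * (2^-1 ^+ 2) ^+ i))//.
    by rewrite ler_wpM2l// lerXn2r ?nnegrE.
  by rewrite -exprM mulSn mul1n exprD mulrA ler_wpM2r ?exprn_ge0.
have [l [cl hl]] := geometric_majorant b.
have -> : pfun c y = l by apply/cvg_lim.
by have := hl 0%N; rewrite /series/= big_geq// subr0 expr0 mulr1.
Qed.

Let quarter : R := 2^-1 ^+ 2.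

Lemma radial_germ_smooth phi : radial_germ phi -> smooth quarter phi.
Proof.
move=> [_ [c hc hphi]] k.
have q1 : quarter < 1 by rewrite exprn_ilt1// invf_lt1// ltr1n.
have hco X : nball quarter X -> forall i, `|X 0 i| <= 1.
  move=> Xq i; rewrite -(@ler_pXn2r _ 2) ?nnegrE// expr1n -normrX ger0_norm ?sqr_ge0//.
  by rewrite (le_trans (nsq_coord X i))// ltW// (lt_trans Xq).
have [M M0 hM] := @ckb_nsq k quarter 1 (lexx _) hco.
pose f j := pfun (iter j (@pseries_diffs R) c).
have dcj j : disc_coef (iter j (@pseries_diffs R) c).
  by elim: j => [|j IH] //=; exact: disc_coef_diffs.
have [A A0 hA] : exists2 A, 0 <= A & forall j, (j <= k)%N -> forall y, `|y| <= quarter -> `|f j y| <= A.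
  elim: k {hM} => [|k [A A0 hA]].
    by have [A A0 hA] := pfun_bound (dcj 0%N); exists A => // j; rewrite leqn0 => /eqP ->.
  have [B B0 hB] := pfun_bound (dcj k.+1); exists (A + B); first exact: addr_ge0.
  move=> j; rewrite leq_eqVlt => /orP[/eqP -> y hy|jk y hy].
    by rewrite (le_trans (hB y hy))// lerDr.
  by rewrite (le_trans (hA j jk y hy))// lerDl.
have nX X : nball quarter X -> `|nsq X| <= quarter by move=> h; rewrite ger0_norm ?nsq_ge0// ltW.
have df j y : `|y| <= quarter -> is_derive y (1 : R) (f j) (f j.+1 y).
  by move=> hy; apply: is_derive_pfun => //; exact: le_lt_trans hy q1.
have h := ckb_comp M0 A0 hM (f := f)
  (fun j p Up _ => df j _ (nX p Up)) _ (fun j p Up jk => hA j jk _ (nX p Up)).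
exists (comp_const k M * A).
  by rewrite mulr_ge0// (le_trans ler01)// comp_const_ge1.
have hk : forall p, nball quarter p -> {for nsq p, continuous (f k)}.
  move=> p Up; have hd := df k _ (nX p Up).
  by apply: differentiable_continuous; apply/derivable1_diffP; exact: ex_derive.
apply: ckb_local (h hk); first exact: open_nball.
move=> p Up; have p1 : nsq p < 1 := lt_trans Up q1.
  have h0 : pseries c (nsq p) @ \oo --> f 0%N (nsq p).
  by apply: (pfun_cvg hc); rewrite ger0_norm// nsq_ge0.
exact: (cvg_unique _ h0 (hphi p p1)).
Qed.

Variables (c0 : R) (d : nat -> R).
Hypothesis c00 : 0 < c0.
Hypothesis symlap_c0 : forall a X, nsq X < a -> symlap s (fun Z => pp s (a - nsq Z)) X = c0.
Hypothesis d0 : d 0%N = c0.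
Hypothesis symlap_v : forall i X, nsq X < 1 -> symlap s (balldiff s i) X = d i * nsq X ^+ i.

(** Each application of [radial_preimage] shrinks the ball, but only finitely many
    are needed. *)
Lemma radial_good K phi : radial_germ phi -> exists2 r, 0 < r & good K r phi.
Proof.
have q0 : 0 < quarter by rewrite exprn_gt0.
have q1 : quarter <= 1 by rewrite exprn_ile1// invf_le1// ler1n.
elim: K phi => [|K IH] phi hphi.
  exists quarter => //; split => //; last exact: radial_germ_smooth.
  have [[c u m dd] _] := hphi; split => // X Xq; apply: dd; exact: lt_le_trans Xq q1.
have [psi hpsi L] := radial_preimage n0 s01 c00 symlap_c0 d0 symlap_v hphi.
have [r r0 g] := IH psi hpsi.
set l : R := 2^-1 ^+ 4 in L; have l0 : 0 < l by rewrite exprn_gt0.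
have l1 : l <= 1 by rewrite exprn_ile1// invf_le1// ler1n.
pose r' := Num.min quarter (Num.min (l ^+ 2 * r) (l ^+ 2)).
have r'0 : 0 < r' by rewrite !lt_min q0 mulr_gt0 ?exprn_gt0.
have sub (q : R) X : nball (l ^+ 2 * q) X -> nball q (l^-1 *: (X - 0)).
  by rewrite /nball/= subr0 nsqZ exprVn ltr_pdivrMl ?exprn_gt0.
exists r' => //; split.
- have [[c u m dd] _] := hphi; split => // X Xq; apply: dd.
  by apply: (lt_le_trans Xq); rewrite (le_trans _ q1)// ge_min lexx.
- move=> k; have [M M0 hM] := radial_germ_smooth hphi k; exists M => //.
  apply: ckb_mono hM => // X Xr; apply: (lt_le_trans Xr); by rewrite ge_min lexx.
exists (fun X => l `^ (2 * s) * psi (l^-1 *: (X - 0))).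
  apply: good_scale; apply: (good_affine (r := r)) => //; first by rewrite invr_gt0.
  move=> X Xr; apply: sub; apply: (lt_le_trans Xr).
  by rewrite !ge_min lexx orbT.
move=> X Xr; have Xl : nsq (l^-1 *: X) < 1.
  rewrite nsqZ exprVn ltr_pdivrMl ?exprn_gt0// mulr1; apply: (lt_le_trans Xr).
  by rewrite !ge_min lexx !orbT.
have [[_ _ m dd] _] := hpsi; have [C hC] := dd _ Xl.
have il0 : 0 < l^-1 by rewrite invr_gt0.
under [X in symlap s X _]eq_fun do rewrite subr0.
rewrite (symlapZ n0 s01 (C := `|C| * (1 + l^-1 ^+ 2)) _ (mfn_dilate l^-1 m)); last exact: (dif2_le_dilate hC).
rewrite (symlap_dilate n0 s01 il0 m hC) L// scalerA divff ?gt_eqF// scale1r mulrA.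
by rewrite -powRM ?(ltW l0) ?(ltW il0)// divff ?gt_eqF// powR1 mul1r.
Qed.

Lemma ball_germ : radial_germ (ballpow s 0 1 : 'rV[R]_n -> R).
Proof.
split.
  split; [exact: continuous_ballpow| |exact: mfn_ballpow|].
    by exists 1 => X; exact: ballpow_out.
  by move=> X X1; exact: dif2_le_ballpow.
exists (bcoef s) => [|X X1].
  apply: (@bounded_disc_coef _ _ 1) => j; have := @bcoef_bound R s 0 j.
  by rewrite addr0 expr0; apply; case/andP: s01 => *; rewrite !ltW.
rewrite /ballpow addr0 pp_pos ?subr_ge0 ?(ltW X1)//.
apply: binomial_series; last by rewrite nsq_ge0.
apply: (@bounded_disc_coef _ _ 1) => j; have := @bcoef_bound R s 0 j.
by rewrite addr0 expr0; apply; case/andP: s01 => *; rewrite !ltW.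
Qed.

End good_functions.

(** * Harmonic approximation of monomials *)

Section taylor_remainder.
Context (R : realType).
Implicit Types (p y : R).

Definition binomial_rem p M y : R := (1 + y) `^ p - \sum_(k < M) gbin p k * y ^+ k.

(** Differentiating the remainder of order [M] of [(1 + y) ^ p] gives that of order
    [M - 1] of [(1 + y) ^ (p - 1)]: bounds follow by induction on [M]. *)
Lemma is_derive_binomial_rem p M y : `|y| <= 2^-1 ->
  is_derive y (1 : R) (binomial_rem p M) (p * binomial_rem (p - 1) M.-1 y).
Proof.
move=> hy; have y0 : 0 < 1 + y by move: hy; rewrite ler_norml => /andP[? _]; lra.
have h1 := is_derive_powR p y0.
have h2 : is_derive y (1 : R) (fun y : R => 1 + y) 1.
  by apply: is_derive_eq; rewrite /GRing.scale/=; ring.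
have h3 := @is_derive1_comp _ (fun z : R => z `^ p) (fun y : R => 1 + y) y _ _ h1 h2.
have dt (k : 'I_M) : is_derive y (1 : R) (fun y : R => gbin p k * y ^+ k) (gbin p k * (k%:R * y ^+ k.-1)).
  have h := is_deriveX k (is_derive_id y (1 : R)).
  have e : (fun y : R => y ^+ k) = (@id R) ^+ k by apply/funext => b; rewrite exprfctE.
  have hk : is_derive y (1 : R) (fun y : R => y ^+ k) (k%:R * y ^+ k.-1).
    by rewrite e; apply: (is_derive_eq h); rewrite /GRing.scale/= mulr1.
  exact: (is_deriveZ (gbin p k) hk).
have h4 := is_derive_sum dt.
have e : binomial_rem p M = (fun y : R => (1 + y) `^ p) - \sum_(k < M) (fun y : R => gbin p k * y ^+ k).
  by apply/funext => z; rewrite /binomial_rem !fctE fct_sumE.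
rewrite e; apply: (is_derive_eq (is_deriveB h3 h4)).
rewrite /binomial_rem mulr1 mulrBr; congr (_ - _).
case: M {dt h4 e} => [|M]; first by rewrite !big_ord0 mulr0.
rewrite big_ord_recl mul0r mulr0 add0r mulr_sumr; apply: eq_bigr => k _.
rewrite /= /bump add1n /= mulrA [gbin p _ * _]mulrC.
by have := gbin_shift (p - 1) k; rewrite subrK => h; rewrite add0n h -mulrA.
Qed.

Lemma binomial_rem_bound p M : exists2 C, 0 <= C & forall y, `|y| <= 2^-1 -> `|binomial_rem p M y| <= C * `|y| ^+ M.
Proof.
elim: M p => [|M IH] p.
  have cw : {within [set` `[2^-1 : R, 2]], continuous (fun z : R => z `^ p)}.
    apply: continuous_in_subspaceT => z; rewrite inE/= in_itv/= => /andP[z0 _].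
    by apply: continuous_powR_pos; rewrite (lt_le_trans _ z0).
  have h2 : (2^-1 : R) <= 2 by lra.
  have [c _ hc] := EVT_max h2 cw.
  exists (c `^ p) => [|y hy]; first exact: powR_ge0.
  rewrite /binomial_rem big_ord0 subr0 expr0 mulr1 ger0_norm ?powR_ge0// hc// in_itv/=.
  by move: hy; rewrite ler_norml => /andP[? ?]; apply/andP; split; lra.
have [C C0 hC] := IH (p - 1); exists (`|p| * C) => [|y hy]; first exact: mulr_ge0.
have b0 : binomial_rem p M.+1 0 = 0.
  rewrite /binomial_rem addr0 powR1 big_ord_recl gbin0 expr0 mulr1 big1 ?addr0 ?subrr// => i _.
  by rewrite /= /bump add1n expr0n/= mulr0.
have dif z : `|z| <= `|y| -> is_derive z (1 : R) (binomial_rem p M.+1) (p * binomial_rem (p - 1) M z).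
  by move=> zy; apply: (@is_derive_binomial_rem p M.+1); exact: le_trans zy hy.
have der_le z : `|z| <= `|y| -> `|p * binomial_rem (p - 1) M z| <= `|p| * C * `|y| ^+ M.
  move=> zy; rewrite normrM -mulrA ler_wpM2l// (le_trans (hC z (le_trans zy hy)))//.
  by rewrite ler_wpM2l// lerXn2r ?nnegrE.
have key (z : R) : `|z| <= `|y| -> exists2 c : R, `|c| <= `|y| & binomial_rem p M.+1 y = p * binomial_rem (p - 1) M c * y.
  move=> _; have [y0|y0] := leP 0 y.
    have [c cy e] : exists2 c, c \in `[0, y] & binomial_rem p M.+1 y - binomial_rem p M.+1 0 = p * binomial_rem (p - 1) M c * (y - 0).
      apply: (@MVT_segment _ (binomial_rem p M.+1) (fun c => p * binomial_rem (p - 1) M c)) => //.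
        move=> c; rewrite in_itv/= => /andP[c0 cy]; apply: dif.
        by rewrite !ger0_norm// ltW.
      apply: derivable_within_continuous => c; rewrite in_itv/= => /andP[c0 cy].
      have h : `|c| <= `|y| by rewrite !ger0_norm.
      by have h' := dif c h; exact: ex_derive.
    exists c; last by move: e; rewrite b0 !subr0.
    by move: cy; rewrite in_itv/= => /andP[c0 cy]; rewrite !ger0_norm.
  have [c cy e] : exists2 c, c \in `[y, 0] & binomial_rem p M.+1 0 - binomial_rem p M.+1 y = p * binomial_rem (p - 1) M c * (0 - y).
    apply: (@MVT_segment _ (binomial_rem p M.+1) (fun c => p * binomial_rem (p - 1) M c)); first exact: ltW.
      move=> c; rewrite in_itv/= => /andP[yc c0]; apply: dif.
      by rewrite (ltr0_norm y0) (ltr0_norm c0) lerN2 ltW.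
    apply: derivable_within_continuous => c; rewrite in_itv/= => /andP[yc c0].
    have h : `|c| <= `|y| by rewrite (ltr0_norm y0) (ler0_norm c0) lerN2.
    by have h' := dif c h; exact: ex_derive.
  exists c; last by move: e; rewrite b0 !sub0r mulrN => /oppr_inj.
  by move: cy; rewrite in_itv/= => /andP[yc c0]; rewrite (ltr0_norm y0) (ler0_norm c0) lerN2.
have [c cy ->] := key y (lexx _).
by rewrite normrM exprSr mulrA ler_wpM2r// der_le.
Qed.

End taylor_remainder.

Section density.
Context (R : realType) (n : nat) (s : R).
Hypothesis n0 : (0 < n)%N.
Hypothesis s01 : 0 < s < 1.
Implicit Types (X Y Z b : 'rV[R]_n) (phi psi : 'rV[R]_n -> R).

Let s0 : 0 < s. Proof. by case/andP: s01. Qed.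

Definition harmonic K r phi := good s K r phi /\ forall X : 'rV[R]_n, nball r X -> symlap s phi X = 0.

Lemma harmonic_lin K r c phi psi : harmonic K r phi -> harmonic K r psi ->
  harmonic K r (fun X => c * phi X + psi X).
Proof.
move=> [g1 h1] [g2 h2]; split => [|X Xr]; first exact: good_lin.
have [[_ _ m1 d1] _] := good_base g1; have [[_ _ m2 d2] _] := good_base g2.
have [C1 h3] := d1 X Xr; have [C2 h4] := d2 X Xr.
by rewrite (symlap_lin n0 s01 c m1 m2 h3 h4) h1// h2// mulr0 addr0.
Qed.

Lemma harmonic_zero K r : harmonic K r (fun _ => 0).
Proof. by split => [|X _]; [exact: good_zero|exact: symlap0]. Qed.

Lemma harmonic_scale K r c phi : harmonic K r phi -> harmonic K r (fun X => c * phi X).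
Proof. by move=> h; have := harmonic_lin c h (harmonic_zero K r); under eq_fun do rewrite addr0. Qed.

(** Completing the square, [1 + eta b . X - eta ^ 2 |X| ^ 2] is a multiple of
    [a - |X - Z| ^ 2] with [Z = b / (2 eta)]: [ballbump] is a translate of the
    solution attached to a large ball, of radius of order [1 / eta], whose image
    under [symlap] does not depend on [b]. *)
Let lin eta b X : R := dotr b X - eta * nsq X.
Let ballbump eta b X : R := pp s (1 + eta * lin eta b X).

Let ballbumpE eta b X : 0 < eta ->
  ballbump eta b X = (eta ^+ 2) `^ s * pp s ((eta ^- 2 + nsq ((2 * eta)^-1 *: b)) - nsq (X - (2 * eta)^-1 *: b)).
Proof.
move=> e0; have e2 : 0 < eta ^+ 2 by rewrite exprn_gt0.
have e : 1 + eta * lin eta b X =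
    eta ^+ 2 * ((eta ^- 2 + nsq ((2 * eta)^-1 *: b)) - nsq (X - (2 * eta)^-1 *: b)).
  rewrite /lin nsqB dotrZr (dotrC b X); move: (nsq _) (nsq X) (dotr X b) => y1 y2 y3.
  by field; rewrite gt_eqF.
rewrite /ballbump e; set w := _ - _; have [h|h] := leP 0 w.
  by rewrite (pp_pos _ h) (pp_pos _ (mulr_ge0 (ltW e2) h)) (powRM _ (ltW e2) h).
by rewrite !pp_neg ?mulr0 ?(ltW h)// pmulr_rle0// ltW.
Qed.

Variables (c0 : R) (d : nat -> R).
Hypothesis c00 : 0 < c0.
Hypothesis symlap_c0 : forall a X, nsq X < a -> symlap s (fun Z => pp s (a - nsq Z)) X = c0.
Hypothesis d0 : d 0%N = c0.
Hypothesis symlap_v : forall i X, nsq X < 1 -> symlap s (balldiff s i) X = d i * nsq X ^+ i.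

(** For small [eta] and [b] the ball of radius [2] sits near the centre of the large
    ball that carries [ballbump], where the germ of [radial_good] is defined. *)
Let good_bump K : exists2 r, 0 < r <= 1 & forall eta b, 0 < eta -> 8 * eta ^+ 2 + nsq b / 2 < r ->
  good s K 4 (ballbump eta b) /\ forall X, nball 4 X -> symlap s (ballbump eta b) X = (eta ^+ 2) `^ s * c0.
Proof.
have [r1 r10 g1] := radial_good n0 s01 c00 symlap_c0 d0 symlap_v K (ball_germ n s01).
pose r := Num.min r1 1.
have r0 : 0 < r by rewrite lt_min r10 ltr01.
have g : good s K r (ballpow s 0 1 : 'rV[R]_n -> R) by apply: good_mono g1; rewrite ge_min lexx.
exists r => [|eta b e0 small]; first by rewrite r0 ge_min lexx orbT.
have r1' : r <= 1 by rewrite ge_min lexx orbT.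
have e2 : 0 < eta ^+ 2 by rewrite exprn_gt0.
pose Z := (2 * eta)^-1 *: b; pose a := eta ^- 2 + nsq Z.
have a0 : 0 < a by rewrite ltr_pwDl ?invr_gt0// nsq_ge0.
have nZ : nsq Z = nsq b / (4 * eta ^+ 2).
  by rewrite nsqZ exprVn; field; rewrite gt_eqF.
have near X : nball 4 X -> nsq (X - Z) < r * a.
  move=> X4; have h1 : nsq (X - Z) <= 2 * nsq X + 2 * nsq Z.
    by have := nsq_le_shift (X - Z) (- Z); rewrite opprK subrK nsqN.
  have h2 : 8 + 2 * nsq Z < r * eta ^- 2.
    rewrite -(ltr_pM2r e2) -(mulrA r) mulVf ?gt_eqF// mulr1 nZ.
    rewrite [ltLHS](_ : _ = 8 * eta ^+ 2 + nsq b / 2)//.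
    by field; rewrite gt_eqF.
  have h3 : r * eta ^- 2 <= r * a by rewrite ler_wpM2l ?(ltW r0)// lerDl nsq_ge0.
  have X4' : nsq X < 4 by [].
  have := nsq_ge0 Z; lra.
have be : ballbump eta b = fun X => (eta ^+ 2) `^ s * pp s (a - nsq (X - Z)).
  by apply/funext => X; rewrite ballbumpE.
pose l := (Num.sqrt a)^-1.
have l0 : 0 < l by rewrite invr_gt0 sqrtr_gt0.
have l2 : l ^+ 2 = a^-1 by rewrite exprVn sqr_sqrtr// ltW.
have e : ballbump eta b = fun X => (eta ^+ 2) `^ s * a `^ s * ballpow s 0 1 (l *: (X - Z)).
  rewrite be; apply/funext => X; rewrite -mulrA; congr (_ * _).
  rewrite /ballpow addr0 nsqZ l2.
  have e1 : a - nsq (X - Z) = a * (1 - a^-1 * nsq (X - Z)) by field; rewrite gt_eqF.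
  rewrite e1; set w := 1 - _; have [h|h] := leP 0 w.
    by rewrite (pp_pos _ h) (pp_pos _ (mulr_ge0 (ltW a0) h)) (powRM _ (ltW a0) h).
  by rewrite !pp_neg ?mulr0 ?(ltW h)// pmulr_rle0// ltW.
split.
  rewrite e; apply: good_scale => //; apply: (good_affine n0 s01 l0 _ g) => X X4.
  by rewrite /nball/= nsqZ l2 mulrC ltr_pdivrMr// near.
move=> X X4; have Xa : nsq (X - Z) < a.
  by rewrite (lt_le_trans (near X X4))// ler_piMl// ltW.
have h : 0 <= nsq (X - Z) < a by rewrite nsq_ge0.
have [K1 _ hK1] := @dif2_le_pp R n _ _ h.
have hD := hK1 s a (X - Z) s0 (lexx _) erefl.
rewrite be (symlapZ n0 s01 (C := K1 * ((s + 1) ^+ 2 * a `^ s)) _ (mfn_translate Z (@mfn_pp R n s a))).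
  by rewrite (symlap_translate s (fun Y => pp s (a - nsq Y))) symlap_c0.
by move=> t; rewrite (dif2_translate (fun Y => pp s (a - nsq Y))); exact: hD.
Qed.

Fixpoint iter_diff (de : R) (l : seq 'I_n) (F : 'rV[R]_n -> R) b : R :=
  if l is i :: l' then iter_diff de l' F (b + de *: delta_mx 0 i) - iter_diff de l' F b else F b.

Lemma iter_diff_lin de l c (F G : 'rV[R]_n -> R) b :
  iter_diff de l (fun b => c * F b + G b) b = c * iter_diff de l F b + iter_diff de l G b.
Proof. by elim: l b => [|i l IH] b //=; rewrite !IH; ring. Qed.

Lemma iter_diff_sum de l m (c : 'I_m -> R) (F : 'I_m -> 'rV[R]_n -> R) b :
  iter_diff de l (fun b => \sum_(k < m) c k * F k b) b = \sum_(k < m) c k * iter_diff de l (F k) b.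
Proof.
elim: m c F => [|m IH] c F.
  rewrite big_ord0; under [X in iter_diff _ _ X]eq_fun do rewrite big_ord0.
  by elim: l b => [|i l IH] b //=; rewrite !IH subrr.
rewrite big_ord_recl; under [X in iter_diff _ _ X]eq_fun do rewrite big_ord_recl.
by rewrite iter_diff_lin IH.
Qed.

Let mono (l : seq 'I_n) X : R := \prod_(i <- l) X 0 i.

(** A difference of order [m] kills polynomials in [b] of degree less than [m], and
    leaves the leading term of degree [m]. *)
Lemma iter_diff_power de eta l k X b :
  ((k < size l)%N -> iter_diff de l (fun b => lin eta b X ^+ k) b = 0) /\
  (k = size l -> iter_diff de l (fun b => lin eta b X ^+ k) b = k`!%:R * de ^+ k * mono l X).
Proof.
elim: l k b => [|i l IH] k b; first by split => // ->; rewrite /= fact0 !expr0 !mul1r /mono big_nil.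
have shiftE F b' : iter_diff de (i :: l) F b' = iter_diff de l (fun b => F (b + de *: delta_mx 0 i) - F b) b'.
  rewrite /=; have := iter_diff_lin de l (-1) F (fun b => F (b + de *: delta_mx 0 i)) b'.
  have -> : (fun b => F (b + de *: delta_mx 0 i) - F b) = (fun b => -1 * F b + F (b + de *: delta_mx 0 i)).
    by apply/funext => b1; rewrite mulN1r addrC.
  move=> ->; rewrite mulN1r [RHS]addrC; congr (_ - _).
  by elim: l {IH} b' => [|j l IH] b' //=; rewrite -!IH addrAC.
have linD b' : lin eta (b' + de *: delta_mx 0 i) X = lin eta b' X + de * X 0 i.
  rewrite /lin dotrDl dotrZl.
  have -> : dotr (delta_mx 0 i) X = X 0 i.
    rewrite /dotr (bigD1 i)//= big1 ?addr0; first by rewrite mxE !eqxx mul1r.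
    by move=> j /negbTE ji; rewrite mxE ji andbF mul0r.
  by ring.
have expand : iter_diff de (i :: l) (fun b => lin eta b X ^+ k) b =
   \sum_(j < k) ((de * X 0 i) ^+ (k - j) *+ 'C(k, j)) * iter_diff de l (fun b => lin eta b X ^+ j) b.
  rewrite shiftE -iter_diff_sum; congr (iter_diff _ _ _ _); apply/funext => b'.
  rewrite linD [lin eta b' X + _]addrC exprDn big_ord_recr/= subnn expr0 mul1r binn mulr1n addrK.
  by apply: eq_bigr => j _; rewrite mulrnAl.
rewrite expand; split => [kl|kl].
  rewrite big1// => j _; have [h _] := IH j b; rewrite h ?mulr0//.
  by rewrite (leq_trans (ltn_ord j)).
rewrite kl /= big_ord_recr/= big1 ?add0r; last first.
  by move=> j _; have [h _] := IH j b; rewrite h ?mulr0.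
have [_ ->//] := IH (size l) b.
rewrite subSnn expr1 binSn /mono big_cons factS natrM exprS -mulr_natl; ring.
Qed.

Let hco X : nball 4 X -> forall i, `|X 0 i| <= 2.
Proof.
move=> X4 i; rewrite -(@ler_pXn2r _ 2) ?nnegrE// -normrX ger0_norm ?sqr_ge0//.
have h : nsq X < 4 by [].
apply: le_trans (nsq_coord X i) _; rewrite (_ : 2 ^+ 2 = 4 :> R); first exact: ltW.
by ring.
Qed.

Let dotr_coord b : (fun X : 'rV[R]_n => dotr b X) = fun X => \sum_(i <- enum 'I_n) b 0 i * X 0 i.
Proof. by apply/funext => X; rewrite /dotr big_enum. Qed.

Let ckb_lin_fun k : exists2 C, 1 <= C & forall eta b, 0 <= eta <= 1 -> (forall i, `|b 0 i| <= 1) ->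
  ckb k (nball 4) C (lin eta b).
Proof.
have [C1 C10 h1] : exists2 C, 0 <= C & forall b, (forall i, `|b 0 i| <= 1) -> ckb k (nball 4) C (fun X => dotr b X).
  suff H (l : seq 'I_n) : exists2 C, 0 <= C & forall b, (forall i, `|b 0 i| <= 1) ->
      ckb k (nball 4) C (fun X : 'rV[R]_n => \sum_(i <- l) b 0 i * X 0 i).
    by have [C C0 hC] := H (enum 'I_n); exists C => // b hb; rewrite dotr_coord; exact: hC.
  elim: l => [|i l [C C0 hC]].
    by exists 0 => // b _; under eq_fun do rewrite big_nil; apply: ckb_cst; rewrite normr0.
  exists (2 + C); first by rewrite addr_ge0.
  move=> b hb; have hi : ckb k (nball 4) 2 (fun X : 'rV[R]_n => X 0 i).
    by apply: ckb_coord => [|X X4]; [rewrite ler1n|exact: hco].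
  under eq_fun do rewrite big_cons.
  by apply: ckb_mono (ckb_lin (b 0 i) hi (hC b hb)) => //; rewrite lerD2r ler_piMl// hb.
have [C2 C20 h2] := @ckb_nsq R n k 4 2 (ltW (ltr1n R 2)) hco.
exists (1 + C2 + C1); first by rewrite -addrA lerDl addr_ge0.
move=> eta b /andP[e0 e1] hb.
have -> : lin eta b = fun X => - eta * nsq X + dotr b X.
  by apply/funext => X; rewrite /lin addrC mulNr.
apply: ckb_mono (ckb_lin (- eta) h2 (h1 b hb)) => //.
rewrite lerD2r normrN ger0_norm// (le_trans (y := C2))// ?lerDr// ler_piMl//.
Qed.

(** A derivative of order [j] in [Y = lin eta b X] costs [j] orders in the
    remainder but brings out a factor [eta ^ j], so that all the derivatives are
    [O(eta ^ m)], uniformly in [b]. *)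
Let rem_bound k m : exists2 C, 0 <= C & exists2 e1, 0 < e1 <= 1 &
  forall eta b, 0 < eta <= e1 -> (forall i, `|b 0 i| <= 1) ->
  [/\ ckb k (nball 4) (C * eta ^+ m) (fun X => binomial_rem s m (eta * lin eta b X)) &
     forall X, nball 4 X -> `|eta * lin eta b X| <= 2^-1].
Proof.
have [M M1 hM] := ckb_lin_fun k; have M0 : 0 < M by exact: lt_le_trans M1.
pose f eta j y := eta ^+ j * ((\prod_(i < j) (s - i%:R)) * binomial_rem (s - j%:R) (m - j) (eta * y)).
have [A A0 hA] : exists2 A, 0 <= A & forall j, (j <= k)%N -> forall y, `|y| <= 2^-1 ->
    `|(\prod_(i < j) (s - i%:R)) * binomial_rem (s - j%:R) (m - j) y| <= A * `|y| ^+ (m - j).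
  elim: k {hM} => [|k [A A0 hA]].
    have [C C0 hC] := binomial_rem_bound s m; exists C => // j; rewrite leqn0 => /eqP -> y hy.
    by rewrite big_ord0 mul1r subr0 subn0 hC.
  have [B B0 hB] := binomial_rem_bound (s - k.+1%:R) (m - k.+1).
  exists (A + `|\prod_(i < k.+1) (s - i%:R)| * B); first by rewrite addr_ge0// mulr_ge0.
  move=> j; rewrite leq_eqVlt => /orP[/eqP -> y hy|jk y hy].
    rewrite normrM mulrDl (le_trans (y := `|\prod_(i < k.+1) (s - i%:R)| * B * `|y| ^+ (m - k.+1)))//.
      by rewrite -mulrA ler_wpM2l// hB.
    by rewrite lerDr mulr_ge0// exprn_ge0.
  rewrite mulrDl (le_trans (hA j jk y hy))// lerDl !mulr_ge0// exprn_ge0//.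
pose e1 := (2 * M)^-1.
have e10 : 0 < e1 by rewrite invr_gt0 mulr_gt0.
have e11 : e1 <= 1 by rewrite invf_le1 ?mulr_gt0//; lra.
exists (comp_const k M * (A * M ^+ m)).
  by rewrite !mulr_ge0 ?exprn_ge0 ?(ltW M0)// (le_trans ler01)// comp_const_ge1// ltW.
exists e1 => [|eta b /andP[e0 ee] hb]; first by rewrite e10.
have eta1 : eta <= 1 by exact: le_trans ee e11.
have hL : ckb k (nball 4) M (lin eta b) by apply: hM; rewrite ?(ltW e0).
have yM X : nball 4 X -> `|lin eta b X| <= M by move=> X4; have [] := ckb_base hL X4.
have y12 X : nball 4 X -> `|eta * lin eta b X| <= 2^-1.
  move=> X4; rewrite normrM (gtr0_norm e0).
  apply: (@le_trans _ _ (e1 * M)); first by rewrite ler_pM// ?(ltW e0)// yM.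
  by rewrite /e1 invfM -mulrA mulVf ?mulr1// gt_eqF.
split => //.
have df j X : nball 4 X -> is_derive (lin eta b X) (1 : R) (f eta j) (f eta j.+1 (lin eta b X)).
  move=> X4; have h1 := @is_derive_binomial_rem R (s - j%:R) (m - j) _ (y12 X X4).
  have h2 : is_derive (lin eta b X) (1 : R) (fun y : R => eta * y) eta.
    by apply: is_derive_eq; rewrite /GRing.scale/= mulr1.
  have h3 := @is_derive1_comp _ (binomial_rem (s - j%:R) (m - j)) (fun y : R => eta * y) _ _ _ h1 h2.
  have h4 := is_deriveZ (eta ^+ j) (is_deriveZ (\prod_(i < j) (s - i%:R)) h3).
  apply: (is_derive_eq h4); rewrite /GRing.scale/= /f big_ord_recr/= exprS.
  by rewrite subnS -natr1 opprD addrA; ring.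
have bf j X : nball 4 X -> (j <= k)%N -> `|f eta j (lin eta b X)| <= A * M ^+ m * eta ^+ m.
  move=> X4 jk; rewrite /f normrM normrX (gtr0_norm e0).
  apply: (@le_trans _ _ (eta ^+ j * (A * `|eta * lin eta b X| ^+ (m - j)))).
    by rewrite ler_wpM2l ?exprn_ge0 ?(ltW e0)// hA// y12.
  rewrite normrM (gtr0_norm e0) exprMn mulrCA -[leRHS]mulrA ler_wpM2l// mulrA -exprD mulrC.
  apply: ler_pM; rewrite ?exprn_ge0 ?(ltW e0)//.
    apply: (@le_trans _ _ (M ^+ (m - j))); first by rewrite lerXn2r ?nnegrE ?(ltW M0)// yM.
    by rewrite ler_weXn2l// leq_subr.
  by rewrite ler_wiXn2l ?(ltW e0)// -leq_subLR.
have e' : (fun X => binomial_rem s m (eta * lin eta b X)) = (fun X => f eta 0%N (lin eta b X)).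
  by apply/funext => X; rewrite /f expr0 mul1r big_ord0 mul1r subr0 subn0.
rewrite e' -mulrA; apply: ckb_comp.
- exact: ltW.
- by rewrite !mulr_ge0 ?exprn_ge0 ?(ltW M0) ?(ltW e0).
- exact: hL.
- by move=> j X X4 _; exact: df.
- move=> X X4; have h := df k X X4.
  by apply: differentiable_continuous; apply/derivable1_diffP; exact: ex_derive.
- by move=> j X X4 jk; exact: bf.
Qed.

Let ballbump_taylor eta b m X : `|eta * lin eta b X| <= 2^-1 ->
  ballbump eta b X = \sum_(k < m) (gbin s k * eta ^+ k) * lin eta b X ^+ k + binomial_rem s m (eta * lin eta b X).
Proof.
move=> h; rewrite /ballbump /binomial_rem pp_pos; last by move: h; rewrite ler_norml => /andP[? _]; lra.
have -> : \sum_(k < m) gbin s k * eta ^+ k * lin eta b X ^+ k = \sum_(k < m) gbin s k * (eta * lin eta b X) ^+ k.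
  by apply: eq_bigr => k _; rewrite exprMn mulrA.
by rewrite [RHS]addrC subrK.
Qed.

Let gbin_s_neq0 k : gbin s k != 0.
Proof.
rewrite /gbin mulf_neq0// ?invr_neq0 ?pnatr_eq0 -?lt0n ?fact_gt0//.
apply/prodf_neq0 => i _; rewrite subr_eq0; apply/eqP => e.
case: (nat_of_ord i) e => [|j] e; first by have := s0; rewrite e ltxx.
have : s < 1 by case/andP: s01.
by rewrite e ltNge ler1n.
Qed.

(** The image of [ballbump eta b] under [symlap] does not depend on [b], so that its
    iterated differences in [b] are [s]-harmonic. In the binomial expansion in
    [eta] the differences of the terms of degree less than [m] vanish, that of the
    term of degree [m] is a multiple of the monomial times [eta ^ m], and the
    remainder is [O(eta ^ m.+1)]; divide by [eta ^ m] and let [eta] tend to [0]. *)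
Lemma harmonic_monomial K k (l : seq 'I_n) (e : R) : 0 < e -> exists2 phi, harmonic K 4 phi &
  ckb k (nball 4) e (fun X => phi X - \prod_(i <- l) X 0 i).
Proof.
move=> e0; have [r /andP[r0 r1] hr] := good_bump K.
have [l0|l0] := eqVneq l [::].
  (* differences in [b] do not produce constants: combine the scales [eta] and
     [2 eta] so that the constant images under [symlap] cancel *)
  rewrite l0; have [C C0 [e1 /andP[e10 e11] hC]] := rem_bound k 1.
  pose p : R := 4 `^ s; have p0 : 0 < p by exact: powR_gt0.
  have p1 : 1 < p.
    have h : 1 <= p by rewrite /p -[leLHS](powRr0 4) ler_powR ?ler1n// ltW.
    rewrite lt_neqAle h andbT; apply/eqP => e4.
    have pE : p `^ s^-1 = 4 by rewrite /p -powRrM divff ?gt_eqF// powRr1.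
    have : (4 : R) = 1 by rewrite -pE -e4 powR1.
    by move/eqP; rewrite (eqr_nat R 4 1).
  pose q := p^-1; have q1 : 0 < 1 - q by rewrite subr_gt0 /q invf_lt1.
  have q0 : 0 < q by rewrite invr_gt0.
  pose eta := Num.min (e1 / 2) (Num.min (r / 64) (e * (1 - q) / (3 * C + 1))).
  have C1 : 0 < 3 * C + 1 by rewrite ltr_wpDl// mulr_ge0.
  have eta0 : 0 < eta by rewrite !lt_min !divr_gt0// mulr_gt0.
  have eta1 : eta <= e1 / 2 by rewrite ge_min lexx.
  have eta2 : eta <= r / 64 by rewrite !ge_min lexx !orbT.
  have eta3 : eta * (3 * C + 1) <= e * (1 - q) by rewrite -ler_pdivlMr// !ge_min lexx !orbT.
  have h0 (c : R) : 0 < c -> c <= r / 32 -> 8 * c ^+ 2 + nsq (0 : 'rV[R]_n) / 2 < r.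
    move=> cp cr; rewrite nsq0 mul0r addr0.
    have h1 : c <= 1 / 32 by rewrite (le_trans cr)// ler_wpM2r// invr_ge0.
    have h2 : c ^+ 2 <= c * (1 / 32) by rewrite expr2 ler_wpM2l// ltW.
    lra.
  have b0 (i : 'I_n) : `|(0 : 'rV[R]_n) 0 i| <= 1 by rewrite mxE normr0.
  have eta20 : 0 < 2 * eta by rewrite mulr_gt0.
  have [g1 l1] := hr eta 0 eta0 (h0 eta eta0 ltac:(lra)).
  have [g2 l2] := hr (2 * eta) 0 eta20 (h0 (2 * eta) eta20 ltac:(lra)).
  have hlast : harmonic K 4 (fun X => (- q) * ballbump (2 * eta) 0 X + ballbump eta 0 X).
    split => [|X X4]; first exact: good_lin.
    have [[_ _ m1 d1] _] := good_base g1; have [[_ _ m2 d2] _] := good_base g2.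
    have [C1' h3] := d1 X X4; have [C2' h4] := d2 X X4.
    rewrite (symlap_lin n0 s01 (- q) m2 m1 h4 h3) l1// l2//.
    have -> : (2 * eta) ^+ 2 = 4 * eta ^+ 2 by ring.
    rewrite powRM ?exprn_ge0 ?(ltW eta0)// -/p mulNr !mulrA mulVf ?gt_eqF//.
    by rewrite mul1r addNr.
  exists (fun X => (1 - q)^-1 * ((- q) * ballbump (2 * eta) 0 X + ballbump eta 0 X)).
    exact: harmonic_scale.
  have ea : 0 < eta <= e1 by rewrite eta0 (le_trans eta1)//; lra.
  have eb : 0 < 2 * eta <= e1 by rewrite eta20; lra.
  have [k1 y1] := hC eta 0 ea b0; have [k2 y2] := hC (2 * eta) 0 eb b0.
  have hk := ckb_scale (1 - q)^-1 (ckb_lin (- q) k2 k1).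
  suff H : forall X, nball 4 X -> (1 - q)^-1 * (- q * binomial_rem s 1 (2 * eta * lin (2 * eta) 0 X) + binomial_rem s 1 (eta * lin eta 0 X)) =
      (1 - q)^-1 * (- q * ballbump (2 * eta) 0 X + ballbump eta 0 X) - \prod_(i <- [::]) X 0 i.
    have oN : open (nball 4 : set 'rV[R]_n) by exact: open_nball.
    have hk' := ckb_local oN H hk; apply: (ckb_mono (leqnn k) (fun p Up => Up) _ hk').
    rewrite normrN (gtr0_norm q0) normfV (gtr0_norm q1) ler_pdivrMl// !expr1.
    have h : q * (C * (2 * eta)) <= C * (2 * eta).
      by rewrite ler_piMl ?mulr_ge0 ?(ltW eta0)//; lra.
    rewrite [leRHS]mulrC; apply: le_trans eta3; lra.
  move=> X X4; rewrite big_nil.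
  have t (c : R) : `|c * lin c 0 X| <= 2^-1 -> ballbump c 0 X = 1 + binomial_rem s 1 (c * lin c 0 X).
    by move=> h; rewrite (ballbump_taylor 1 h) big_ord1 gbin0 !expr0 !mul1r.
  rewrite (t _ (y1 X X4)) (t _ (y2 X X4)).
  by field; rewrite gt_eqF.
pose m := size l; have m0 : (0 < m)%N by rewrite /m lt0n size_eq0.
have mR : 0 < (m%:R : R) by rewrite ltr0n.
have [C C0 [e1 /andP[e10 e11] hC]] := rem_bound k m.+1.
(* the [m] increments keep [b] in the region where [good_bump] applies *)
pose de : R := r / 2 / m%:R; have de0 : 0 < de by rewrite !divr_gt0.
pose ka : R := gbin s m * (m`!%:R * de ^+ m).
have ka0 : ka != 0.
  rewrite /ka mulf_neq0 ?gbin_s_neq0// mulf_neq0 ?expf_neq0 ?(gt_eqF de0)//.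
have nka : 0 < `|ka| by rewrite normr_gt0.
pose D : R := 2 ^+ m * C + 1; have D0 : 0 < D by rewrite ltr_wpDl// mulr_ge0// exprn_ge0.
pose eta := Num.min e1 (Num.min (r / 8) (e * `|ka| / D)).
have eta0 : 0 < eta by rewrite !lt_min e10 !divr_gt0// mulr_gt0.
have eta1 : eta <= e1 by rewrite ge_min lexx.
have eta2 : eta <= r / 8 by rewrite !ge_min lexx !orbT.
have eta3 : eta * D <= e * `|ka| by rewrite -ler_pdivlMr// !ge_min lexx !orbT.
have ea : 0 < eta <= e1 by rewrite eta0.
have small b : enorm b <= r / 2 -> 8 * eta ^+ 2 + nsq b / 2 < r /\ forall i, `|b 0 i| <= 1.
  move=> hb; split; last by move=> i; rewrite (le_trans (coord_enorm b i))// (le_trans hb)//; lra.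
  have h1 : nsq b <= r / 2 * (1 / 2).
    rewrite -enorm_sq expr2 ler_pM ?enorm_ge0// (le_trans hb)//; lra.
  have h2 : eta ^+ 2 <= r / 8 * (1 / 8).
    by rewrite expr2 ler_pM ?(ltW eta0)// (le_trans eta2)//; lra.
  lra.
have step b i j : enorm b + j.+1%:R * de <= r / 2 ->
   enorm (b + de *: delta_mx 0 i) + j%:R * de <= r / 2 /\ enorm b + j%:R * de <= r / 2.
  move=> h; have e1' : enorm (b + de *: delta_mx 0 i) <= enorm b + de.
    rewrite (le_trans (enormD _ _))// lerD2l enormZ gtr0_norm// enormE nsqE (bigD1 i)//=.
    rewrite big1 ?addr0; first by rewrite mxE !eqxx expr1n sqrtr1 mulr1.
    by move=> j' /negbTE ji; rewrite mxE ji andbF expr0n.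
  by move: h; rewrite -natr1 mulrDl mul1r => h; split; lra.
pose F b X := ballbump eta b X; pose B b X := binomial_rem s m.+1 (eta * lin eta b X).
pose T b X := \sum_(k < m.+1) (gbin s k * eta ^+ k) * lin eta b X ^+ k.
have key (l' : seq 'I_n) b : enorm b + (size l')%:R * de <= r / 2 ->
  [/\ good s K 4 (fun X => iter_diff de l' (fun b => F b X) b),
      forall X, nball 4 X -> symlap s (fun X => iter_diff de l' (fun b => F b X) b) X =
         if l' is [::] then (eta ^+ 2) `^ s * c0 else 0,
      ckb k (nball 4) (2 ^+ size l' * (C * eta ^+ m.+1)) (fun X => iter_diff de l' (fun b => B b X) b) &
      forall X, nball 4 X -> iter_diff de l' (fun b => F b X) b =
        iter_diff de l' (fun b => T b X) b + iter_diff de l' (fun b => B b X) b].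
  elim: l' b => [|i l' IH] b hb.
    rewrite mul0r addr0 in hb; have [s1 s2] := small b hb.
    have [g1 l1] := hr eta b eta0 s1; have [k1 y1] := hC eta b ea s2.
    split => //=; first by rewrite expr0 mul1r.
    by move=> X X4; rewrite /F (ballbump_taylor m.+1 (y1 X X4)).
  have [h1 h2] := step b i (size l') hb.
  have [g1 l1 k1 t1] := IH _ h1; have [g2 l2 k2 t2] := IH _ h2.
  have e2 (G : 'rV[R]_n -> 'rV[R]_n -> R) : (fun X => iter_diff de (i :: l') (fun b => G b X) b) =
     (fun X => -1 * iter_diff de l' (fun b => G b X) b + iter_diff de l' (fun b => G b X) (b + de *: delta_mx 0 i)).
    by apply/funext => X /=; rewrite mulN1r addrC.
  split.
  - by rewrite e2; exact: good_lin.
  - move=> X X4; have [[_ _ m1 d1] _] := good_base g1; have [[_ _ m2 d2] _] := good_base g2.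
    have [C1' h3] := d1 X X4; have [C2' h4] := d2 X X4.
    by rewrite e2 (symlap_lin n0 s01 (-1) m2 m1 h4 h3) l1// l2// mulN1r addNr.
  - rewrite e2; have := ckb_lin (-1) k2 k1; rewrite normrN1 mul1r /=.
    by have -> : forall x : R, 2 ^+ (size l').+1 * x = 2 ^+ size l' * x + 2 ^+ size l' * x by move=> x; rewrite exprS; ring.
  - by move=> X X4 /=; rewrite t1// t2//; ring.
have start : enorm (0 : 'rV[R]_n) + (size l)%:R * de <= r / 2.
  by rewrite enorm0 add0r -/m /de mulrC divfK// gt_eqF.
have [g1 L1 k1 t1] := key l 0 start.
have lN : (if l is [::] then (eta ^+ 2) `^ s * c0 else 0) = 0 :> R by case: (l) l0.
exists (fun X => (ka * eta ^+ m)^-1 * iter_diff de l (fun b => F b X) 0).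
  by apply: harmonic_scale; split => // X X4; rewrite L1.
have kan : ka * eta ^+ m != 0 by rewrite mulf_neq0// expf_neq0// gt_eqF.
have hk := ckb_scale (ka * eta ^+ m)^-1 k1.
suff H : forall X, nball 4 X -> (ka * eta ^+ m)^-1 * iter_diff de l (fun b => B b X) 0 =
    (ka * eta ^+ m)^-1 * iter_diff de l (fun b => F b X) 0 - \prod_(i <- l) X 0 i.
  have oN : open (nball 4 : set 'rV[R]_n) by exact: open_nball.
    have hk' := ckb_local oN H hk; apply: (ckb_mono (leqnn k) (fun p Up => Up) _ hk').
  rewrite normfV normrM (ger0_norm (exprn_ge0 m (ltW eta0))) -/m ler_pdivrMl ?mulr_gt0 ?exprn_gt0//.
  have -> : 2 ^+ m * (C * eta ^+ m.+1) = eta ^+ m * (eta * (2 ^+ m * C)) by rewrite exprS; ring.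
  rewrite [leRHS](_ : _ = eta ^+ m * (e * `|ka|)); last first.
    by rewrite mulrAC mulrC [`|ka| * e]mulrC.
  rewrite ler_wpM2l ?exprn_ge0 ?(ltW eta0)//; apply: le_trans eta3; rewrite ler_wpM2l ?(ltW eta0)// /D lerDl//.
move=> X X4; rewrite t1//.
have -> : iter_diff de l (fun b => T b X) 0 = ka * eta ^+ m * mono l X.
  rewrite /T iter_diff_sum big_ord_recr/= big1 ?add0r; last first.
    by move=> j _; have [h _] := iter_diff_power de eta l j X 0; rewrite h ?mulr0.
  by have [_ ->//] := iter_diff_power de eta l m X 0; rewrite /ka; ring.
by rewrite -/(mono l X) mulrDr mulrA mulVf// mul1r [RHS]addrAC subrr add0r.
Qed.

End density.

(** * Functions of class C^k on the whole space *)

(** Finitely many smallness conditions can be met simultaneously. *)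
Lemma bounded_min (R : realType) (T : finType) (P : T -> R -> Prop) :
  (forall x, exists2 r, 0 < r & forall t, 0 < t <= r -> P x t) ->
  exists2 r, 0 < r & forall x t, 0 < t <= r -> P x t.
Proof.
move=> h; suff [r r0 H] : exists2 r : R, 0 < r & forall x, x \in enum T -> forall t, 0 < t <= r -> P x t.
  by exists r => // x t; apply: H; rewrite mem_enum.
elim: (enum T) => [|y l [r r0 H]]; first by exists 1.
have [r' r0' H'] := h y; exists (Num.min r r') => [|x]; first by rewrite lt_min r0.
rewrite inE => /orP[/eqP ->|xl] t /andP[t0]; rewrite le_min => /andP[t1 t2].
  by apply: H'; rewrite t0.
by apply: H => //; rewrite t0.
Qed.

Lemma bounded_min_words (R : realType) (T : finType) k (P : seq T -> R -> Prop) :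
  (forall w, (size w <= k)%N -> exists2 r, 0 < r & forall t, 0 < t <= r -> P w t) ->
  exists2 r, 0 < r & forall w, (size w <= k)%N -> forall t, 0 < t <= r -> P w t.
Proof.
elim: k P => [|k IH] P h.
  by have [r r0 hr] := h [::] isT; exists r => // w; rewrite leqn0 => /nilP ->.
have [r0 r00 h0] := h [::] isT.
have h1 x : exists2 r : R, 0 < r & forall t, 0 < t <= r -> forall w, (size w <= k)%N -> P (x :: w) t.
  have [|r rp hr] := IH (fun w => P (x :: w)); first by move=> w wk; exact: h.
  by exists r => // t tr w wk; exact: hr.
have [r1 r10 h1'] := bounded_min h1.
exists (Num.min r0 r1) => [|[|x w] wk t /andP[t0]]; first by rewrite lt_min r00.
  by rewrite le_min => /andP[t1 t2]; apply: h0; rewrite t0.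
by rewrite le_min => /andP[t1 t2]; apply: h1' => //; rewrite t0.
Qed.

Section uniform_continuity.
Context (R : realType) (n : nat).
Implicit Types (p q : 'rV[R]_n) (F : 'rV[R]_n -> R).

Lemma norm_coordP p (e : R) : 0 <= e -> (forall j, `|p 0 j| <= e) -> `|p| <= e.
Proof.
move=> e0 h; rewrite /Num.norm/= mx_normrE; apply/bigmax_leP; split => // -[i j] _ /=.
by rewrite (ord1 i).
Qed.

Lemma uniformly_continuous (K : set 'rV[R]_n) F (e : R) : compact K ->
  {within K, continuous F} -> 0 < e -> exists2 r, 0 < r & forall p q, K p -> K q ->
    (forall j, `|p 0 j - q 0 j| <= r) -> `|F p - F q| <= e.
Proof.
move=> cK /subspace_continuousP cF e0; have e2 : 0 < e / 2 by rewrite divr_gt0.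
have cov : near_covering_within K by apply/near_covering_withinP/compact_near_coveringP.
have /(cov R (0^'+)) : forall p, K p -> \forall p' \near p & r \near 0^'+,
    K p' -> forall q, K q -> (forall j, `|p' 0 j - q 0 j| <= r) -> `|F p' - F q| <= e.
  move=> p Kp; have /cvgrPdist_le /(_ _ e2) := cF p Kp.
  rewrite near_withinE => /nbhs_normP[r r0 hr].
  have r2 : 0 < r / 2 by rewrite divr_gt0.
  have half : r / 2 + r / 2 = r by field.
  exists (ball p (r / 2), [set t : R | 0 < t < r / 2]); first split => /=.
  - exact: nbhsx_ballx.
  - near=> t; apply/andP; split; near: t; [exact: nbhs_right_gt|exact: nbhs_right_lt].
  move=> [p' t] /= [hp' /andP[t0 tr]] Kp' q Kq hq.
  rewrite -ball_normE/= in hp'.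
  have h1 : `|F p - F p'| <= e / 2.
    by apply: hr => //; rewrite /ball_/= (lt_le_trans hp')//; lra.
  have h2 : `|F p - F q| <= e / 2.
    apply: hr => //; rewrite /ball_/=.
    have -> : p - q = (p - p') + (p' - q) by rewrite addrA subrK.
    rewrite -half (le_lt_trans (ler_normD _ _))// ltr_leD//.
    by apply: norm_coordP => [|j]; rewrite ?(ltW r2)// !mxE (le_trans (hq j))// ltW.
  have -> : F p' - F q = (F p - F q) - (F p - F p') by ring.
  by rewrite (le_trans (ler_normB _ _))// (_ : e = e / 2 + e / 2) ?lerD//; field.
move=> [r /= r0 hr]; exists (r / 2) => [|p q Kp Kq h]; first by rewrite divr_gt0.
apply: (hr (r / 2) _ _ p Kp q Kq h); rewrite ?divr_gt0//=.
by rewrite /ball_/= sub0r normrN gtr0_norm ?divr_gt0//; lra.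
Unshelve. all: by end_near. Qed.

Lemma continuous_coords p F (e : R) : {for p, continuous F} -> 0 < e -> exists2 r, 0 < r &
  forall q, (forall j, `|p 0 j - q 0 j| <= r) -> `|F p - F q| <= e.
Proof.
move=> /cvgrPdist_le cF e0; have /nbhs_normP[r /= r0 hr] := cF _ e0.
exists (r / 2) => [|q hq]; first by rewrite divr_gt0.
apply: hr; rewrite /ball_/= (le_lt_trans (y := r / 2))//; last lra.
by apply: norm_coordP => [|j]; rewrite ?mxE// divr_ge0// ltW.
Qed.

End uniform_continuity.

Section ck_functions.
Context (R : realType) (n : nat).
Implicit Types (p q : 'rV[R]_n) (F G : 'rV[R]_n -> R) (w : seq 'I_n).
Local Notation dir i := (delta_mx 0 i : 'rV[R]_n).

Definition ck k F := forall w, (size w <= k)%N -> continuous (pderiv w F) /\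
  ((size w < k)%N -> forall p i, derivable (pderiv w F) p (dir i)).

Lemma ck_mono k k' F : (k' <= k)%N -> ck k F -> ck k' F.
Proof.
move=> kk h w wk; have [c d] := h w (leq_trans wk kk); split => // wk'.
by apply: d; exact: leq_trans wk' kk.
Qed.

Lemma ck_continuous k F : ck k F -> continuous F.
Proof. by move=> h; have [] := h [::] isT. Qed.

Lemma ck_is_derive k F p i : ck k.+1 F -> is_derive p (dir i) F ('D_(dir i) F p).
Proof. by move=> h; have [_ d] := h [::] isT; exact/derivableP/d. Qed.

Lemma ck_deriv k F i : ck k.+1 F -> ck k (fun p => 'D_(dir i) F p).
Proof. by move=> h w wk; rewrite -pderiv_rcons; have := h (rcons w i); rewrite size_rcons; exact. Qed.

Lemma ck_intro k F (F' : 'I_n -> 'rV[R]_n -> R) : continuous F ->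
  (forall i p, is_derive p (dir i) F (F' i p)) -> (forall i, ck k (F' i)) -> ck k.+1 F.
Proof.
move=> cF dF h; have e i : (fun p => 'D_(dir i) F p) = F' i.
  by apply/funext => p; have := dF i p => d; rewrite derive_val.
elim/last_ind => [_|w i _].
  by split => // _ p i; have d := dF i p; exact: ex_derive.
by rewrite size_rcons ltnS => wk; rewrite pderiv_rcons e; exact: (h i).
Qed.

Lemma continuous_combination c F G : continuous F -> continuous G -> continuous (fun p => c * F p + G p).
Proof. by move=> hF hG p; exact: (continuous_add2 (f := fun p => c * F p) (g := G) (continuous_scale (hF p)) (hG p)). Qed.

Lemma is_derive_combination c F G p v (dF dG : R) : is_derive p v F dF -> is_derive p v G dG ->
  is_derive p v (fun q => c * F q + G q) (c * dF + dG).
Proof. by move=> hF hG; exact: (is_deriveD (is_deriveZ c hF) hG). Qed.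

Lemma ck_cst k c : ck k (fun _ => c).
Proof.
elim: k c => [|k IH] c; last first.
  apply: (@ck_intro _ _ (fun _ _ => 0)) => //.
  by move=> p; exact: cst_continuous.
by move=> w; rewrite leqn0 => /nilP ->; split => // p; exact: cst_continuous.
Qed.

Lemma ck_lin k c F G : ck k F -> ck k G -> ck k (fun p => c * F p + G p).
Proof.
elim: k F G => [|k IH] F G hF hG.
  move=> w; rewrite leqn0 => /nilP ->; split => //.
  by apply: continuous_combination; [exact: ck_continuous hF|exact: ck_continuous hG].
apply: (@ck_intro _ _ (fun i p => c * 'D_(dir i) F p + 'D_(dir i) G p)).
- by apply: continuous_combination; [exact: ck_continuous hF|exact: ck_continuous hG].
- by move=> i p; exact: (is_derive_combination c (ck_is_derive p i hF) (ck_is_derive p i hG)).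
- by move=> i; apply: IH; exact: ck_deriv.
Qed.

Lemma pderiv_lin k c F G w : ck k F -> ck k G -> (size w <= k)%N ->
  pderiv w (fun p => c * F p + G p) = (fun p => c * pderiv w F p + pderiv w G p).
Proof.
move=> hF hG; elim: w => [|i w IH] //= wk; rewrite IH ?(ltnW wk)//; apply/funext => p.
have [_ dF] := hF w (ltnW wk); have [_ dG] := hG w (ltnW wk).
have d := is_derive_combination c (derivableP (dF wk p i)) (derivableP (dG wk p i)).
by rewrite derive_val.
Qed.

Lemma ck_mul k F G : ck k F -> ck k G -> ck k (fun p => F p * G p).
Proof.
elim: k F G => [|k IH] F G hF hG.
  move=> w; rewrite leqn0 => /nilP ->; split => // p.
  by apply: continuousM; [exact: (ck_continuous hF)|exact: (ck_continuous hG)].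
apply: (@ck_intro _ _ (fun i p => 1 * (F p * 'D_(dir i) G p) + G p * 'D_(dir i) F p)).
- by move=> p; apply: continuousM; [exact: (ck_continuous hF)|exact: (ck_continuous hG)].
- move=> i p; have := is_deriveM (ck_is_derive p i hF) (ck_is_derive p i hG).
  by move=> d; apply: (is_derive_eq d); rewrite /GRing.scale/= mul1r.
- move=> i; apply: ck_lin; apply: IH.
  + exact: (ck_mono (leqnSn k) hF).
  + exact: ck_deriv.
  + exact: (ck_mono (leqnSn k) hG).
  + exact: ck_deriv.
Qed.

Lemma pderiv_shift w F v : pderiv w (fun p => F (v + p)) = (fun p => pderiv w F (v + p)).
Proof.
elim: w => [|i w IH] //=; rewrite IH; apply/funext => p; rewrite /derive.
by under eq_fun do rewrite /= (addrCA v).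
Qed.

Lemma ck_shift k F v : ck k F -> ck k (fun p => F (v + p)).
Proof.
move=> h w wk; have [c d] := h w wk; rewrite pderiv_shift; split.
  move=> p; apply: (@continuous_comp _ _ _ (fun p => v + p)); last exact: c.
  have -> : +%R v = fun q : 'rV[R]_n => 1 *: (q - - v) by apply/funext => q; rewrite scale1r opprK addrC.
  exact: continuous_scale_shift.
move=> wk' p i; have /derivableP := d wk' (v + p) i => h'.
have := @is_derive_affine R n n (fun p => v + p) p (dir i) (dir i) _ _ _ h' => /(_ _) h2.
by have := h2 (fun t => addrCA _ _ _) => h3; exact: ex_derive.
Qed.

Lemma ckb_ck k F : (forall p, exists U M, [/\ open U, U p & ckb k U M F]) -> ck k F.
Proof.
move=> h w wk; split=> [p|wk' p i]; have [U [M [oU Up hM]]] := h p.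
  by have [] := ckb_pderiv oU hM wk Up.
by have [_ _ d] := ckb_pderiv oU hM wk Up; exact: d.
Qed.

Lemma ck_coord k i : ck k (fun p => p 0 i).
Proof.
apply: ckb_ck => p; exists (nball (nsq p + 1)), (nsq p + 2); split; first exact: open_nball.
  by rewrite /nball/= ltrDl.
apply: ckb_coord => [|q qp]; first by have := nsq_ge0 p; lra.
have h := nsq_coord q i; have h2 : nsq q < nsq p + 1 by [].
rewrite -(@ler_pXn2r _ 2) ?nnegrE ?addr_ge0 ?nsq_ge0// -normrX ger0_norm ?sqr_ge0//.
apply: (le_trans h); have a0 := nsq_ge0 p; apply: (le_trans (ltW h2)); move: (nsq p) a0 => a a0; rewrite expr2; nra.
Qed.

Definition in_cube (r : R) p := forall j, `|p 0 j| <= r.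
Definition close k r (e : R) F G := forall w, (size w <= k)%N -> forall p, in_cube r p ->
  `|pderiv w F p - pderiv w G p| <= e.

Lemma in_cube_nsq r p : 0 <= r -> in_cube r p -> nsq p <= n%:R * r ^+ 2.
Proof.
move=> r0 h; rewrite nsqE (le_trans (y := \sum_(i < n) r ^+ 2))//.
  apply: ler_sum => i _; rewrite -[p 0 i ^+ 2]ger0_norm ?sqr_ge0// normrX.
  by rewrite lerXn2r ?nnegrE.
by rewrite sumr_const card_ord mulr_natl.
Qed.

Lemma in_cube_uniform r F (e : R) : 0 <= r -> continuous F -> 0 < e ->
  exists2 t, 0 < t & forall p q, in_cube r p -> in_cube r q -> (forall j, `|p 0 j - q 0 j| <= t) -> `|F p - F q| <= e.
Proof.
move=> r0 cF e0; have cw := @continuous_subspaceT _ _ [set X : 'rV[R]_n | nsq X <= n%:R * r ^+ 2] _ cF.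
have [t t0 h] := uniformly_continuous (@compact_nsq R n _) cw e0.
by exists t => // p q hp hq; apply: h; exact: in_cube_nsq.
Qed.

Lemma nsq_bounded r F : continuous F -> exists2 M, 0 < M & forall p, nsq p <= r -> `|F p| <= M.
Proof.
move=> cF; have cK := @compact_nsq R n r.
have cw := @continuous_subspaceT _ _ [set X : 'rV[R]_n | nsq X <= r] _ cF.
have /compact_bounded[M [_ hM]] := continuous_compact cw cK.
exists (`|M| + 1) => [|p hp]; first by rewrite ltr_wpDl.
by apply: (hM (`|M| + 1)); [rewrite (le_lt_trans (ler_norm M))// ltrDl|exists p].
Qed.

Lemma mvt_direction F F' v p (t : R) : (forall q, is_derive q v F (F' q)) -> 0 < t ->
  exists2 a, 0 <= a <= t & F (t *: v + p) - F p = t * F' (a *: v + p).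
Proof.
move=> dF t0; pose f (x : R) := F (x *: v + p).
have df x : is_derive x (1 : R) f (F' (x *: v + p)).
  have /is_derive_lineP h := dF (x *: v + p).
  have h' : is_derive (x - x) (1 : R) (fun t : R => F (t *: v + (x *: v + p))) (F' (x *: v + p)) by rewrite subrr.
  have h2 : is_derive x (1 : R) (fun y : R => y - x) 1 by apply: is_derive_eq; rewrite subr0.
  have := @is_derive1_comp _ (fun t : R => F (t *: v + (x *: v + p))) (fun y : R => y - x) x _ _ h' h2.
  rewrite mulr1 (_ : _ \o _ = f)//; apply/funext => y /=.
  by rewrite addrA -scalerDl subrK.
have [a a0 e] : exists2 a, a \in `[0, t] & f t - f 0 = F' (a *: v + p) * (t - 0).
  apply: (@MVT_segment _ f (fun x => F' (x *: v + p))); first exact: ltW.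
  by apply: derivable_within_continuous => x _; have h := df x; exact: ex_derive.
exists a; first by move: a0; rewrite in_itv.
by move: e; rewrite /f scale0r add0r subr0 mulrC.
Qed.

(** Both mixed derivatives are limits of the same second difference quotient. *)
Lemma schwarz F i j p : ck 2 F ->
  'D_(dir i) (fun q => 'D_(dir j) F q) p = 'D_(dir j) (fun q => 'D_(dir i) F q) p.
Proof.
move=> hF; have [A AE] : exists A : 'I_n -> 'I_n -> 'rV[R]_n -> R, A = fun i j q => 'D_(dir i) (fun q => 'D_(dir j) F q) q.
  by eexists.
have cA a b : continuous (A a b) by rewrite AE; have [] := hF [:: a; b] isT.
have dd a b (h : R) : 0 < h -> exists x y, [/\ 0 <= x <= h, 0 <= y <= h &
    F (h *: dir a + (h *: dir b + p)) - F (h *: dir b + p) - (F (h *: dir a + p) - F p) =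
      h * (h * A a b (x *: dir a + (y *: dir b + p)))].
  move=> h0; pose g q := F (h *: dir a + q) - F q.
  have dg q : is_derive q (dir b) g ('D_(dir b) F (h *: dir a + q) - 'D_(dir b) F q).
    apply: is_deriveB; last exact: ck_is_derive hF.
    apply: (@is_derive_affine R n n (fun q => h *: dir a + q) q (dir b) (dir b)).
      by move=> t; rewrite addrCA.
    exact: ck_is_derive hF.
  have [y yh e1] := mvt_direction p dg h0.
  have dF' q : is_derive q (dir a) (fun q => 'D_(dir b) F q) (A a b q).
    by rewrite AE; apply: ck_is_derive; exact: ck_deriv hF.
  have [x xh e2] := mvt_direction (y *: dir b + p) dF' h0.
  by exists x, y; split => //; rewrite -e2 -e1.
have -> : 'D_(dir i) (fun q => 'D_(dir j) F q) p = A i j p by rewrite AE.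
have -> : 'D_(dir j) (fun q => 'D_(dir i) F q) p = A j i p by rewrite AE.
have T (e a b a' b' : R) : a' = b' -> `|a - a'| <= e / 2 -> `|b - b'| <= e / 2 -> `|a - b| <= e.
  move=> E1 h1 h2; have -> : a - b = (a - a') - (b - b') by rewrite E1; ring.
  by rewrite (le_trans (ler_normB _ _))//; lra.
have hb (h x : R) (b : bool) : 0 <= x <= h -> `|x * b%:R| <= h.
  by case: b => /andP[x0 xh]; rewrite ?mulr1 ?mulr0 ?normr0 ?ger0_norm// (le_trans x0).
apply/eqP; rewrite -subr_eq0 -normr_le0; apply/ler_addgt0Pl => e e0; rewrite addr0.
have e2 : 0 < e / 2 by rewrite divr_gt0.
have [r1 r10 h1] := continuous_coords (cA i j p) e2.
have [r2 r20 h2] := continuous_coords (cA j i p) e2.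
pose h := Num.min r1 r2 / 2; have h0 : 0 < h by rewrite divr_gt0// lt_min r10.
have hr1 : h + h <= r1 by rewrite -mulr2n -mulr_natr divfK// ge_min lexx.
have hr2 : h + h <= r2 by rewrite -mulr2n -mulr_natr divfK// ge_min lexx orbT.
have co x y a b l : 0 <= x <= h -> 0 <= y <= h -> `|p 0 l - (x *: dir a + (y *: dir b + p)) 0 l| <= h + h.
  move=> xh yh; rewrite !mxE.
  have -> : forall u v : R, p 0 l - (u + (v + p 0 l)) = - (u + v) by move=> u v; ring.
  by rewrite normrN (le_trans (ler_normD _ _))// lerD// hb.
have [x [y [xh yh E1]]] := dd i j h h0; have [x' [y' [xh' yh' E2]]] := dd j i h h0.
have E : A i j (x *: dir i + (y *: dir j + p)) = A j i (x' *: dir j + (y' *: dir i + p)).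
  have hh : h != 0 by rewrite gt_eqF.
  apply: (mulfI hh); apply: (mulfI hh); rewrite -E1 -E2 (addrCA (h *: dir j) (h *: dir i) p).
  by clear; move: (F _) (F _) (F _) (F _) => a b c d; ring.
have B1 := h1 _ (fun l => le_trans (co x y i j l xh yh) hr1).
have B2 := h2 _ (fun l => le_trans (co x' y' j i l xh' yh') hr2).
exact: (T _ _ _ _ _ E B1 B2).
Qed.

Lemma pderiv_swap F i w : ck (size w).+1 F -> pderiv (i :: w) F = pderiv (rcons w i) F.
Proof.
elim: w => [|j w IH] //= hF; rewrite -IH; last exact: ck_mono hF.
apply/funext => p; apply: (@schwarz (pderiv w F)).
move=> w'; rewrite /pderiv -foldr_cat -/(pderiv (w' ++ w) F) => w2.
have := hF (w' ++ w); rewrite size_cat /=.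
by rewrite -add2n leq_add2r ltn_add2r; apply.
Qed.

End ck_functions.

(** * Bernstein polynomials in one coordinate *)

Section de_casteljau.
Context (R : realType).
Implicit Types (g f : nat -> R) (x h : R).

(** The Bernstein polynomial [\sum_j 'C(m, j) x ^ j (1 - x) ^ (m - j) g j], by
    de Casteljau's recursion: linearity, monotonicity, second moment and
    derivative then follow by induction on [m]. *)
Fixpoint casteljau m g x : R :=
  if m is m'.+1 then (1 - x) * casteljau m' g x + x * casteljau m' (fun j => g j.+1) x else g 0%N.

Lemma casteljau_lin m c f g x : casteljau m (fun j => c * f j + g j) x = c * casteljau m f x + casteljau m g x.
Proof. by elim: m f g => [|m IH] f g //=; rewrite !IH; ring. Qed.

Lemma casteljau_cst m c x : casteljau m (fun _ => c) x = c.
Proof. by elim: m => [|m IH] //=; rewrite !IH; ring. Qed.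

Lemma casteljau_le m f g x : 0 <= x <= 1 -> (forall j, (j <= m)%N -> f j <= g j) -> casteljau m f x <= casteljau m g x.
Proof.
move=> /andP[x0 x1]; elim: m f g => [|m IH] f g h /=; first exact: h.
rewrite lerD// ler_wpM2l ?subr_ge0//; apply: IH => j jm; apply: h => //; exact: ltnW.
Qed.

Lemma casteljau_moment m a h x : casteljau m (fun j => (a + j%:R * h) ^+ 2) x =
  (a + m%:R * h * x) ^+ 2 + m%:R * h ^+ 2 * x * (1 - x).
Proof.
elim: m a => [|m IH] a /=; first by ring.
have -> : (fun j => (a + j.+1%:R * h) ^+ 2) = (fun j => ((a + h) + j%:R * h) ^+ 2).
  by apply/funext => j; rewrite -natr1; ring.
by rewrite !IH -natr1; ring.
Qed.

End de_casteljau.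

Section bernstein.
Context (R : realType) (n : nat).
Implicit Types (p q : 'rV[R]_n) (F G : 'rV[R]_n -> R) (w : seq 'I_n).
Local Notation dir i := (delta_mx 0 i : 'rV[R]_n).

Definition seti i (y : R) p := (y - p 0 i) *: dir i + p.

Lemma setiE i y p j : seti i y p 0 j = if j == i then y else p 0 j.
Proof. by rewrite !mxE eqxx /=; case: eqP => [->|_]; rewrite ?mulr1 ?mulr0 ?add0r ?subrK. Qed.

Lemma seti_shift i y p l (t : R) : seti i y (t *: dir l + p) = t *: (if l == i then 0 else dir l) + seti i y p.
Proof.
apply/rowP => j; have D (a b : 'rV[R]_n) : (t *: a + b) 0 j = t * a 0 j + b 0 j by rewrite !mxE.
rewrite D !setiE D; have [/eqP ->|ji] := boolP (j == i); have [li|li] := boolP (l == i).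
- by rewrite mxE mulr0 add0r.
- by rewrite mxE eqxx/= eq_sym (negbTE li) mulr0 add0r.
- by rewrite !mxE (eqP li) (negbTE ji) mulr0.
- by [].
Qed.

Lemma in_cube_seti r i y p : in_cube r p -> `|y| <= r -> in_cube r (seti i y p).
Proof. by move=> pr yr j; rewrite setiE; case: eqP. Qed.

Lemma continuous_seti i y : continuous (seti i y).
Proof.
move=> p; rewrite /seti; apply: (@continuousD _ _ _ (fun p => (y - p 0 i) *: dir i) id p); last exact: cvg_id.
have c : {for p, continuous (fun q : 'rV[R]_n => y - q 0 i)}.
  by apply: continuousB; [exact: cst_continuous|exact: coord_continuous].
exact: (@cvgZr_tmp R _ _ (nbhs p) _ (fun q : 'rV[R]_n => y - q 0 i) _ (dir i) c).
Qed.

Lemma is_derive_seti i y F p l d : is_derive (seti i y p) (dir l) F d ->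
  is_derive p (dir l) (fun q => F (seti i y q)) (if l == i then 0 else d).
Proof.
move=> h; have [li|li] := boolP (l == i).
  have := @is_derive_affine R n n (seti i y) p (dir l) 0 F 0.
  apply; first by move=> t; rewrite seti_shift li.
  apply/is_derive_lineP; under [X in is_derive _ _ X]eq_fun do rewrite scaler0 add0r.
  exact: is_derive_cst.
apply: (@is_derive_affine R n n (seti i y) p (dir l) (dir l)) => // t.
by rewrite seti_shift (negbTE li).
Qed.

Lemma ck_seti k i y F : ck k F -> ck k (fun p => F (seti i y p)).
Proof.
elim: k F => [|k IH] F hF.
  move=> w; rewrite leqn0 => /nilP ->; split => // p.
  by apply: (@continuous_comp _ _ _ (seti i y)); [exact: continuous_seti|exact: (ck_continuous hF)].
apply: (@ck_intro _ _ _ _ (fun l p => if l == i then 0 else 'D_(dir l) F (seti i y p))).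
- move=> p; apply: (@continuous_comp _ _ _ (seti i y)); first exact: continuous_seti.
  exact: (ck_continuous hF).
- by move=> l p; apply: is_derive_seti; exact: ck_is_derive hF.
- move=> l; case: eqP => _; first exact: ck_cst.
  by apply: (IH (fun p => 'D_(dir l) F p)); exact: ck_deriv.
Qed.

(** The affine change [(p 0 i + 1) / 2] maps the interval [-1, 1] onto [0, 1].
    The coefficients may depend on all the coordinates. *)
Definition casteljau_coord i m (g : nat -> 'rV[R]_n -> R) p : R := casteljau m (fun j => g j p) ((p 0 i + 1) / 2).

Lemma casteljau_coordS i m g p : casteljau_coord i m.+1 g p =
  (1 / 2 + (- (1 / 2)) * p 0 i) * casteljau_coord i m g p + (1 / 2 + 1 / 2 * p 0 i) * casteljau_coord i m (fun j => g j.+1) p.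
Proof. by rewrite /casteljau_coord /=; congr (_ * _ + _ * _); field. Qed.

Lemma casteljau_coord_lin i m c f g p : casteljau_coord i m (fun j q => c * f j q + g j q) p = c * casteljau_coord i m f p + casteljau_coord i m g p.
Proof. exact: casteljau_lin. Qed.

Lemma casteljau_coord_ind (P : ('rV[R]_n -> R) -> Prop) i m g :
  (forall (a b : R) F, P F -> P (fun p => (a + b * p 0 i) * F p)) ->
  (forall F G, P F -> P G -> P (fun p => F p + G p)) -> (forall j, P (g j)) -> P (casteljau_coord i m g).
Proof.
move=> hM hD; elim: m g => [|m IH] g hg; first exact: hg.
have -> : casteljau_coord i m.+1 g = fun p => (1 / 2 + (- (1 / 2)) * p 0 i) * casteljau_coord i m g p + (1 / 2 + 1 / 2 * p 0 i) * casteljau_coord i m (fun j => g j.+1) p.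
  by apply/funext => p; rewrite casteljau_coordS.
by apply: hD; apply: hM; apply: IH.
Qed.

Lemma ck_casteljau_coord k i m g : (forall j, ck k (g j)) -> ck k (casteljau_coord i m g).
Proof.
apply: casteljau_coord_ind => [a b F hF|F G hF hG].
  have h := ck_lin b (@ck_coord R n k i) (@ck_cst R n k a).
  have := ck_mul h hF; congr ck; apply/funext => p; by rewrite addrC.
by have := ck_lin 1 hF hG; congr ck; apply/funext => p; rewrite mul1r.
Qed.

(** The derivative of a Bernstein polynomial of degree [m] is, up to a factor, the
    Bernstein polynomial of degree [m - 1] of the differences of its coefficients. *)
Lemma is_derive_casteljau_coord i m (g g' : nat -> 'rV[R]_n -> R) p l : (forall j, is_derive p (dir l) (g j) (g' j p)) ->
  is_derive p (dir l) (casteljau_coord i m g)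
    ((l == i)%:R * (m%:R / 2) * casteljau_coord i m.-1 (fun j q => -1 * g j q + g j.+1 q) p + casteljau_coord i m g' p).
Proof.
elim: m g g' => [|m IH] g g' h.
  by have := h 0%N; congr is_derive; rewrite /casteljau_coord /= mul0r mulr0 mul0r add0r.
have -> : casteljau_coord i m.+1 g = fun p => (1 / 2 + (- (1 / 2)) * p 0 i) * casteljau_coord i m g p + (1 / 2 + 1 / 2 * p 0 i) * casteljau_coord i m (fun j => g j.+1) p.
  by apply/funext => q; rewrite casteljau_coordS.
have hx (b : R) : is_derive p (dir l) (fun q : 'rV[R]_n => 1 / 2 + b * q 0 i) (b * (l == i)%:R).
  have h1 := ck_is_derive p l (@ck_coord R n 1 i).
  have e : 'D_(dir l) (fun q : 'rV[R]_n => q 0 i) p = (l == i)%:R.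
    have h2 : is_derive p (dir l) (fun q : 'rV[R]_n => q 0 i) (l == i)%:R.
      apply/is_derive_lineP; apply: (near_eq_is_derive (f := fun t : R => t * (l == i)%:R + p 0 i)).
        by near=> t; rewrite !mxE eqxx /= (eq_sym i).
      by apply: is_derive_eq; rewrite /GRing.scale/=; ring.
    by rewrite derive_val.
  have := is_derive_combination b h1 (is_derive_cst (1 / 2 : R) p (dir l)).
  rewrite e addr0; congr is_derive; apply/funext => q; by rewrite addrC.
have h1 := IH _ _ h; have h2 := IH (fun j => g j.+1) (fun j => g' j.+1) (fun j => h j.+1).
have d := is_deriveD (is_deriveM (hx (- (1 / 2))) h1) (is_deriveM (hx (1 / 2)) h2).
apply: (is_derive_eq d); rewrite /GRing.scale/= {h hx h1 h2 d IH}.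
have -> : casteljau_coord i m (fun j q => -1 * g j q + g j.+1 q) p = - casteljau_coord i m g p + casteljau_coord i m (fun j => g j.+1) p.
  by rewrite casteljau_coord_lin mulN1r.
have -> : casteljau_coord i m.+1 g' p = (1 / 2 + (- (1 / 2)) * p 0 i) * casteljau_coord i m g' p + (1 / 2 + 1 / 2 * p 0 i) * casteljau_coord i m (fun j => g' j.+1) p.
  exact: casteljau_coordS.
have E : m%:R * (- casteljau_coord i m g p + casteljau_coord i m (fun j => g j.+1) p) =
   m%:R * ((1 / 2 + (- (1 / 2)) * p 0 i) * casteljau_coord i m.-1 (fun j q => -1 * g j q + g j.+1 q) p
      + (1 / 2 + 1 / 2 * p 0 i) * casteljau_coord i m.-1 (fun j q => -1 * g j.+1 q + g j.+2 q) p).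
  case: m => [|m]; first by rewrite !mul0r.
  by rewrite -casteljau_coordS casteljau_coord_lin mulN1r.
have -> : m.+1%:R = m%:R + 1 :> R by rewrite natr1.
move: (casteljau_coord i m g' p) (casteljau_coord i m (fun j => g' j.+1) p) => y1 y2.
move: E; move: (casteljau_coord i m.-1 (fun j q => -1 * g j q + g j.+1 q) p) => a.
move: (casteljau_coord i m.-1 (fun j q => -1 * g j.+1 q + g j.+2 q) p) => b.
move: (casteljau_coord i m g p) (casteljau_coord i m (fun j => g j.+1) p) => c e.
move: (m%:R) ((l == i)%:R) (p 0 i) => M de x E.
have {}E : M * (a * (1 / 2 - 1 / 2 * x) + b * (1 / 2 + 1 / 2 * x)) = M * (e - c).
  rewrite [RHS](_ : _ = M * (- c + e)); last by ring.
  by rewrite E; ring.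
have -> : de * ((M + 1) / 2) * (- c + e) = de / 2 * (M * (e - c)) + de / 2 * (e - c) by field.
by rewrite -E; field.
Unshelve. all: by end_near. Qed.

(** The nodes are [j h - 1]; the parameter [h] is independent of the degree because a
    derivation decreases [m] and keeps the step. *)
Definition bern i m h G := casteljau_coord i m (fun j p => G (seti i (j%:R * h - 1) p)).

Lemma ck_bern k i m h G : ck k G -> ck k (bern i m h G).
Proof. by move=> hG; apply: ck_casteljau_coord => j; exact: ck_seti. Qed.

Lemma derive_bern i m h G l : l != i -> ck 1 G ->
  (fun p => 'D_(dir l) (bern i m h G) p) = bern i m h (fun p => 'D_(dir l) G p).
Proof.
move=> li hG; apply/funext => p.
have := @is_derive_casteljau_coord i m (fun j p => G (seti i (j%:R * h - 1) p)) (fun j p => 'D_(dir l) G (seti i (j%:R * h - 1) p)) p l.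
rewrite (negbTE li) !mul0r add0r => H.
have {}H : is_derive p (dir l) (bern i m h G) (bern i m h (fun p => 'D_(dir l) G p) p).
  apply: H => j; have := is_derive_seti (y := j%:R * h - 1) (i := i) (ck_is_derive (seti i (j%:R * h - 1) p) l hG).
  by rewrite (negbTE li).
by rewrite derive_val.
Qed.

Lemma derive_bern_same i m h G : ck 1 G ->
  (fun p => 'D_(dir i) (bern i m.+1 h G) p) =
  bern i m h (fun p => m.+1%:R / 2 * G (h *: dir i + p) + (- (m.+1%:R / 2)) * G p).
Proof.
move=> hG; apply/funext => p.
have := @is_derive_casteljau_coord i m.+1 (fun j p => G (seti i (j%:R * h - 1) p)) (fun j p => 0) p i.
have -> : casteljau_coord i m.+1 (fun _ _ => 0) p = 0 by exact: casteljau_cst.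
rewrite eqxx mul1r addr0 => H.
have {}H : is_derive p (dir i) (bern i m.+1 h G) (bern i m h (fun p => m.+1%:R / 2 * G (h *: dir i + p) + (- (m.+1%:R / 2)) * G p) p).
  have -> : bern i m h (fun p => m.+1%:R / 2 * G (h *: dir i + p) + (- (m.+1%:R / 2)) * G p) p =
     m.+1%:R / 2 * casteljau_coord i m (fun j q => -1 * G (seti i (j%:R * h - 1) q) + G (seti i (j.+1%:R * h - 1) q)) p.
    have := casteljau_lin m (m.+1%:R / 2) (fun j => -1 * G (seti i (j%:R * h - 1) p) + G (seti i (j.+1%:R * h - 1) p)) (fun=> 0) ((p 0 i + 1) / 2).
    rewrite casteljau_cst addr0 => e; rewrite /casteljau_coord -e /bern /casteljau_coord; congr casteljau; apply/funext => j.
    have -> : seti i (j.+1%:R * h - 1) p = h *: dir i + seti i (j%:R * h - 1) p.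
      by rewrite /seti addrA -scalerDl -natr1; congr (_ *: _ + _); ring.
    by rewrite addr0; ring.
  apply: H => j; have := is_derive_seti (y := j%:R * h - 1) (i := i) (ck_is_derive (seti i (j%:R * h - 1) p) i hG).
  by rewrite eqxx.
by rewrite derive_val.
Qed.

(** Bernstein's argument: [|G - F|] at the nodes is bounded by a quadratic polynomial
    in the distance to [p], whose Bernstein polynomial is explicit. The slack in [m h]
    and in [G] is what the induction on the order of derivation requires. *)
Lemma bern_uniform i F (e : R) : continuous F -> 0 < e -> exists2 r, 0 < r <= 1 / 4 &
  forall m h G, 0 < h <= r -> 2 - r <= m%:R * h <= 2 ->
   (forall p, in_cube 1 p -> `|G p - F p| <= r) -> forall p, in_cube 1 p -> `|bern i m h G p - F p| <= e.
Proof.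
move=> cF e0; have e4 : 0 < e / 4 by rewrite divr_gt0.
have [t t0 ht] := in_cube_uniform ler01 cF e4.
have [M M0 hM] := nsq_bounded (n%:R * 1 ^+ 2) cF.
have {}hM p : in_cube 1 p -> `|F p| <= M by move=> hp; apply: hM; exact: in_cube_nsq.
pose A := 2 * M / t ^+ 2; have A0 : 0 < A by rewrite divr_gt0 ?mulr_gt0 ?exprn_gt0.
pose r := Num.min (1 / 4) (Num.min (e / 4) (e / 2 / A)).
have e2 : 0 < e / 2 by rewrite divr_gt0.
have r0 : 0 < r.
  by rewrite !lt_min; apply/and3P; split; [lra|exact: e4|exact: (divr_gt0 e2 A0)].
exists r; first by rewrite r0 ge_min lexx.
have r4 : r <= 1 / 4 by rewrite ge_min lexx.
have re : r <= e / 4 by rewrite !ge_min lexx !orbT.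
have rA : A * r <= e / 2 by rewrite mulrC -ler_pdivlMr// !ge_min lexx !orbT.
move=> m h G /andP[h0 hr] /andP[mh mh2] hG p hp.
pose x := (p 0 i + 1) / 2.
have px : p 0 i = 2 * x - 1 by rewrite /x; field.
have x01 : 0 <= x <= 1.
  by have := hp i; rewrite ler_norml => /andP[? ?]; rewrite /x; apply/andP; split; lra.
have node j : (j <= m)%N -> `|j%:R * h - 1| <= 1.
  move=> jm; have : j%:R * h <= m%:R * h by rewrite ler_wpM2r ?(ltW h0)// ler_nat.
  by have := mulr_ge0 (ler0n R j) (ltW h0); rewrite ler_norml => *; apply/andP; split; lra.
pose g j := G (seti i (j%:R * h - 1) p).
pose b j := A * ((-1 - p 0 i) + j%:R * h) ^+ 2 + e / 2.
have bnd j : (j <= m)%N -> `|g j - F p| <= b j.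
  move=> jm; pose q := seti i (j%:R * h - 1) p.
  have hq : in_cube 1 q by apply: in_cube_seti => //; exact: node.
  have h1 : `|g j - F q| <= e / 4 by apply: le_trans re; exact: hG.
  have h2 : `|F q - F p| <= A * ((-1 - p 0 i) + j%:R * h) ^+ 2 + e / 4.
    have sq0 := sqr_ge0 (-1 - p 0 i + j%:R * h).
    have [small|large] := leP (`|-1 - p 0 i + j%:R * h|) t.
      apply: (@le_trans _ _ (e / 4)); last by rewrite lerDr mulr_ge0// ltW.
      apply: ht => // l; rewrite setiE; case: eqP => [->|_]; last by rewrite subrr normr0 ltW.
      by rewrite (_ : _ - _ = -1 - p 0 i + j%:R * h)//; ring.
    have : `|F q - F p| <= 2 * M.
      by rewrite (le_trans (ler_normB _ _))// mulr2n mulrDl mul1r lerD// hM.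
    move=> h2; apply: (le_trans h2); rewrite -[leLHS]addr0 lerD ?(ltW e4)//.
    rewrite -[leLHS](divfK (lt0r_neq0 (exprn_gt0 2 t0))) ler_wpM2l ?(ltW A0)//.
    by rewrite -[leRHS]ger0_norm// normrX lerXn2r ?nnegrE ?(ltW t0)// ltW.
  have -> : g j - F p = (g j - F q) + (F q - F p) by rewrite addrA subrK.
  rewrite (le_trans (ler_normD _ _))// /b; move: h1 h2; move: (`|_|) (`|_|) (A * _) => a1 a2 a3 h1 h2; lra.
have E : bern i m h G p - F p = casteljau m (fun j => 1 * g j + - F p) x.
  by rewrite casteljau_lin casteljau_cst mul1r.
have B : casteljau m b x <= e.
  rewrite /b casteljau_lin casteljau_cst casteljau_moment.
  have -> : -1 - p 0 i + m%:R * h * x = (m%:R * h - 2) * x by rewrite px; ring.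
  have h1 : ((m%:R * h - 2) * x) ^+ 2 <= r / 4.
    rewrite exprMn; have h3 : (m%:R * h - 2) ^+ 2 <= r * (1 / 4).
      rewrite -sqrrN expr2; apply: ler_pM; lra.
    have h4 : x ^+ 2 <= 1 by rewrite expr_le1//; [case/andP: x01|case/andP: x01].
    apply: (@le_trans _ _ ((m%:R * h - 2) ^+ 2 * 1)); first by rewrite ler_wpM2l ?sqr_ge0.
    by rewrite mulr1 (le_trans h3)// mul1r.
  have h2 : m%:R * h ^+ 2 * x * (1 - x) <= r / 2.
    have h3 : x * (1 - x) <= 1 / 4 by have := sqr_ge0 (x - 1 / 2); rewrite expr2; lra.
    have h4 : m%:R * h ^+ 2 <= 2 * r by rewrite expr2 mulrA ler_pM// ?(ltW h0)// mulr_ge0// ltW.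
    have h5 : 0 <= x * (1 - x) by case/andP: x01 => ? ?; rewrite mulr_ge0// subr_ge0.
    rewrite -mulrA (le_trans (ler_wpM2r h5 h4))// (le_trans (ler_wpM2l _ h3)) ?mulr_ge0 ?(ltW r0)//; lra.
  have h3 : A * (((m%:R * h - 2) * x) ^+ 2 + m%:R * h ^+ 2 * x * (1 - x)) <= A * r.
    by rewrite ler_wpM2l ?(ltW A0)//; lra.
  lra.
have casteljau_le_e (f : nat -> R) : (forall j, (j <= m)%N -> f j <= b j) -> casteljau m f x <= e.
  by move=> hf; apply: le_trans B; exact: casteljau_le.
rewrite E ler_norml; apply/andP; split; last first.
  by apply: casteljau_le_e => j /bnd; rewrite mul1r ler_norml => /andP[].
rewrite lerNl; have -> : - casteljau m (fun j => 1 * g j + - F p) x = casteljau m (fun j => -1 * (1 * g j + - F p) + 0) x.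
  by rewrite (casteljau_lin m (-1) (fun j => 1 * g j + - F p)) casteljau_cst addr0 mulN1r.
by apply: casteljau_le_e => j /bnd; rewrite ler_norml => /andP[? ?]; lra.
Qed.

End bernstein.

(** * Weierstrass approximation with derivatives *)

Section bernstein_convergence.
Context (R : realType) (n : nat).
Implicit Types (p q : 'rV[R]_n) (F G : 'rV[R]_n -> R) (w : seq 'I_n).
Local Notation dir i := (delta_mx 0 i : 'rV[R]_n).

Lemma close_deriv k r (e : R) F G l : close k.+1 r e F G ->
  close k r e (fun p => 'D_(dir l) F p) (fun p => 'D_(dir l) G p).
Proof. by move=> h w wk; rewrite -!pderiv_rcons; apply: h; rewrite size_rcons. Qed.

Lemma close_intro k r (e : R) F G : (forall p, in_cube r p -> `|F p - G p| <= e) ->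
  (forall l, close k r e (fun p => 'D_(dir l) F p) (fun p => 'D_(dir l) G p)) -> close k.+1 r e F G.
Proof.
by move=> h0 h; elim/last_ind => [|w l _] //=; rewrite size_rcons ltnS !pderiv_rcons; exact: h.
Qed.

Lemma close_mono k k' r r' (e e' : R) F G : (k' <= k)%N -> r' <= r -> e <= e' ->
  close k r e F G -> close k' r' e' F G.
Proof.
move=> kk rr ee h w wk p hp; apply: le_trans ee; apply: h; first exact: leq_trans kk.
by move=> j; exact: le_trans rr.
Qed.

(** By the mean value theorem and the symmetry of mixed derivatives. The factor
    [c] is only near [1 / h], because [m h] is not exactly [2] once a derivation
    has decreased [m]; the cube shrinks by [1] to contain the translates. *)
Lemma close_quotient k r i F (e : R) : 0 <= r -> ck k.+1 F -> 0 < e -> exists2 t, 0 < t <= 1 &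
  forall h c G, 0 < h <= t -> 1 - t <= c * h <= 1 -> ck k.+1 G -> close k.+1 (r + 1) t G F ->
  close k r e (fun p => c * G (h *: dir i + p) + (- c) * G p) (fun p => 'D_(dir i) F p).
Proof.
move=> r0 hF e0; have e4 : 0 < e / 4 by rewrite divr_gt0.
have r10 : 0 <= r + 1 by rewrite addr_ge0.
pose P w (t : R) := (forall p q, in_cube (r + 1) p -> in_cube (r + 1) q -> (forall j, `|p 0 j - q 0 j| <= t) ->
    `|pderiv (i :: w) F p - pderiv (i :: w) F q| <= e / 4) /\
  forall p, in_cube (r + 1) p -> t * `|pderiv (i :: w) F p| <= e / 4.
have [t1 t10 ht1] : exists2 t1 : R, 0 < t1 & forall w, (size w <= k)%N -> forall t, 0 < t <= t1 -> P w t.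
  apply: bounded_min_words => w wk; have [cF _] := hF (i :: w) wk.
  have [t1 t10 h1] := in_cube_uniform r10 cF e4.
  have [M M0 hM] := nsq_bounded (n%:R * (r + 1) ^+ 2) cF.
  exists (Num.min t1 (e / 4 / M)); first by rewrite lt_min t10 divr_gt0.
  move=> t /andP[t0]; rewrite le_min => /andP[tt1 tM]; split.
    by move=> p q hp hq hpq; apply: h1 => // j; exact: le_trans tt1.
  move=> p hp; rewrite ler_pdivlMr// in tM; apply: le_trans tM.
  by rewrite ler_wpM2l ?(ltW t0)// hM// in_cube_nsq.
pose t := Num.min 1 (Num.min t1 (e / 4)).
have t0 : 0 < t by rewrite !lt_min ltr01 t10.
exists t; first by rewrite t0 ge_min lexx.
have tt1 : 0 < t <= t1 by rewrite t0 !ge_min lexx !orbT.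
have te : t <= e / 4 by rewrite !ge_min lexx !orbT.
have t1' : t <= 1 by rewrite ge_min lexx.
move=> h c G /andP[h0 ht] /andP[ch1 ch2] hG GF w wk p hp.
have [u1 u2] := ht1 w wk t tt1.
have wk1 : (size w <= k.+1)%N by exact: leqW.
have hGs : ck k.+1 (fun p => G (h *: dir i + p)) by exact: ck_shift.
have e1 : pderiv w (fun p => c * G (h *: dir i + p) + (- c) * G p) p =
    c * (pderiv w G (h *: dir i + p) - pderiv w G p).
  rewrite (pderiv_lin c hGs (G := fun p => - c * G p) _ wk1).
    rewrite pderiv_shift; have -> : (fun p => - c * G p) = (fun p => - c * G p + 0) by apply/funext => q; rewrite addr0.
    rewrite (pderiv_lin (- c) hG (@ck_cst R n k.+1 0) wk1).
    have -> : pderiv w (fun=> 0 : R) p = 0.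
      have := pderiv_lin (-1) (@ck_cst R n k.+1 0) (@ck_cst R n k.+1 0) wk1.
      under eq_fun do rewrite mulr0 addr0.
      by move=> /(congr1 (fun f => f p)) ->; rewrite mulN1r addNr.
    by rewrite addr0; ring.
  by have := ck_lin (- c) hG (@ck_cst R n k.+1 0); under eq_fun do rewrite addr0.
have dW q : is_derive q (dir i) (pderiv w G) (pderiv (i :: w) G q).
  by have [_ d] := hG w wk1; exact/derivableP/d.
have [a /andP[a0 ah] e2] := mvt_direction p dW h0.
set q := a *: dir i + p in e2.
have hq : in_cube (r + 1) q.
  move=> j; rewrite !mxE eqxx/=; rewrite addrC (le_trans (ler_normD _ _))// lerD ?hp//.
  rewrite normrM ger0_norm//; case: (_ == _); rewrite ?normr1 ?normr0 ?mulr1 ?mulr0//.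
  by rewrite (le_trans ah)// (le_trans ht).
have hp1 : in_cube (r + 1) p by move=> j; rewrite (le_trans (hp j))// lerDl.
have pq j : `|q 0 j - p 0 j| <= t.
  rewrite !mxE eqxx/= addrK normrM ger0_norm//; case: (_ == _); rewrite ?normr1 ?normr0 ?mulr1 ?mulr0//.
    by rewrite (le_trans ah).
  exact: ltW.
rewrite e1 e2 -pderiv_rcons -pderiv_swap; last exact: ck_mono hF.
have b1 := GF (i :: w) wk q hq.
have b2 := u1 q p hq hp1 pq.
have b3 := u2 p hp1.
have e5 : c * (h * pderiv (i :: w) G q) - pderiv (i :: w) F p =
   (c * h) * ((pderiv (i :: w) G q - pderiv (i :: w) F q) + (pderiv (i :: w) F q - pderiv (i :: w) F p))
   - (1 - c * h) * pderiv (i :: w) F p.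
  by move: (pderiv _ G q) (pderiv _ F q) (pderiv _ F p) => x y z; ring.
rewrite e5; have ch0 : 0 <= c * h by lra.
have ch3 : 0 <= 1 - c * h by lra.
apply: (le_trans (ler_normB _ _)); rewrite [X in X + _]normrM [X in _ + X]normrM (ger0_norm ch0) (ger0_norm ch3).
have b4 : `|pderiv (i :: w) G q - pderiv (i :: w) F q + (pderiv (i :: w) F q - pderiv (i :: w) F p)| <= e / 4 + e / 4.
  by rewrite (le_trans (ler_normD _ _))// lerD// (le_trans b1).
have b5 : (1 - c * h) * `|pderiv (i :: w) F p| <= e / 4.
  apply: le_trans b3; rewrite ler_wpM2r//; lra.
have b6 : c * h * `|pderiv (i :: w) G q - pderiv (i :: w) F q + (pderiv (i :: w) F q - pderiv (i :: w) F p)| <= e / 4 + e / 4.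
  by apply: le_trans b4; rewrite ler_piMl.
by apply: le_trans (lerD b6 b5) _; clear -e0; lra.
Qed.

(** By induction on [K]: a derivative in another coordinate commutes with the
    operator, and a derivative in the coordinate [i] replaces [G] by its difference
    quotient, which is close to the derivative of [F] by [close_quotient]. Each
    derivation enlarges the cube by [1]. *)
Lemma bern_close K i F (e : R) : ck K F -> 0 < e -> exists2 t, 0 < t <= 1 / 4 &
  forall m h G, 0 < h <= t -> 2 - t <= m%:R * h <= 2 -> ck K G -> close K (1 + K%:R) t G F ->
  close K 1 e (bern i m h G) F.
Proof.
elim: K F e => [|K IH] F e hF e0.
  have [t t01 ht] := bern_uniform i (ck_continuous hF) e0; exists t => // m h G ht' mh hG GF w.
  rewrite leqn0 => /nilP -> p hp; apply: ht => // q hq.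
  by have := GF [::] isT q; rewrite addr0 => /(_ hq).
have [t0 /andP[t00 t01] h0] := bern_uniform i (ck_continuous hF) e0.
have [r1 r10 h1] : exists2 r1 : R, 0 < r1 & forall l t, 0 < t <= r1 -> forall m h G, 0 < h <= t ->
    2 - t <= m%:R * h <= 2 -> ck K G -> close K (1 + K%:R) t G (fun p => 'D_(dir l) F p) ->
    close K 1 e (bern i m h G) (fun p => 'D_(dir l) F p).
  apply: bounded_min => l; have [t /andP[tp _] ht] := IH _ _ (ck_deriv l hF) e0.
  exists t => // t' /andP[t'0 t't] m h G /andP[hp hh] /andP[m1 m2] hG GF.
  apply: ht => //; first by rewrite hp (le_trans hh).
    by rewrite m2 andbT; lra.
  exact: close_mono GF.
pose r2 := Num.min r1 (1 / 4).
have r20 : 0 < r2 by rewrite lt_min r10; lra.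
have K0 : 0 <= 1 + K%:R :> R by rewrite addr_ge0.
have [t2 /andP[t20 t21] h2] := close_quotient i K0 hF r20.
pose t := Num.min t0 (Num.min (r2 / 2) t2).
have tp : 0 < t by rewrite !lt_min t00 t20 divr_gt0.
have tt0 : t <= t0 by rewrite ge_min lexx.
have tr2 : t <= r2 / 2 by rewrite !ge_min lexx !orbT.
have tt2 : t <= t2 by rewrite !ge_min lexx !orbT.
have r21 : r2 <= r1 by rewrite ge_min lexx.
have r24 : r2 <= 1 / 4 by rewrite ge_min lexx orbT.
exists t; first by rewrite tp (le_trans tt0).
move=> m h G /andP[hp ht] /andP[m1 m2] hG GF.
have hG1 : ck 1 G by exact: ck_mono hG.
apply: close_intro => [p hcp|l].
  apply: h0 => //; first by rewrite hp (le_trans ht).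
    by rewrite m2 andbT; lra.
  move=> q hq; apply: le_trans tt0; apply: (GF [::] isT) => j.
  by rewrite (le_trans (hq j))// lerDl.
have hr2 : 0 < r2 <= r1 by rewrite r20.
have [li|li] := boolP (l == i); last first.
  rewrite derive_bern//; apply: (h1 l r2 hr2) => //.
  - by rewrite hp; lra.
  - by rewrite m2 andbT; lra.
  - exact: ck_deriv.
  - apply: close_mono (close_deriv l GF) => //; last lra.
    by rewrite lerD2l ler_nat.
rewrite (eqP li); case: m m1 m2 => [|m] m1 m2; first by move: m1; rewrite mul0r; lra.
have mh : m%:R * h = m.+1%:R * h - h by rewrite -natr1; ring.
rewrite derive_bern_same//; apply: (h1 i r2 hr2).
- by rewrite hp; lra.
- by rewrite mh; apply/andP; split; lra.
- have h3 := @ck_lin R n K (- (m.+1%:R / 2)) _ _ (ck_mono (leqnSn K) hG) (@ck_cst R n K 0).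
  have := ck_lin (m.+1%:R / 2) (ck_shift (h *: dir i) (ck_mono (leqnSn K) hG)) h3.
  by under eq_fun do rewrite addr0.
- apply: h2 => //.
  + by rewrite hp (le_trans ht).
  + have -> : m.+1%:R / 2 * h = m.+1%:R * h / 2 by rewrite mulrAC.
    by apply/andP; split; lra.
  + apply: close_mono GF => //.
    by rewrite -natr1 addrA.
Qed.

(** Polynomials in the coordinates of [S], with arbitrary functions of the other
    coordinates as coefficients: the invariant of an approximation that treats
    one coordinate after another. *)
Inductive pol (S : pred 'I_n) : ('rV[R]_n -> R) -> Prop :=
| pol_inv G : (forall j y p, S j -> G (seti j y p) = G p) -> pol S G
| pol_lin c F G : pol S F -> pol S G -> pol S (fun p => c * F p + G p)
| pol_mul j F : pol S F -> pol S (fun p => p 0 j * F p).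

Lemma pol_seti S i y F : pol S F -> pol [predU1 i & S] (fun p => F (seti i y p)).
Proof.
elim=> {F} [G h|c F G _ hF _ hG|j F _ hF].
- apply: pol_inv => j z p /orP[/eqP ->|Sj].
    by congr G; apply/rowP => l; rewrite !setiE; case: eqP.
  have [<-|ij] := eqVneq j i; first by congr G; apply/rowP => l; rewrite !setiE; case: eqP.
  have -> : seti i y (seti j z p) = seti j z (seti i y p).
    by apply/rowP => l; rewrite !setiE; case: (eqVneq l i) => [->|//]; rewrite eq_sym (negbTE ij).
  exact: h.
- exact: (pol_lin c hF hG).
- have [ji|ji] := eqVneq j i.
    have := pol_lin y hF (pol_inv (G := fun=> 0) (fun _ _ _ _ => erefl)).
    by congr pol; apply/funext => p; rewrite setiE ji eqxx addr0.
  by have := pol_mul j hF; congr pol; apply/funext => p; rewrite setiE (negbTE ji).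
Qed.

Lemma pol_bern S i m h F : pol S F -> pol [predU1 i & S] (bern i m h F).
Proof.
move=> hF; apply: casteljau_coord_ind => [a b G hG|G H hG hH|j]; last exact: pol_seti.
  have h0 := pol_lin a hG (pol_inv (G := fun=> 0) (fun _ _ _ _ => erefl)).
  have := pol_lin b (pol_mul i hG) h0; congr pol; apply/funext => p; ring.
by have := pol_lin 1 hG hH; congr pol; apply/funext => p; rewrite mul1r.
Qed.

Lemma bern_step k i F (e : R) : ck k F -> 0 < e -> exists2 G, ck k G /\ close k 1 e G F &
  forall S, pol S F -> pol [predU1 i & S] G.
Proof.
move=> hF e0; have [t /andP[t0 _] ht] := bern_close i hF e0.
(* the degree is such that the step [2 / m] is at most [t] *)
pose m := (Num.truncn (2 / t)).+1; have m0 : 0 < (m%:R : R) by rewrite ltr0n.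
have mt : 2 / t < m%:R.
  by rewrite /m truncnS_gt.
exists (bern i m (2 / m%:R) F); last by move=> S; exact: pol_bern.
split; first exact: ck_bern.
apply: ht => //.
- rewrite divr_gt0// ler_pdivrMr// mulrC -ler_pdivrMr// ltW//.
- by rewrite mulrC divfK ?gt_eqF// lexx andbT lerBlDr lerDl ltW.
- by move=> w wk p hp; rewrite subrr normr0 ltW.
Qed.

(** Monomials are indexed by words rather than by exponents, so that
    multiplication by a coordinate is [cons]. *)
Definition peval (P : seq (R * seq 'I_n)) p : R := \sum_(t <- P) t.1 * \prod_(i <- t.2) p 0 i.

Lemma pol_peval F : pol predT F -> exists P, F = peval P.
Proof.
elim=> {F} [G h|c F G _ [P ->] _ [Q ->]|j F _ [P ->]].
- exists [:: (G 0, [::])]; apply/funext => p; rewrite /peval big_seq1/= big_nil mulr1.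
  have H (l : seq 'I_n) : forall p, G (foldr (fun i q => seti i 0 q) p l) = G p.
    by elim: l => [|i l IH] q //=; rewrite h.
  rewrite -(H (enum 'I_n) p); congr G; apply/rowP => j; rewrite mxE.
  suff : j \in enum 'I_n -> foldr (fun i q => seti i 0 q) p (enum 'I_n) 0 j = 0 by apply; rewrite mem_enum.
  elim: (enum 'I_n) => [|i l IH] //=; rewrite inE setiE.
  by case: eqP => //= _; exact: IH.
- exists ([seq (c * t.1, t.2) | t <- P] ++ Q); apply/funext => p.
  rewrite /peval big_cat/= big_map mulr_sumr; congr (_ + _).
  by apply: eq_bigr => t _; rewrite mulrA.
- exists [seq (t.1, j :: t.2) | t <- P]; apply/funext => p.
  rewrite /peval big_map mulr_sumr; apply: eq_bigr => t _ /=.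
  by rewrite big_cons mulrCA.
Qed.

Theorem weierstrass k F (e : R) : ck k F -> 0 < e -> exists P, ck k (peval P) /\ close k 1 e (peval P) F.
Proof.
move=> hF e0; have N0 : 0 < (n.+1%:R : R) by rewrite ltr0n.
pose e' := e / n.+1%:R; have e'0 : 0 < e' by rewrite divr_gt0.
have H (l : seq 'I_n) : exists G, [/\ ck k G, close k 1 ((size l)%:R * e') G F & pol (mem l) G].
  elim: l => [|i l [G [hG GF pG]]].
    exists F; split => // [w wk p hp|]; first by rewrite subrr normr0 mul0r.
    by apply: pol_inv.
  have [H [hH HG] pH] := bern_step i hG e'0; exists H; split => //.
    move=> w wk p hp; rewrite /= -natr1 mulrDl mul1r.
    have -> : pderiv w H p - pderiv w F p = (pderiv w G p - pderiv w F p) + (pderiv w H p - pderiv w G p).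
      by move: (pderiv w H p) (pderiv w F p) (pderiv w G p) => x y z; ring.
    by rewrite (le_trans (ler_normD _ _))// lerD//; [exact: GF|exact: HG].
  have := pH _ pG; congr pol; apply/funext => j; by rewrite /= inE.
have [G [hG GF pG]] := H (enum 'I_n).
have {}pG : pol predT G.
  move: pG; congr pol; apply/funext => j /=; by rewrite mem_enum.
have [P GP] := pol_peval pG; exists P; rewrite -GP; split => //.
apply: close_mono GF => //; rewrite size_enum_ord /e' mulrA ler_pdivrMr// mulrC ler_wpM2l ?(ltW e0)//.
by rewrite ler_nat.
Qed.

End bernstein_convergence.

(** * Polynomial approximation on the closed ball *)

Section cutoff.
Context (R : realType) (n : nat).
Implicit Types (p q : 'rV[R]_n) (F G : 'rV[R]_n -> R) (w : seq 'I_n).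
Local Notation dir i := (delta_mx 0 i : 'rV[R]_n).

Lemma continuous_pospow a : continuous (fun y : R => Num.max y 0 ^+ a).
Proof.
move=> y; have c : {for y, continuous (fun y : R => Num.max y 0)}.
  by apply: continuous_max; [exact: cvg_id|exact: cst_continuous].
elim: a => [|a IH]; first by under eq_fun do rewrite expr0; exact: cst_continuous.
have e : (fun y : R => Num.max y 0 ^+ a.+1) = (fun y => Num.max y 0 * Num.max y 0 ^+ a).
  by apply/funext => z; rewrite exprS.
rewrite e; exact: (continuousM (s := fun y : R => Num.max y 0) (t := fun y => Num.max y 0 ^+ a) c IH).
Qed.

Lemma is_derive_pospow a (y : R) :
  is_derive y (1 : R) (fun y : R => Num.max y 0 ^+ a.+2) (a.+2%:R * Num.max y 0 ^+ a.+1).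
Proof.
have [y0|y0|->] := ltgtP y 0.
- rewrite expr0n mulr0; apply: (near_eq_is_derive (f := fun=> 0)).
  near=> z; rewrite max_r ?expr0n//; apply: ltW; near: z; exact: lt_nbhsl.
- apply: (near_eq_is_derive (f := fun z : R => z ^+ a.+2)).
    near=> z; rewrite max_l//; apply: ltW; near: z; exact: lt_nbhsr.
  have h := is_deriveX a.+2 (is_derive_id y (1 : R)).
  have e : (fun y : R => y ^+ a.+2) = (@id R) ^+ a.+2 by apply/funext => b; rewrite exprfctE.
  by rewrite e; apply: (is_derive_eq h); rewrite /GRing.scale/= mulr1.
- rewrite expr0n mulr0.
  pose f (x : R) : R := Num.max x 0 ^+ a.+2.
  have E : (fun h : R => h^-1 *: (f (h *: (1 : R) + 0) - f 0)) = (fun h : R => Num.max h 0 ^+ a.+1).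
    apply/funext => h; rewrite /f maxxx [in X in _ - X]expr0n subr0 /GRing.scale/= mulr1 addr0.
    have [h0|h0] := leP h 0; first by rewrite !expr0n mulr0.
    by rewrite exprS mulrA mulVf ?mul1r// gt_eqF.
  have cv : (fun h : R => h^-1 *: (f (h *: (1 : R) + 0) - f 0)) @ 0^' --> (0 : R).
    rewrite E; have c := @continuous_pospow a.+1 0; rewrite /prop_for/continuous_at maxxx expr0n in c.
    by apply: (cvg_trans _ c); apply: cvg_app; exact: cvg_within.
  apply: DeriveDef; first by apply/cvg_ex; exists 0.
  exact: cvg_lim cv.
Unshelve. all: by end_near. Qed.

Lemma ck_pospow k a F : (k < a)%N -> ck k F -> ck k (fun p => Num.max (F p) 0 ^+ a).
Proof.
elim: k a F => [|k IH] a F ka hF.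
  move=> w; rewrite leqn0 => /nilP ->; split => // p.
  by apply: (@continuous_comp _ _ _ F (fun y : R => Num.max y 0 ^+ a)); [exact: (ck_continuous hF)|exact: continuous_pospow].
have [b -> {}ka] : exists2 b, a = b.+2 & (k < b.+1)%N.
  by clear IH hF; case: a ka => [|[|b]] // kb; exists b.
move: b ka => {}a ka.
apply: (@ck_intro _ _ _ _ (fun i p => (a.+2%:R * Num.max (F p) 0 ^+ a.+1) * 'D_(dir i) F p)).
- move=> p; apply: (@continuous_comp _ _ _ F (fun y : R => Num.max y 0 ^+ a.+2)).
    exact: (ck_continuous hF).
  exact: continuous_pospow.
- by move=> i p;
  exact: (is_derive_comp1 (f := fun y : R => Num.max y 0 ^+ a.+2) (is_derive_pospow a (F p)) (ck_is_derive p i hF)).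
- move=> i; apply: ck_mul; last exact: ck_deriv.
  have h := IH a.+1 F ka (ck_mono (leqnSn k) hF).
  by have := ck_lin a.+2%:R h (@ck_cst R n k 0); under eq_fun do rewrite addr0.
Qed.

Lemma ck_nsq k : ck k (@nsq R n).
Proof.
suff H (l : seq 'I_n) : ck k (fun p => \sum_(i <- l) p 0 i * p 0 i) by exact: H.
elim: l => [|i l IH]; first by under eq_fun do rewrite big_nil; exact: ck_cst.
under eq_fun do rewrite big_cons.
have := ck_lin 1 (ck_mul (@ck_coord R n k i) (@ck_coord R n k i)) IH.
by under eq_fun do rewrite mul1r.
Qed.

(** The function [1 - (1 - z_+ ^ a)_+ ^ a] of [z = (rho - |p| ^ 2) / (rho - 1)] is
    [1] for [1 <= z], [0] for [z <= 0] and of class [C^(a-1)]. *)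
Lemma cutoff k (rho : R) : 1 < rho -> exists2 chi : 'rV[R]_n -> R, ck k chi &
  (forall p, nsq p <= 1 -> chi p = 1) /\ (forall p, rho <= nsq p -> chi p = 0).
Proof.
move=> r1; have d0 : 0 < rho - 1 by rewrite subr_gt0.
pose z p := (rho - 1)^-1 * (rho - nsq p).
have hz : ck k z.
  have h := ck_lin (- (rho - 1)^-1) (@ck_nsq k) (@ck_cst R n k ((rho - 1)^-1 * rho)).
  by move: h; congr ck; apply/funext => p; rewrite /z mulrBr mulNr addrC.
pose y p := -1 * Num.max (z p) 0 ^+ k.+1 + 1.
have hy : ck k y by exact: ck_lin (ck_pospow (ltnSn k) hz) (@ck_cst R n k 1).
exists (fun p => -1 * Num.max (y p) 0 ^+ k.+1 + 1).
  exact: ck_lin (ck_pospow (ltnSn k) hy) (@ck_cst R n k 1).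
split => p hp.
  have z1 : 1 <= z p by rewrite /z mulrC ler_pdivlMr// mul1r lerB.
  have : y p <= 0 by rewrite /y mulN1r addrC subr_le0 max_l ?(le_trans ler01)// exprn_ege1.
  by move=> y0; rewrite (max_r y0) expr0n mulr0 add0r.
have z0 : z p <= 0 by rewrite /z pmulr_rle0 ?invr_gt0// subr_le0.
have -> : y p = 1 by rewrite /y (max_r z0) expr0n mulr0 add0r.
by rewrite max_l// expr1n mulr1 addNr.
Qed.

Lemma ck_ckb k r F : ck k F -> exists M, ckb k (nball r) M F.
Proof.
move=> hF; have [t t0 ht] : exists2 t : R, 0 < t & forall w, (size w <= k)%N -> forall t', 0 < t' <= t ->
    forall p, nsq p <= r -> t' * `|pderiv w F p| <= 1.
  apply: bounded_min_words => w wk; have [c _] := hF w wk.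
  have [M M0 hM] := nsq_bounded r c; exists M^-1; first by rewrite invr_gt0.
  move=> t' /andP[t0 tM] p pr; rewrite (le_trans (ler_wpM2l (ltW t0) (hM p pr)))//.
  by rewrite -ler_pdivlMr// div1r.
exists t^-1; apply: pderiv_ckb => w p wk hp; have [c d] := hF w wk; split => //; first exact: c.
  rewrite -[leRHS]mulr1 ler_pdivlMl// ht ?t0 ?lexx//; exact: ltW.
by move=> wk' i; exact: d.
Qed.

Lemma extension k (rho M : R) F : 1 < rho -> ckb k (nball rho) M F ->
  exists2 G, ck k G & forall p, nsq p <= 1 -> G p = F p.
Proof.
move=> r1 hF; pose r := (1 + rho) / 2.
have r1' : 1 < r by rewrite /r; lra.
have rr : r < rho by rewrite /r; lra.
have [chi hchi [c1 c0]] := cutoff k r1'.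
exists (fun p => chi p * F p); last by move=> p hp; rewrite c1// mul1r.
apply: ckb_ck => p; have [pr|pr] := ltP (nsq p) rho.
  have [M' hM'] := ck_ckb rho hchi.
  by exists (nball rho), (2 ^+ k * (M' * M)); split => //; [exact: open_nball|exact: ckb_mul].
exists [set q | r < nsq q], 0; split => /=.
- exact: (@open_comp _ _ (@nsq R n) [set y | r < y] (fun X _ => @continuous_nsq R n X) (@open_gt R r)).
- exact: lt_le_trans pr.
- apply: (@ckb_local _ _ k _ 0 (fun=> 0)) => [|q /= hq|].
  + exact: (@open_comp _ _ (@nsq R n) [set y | r < y] (fun X _ => @continuous_nsq R n X) (@open_gt R r)).
  + by rewrite c0 ?mul0r// ltW.
  + by apply: ckb_cst; rewrite normr0.
Qed.

Lemma polynomial_density k (rho M e : R) F : 1 < rho -> ckb k (nball rho) M F -> 0 < e ->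
  exists P, ckb k (nball 1) e (fun p => peval P p - F p).
Proof.
move=> r1 hF e0; have [G hG GF] := extension r1 hF.
have [P [hP PG]] := weierstrass hG e0; exists P.
have oN : open (nball 1 : set 'rV[R]_n) by exact: open_nball.
have hPG : ckb k (nball 1) e (fun p => -1 * G p + peval P p).
  apply: pderiv_ckb => w p wk hp; have [c d] := ck_lin (-1) hG hP wk; split => //.
  - exact: c.
  - rewrite (pderiv_lin (-1) hG hP wk) mulN1r addrC; apply: PG => // j.
    rewrite -(@ler_pXn2r _ 2) ?nnegrE// -normrX ger0_norm ?sqr_ge0// expr1n.
    by rewrite (le_trans (nsq_coord p j))// ltW.
  - by move=> wk' i; exact: d.
apply: (ckb_local oN _ hPG) => p hp; rewrite mulN1r addrC GF//; exact: ltW.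
Qed.

Lemma pderiv_lin_on k (U : set 'rV[R]_n) c M1 M2 F G w p : open U -> ckb k U M1 F -> ckb k U M2 G ->
  (size w <= k)%N -> U p ->
  pderiv w (fun p => c * F p + G p) p = c * pderiv w F p + pderiv w G p.
Proof.
move=> oU hF hG; elim: w p => [|i w IH] //= p wk Up.
have [_ _ dF] := ckb_pderiv oU hF (ltnW wk) Up; have [_ _ dG] := ckb_pderiv oU hG (ltnW wk) Up.
have d := is_derive_combination c (derivableP (dF wk i)) (derivableP (dG wk i)).
have nE : \forall q \near p, c * pderiv w F q + pderiv w G q = pderiv w (fun p => c * F p + G p) q.
  near=> q; rewrite IH ?(ltnW wk)//; near: q; exact: open_nbhs_nbhs.
have d' := near_eq_is_derive nE d.
by rewrite derive_val.
Unshelve. all: by end_near. Qed.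

Lemma pderiv_dilate k (rho r M : R) F w p : r != 0 -> ckb k (nball rho) M F -> (size w <= k)%N ->
  nball rho (r *: p) -> pderiv w (fun p => F (r *: p)) p = r ^+ size w * pderiv w F (r *: p).
Proof.
move=> r0 hF; have oN : open (nball rho : set 'rV[R]_n) by exact: open_nball.
elim: w p => [|i w IH] p wk hp; first by rewrite expr0 mul1r.
have [_ _ dF] := ckb_pderiv oN hF (ltnW wk) hp.
have h1 : is_derive (r *: p) (r *: dir i) (pderiv w F) (r * pderiv (i :: w) F (r *: p)).
  by apply: is_derive_scale; exact/derivableP/dF.
have h2 : is_derive p (dir i) (fun q => pderiv w F (r *: q)) (r * pderiv (i :: w) F (r *: p)).
  apply: (@is_derive_affine R n n (fun q => r *: q) p (dir i) (r *: dir i)) => // t.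
  by rewrite scalerDr !scalerA mulrC.
have h3 := is_deriveZ (r ^+ size w) h2.
have nE : \forall q \near p, r ^+ size w * pderiv w F (r *: q) = pderiv w (fun p => F (r *: p)) q.
  near=> q; rewrite IH ?(ltnW wk)// /nball/= nsqZ; near: q.
  have hp' : nsq p < rho / r ^+ 2 by rewrite ltr_pdivlMr ?exprn_even_gt0// mulrC -nsqZ.
  have o2 : open (nball (rho / r ^+ 2) : set 'rV[R]_n) by exact: open_nball.
  have : nbhs p (nball (rho / r ^+ 2)) by exact: open_nbhs_nbhs.
  by apply: filterS => q; rewrite /nball/= ltr_pdivlMr ?exprn_even_gt0// mulrC.
have h4 := near_eq_is_derive nE h3.
by rewrite /= derive_val /GRing.scale/= exprSr mulrA.
Unshelve. all: by end_near. Qed.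

Lemma eball_nball : eball n 1 = nball 1 :> set 'rV[R]_n.
Proof.
apply/seteqP; split => p; rewrite /eball /nball/= => h.
  by rewrite -enorm_sq expr_lt1 ?enorm_ge0.
by move: h; rewrite -enorm_sq expr_lt1 ?enorm_ge0.
Qed.

(** A function that is only regular up to the boundary is replaced by its dilation
    [F (r p)], [r < 1], which is defined on a larger ball; it is close to [F] by
    uniform continuity of the derivatives on the closed ball. *)
Lemma polynomial_density_closure k F (e : R) : Ck_closure (eball n 1) k F -> 0 < e ->
  exists P, ckb k (eball n 1) e (fun p => peval P p - F p).
Proof.
rewrite eball_nball => -[hd hc] e0.
have oN : open (nball 1 : set 'rV[R]_n) by exact: open_nball.
pose K := closure (nball 1 : set 'rV[R]_n).
have K1 : K `<=` [set p | nsq p <= 1].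
  have cl : closed [set p : 'rV[R]_n | nsq p <= 1].
    apply: (@closed_comp _ _ (@nsq R n) [set y | y <= 1]); last exact: closed_le.
    by move=> X _; exact: continuous_nsq.
  rewrite ((closure_id _).1 cl); apply: closure_subset => p; exact: ltW.
have cK : compact K.
  by apply: (subclosed_compact _ (@compact_nsq R n 1) K1); exact: closed_closure.
have NK : nball 1 `<=` K by exact: subset_closure.
have [t t0 ht] : exists2 t : R, 0 < t & forall w, (size w <= k)%N -> forall t', 0 < t' <= t ->
    forall p, nball 1 p -> t' * `|pderiv w F p| <= 1.
  apply: bounded_min_words => w wk; have [h [ch hE]] := hc w wk.
  have /compact_bounded[M [_ hM]] := continuous_compact ch cK.
  have M0 : 0 < `|M| + 1 by rewrite ltr_wpDl.
  exists (`|M| + 1)^-1; first by rewrite invr_gt0.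
  move=> t' /andP[t0 tM] p hp; have b : `|pderiv w F p| <= `|M| + 1.
    rewrite -hE//; apply: (hM (`|M| + 1)); first by rewrite (le_lt_trans (ler_norm M))// ltrDl.
    by exists p => //; exact: NK.
  by rewrite (le_trans (ler_wpM2l (ltW t0) b))// -ler_pdivlMr// div1r.
have hF : ckb k (nball 1) t^-1 F.
  apply: pderiv_ckb => w p wk hp; have [h [ch hE]] := hc w wk; split.
  - have ch' : {within (nball 1 : set 'rV[R]_n), continuous h} by apply: continuous_subspaceW ch.
    have c : {for p, continuous h}.
      by move: ch'; rewrite continuous_open_subspace// => /(_ p); rewrite inE => /(_ hp).
    apply: continuous_near_eq c; near=> q; apply: hE; near: q; exact: open_nbhs_nbhs.
  - by rewrite -[leRHS]mulr1 ler_pdivlMl// ht ?t0 ?lexx.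
  - by move=> wk' i; exact: hd.
have e3 : 0 < e / 3 by rewrite divr_gt0.
have [u u0 hu] : exists2 u : R, 0 < u & forall w, (size w <= k)%N -> forall u', 0 < u' <= u -> u' < 1 ->
    forall p, nball 1 p -> `|(1 - u') ^+ size w * pderiv w F ((1 - u') *: p) - pderiv w F p| <= e / 3 + e / 3.
  apply: bounded_min_words => w wk; have [h [ch hE]] := hc w wk.
  have [r r0 hr] := uniformly_continuous cK ch e3.
  have [a a0 ha] : exists2 a : R, 0 < a & forall u', 0 < u' <= a -> u' < 1 -> 1 - (1 - u') ^+ size w <= t * (e / 3).
    elim: {wk h ch hE hr} (size w) (t * (e / 3)) (mulr_gt0 t0 e3) => [|m IH] c c0.
      by exists 1 => // u' _ _; rewrite expr0 subrr ltW.
    have c2 : 0 < c / 2 by rewrite divr_gt0.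
    have [a a0 ha] := IH _ c2; exists (Num.min a (c / 2)); first by rewrite lt_min a0.
    move=> u' /andP[u0]; rewrite le_min => /andP[ua uc] u1.
    have := ha u'; rewrite u0 ua => /(_ isT u1); rewrite exprS.
    have : (1 - u') ^+ m <= 1 by rewrite exprn_ile1//; lra.
    have : 0 <= (1 - u') ^+ m by rewrite exprn_ge0//; lra.
    move: ((1 - u') ^+ m) => x x0 x1 hx.
    have : u' * x <= u' by rewrite ler_piMr// ltW.
    by rewrite mulrBl mul1r; lra.
  exists (Num.min r a); first by rewrite lt_min r0.
  move=> u' /andP[up]; rewrite le_min => /andP[ur ua] u1 p hp.
  have hp' : nball 1 ((1 - u') *: p).
    rewrite /nball/= nsqZ (le_lt_trans _ hp)// ler_piMl ?nsq_ge0// expr_le1//; lra.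
  have b1 : `|pderiv w F ((1 - u') *: p) - pderiv w F p| <= e / 3.
    rewrite -!hE//; apply: hr; [exact: NK|exact: NK|] => j.
    rewrite !mxE (_ : _ - _ = - (u' * p 0 j)); last by ring.
    rewrite normrN normrM gtr0_norm// (le_trans _ ur)// ler_piMr ?(ltW up)//.
    rewrite -(@ler_pXn2r _ 2) ?nnegrE// -normrX ger0_norm ?sqr_ge0// expr1n.
    by rewrite (le_trans (nsq_coord p j))// ltW.
  have b2 : t * `|pderiv w F ((1 - u') *: p)| <= 1 by rewrite ht// t0 lexx.
  have b3 : 1 - (1 - u') ^+ size w <= t * (e / 3) by rewrite ha ?up.
  have b4 : 0 <= 1 - (1 - u') ^+ size w by rewrite subr_ge0 exprn_ile1//; lra.
  move: b1 b2; move: (pderiv w F _) (pderiv w F p) => x y b1 b2.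
  have -> : (1 - u') ^+ size w * x - y = (x - y) - (1 - (1 - u') ^+ size w) * x by ring.
  rewrite (le_trans (ler_normB _ _))// lerD// normrM (ger0_norm b4).
  rewrite (le_trans (ler_wpM2r _ b3))// mulrAC -[leRHS]mul1r ler_wpM2r// ltW//.
pose u' := Num.min u (1 / 2); have u'0 : 0 < u' by rewrite lt_min u0; lra.
have u'u : u' <= u by rewrite ge_min lexx.
have u'1 : u' <= 1 / 2 by rewrite ge_min lexx orbT.
pose r := 1 - u'; have r0 : 0 < r by rewrite /r; lra.
have r1 : r < 1 by rewrite /r; lra.
have hA (p : 'rV[R]_n) : nball (r ^- 2) p -> nball 1 (r *: p).
  by rewrite /nball/= nsqZ => h; rewrite -(mulfV (lt0r_neq0 (exprn_gt0 2 r0))) ltr_pM2l ?exprn_gt0.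
have hFr : ckb k (nball (r ^- 2)) ((1 + `|r|) ^+ k * t^-1) (fun p => F (r *: p)).
  apply: (@ckb_affine R n n (fun i => Some i) _ (fun p => r *: p) r k (nball 1)) => //.
  - by move=> i j l [->] [->].
  - by move=> p; exact: (@scaler_continuous R _ r p).
  - by move=> s p i; rewrite (big_pred1 i) => [|j]; rewrite ?scalerDr ?scalerA 1?mulrC//; apply/eqP/eqP => [[]|->].
  - by rewrite invr_ge0 ltW.
have r2 : 1 < r ^- 2 by rewrite invf_gt1 ?exprn_gt0// expr_lt1// ltW.
have [P hP] := polynomial_density r2 hFr e3; exists P.
have hFr1 : ckb k (nball 1) ((1 + `|r|) ^+ k * t^-1) (fun p => F (r *: p)).
  by apply: ckb_mono hFr => // p hp; exact: lt_trans r2.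
have hd2 : ckb k (nball 1) (e / 3 + e / 3) (fun p => -1 * F p + F (r *: p)).
  have big := ckb_lin (-1) hF hFr1.
  apply: pderiv_ckb => w p wk hp; have [c _ d] := ckb_pderiv oN big wk hp; split => //.
  rewrite (pderiv_lin_on (-1) oN hF hFr1 wk hp).
  rewrite (pderiv_dilate (rho := 1) _ hF wk); [|by rewrite gt_eqF|by apply: hA; exact: lt_trans r2].
  by rewrite mulN1r addrC; apply: hu => //; rewrite ?u'0//; lra.
have := ckb_lin 1 hP hd2; rewrite normr1 mul1r => h.
have {}h := ckb_mono (leqnn k) (fun p Up => Up) _ h.
have {}h : ckb k (nball 1) e (fun p => 1 * (peval P p - F (r *: p)) + (-1 * F p + F (r *: p))).
  by apply: h; lra.
by apply: (ckb_local oN _ h) => p _; move: (F (r *: p)) => y; ring.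
Unshelve. all: by end_near. Qed.

End cutoff.

(** * Density of fractional harmonic functions *)

Section harmonic_density.
Context (R : realType) (n : nat) (s : R).
Hypothesis n0 : (0 < n)%N.
Hypothesis s01 : 0 < s < 1.

Lemma harmonic_monomial_approx K k (l : seq 'I_n) (e : R) : 0 < e -> exists2 phi, harmonic s K 4 phi &
  ckb k (nball 4) e (fun X : 'rV[R]_n => phi X - \prod_(i <- l) X 0 i).
Proof.
have [c0 c00 hc] := @symlap_pp_const R n s n0 s01; have [d [d0 hd]] := symlap_balldiff n0 s01 hc.
exact: (harmonic_monomial n0 s01 c00 hc d0 hd).
Qed.

Lemma harmonic_polynomial_approx K k P (e : R) : 0 < e -> exists2 phi, harmonic s K 4 phi &
  ckb k (nball 4) e (fun X : 'rV[R]_n => phi X - peval P X).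
Proof.
elim: P e => [|[c l] P IH] e e0.
  exists (fun=> 0); first exact: harmonic_zero.
  by under eq_fun do rewrite /peval big_nil subrr; apply: ckb_cst; rewrite normr0 ltW.
have e2 : 0 < e / 2 by rewrite divr_gt0.
have c1 : 0 < `|c| + 1 by rewrite ltr_wpDl.
have [phi h1 b1] := IH _ e2.
have [psi h2 b2] := harmonic_monomial_approx K k l (divr_gt0 e2 c1).
exists (fun X => c * psi X + phi X); first exact: harmonic_lin.
have := ckb_lin c b2 b1 => h.
apply: (ckb_mono (leqnn k) (fun p Up => Up) _ (M := `|c| * (e / 2 / (`|c| + 1)) + e / 2)).
  have : `|c| * (e / 2 / (`|c| + 1)) <= e / 2.
    by rewrite mulrA ler_pdivrMr// mulrC ler_wpM2l ?(ltW e2)// lerDl.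
  lra.
move: h; congr ckb; apply/funext => X; rewrite /peval big_cons /=.
by move: (\sum_(_ <- _) _) (\prod_(_ <- _) _) => y1 y2; ring.
Qed.

(** All functions are locally [s]-harmonic up to a small error, for one
    fractional Laplacian; the approximants moreover have [K] preimages. *)
Lemma harmonic_density K k (M e : R) F : ckb k (nball 4) M F -> 0 < e ->
  exists2 phi, harmonic s K 4 phi & ckb k (nball 1) e (fun X : 'rV[R]_n => phi X - F X).
Proof.
move=> hF e0; have e2 : 0 < e / 2 by rewrite divr_gt0.
have lt14 : 1 < 4 :> R by lra.
have [P hP] := polynomial_density lt14 hF e2.
have [phi h1 b1] := harmonic_polynomial_approx K k P e2; exists phi => //.
have b1' : ckb k (nball 1) (e / 2) (fun X : 'rV[R]_n => phi X - peval P X).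
  by apply: ckb_mono b1 => // p hp; exact: lt_trans lt14.
have := ckb_lin 1 b1' hP; rewrite normr1 mul1r (_ : e / 2 + e / 2 = e); last by field.
by congr ckb; apply/funext => X; move: (peval P X) => y; ring.
Qed.

End harmonic_density.

(** * Principal values and the normalizing constant *)

Section reflection.
Context (R : realType) (n : nat) (s : R).
Local Notation RT := (measurableTypeR R).
Local Notation mu := (lebesgue_tuple R n).
Implicit Types t : n.-tuple RT.

Lemma outside_opp (rho : R) t : (tscale (-1) t \in @outside R n rho) = (t \in @outside R n rho).
Proof. by rewrite /outside /eball; apply/idP/idP; rewrite !inE/= row_of_opp enormN. Qed.

Lemma kern_opp t : kern s (tscale (-1) t) = kern s t.
Proof. by rewrite /kern row_of_opp enormN. Qed.

Lemma integral_reflection_average (g : n.-tuple RT -> \bar R) (G : n.-tuple RT -> R) :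
  mu.-integrable setT g -> (forall t, (g t + g (tscale (-1) t) = (G t)%:E)%E) ->
  fine (\int[mu]_t g t) = 2^-1 * \int[mu]_t G t.
Proof.
move=> ig e2; have mg := measurable_int _ ig.
have igO : mu.-integrable setT (fun t => g (tscale (-1) t)).
  by apply: integrable_tscale; rewrite ?oppr_eq0 ?oner_eq0.
have e1 : (\int[mu]_t g (tscale (-1) t) = \int[mu]_t g t)%E by exact: (integral_preserving (@preserving_opp R n) mg).
have fg := integrable_fin_num measurableT ig.
have -> : \int[mu]_t G t = fine (\int[mu]_t g t + \int[mu]_t g t)%E.
  rewrite /Rintegral; congr fine; rewrite -[X in _ = (_ + X)%E]e1 -integralD//.
  by apply: eq_integral => t _; rewrite -e2.
have A (y : R) : y = 2^-1 * (y + y) by field.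
rewrite (fineD fg fg); exact: A.
Qed.

End reflection.

Section principal_value.
Context (R : realType) (n : nat) (s : R).
Local Notation RT := (measurableTypeR R).
Local Notation mu := (lebesgue_tuple R n).
Implicit Types (phi : 'rV[R]_n -> R) (X : 'rV[R]_n) (t : n.-tuple RT).
Hypothesis n0 : (0 < n)%N.
Hypothesis s01 : 0 < s < 1.
Variables (phi : 'rV[R]_n -> R) (X : 'rV[R]_n) (C M : R).
Hypothesis mphi : mfn phi.
Hypothesis hD : dif2_le C phi X.
Hypothesis hM : forall Y, `|phi Y| <= M.

Let h t : R := (phi X - phi (X + row_of_tuple t)) * kern s t.

Lemma measurable_outside rho : measurable (@outside R n rho : set (n.-tuple RT)).
Proof.
have m : measurable_fun [set: n.-tuple RT] (fun t : n.-tuple RT => enorm (row_of_tuple t)).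
  exact: measurable_enorm.
have e : @outside R n rho = (fun t : n.-tuple RT => enorm (row_of_tuple t)) @^-1` `[rho, +oo[%classic.
  apply/seteqP; split => t /=; rewrite /outside /eball/= in_itv/= andbT leNgt; first by move/negP.
  by move=> /negP.
by rewrite e -[X in measurable X]setTI; exact: m.
Qed.

Let mh : measurable_fun setT h.
Proof.
by apply: measurable_funM; [apply: measurable_funB|exact: measurable_kern].
Qed.

Lemma pv_integrable rho : 0 < rho -> mu.-integrable (@outside R n rho) (EFin \o h).
Proof.
move=> r0; have mO := measurable_outside rho.
pose r := Num.min 1 (rho ^+ 2); have rp : 0 < r by rewrite lt_min ltr01 exprn_gt0.
have M0 : 0 <= M by exact: le_trans (hM X).
have h1 := integrableC n0 s01 (2 * M / r).
have h2 : mu.-integrable (@outside R n rho) (EFin \o (fun t => 2 * M / r * dom s t)).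
  exact: (integrableS measurableT mO _ h1).
apply: (le_integrable mO _ _ h2); first by apply/measurable_EFinP; exact: measurable_funTS.
move=> t /= ht; rewrite lee_fin normrM (ger0_norm (kern_ge0 _ _)).
have tr : rho <= enorm (row_of_tuple t) by rewrite leNgt; exact/negP.
rewrite [leRHS]ger0_norm; last first.
  by apply: mulr_ge0; [apply: mulr_ge0; [exact: mulr_ge0|rewrite invr_ge0 ltW]|exact: dom_ge0].
rewrite /dom mulrA ler_wpM2r ?kern_ge0//.
apply: (@le_trans _ _ (2 * M)).
  by rewrite (le_trans (ler_normB _ _))// mulr2n mulrDl mul1r lerD.
rewrite -mulrA -[leLHS]mulr1 ler_wpM2l ?mulr_ge0// mulrC ler_pdivlMr// mul1r.
rewrite /r le_min !ge_min lexx /= -enorm_sq lerXn2r ?nnegrE ?orbT ?(ltW r0)//; exact: enorm_ge0.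
Qed.

Let half (rho : R) t : R := \1_(@outside R n rho) t * (dif2 phi X t * kern s t).

Let measurable_half rho : measurable_fun setT (half rho).
Proof.
apply: measurable_funM; last exact: measurable_dif2.
by apply: measurable_indic; exact: measurable_outside.
Qed.

(** The truncated domain is symmetric, so that averaging over [Y] and [- Y]
    replaces first differences by second ones, which are integrable at [0]. *)
Lemma pv_symmetrize rho : 0 < rho ->
  \int[mu]_(t in @outside R n rho) h t = 2^-1 * \int[mu]_t half rho t.
Proof.
move=> r0; have mO := measurable_outside rho.
have ih := pv_integrable r0.
pose g : n.-tuple RT -> \bar R := (EFin \o h) \_ (@outside R n rho).
have ig : mu.-integrable setT g by rewrite /g -integrable_mkcond.
have e2 t : (g t + g (tscale (-1) t) = (half rho t)%:E)%E.
  rewrite /g /half !patchE indicE outside_opp; case: (t \in @outside R n rho); last by rewrite mul0r adde0.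
  rewrite mul1r /= -EFinD /h /dif2 row_of_opp kern_opp; congr EFin.
  by move: (kern s t) (phi _) (phi _) (phi _) => a b c d; ring.
have H := integral_reflection_average ig e2.
by rewrite -H [LHS]/Rintegral integral_mkcond.
Qed.

Lemma pv_cvg : (\int[mu]_(t in @outside R n rho) h t) @[rho --> 0^'+] --> symlap s phi X.
Proof.
apply/cvg_at_rightP => u [u0 cu].
under eq_fun do rewrite pv_symmetrize//.
apply: cvgMr.
have [] := @dominated_convergence _ _ _ mu setT measurableT
  (fun k t => (half (u k) t)%:E)
  (fun t => (dif2 phi X t * kern s t)%:E) (fun t => (C * dom s t)%:E).
- by move=> k; apply/measurable_EFinP; exact: measurable_half.
- by apply/measurable_EFinP; exact: measurable_dif2.
- apply: aeW => t _; apply: cvg_EFin; first exact: nearW.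
  have [t0|t0] := eqVneq (enorm (row_of_tuple t)) 0.
    have z : dif2 phi X t = 0.
      have := hD t; rewrite -enorm_sq t0 expr0n/= min_r// mulr0 normr_le0 => /eqP.
      by [].
    rewrite z mul0r /half z; under eq_fun do rewrite mul0r mulr0; exact: cvg_cst.
  have tp : 0 < enorm (row_of_tuple t) by rewrite lt_neqAle eq_sym t0 enorm_ge0.
  apply: cvg_near_cst; near=> k; rewrite /= /half indicE mem_set ?mul1r// /outside /eball/=.
  by apply/negP; rewrite -leNgt; near: k; exact: (cvgr_le 0 cu).
- exact: (integrableC n0 s01).
- apply: aeW => t k _; rewrite lee_fin /half normrM.
  rewrite (le_trans _ (dif2_le_dom s t hD))// ler_piMl// ger0_norm ?indicE; by case: (_ \in _).
move=> i _ h1; apply: fine_cvg; rewrite fineK//.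
exact: (integrable_fin_num measurableT i).
Unshelve. all: by end_near. Qed.

End principal_value.

Section gamma.
Context (R : realType).
Local Notation leb := (@lebesgue_measure R).

Let mG (x : R) (D : set R) : measurable_fun D (fun t : R => (t `^ (x - 1) * expR (- t))%:E).
Proof.
apply/measurable_EFinP; apply: measurable_funTS; apply: measurable_funM; first exact: measurable_powR.
by apply: (measurableT_comp (@measurable_expR R)); exact: measurable_funN.
Qed.

Let G0 (x t : R) : (0 <= (t `^ (x - 1) * expR (- t))%:E)%E.
Proof. by rewrite lee_fin mulr_ge0 ?powR_ge0 ?expR_ge0. Qed.

Lemma Gamma_lty (x : R) : 0 < x ->
  (\int[leb]_(t in `]0%R, +oo[) (t `^ (x - 1) * expR (- t))%:E < +oo)%E.
Proof.
move=> x0; have -> : `]0%R, +oo[%classic = `]0%R, 1%R]%classic `|` `]1%R, +oo[%classic :> set R.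
  apply/seteqP; split => t /=; rewrite !in_itv/= !andbT; last by move=> [/andP[]//|/(lt_trans ltr01)].
  by move=> t0; case: (leP t 1) => t1; [left|right] => //; rewrite t0.
rewrite ge0_integral_setU//=; last 2 first.
- exact: mG.
- by apply/disj_setPRL => t /=; rewrite !in_itv/= andbT => t1 /andP[_]; rewrite leNgt t1.
apply: lte_add_pinfty.
  apply: (@le_lt_trans _ _ (\int[leb]_(t in `]0%R, 1%R]) (t `^ (x - 1))%:E)%E).
    apply: ge0_le_integral => //.
    - exact: mG.
    - by apply/measurable_EFinP; apply: measurable_funTS; exact: measurable_powR.
    - move=> t; rewrite /= in_itv/= => /andP[t0 _]; rewrite lee_fin ler_piMr ?powR_ge0//.
      by rewrite -expR0 ler_expR oppr_le0 ltW.
  by rewrite (le_lt_trans (integral_powR_unit x0))// ltry.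
pose m := (Num.truncn (x + 1)).+1; have m0 : 0 < (m%:R : R) by rewrite ltr0n.
have xm : x + 1 <= m%:R by rewrite ltW// truncnS_gt.
have bnd (t : R) : 1 <= t -> t `^ (x - 1) * expR (- t) <= m%:R ^+ m * t `^ (- 1 - 1).
  move=> t1; have t0 : 0 < t by exact: lt_le_trans t1.
  have e1 : t `^ (x - 1) = t `^ (x + 1) * t `^ (- 1 - 1).
    rewrite -powRD; last by rewrite (gt_eqF t0) implybT.
    by congr (t `^ _); ring.
  rewrite e1 mulrAC ler_wpM2r ?powR_ge0// expRN ler_pdivrMr ?expR_gt0//.
  have h1 : t `^ (x + 1) <= t ^+ m by rewrite -powR_mulrn ?(ltW t0)// ler_powR.
  rewrite (le_trans h1)//.
  have h2 : (t / m%:R) ^+ m <= expR t.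
    have -> : expR t = expR (t / m%:R) ^+ m by rewrite -expRM_natr; congr expR; field; rewrite gt_eqF.
    rewrite lerXn2r ?nnegrE ?expR_ge0 ?divr_ge0 ?(ltW t0) ?(ltW m0)//.
    by rewrite (le_trans _ (expR_ge1Dx _))// lerDr.
  move: h2; rewrite expr_div_n ler_pdivrMr ?exprn_gt0// mulrC//.
apply: (@le_lt_trans _ _ (\int[leb]_(t in `[1%R, +oo[) ((m%:R ^+ m)%:E * (t `^ (- 1 - 1))%:E))%E).
  apply: (@le_trans _ _ (\int[leb]_(t in `[1%R, +oo[) (t `^ (x - 1) * expR (- t))%:E)%E).
    apply: ge0_subset_integral => //; first exact: mG.
    move=> t /=; rewrite !in_itv/= !andbT; exact: ltW.
  apply: ge0_le_integral => //.
  - exact: mG.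
  - apply: emeasurable_funM => //; apply/measurable_EFinP; apply: measurable_funTS; exact: measurable_powR.
  - by move=> t; rewrite /= in_itv/= andbT => t1; rewrite -EFinM lee_fin bnd.
rewrite ge0_integralZl//; last 2 first.
- by apply/measurable_EFinP; apply: measurable_funTS; exact: measurable_powR.
- by move=> t _; rewrite lee_fin powR_ge0.
by rewrite integral_powR_ray// -EFinM ltry.
Qed.

Lemma Gamma_gt0 (x : R) : 0 < x -> 0 < Gamma x.
Proof.
move=> x0; rewrite /Gamma /Rintegral fine_gt0// Gamma_lty// andbT.
have c0 : 0 < 2^-1 * expR (- 2) :> R by rewrite mulr_gt0 ?expR_gt0.
apply: (@lt_le_trans _ _ (\int[leb]_(t in `[1%R, 2%R]) (2^-1 * expR (- 2))%:E)%E).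
  rewrite integral_cst//= lebesgue_measure_itv/= lte_fin ltr1n -EFinD mule_gt0 ?lte_fin//.
apply: (@le_trans _ _ (\int[leb]_(t in `[1%R, 2%R]) (t `^ (x - 1) * expR (- t))%:E)%E).
  apply: ge0_le_integral => //.
  - exact: mG.
  - move=> t; rewrite /= in_itv/= => /andP[t1 t2]; have t0 : 0 < t by exact: lt_le_trans t1.
    rewrite lee_fin ler_pM// ?expR_ge0 ?ler_expR ?lerN2//.
    have -> : t `^ (x - 1) = t^-1 * t `^ x.
      rewrite addrC powRD; last by rewrite (gt_eqF t0) implybT.
      by rewrite powR_inv1// ltW.
    have h : 1 <= t `^ x by rewrite -[leLHS](powRr0 t) ler_powR// ltW.
    rewrite (@le_trans _ _ (t^-1))// ?lef_pV2 ?posrE//.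
    by rewrite ler_peMr// invr_ge0 ltW.
apply: ge0_subset_integral => //; first exact: mG.
    move=> t /=; rewrite !in_itv/= andbT => /andP[t1 _].
exact: lt_le_trans t1.
Qed.

Lemma fracLap_const_gt0 n (s : R) : 0 < s < 1 -> 0 < fracLap_const n s.
Proof.
move=> /andP[s0 s1]; rewrite /fracLap_const divr_gt0//.
  rewrite mulr_gt0 ?Gamma_gt0// ?mulr_gt0 ?powR_gt0//.
  by rewrite ltr_wpDl// divr_ge0.
by rewrite mulr_gt0 ?Gamma_gt0 ?subr_gt0// powR_gt0// pi_gt0.
Qed.

End gamma.

Lemma continuous_select (R : realType) k l (f : 'I_l -> 'I_k) :
  continuous (fun p : 'rV[R]_k => \row_i p 0 (f i) : 'rV[R]_l).
Proof.
have -> : (fun p : 'rV[R]_k => \row_i p 0 (f i) : 'rV[R]_l) = fun p => \sum_i p 0 (f i) *: delta_mx 0 i.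
  by apply/funext => p; rewrite [LHS]row_sum_delta; apply: eq_bigr => i _; rewrite mxE.
move=> p; elim: (index_enum 'I_l) => [|i r IH].
  by under eq_fun do rewrite big_nil; exact: cst_continuous.
under eq_fun do rewrite big_cons.
apply: (@continuousD _ _ _ (fun p : 'rV[R]_k => p 0 (f i) *: (delta_mx 0 i : 'rV[R]_l)) _ p); last exact: IH.
exact: (@cvgZr_tmp R _ _ (nbhs p) _ (fun q : 'rV[R]_k => q 0 (f i)) _ (delta_mx 0 i : 'rV[R]_l) (@coord_continuous R 1 k 0 (f i) p)).
Qed.

Lemma cvg_combination (R : realType) (T : Type) (F : set_system T) (FF : Filter F) (f g : T -> R) (c l l' : R) :
  f @ F --> l -> g @ F --> l' -> (fun x => c * f x + g x) @ F --> c * l + l'.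
Proof. by move=> hf hg; apply: cvgD => //; exact: cvgMr. Qed.

(** * The operator in the blocks of variables *)

Section blocks.
Context (R : realType) (d N : nat) (n : 'I_N -> nat).
Local Notation nun := (nu d n).
Implicit Types (p q : 'rV[R]_nun) (u v : 'rV[R]_nun -> R).

Definition block j p : 'rV[R]_(n j) := \row_i p 0 (Xcoord d i).

Lemma Xcoord_eq j l (i : 'I_(n j)) (i' : 'I_(n l)) :
  (Xcoord d i == Xcoord d i') = (j == l) && (i == i' :> nat).
Proof. by rewrite /Xcoord eq_rshift -tagnat.eq_Rank. Qed.

Lemma Xcoord_inj j : injective (@Xcoord d N n j).
Proof. by move=> i i' /eqP; rewrite Xcoord_eq eqxx => /eqP/val_inj. Qed.

Lemma xcoord_Xcoord i j (i' : 'I_(n j)) : (xcoord n i == Xcoord d i') = false.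
Proof. by rewrite /xcoord /Xcoord eq_lrshift. Qed.

Lemma coordP (q : 'I_nun) : (exists i, q = xcoord n i) \/ (exists j (i : 'I_(n j)), q = Xcoord d i).
Proof.
case: (split_ordP q) => [i ->|i ->]; first by left; exists i.
by right; exists (tagnat.sig1 i), (tagnat.sig2 i); rewrite /Xcoord tagnat.sig2K.
Qed.

Lemma Xshift_coord j p (Y : 'rV[R]_(n j)) (q : 'I_nun) :
  Xshift p Y 0 q = p 0 q + \sum_i Y 0 i * (q == Xcoord d i)%:R.
Proof.
rewrite mxE summxE; congr (_ + _); apply: eq_bigr => i _.
by rewrite !mxE eqxx.
Qed.

Lemma Xshift_x j p (Y : 'rV[R]_(n j)) i : Xshift p Y 0 (xcoord n i) = p 0 (xcoord n i).
Proof. by rewrite Xshift_coord big1 ?addr0// => l _; rewrite xcoord_Xcoord mulr0. Qed.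

Lemma Xshift0 j p : Xshift p (0 : 'rV[R]_(n j)) = p.
Proof. by apply/rowP => q; rewrite Xshift_coord big1 ?addr0// => l _; rewrite mxE mul0r. Qed.

Lemma block_Xshift j p (Y : 'rV[R]_(n j)) : block j (Xshift p Y) = block j p + Y.
Proof.
apply/rowP => i; rewrite mxE Xshift_coord !mxE (bigD1 i)//= eqxx mulr1 big1 ?addr0// => l li.
by rewrite (inj_eq (@Xcoord_inj j)) eq_sym (negbTE li) mulr0.
Qed.

Lemma block_Xshift_neq j l p (Y : 'rV[R]_(n j)) : l != j -> block l (Xshift p Y) = block l p.
Proof.
move=> lj; apply/rowP => i; rewrite mxE Xshift_coord !mxE big1 ?addr0// => i' _.
by rewrite Xcoord_eq (negbTE lj) mulr0.
Qed.

Lemma sum_injective_le k (f : 'I_k -> 'I_nun) p : injective f ->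
  \sum_i p 0 (f i) ^+ 2 <= nsq p.
Proof.
move=> fi; rewrite nsqE (bigID (mem (imset f (mem 'I_k))))/=.
rewrite big_imset/=; last by move=> x y _ _; exact: fi.
rewrite [leLHS](eq_bigl (mem 'I_k))//.
by rewrite lerDl sumr_ge0// => q _; rewrite sqr_ge0.
Qed.

Lemma nsq_block j p : nsq (block j p) <= nsq p.
Proof.
rewrite nsqE; under eq_bigr do rewrite mxE; exact: sum_injective_le (@Xcoord_inj j).
Qed.

Lemma continuous_block j : continuous (block j).
Proof.
exact: continuous_select.
Qed.

Lemma ckb_block k j M (F : 'rV[R]_(n j) -> R) : 0 <= M -> ckb k (nball 1) M F ->
  ckb k (nball 1) ((1 + `|1|) ^+ k * M) (fun p => F (block j p)).
Proof.
move=> M0 hF; apply: (@ckb_affine R (n j) nun (fun i => Some (Xcoord d i)) _ (block j) 1 k (nball 1)) => //.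
- by move=> i i' q [h1] [h2]; apply: (@Xcoord_inj j); rewrite h1 h2.
- exact: continuous_block.
- move=> t p q; apply/rowP => i; rewrite !mxE eqxx /= summxE; congr (_ + _).
  congr (_ * _); have [->|iq] := eqVneq q (Xcoord d i).
    rewrite (bigD1 i)//= !mxE !eqxx mulr1 big1 ?addr0 ?eqxx// => l /andP[_ li].
    by rewrite !mxE eqxx/= eq_sym (negbTE li) mulr0.
  rewrite big1// => l /eqP[lq]; rewrite !mxE eqxx /=.
  by case: eqP => [il|]; rewrite ?mulr0//; move: iq; rewrite il lq eqxx.
- by move=> p; apply: le_lt_trans; exact: nsq_block.
Qed.

(** When [u] depends on [X_j] through a factor [phi], the other variables act as a
    constant [b], and the principal value is that of [phi]. *)
Lemma fracLap_block j (s : R) u p b (phi : 'rV[R]_(n j) -> R) C M : (0 < n j)%N -> 0 < s < 1 ->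
  mfn phi -> dif2_le C phi (block j p) -> (forall Y, `|phi Y| <= M) ->
  (forall Y : 'rV[R]_(n j), u (Xshift p Y) = b * phi (block j p + Y)) ->
  fracLap_defined j s u p /\ fracLap j s u p = fracLap_const (n j) s * (b * symlap s phi (block j p)).
Proof.
move=> n0 s01 mphi hD hM hu; set X := block j p in hD hu *.
pose h (t : (n j).-tuple (measurableTypeR R)) : R := (phi X - phi (X + row_of_tuple t)) * kern s t.
have e : @fracLap_integrand R d N n j s u p = fun t => b * h t.
  apply/funext => t; rewrite /fracLap_integrand /h hu -[in u p](Xshift0 j p) hu addr0 /kern.
  by move: ((_ `^ _)^-1) (phi _) (phi _) => y1 y2 y3; ring.
have ih rho : 0 < rho -> (lebesgue_tuple R (n j)).-integrable (@outside R (n j) rho) (EFin \o h).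
  by move=> r0; exact: (pv_integrable n0 s01 X mphi hM r0).
have et rho : 0 < rho -> @fracLap_trunc R d N n j s u p rho = b * \int[lebesgue_tuple R (n j)]_(t in @outside R (n j) rho) h t.
  move=> r0; rewrite /fracLap_trunc e RintegralZl//; first exact: measurable_outside.
  exact: ih.
have cv : @fracLap_trunc R d N n j s u p rho @[rho --> 0^'+] --> b * symlap s phi X.
  have c : b * \int[lebesgue_tuple R (n j)]_(t in @outside R (n j) rho) h t @[rho --> 0^'+] --> b * symlap s phi X.
    by apply: cvgMr; exact: (pv_cvg n0 s01 mphi hD hM).
  apply: (cvg_trans _ c); apply: near_eq_cvg; near=> rho; rewrite et//.
split; last by rewrite /fracLap (cvg_lim _ cv).
split; last by apply/cvg_ex; eexists; exact: cv.
move=> rho r0; rewrite e.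
have -> : EFin \o (fun t => b * h t) = fun t => (b%:E * (EFin \o h) t)%E by [].
by apply: integrableZl; [exact: measurable_outside|exact: ih].
Unshelve. all: by end_near. Qed.

Lemma fracLap_lin j (s c : R) u v p : fracLap_defined j s u p -> fracLap_defined j s v p ->
  fracLap_defined j s (fun q => c * u q + v q) p /\
  fracLap j s (fun q => c * u q + v q) p = c * fracLap j s u p + fracLap j s v p.
Proof.
move=> [iu /cvg_ex[lu cu]] [iv /cvg_ex[lw cv]].
have e : @fracLap_integrand R d N n j s (fun q => c * u q + v q) p =
    fun t => c * fracLap_integrand s u p t + fracLap_integrand s v p t.
  apply/funext => t; rewrite /fracLap_integrand.
  by move: ((_ `^ _)^-1) (u _) (u _) (v _) (v _) => y1 y2 y3 y4 y5; ring.
have iuc rho : 0 < rho -> (lebesgue_tuple R (n j)).-integrable (@outside R (n j) rho)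
    (EFin \o (fun t => c * @fracLap_integrand R d N n j s u p t)).
  move=> r0; have -> : EFin \o (fun t => c * @fracLap_integrand R d N n j s u p t) =
    fun t => (c%:E * (EFin \o (@fracLap_integrand R d N n j s u p)) t)%E by [].
  by apply: integrableZl; [exact: measurable_outside|exact: iu].
have et rho : 0 < rho -> @fracLap_trunc R d N n j s (fun q => c * u q + v q) p rho =
    c * fracLap_trunc j s u p rho + fracLap_trunc j s v p rho.
  move=> r0; rewrite /fracLap_trunc e RintegralD//.
  - by rewrite RintegralZl//; [exact: measurable_outside|exact: iu].
  - exact: measurable_outside.
  - exact: iuc.
  - exact: iv.
have cw : @fracLap_trunc R d N n j s (fun q => c * u q + v q) p rho @[rho --> 0^'+] --> c * lu + lw.
  have h : c * @fracLap_trunc R d N n j s u p rho + @fracLap_trunc R d N n j s v p rho @[rho --> 0^'+] --> c * lu + lw.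
    by apply: cvg_combination; [exact: cu|exact: cv].
  apply: (cvg_trans _ h); apply: near_eq_cvg; near=> rho; rewrite et//.
split; last first.
  rewrite /fracLap (cvg_lim _ cw)// (cvg_lim _ cu)// (cvg_lim _ cv)//.
  by move: (fracLap_const _ _) => y; ring.
split; last by apply/cvg_ex; eexists; exact: cw.
move=> rho r0; rewrite e.
exact: (integrableD (measurable_outside _) (iuc rho r0) (iv rho r0)).
Unshelve. all: by end_near. Qed.

Variables (a : 'rV[R]_d) (m : 'I_d -> nat) (A : 'rV[R]_N) (s : 'I_N -> R).

(** Everything that the theorem asks from [u] except the approximation property,
    with a right-hand side [g] so that linear combinations can be formed. *)
Definition sol u (g : 'rV[R]_nun -> R) := [/\ continuous u,
  exists r, forall p, r <= nsq p -> u p = 0,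
  forall k, exists2 M, 0 <= M & ckb k (nball 1) M u,
  forall p, nball 1 p -> forall j, fracLap_defined j (s j) u p &
  forall p, nball 1 p -> Lambda a m A s u p = g p].

Lemma Lambda_lin c u v p : (forall k, exists2 M, 0 <= M & ckb k (nball 1) M u) ->
  (forall k, exists2 M, 0 <= M & ckb k (nball 1) M v) -> nball 1 p ->
  (forall j, fracLap_defined j (s j) u p) -> (forall j, fracLap_defined j (s j) v p) ->
  Lambda a m A s (fun q => c * u q + v q) p = c * Lambda a m A s u p + Lambda a m A s v p.
Proof.
move=> su sv hp du dv; rewrite /Lambda mulrDr !mulr_sumr addrACA -!big_split/=; congr (_ + _).
  apply: eq_bigr => j _; have [M1 _ h1] := su (m j); have [M2 _ h2] := sv (m j).
  have oN : open (nball 1 : set 'rV[R]_nun) by exact: open_nball.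
  rewrite (pderiv_lin_on c oN h1 h2) ?size_nseq//.
  by move: (pderiv _ _ _) (pderiv _ _ _) => y1 y2; ring.
apply: eq_bigr => j _; have [_ ->] := fracLap_lin c (du j) (dv j).
by move: (fracLap _ _ _ _) (fracLap _ _ _ _) => y1 y2; ring.
Qed.

Lemma sol_lin c u v g g' : sol u g -> sol v g' -> sol (fun p => c * u p + v p) (fun p => c * g p + g' p).
Proof.
move=> [c1 [r1 z1] s1 d1 l1] [c2 [r2 z2] s2 d2 l2]; split.
- exact: continuous_combination.
- exists (Num.max r1 r2) => p; rewrite ge_max => /andP[p1 p2].
  by rewrite z1// z2// mulr0 addr0.
- move=> k; have [M1 M10 h1] := s1 k; have [M2 M20 h2] := s2 k.
  by exists (`|c| * M1 + M2); [rewrite addr_ge0// mulr_ge0|exact: ckb_lin].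
- by move=> p hp j; have [] := fracLap_lin c (d1 p hp j) (d2 p hp j).
- move=> p hp; rewrite -l1// -l2//; apply: Lambda_lin => //; [exact: d1|exact: d2].
Qed.

Hypothesis hn : forall j, (0 < n j)%N.
Hypothesis hs : forall j, 0 < s j < 1.
Hypothesis hm : forall j, (0 < m j)%N.

Lemma sol_zero : sol (fun=> 0) (fun=> 0).
Proof.
have hD j p : fracLap_defined j (s j) (fun=> 0 : R) p /\ fracLap j (s j) (fun=> 0 : R) p = 0.
  have [] := @fracLap_block j (s j) (fun=> 0) p 0 (fun=> 0) 0 0 (hn j) (hs j).
  - by move=> X; exact: measurable_cst.
  - by move=> t; rewrite /dif2 mulr0 !subr0 normr0 mul0r.
  - by move=> Y; rewrite normr0.
  - by move=> Y; rewrite mulr0.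
  by move=> h1 h2; split => //; rewrite h2 mul0r mulr0.
split.
- by move=> p; exact: cst_continuous.
- by exists 0.
- by move=> k; exists 0 => //; apply: ckb_cst; rewrite normr0.
- by move=> p _ j; have [] := hD j p.
- move=> p _; rewrite /Lambda !big1 ?addr0// => j _.
    by have [_ ->] := hD j p; rewrite mulr0.
  have h := ckb_cst (n := nun) (m j) (nball 1) (c := 0) (M := 0).
  have := @pderiv_lin R nun (m j) (-1) (fun=> 0) (fun=> 0) (nseq (m j) (xcoord n j)) (@ck_cst R nun _ 0) (@ck_cst R nun _ 0).
  rewrite size_nseq => /(_ (leqnn _)); under eq_fun do rewrite mulr0 addr0.
  by move=> /(congr1 (fun f => f p)) ->; rewrite mulN1r addNr mulr0.
Qed.

End blocks.

(** * Products of functions of the blocks *)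

Section elementary.
Context (R : realType) (d N : nat) (n : 'I_N -> nat).
Local Notation nun := (nu d n).
Local Notation fam := (forall j, 'rV[R]_(n j) -> R).
Implicit Types (p q : 'rV[R]_nun) (h : fam) (w : seq 'I_d).
Local Notation dirx i := (delta_mx 0 (xcoord n i) : 'rV[R]_nun).

Definition xs p : R := \sum_(i < d) p 0 (xcoord n i) ^+ 2.

(** The cutoff makes products of functions of the blocks compactly supported in
    [x]. Continuity suffices: it only depends on [x], hence is a constant for the
    fractional Laplacians, and it is [1] where derivatives in [x] are taken. *)
Definition cut p : R := Num.max 0 (Num.min 1 (2 - xs p)).
Definition mono w p : R := \prod_(i <- w) p 0 (xcoord n i).
Definition rest j w h p : R := mono w p * \prod_(l < N | l != j) h l (block l p).
Definition mono_prod w h p : R := mono w p * \prod_(j < N) h j (block j p).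
Definition cut_prod w h p : R := cut p * mono_prod w h p.

(** The number [4] is the square of the radius; the ball of radius [2] leaves room
    around the unit ball. *)
Definition tame h := forall j, regular 4 (h j) /\ smooth 4 (h j).

Lemma mono_prod_rest j w h p : mono_prod w h p = rest j w h p * h j (block j p).
Proof. by rewrite /mono_prod (bigD1 j)//= /rest -mulrA [h j _ * _]mulrC. Qed.

Lemma xs_le_nsq p : xs p <= nsq p.
Proof. by apply: sum_injective_le => i j /lshift_inj. Qed.

Lemma cut_ball p : nball 1 p -> cut p = 1.
Proof.
move=> hp; have h : 1 <= 2 - xs p.
  by have h1 := xs_le_nsq p; have h2 : nsq p < 1 := hp; lra.
by rewrite /cut (min_l h) max_r.
Qed.

Lemma continuous_xs : continuous xs.
Proof.
move=> p; apply: continuous_sum_fin => i _.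
by apply: continuousM; exact: (@coord_continuous R 1 nun 0 (xcoord n i) p).
Qed.

Lemma continuous_cut : continuous cut.
Proof.
move=> p; have c1 : {for p, continuous (fun p => 2 - xs p)}.
  by apply: continuousB; [exact: cst_continuous|exact: continuous_xs].
have c2 : {for p, continuous (fun p => Num.min 1 (2 - xs p))}.
  by apply: continuous_min; [exact: cst_continuous|exact: c1].
have c3 : {for p, continuous (fun p => Num.max 0 (Num.min 1 (2 - xs p)))}.
  by apply: continuous_max; [exact: cst_continuous|exact: c2].
exact: c3.
Qed.

Lemma continuous_prod (T : topologicalType) (I : Type) (r : seq I) (P : pred I) (F : I -> T -> R) x :
  (forall i, P i -> {for x, continuous (F i)}) ->
  {for x, continuous (fun y => \prod_(i <- r | P i) F i y)}.
Proof.
move=> hF; elim: r => [|i r IH].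
  have -> : (fun y => \prod_(i <- [::] | P i) F i y) = fun=> 1 by apply/funext => y; rewrite big_nil.
  exact: cst_continuous.
have [Pi|Pi] := boolP (P i); last first.
  have -> : (fun y => \prod_(i <- i :: r | P i) F i y) = fun y => \prod_(i <- r | P i) F i y.
    by apply/funext => y; rewrite big_cons (negbTE Pi).
  exact: IH.
have -> : (fun y => \prod_(i <- i :: r | P i) F i y) = fun y => F i y * \prod_(i <- r | P i) F i y.
  by apply/funext => y; rewrite big_cons Pi.
exact: (continuousM (s := F i) (t := fun y => \prod_(i <- r | P i) F i y) (hF i Pi) IH).
Qed.

Lemma continuous_cut_prod w h : tame h -> continuous (cut_prod w h).
Proof.
move=> th p.
have c1 : {for p, continuous (mono w)}.
  by apply: continuous_prod => i _; exact: (@coord_continuous R 1 nun 0 (xcoord n i) p).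
have c2 : {for p, continuous (fun p => \prod_(j < N) h j (block j p))}.
  apply: continuous_prod => j _; have [[c _ _ _] _] := th j.
  by apply: (@continuous_comp _ _ _ (block j) (h j)); [exact: continuous_block|exact: c].
have c3 := continuousM (s := mono w) (t := fun p => \prod_(j < N) h j (block j p)) c1 c2.
exact: (continuousM (s := cut) (t := mono_prod w h) (continuous_cut (x := p)) c3).
Qed.

Lemma mono_Xshift j w p (Y : 'rV[R]_(n j)) : mono w (Xshift p Y) = mono w p.
Proof. by apply: eq_bigr => i _; rewrite Xshift_x. Qed.

Lemma cut_prod_Xshift j w h p (Y : 'rV[R]_(n j)) :
  cut_prod w h (Xshift p Y) = cut p * rest j w h p * h j (block j p + Y).
Proof.
rewrite /cut_prod (mono_prod_rest j) mulrA /rest mono_Xshift block_Xshift; congr (_ * (_ * _) * _).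
  by rewrite /cut /xs; congr (Num.max _ (Num.min _ (_ - _))); apply: eq_bigr => i _; rewrite Xshift_x.
by apply: eq_bigr => l lj; rewrite block_Xshift_neq.
Qed.

Lemma cut_prod_support w h : tame h -> exists r, forall p, r <= nsq p -> cut_prod w h p = 0.
Proof.
move=> th; have /boolp.choice[rho hrho] : forall j, exists rho, forall X : 'rV[R]_(n j), rho <= nsq X -> h j X = 0.
  by move=> j; have [[_ hr _ _] _] := th j.
pose c := 2 + \sum_j `|rho j|; have c2 : 2 <= c by rewrite lerDl sumr_ge0.
have cr j : rho j <= c.
  rewrite /c (bigD1 j)//= (le_trans (ler_norm _))// addrCA lerDl addr_ge0// sumr_ge0//.
exists (nun%:R * c + 1) => p hp; apply/eqP/negPn/negP => nz.
have : cut_prod w h p != 0 by [].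
rewrite /cut_prod !mulf_eq0 !negb_or => /and3P[cz _ hz].
have xs2 : xs p <= 2.
  rewrite leNgt; apply/negP => x2; move: cz; rewrite /cut.
  have x2' : 2 - xs p <= 0 by rewrite subr_le0 ltW.
  by rewrite min_r ?(le_trans x2')// (max_l x2') eqxx.
have hb j : nsq (block j p) <= c.
  rewrite leNgt; apply/negP => cb; move: hz; rewrite (bigD1 j)//= hrho ?mul0r ?eqxx//.
  by rewrite (le_trans (cr j))// ltW.
have co (q : 'I_nun) : p 0 q ^+ 2 <= c.
  case: (coordP q) => [[i ->]|[j [i ->]]].
    apply: le_trans c2; apply: le_trans xs2; rewrite /xs (bigD1 i)//= lerDl sumr_ge0// => l _.
    exact: sqr_ge0.
  by apply: le_trans (hb j); have := nsq_coord (block j p) i; rewrite mxE.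
have : nsq p <= nun%:R * c.
  rewrite nsqE; apply: (@le_trans _ _ (\sum_(q < nun) c)); first by apply: ler_sum => q _; exact: co.
  by rewrite sumr_const card_ord mulr_natl.
by move=> hp'; have := le_trans hp hp'; rewrite gerDl ler10.
Qed.

Lemma ckb_prod k (I : Type) (r : seq I) (P : pred I) (U : set 'rV[R]_nun) (F : I -> 'rV[R]_nun -> R) :
  (forall i, P i -> exists2 M, 0 <= M & ckb k U M (F i)) ->
  exists2 M, 0 <= M & ckb k U M (fun p => \prod_(i <- r | P i) F i p).
Proof.
move=> hF; elim: r => [|i r [M M0 IH]].
  by exists 1 => //; under eq_fun do rewrite big_nil; apply: ckb_cst; rewrite normr1.
have [Pi|Pi] := boolP (P i); last by exists M => //; under eq_fun do rewrite big_cons (negbTE Pi).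
have [M1 M10 h1] := hF i Pi; exists (2 ^+ k * (M1 * M)); last by under eq_fun do rewrite big_cons Pi; exact: ckb_mul.
by rewrite mulr_ge0 ?exprn_ge0// mulr_ge0.
Qed.

Lemma ckb_mono_x k w : exists2 M, 0 <= M & ckb k (nball 1) M (mono w).
Proof.
apply: ckb_prod => i _; exists 1 => //; apply: ckb_coord => // p hp.
rewrite -(@ler_pXn2r _ 2) ?nnegrE// -normrX ger0_norm ?sqr_ge0// expr1n.
by rewrite (le_trans (nsq_coord p _))// ltW.
Qed.

Lemma ckb_smooth_block k j (f : 'rV[R]_(n j) -> R) : smooth 4 f ->
  exists2 M, 0 <= M & ckb k (nball 1) M (fun p : 'rV[R]_nun => f (block j p)).
Proof.
move=> /(_ k)[M M0 hM]; exists ((1 + `|1|) ^+ k * M).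
  by rewrite mulr_ge0// exprn_ge0// addr_ge0.
apply: ckb_block => //; apply: ckb_mono hM => // X X1.
by have h : nsq X < 1 := X1; rewrite /nball/=; lra.
Qed.

Lemma ckb_rest k j w h : (forall l, l != j -> smooth 4 (h l)) ->
  exists2 M, 0 <= M & ckb k (nball 1) M (rest j w h).
Proof.
move=> th; have [M1 M10 h1] := ckb_mono_x k w.
have [M2 M20 h2] : exists2 M, 0 <= M & ckb k (nball 1) M (fun p => \prod_(l < N | l != j) h l (block l p)).
  by apply: ckb_prod => l lj; apply: ckb_smooth_block; exact: th.
exists (2 ^+ k * (M1 * M2)); first by rewrite mulr_ge0 ?exprn_ge0// mulr_ge0.
exact: ckb_mul.
Qed.

Lemma ckb_mono_prod k w h : tame h -> exists2 M, 0 <= M & ckb k (nball 1) M (mono_prod w h).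
Proof.
move=> th; have [M1 M10 h1] := ckb_mono_x k w.
have [M2 M20 h2] : exists2 M, 0 <= M & ckb k (nball 1) M (fun p => \prod_(l < N) h l (block l p)).
  by apply: ckb_prod => l _; apply: ckb_smooth_block; have [] := th l.
exists (2 ^+ k * (M1 * M2)); first by rewrite mulr_ge0 ?exprn_ge0// mulr_ge0.
exact: ckb_mul.
Qed.

Lemma mono_prod_cut_prod w h p : nball 1 p -> mono_prod w h p = cut_prod w h p.
Proof. by move=> hp; rewrite /cut_prod cut_ball// mul1r. Qed.

Lemma is_derive_mono w i p : is_derive p (dirx i) (mono w) ((count_mem i w)%:R * mono (rem i w) p).
Proof.
elim: w => [|j w IH].
  rewrite mul0r; have -> : mono [::] = fun=> 1 by apply/funext => q; rewrite /mono big_nil.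
  exact: is_derive_cst.
have -> : mono (j :: w) = fun q => q 0 (xcoord n j) * mono w q.
  by apply/funext => q; rewrite /mono big_cons.
have hx : is_derive p (dirx i) (fun q : 'rV[R]_nun => q 0 (xcoord n j)) (j == i)%:R.
  apply/is_derive_lineP; apply: (near_eq_is_derive (f := fun t : R => t * (j == i)%:R + p 0 (xcoord n j))).
    by near=> t; rewrite !mxE eqxx /= (inj_eq (@lshift_inj _ _)).
  by apply: is_derive_eq; rewrite /GRing.scale/=; ring.
apply: (is_derive_eq (is_deriveM hx IH)); rewrite /GRing.scale/=.
have [->|ji] := eqVneq j i.
  rewrite mulr1 natrD mulrDl mul1r addrC; congr (_ + _).
  have [iw|iw] := boolP (i \in w); last by rewrite (count_memPn iw) !mul0r mulr0.
  rewrite mulrCA; congr (_ * _); rewrite /mono (perm_big _ (perm_to_rem iw))/=.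
  by rewrite big_cons.
by rewrite mulr0 addr0 add0n /mono big_cons mulrCA.
Unshelve. all: by end_near. Qed.

Lemma block_dirx j i p (t : R) : block j (t *: dirx i + p) = block j p.
Proof.
apply/rowP => l; rewrite !mxE eqxx /= eq_sym xcoord_Xcoord mulr0 add0r//.
Qed.

Lemma is_derive_mono_prod w h i p : is_derive p (dirx i) (mono_prod w h) ((count_mem i w)%:R * mono_prod (rem i w) h p).
Proof.
have h0 : is_derive p (dirx i) (fun q => \prod_(j < N) h j (block j q)) 0.
  apply/is_derive_lineP; under [X in is_derive _ _ X]eq_fun do under eq_bigr do rewrite block_dirx.
  exact: is_derive_cst.
apply: (is_derive_eq (is_deriveM (is_derive_mono w i p) h0)); rewrite /GRing.scale/= mulr0 add0r /mono_prod.
by rewrite mulrC mulrA.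
Qed.

(** Either the derivative vanishes ([cw.1 = 0]) or the length of the word drops by
    [k]: this is the decreasing quantity of the main induction. *)
Lemma pderiv_mono_prod w k i : exists cw : R * seq 'I_d, (cw.1 != 0 -> (size cw.2 + k <= size w)%N) /\
  forall h, pderiv (nseq k (xcoord n i)) (mono_prod w h) = fun p => cw.1 * mono_prod cw.2 h p.
Proof.
elim: k => [|k [[c w'] [/= sz IH]]].
  by exists (1, w); split => [_|h] /=; [rewrite addn0|apply/funext => p; rewrite mul1r].
exists (c * (count_mem i w')%:R, rem i w'); split => [/=|h /=].
  rewrite mulf_eq0 negb_or pnatr_eq0 => /andP[/sz szw ci].
  have iw : i \in w' by rewrite -has_pred1 has_count lt0n.
  rewrite size_rem//; apply: leq_trans szw; rewrite addnS -addSn prednK//.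
  by case: (w') iw.
rewrite IH; apply/funext => p.
have D : is_derive p (dirx i) (fun q => c * mono_prod w' h q) (c * ((count_mem i w')%:R * mono_prod (rem i w') h p)).
  exact: (is_deriveZ c (is_derive_mono_prod w' h i p)).
by rewrite derive_val mulrA.
Qed.

Variables (a : 'rV[R]_d) (m : 'I_d -> nat) (A : 'rV[R]_N) (s : 'I_N -> R).
Hypothesis hn : forall j, (0 < n j)%N.
Hypothesis hs : forall j, 0 < s j < 1.
Local Notation sol := (@sol R d N n a m A s).

Lemma sol_eq u g g' : sol u g -> (forall p, nball 1 p -> g p = g' p) -> sol u g'.
Proof. by move=> [c z sm df l] e; split => // p hp; rewrite l// e. Qed.

Lemma sol_cut_prod w h : tame h -> sol (cut_prod w h) (fun p =>
   \sum_(i < d) a 0 i * pderiv (nseq (m i) (xcoord n i)) (mono_prod w h) p +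
   \sum_(j < N) A 0 j * (fracLap_const (n j) (s j) * (rest j w h p * symlap (s j) (h j) (block j p)))).
Proof.
move=> th; have oN : open (nball 1 : set 'rV[R]_nun) by exact: open_nball.
have fl p j : nball 1 p -> fracLap_defined j (s j) (cut_prod w h) p /\
    fracLap j (s j) (cut_prod w h) p = fracLap_const (n j) (s j) * (cut p * rest j w h p * symlap (s j) (h j) (block j p)).
  move=> hp; have [[c [rho hrho] mh hD] _] := th j.
  have b4 : nsq (block j p) < 4.
    by have h1 := nsq_block j p; have h2 : nsq p < 1 := hp; lra.
  have [C hC] := hD _ b4; have [M M0 hM] := nsq_bounded rho c.
  apply: (fracLap_block (hn j) (hs j) mh hC (M := M)) => [Y|Y]; last exact: cut_prod_Xshift.
  by have [h1|h1] := leP (nsq Y) rho; [exact: hM|rewrite hrho ?normr0 ?ltW].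
split.
- exact: continuous_cut_prod.
- exact: cut_prod_support.
- move=> k; have [M M0 hM] := ckb_mono_prod k w th; exists M => //.
  by apply: (ckb_local oN _ hM) => p hp; exact: mono_prod_cut_prod.
- by move=> p hp j; have [] := fl p j hp.
- move=> p hp; rewrite /Lambda; congr (_ + _).
    apply: eq_bigr => i _; congr (_ * _); apply: (pderiv_eq_on _ oN _ hp) => q hq.
    by rewrite mono_prod_cut_prod.
  by apply: eq_bigr => j _; have [_ ->] := fl p j hp; rewrite cut_ball// mul1r.
Qed.

End elementary.

Section product_estimate.
Context (R : realType) (D : nat) (I : Type).
Implicit Types (F G : I -> 'rV[R]_D -> R).

(** Replacing the factors one at a time. *)
Lemma prod_close k (U : set 'rV[R]_D) F (r : seq I) :
  (forall i, exists2 M, 0 <= M & ckb k U M (F i)) ->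
  exists2 C, 0 <= C & forall e G, 0 < e <= 1 -> (forall i, ckb k U e (fun p => G i p - F i p)) ->
    ckb k U (C * e) (fun p => \prod_(i <- r) G i p - \prod_(i <- r) F i p).
Proof.
move=> hF; suff [C C0 [B B0 H]] : exists2 C, 0 <= C & exists2 B, 0 <= B &
    forall e G, 0 < e <= 1 -> (forall i, ckb k U e (fun p => G i p - F i p)) ->
    ckb k U (C * e) (fun p => \prod_(i <- r) G i p - \prod_(i <- r) F i p) /\
    ckb k U B (fun p => \prod_(i <- r) G i p).
  by exists C => // e G he hG; have [] := H e G he hG.
elim: r => [|i r [C C0 [B B0 IH]]].
  exists 0 => //; exists 1 => // e G _ _; split.
    by under eq_fun do rewrite !big_nil subrr; apply: ckb_cst; rewrite normr0 mul0r.
  by under eq_fun do rewrite big_nil; apply: ckb_cst; rewrite normr1.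
have [M M0 hM] := hF i; have k0 : 0 <= 2 ^+ k :> R by rewrite exprn_ge0.
exists (2 ^+ k * (M * C) + 2 ^+ k * B); first by rewrite addr_ge0 ?mulr_ge0.
exists (2 ^+ k * ((1 + M) * B)); first by rewrite !mulr_ge0// addr_ge0.
move=> e G he hG; have [h1 h2] := IH e G he hG; have /andP[e0 e1] := he.
have gi : ckb k U (1 + M) (G i).
  have := ckb_lin 1 (hG i) hM; rewrite normr1 mul1r => h.
  apply: (ckb_mono (leqnn k) (fun p Up => Up) (M := e + M)); first by rewrite lerD2r.
  move: h; congr ckb; apply/funext => p; rewrite mul1r subrK//.
split; last by under eq_fun do rewrite big_cons; exact: ckb_mul.
have := ckb_lin 1 (ckb_mul hM h1) (ckb_mul (hG i) h2); rewrite normr1 mul1r => h.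
have e3 : 2 ^+ k * (M * (C * e)) + 2 ^+ k * (e * B) = (2 ^+ k * (M * C) + 2 ^+ k * B) * e.
  by move: (2 ^+ k) => x; ring.
rewrite -e3; move: h; congr ckb; apply/funext => p; rewrite !big_cons.
by move: (\prod_(_ <- _) _) (\prod_(_ <- _) _) (G i p) (F i p) => x y z t; ring.
Qed.

End product_estimate.

(** * Corrections by small solutions *)

Section solution.
Context (R : realType) (d N : nat) (n : 'I_N -> nat).
Local Notation nun := (nu d n).
Local Notation fam := (forall j, 'rV[R]_(n j) -> R).
Implicit Types (p q : 'rV[R]_nun) (h : fam) (w : seq 'I_d).
Variables (a : 'rV[R]_d) (m : 'I_d -> nat) (A : 'rV[R]_N) (s : 'I_N -> R).
Hypothesis hn : forall j, (0 < n j)%N.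
Hypothesis hs : forall j, 0 < s j < 1.
Hypothesis hm : forall j, (0 < m j)%N.
Variable J : 'I_N.
Hypothesis AJ : A 0 J != 0.
Local Notation sol := (@sol R d N n a m A s).
Local Notation B1 := (nball 1 : set 'rV[R]_nun).

Definition harmonics h := forall j, [/\ regular 4 (h j), smooth 4 (h j) &
  forall X, nball 4 X -> symlap (s j) (h j) X = 0].

Definition update h (f : 'rV[R]_(n J) -> R) : fam :=
  @eqtype.dfwith 'I_N (fun j => 'rV[R]_(n j) -> R) h J f.

Lemma update_in h f : @update h f J = f.
Proof. exact: (@eqtype.dfwith_in 'I_N (fun j => 'rV[R]_(n j) -> R) h J f). Qed.

Lemma update_out h f (j : 'I_N) : j != J -> @update h f j = h j.
Proof.
rewrite eq_sym => Jj; exact: (@eqtype.dfwith_out 'I_N (fun j => 'rV[R]_(n j) -> R) h J f j Jj).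
Qed.

Let ka := A 0 J * fracLap_const (n J) (s J).
Let ka0 : ka != 0.
Proof. by rewrite mulf_neq0// gt_eqF// fracLap_const_gt0. Qed.

Lemma rest_update w h (f : 'rV[R]_(n J) -> R) p : rest J w (update h f) p = rest J w h p.
Proof. by rewrite /rest; congr (_ * _); apply: eq_bigr => l lJ; rewrite update_out. Qed.

Lemma mono_prod_update w h (f : 'rV[R]_(n J) -> R) p : mono_prod w (update h f) p = rest J w h p * f (block J p).
Proof. by rewrite (mono_prod_rest J) rest_update update_in. Qed.

Lemma tame_update h (f : 'rV[R]_(n J) -> R) : harmonics h -> regular 4 f -> smooth 4 f -> tame (update h f).
Proof.
move=> hh rf sf j; have [->|jJ] := eqVneq j J; first by rewrite update_in.
by rewrite update_out//; have [] := hh j.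
Qed.

Lemma nball_block j p : B1 p -> nball 4 (block j p).
Proof. by move=> hp; have h1 := nsq_block j p; have h2 : nsq p < 1 := hp; rewrite /nball/=; lra. Qed.

Lemma sol_update w h (f : 'rV[R]_(n J) -> R) : harmonics h -> regular 4 f -> smooth 4 f ->
  sol (cut_prod w (update h f)) (fun p =>
   \sum_(i < d) a 0 i * pderiv (nseq (m i) (xcoord n i)) (mono_prod w (update h f)) p +
   ka * (rest J w h p * symlap (s J) f (block J p))).
Proof.
move=> hh rf sf; apply: (sol_eq (sol_cut_prod a m A hn hs w (tame_update hh rf sf))) => p hp.
congr (_ + _); rewrite (bigD1 J)//= big1 ?addr0 => [|l lJ].
  by rewrite rest_update update_in /ka -mulrA.
by rewrite update_out//; have [_ _ ->] := hh l; rewrite ?mulr0//; exact: nball_block.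
Qed.

Lemma sol_small_sum k (b : 'I_d -> R) (g : 'I_d -> 'rV[R]_nun -> R) :
  (forall i e, 0 < e -> exists2 v, sol v (g i) & ckb k B1 e v) ->
  forall e, 0 < e -> exists2 v, sol v (fun p => \sum_(i < d) b i * g i p) & ckb k B1 e v.
Proof.
move=> hg; suff H (r : seq 'I_d) e : 0 < e -> exists2 v, sol v (fun p => \sum_(i <- r) b i * g i p) & ckb k B1 e v.
  by move=> e e0; exact: H.
elim: r e => [|i r IH] e e0.
  exists (fun=> 0); last by apply: ckb_cst; rewrite normr0 ltW.
  by apply: (sol_eq (sol_zero a m A hn hs)) => p _; rewrite big_nil.
have e2 : 0 < e / 2 by rewrite divr_gt0.
have b1 : 0 < `|b i| + 1 by rewrite ltr_wpDl.
have [v sv cv] := IH _ e2; have [v' sv' cv'] := hg i _ (divr_gt0 e2 b1).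
exists (fun p => b i * v' p + v p).
  by apply: (sol_eq (sol_lin (b i) sv' sv)) => p _; rewrite big_cons.
apply: (ckb_mono (leqnn k) (fun p Up => Up) _ (ckb_lin (b i) cv' cv)).
have : `|b i| * (e / 2 / (`|b i| + 1)) <= e / 2.
  by rewrite mulrA ler_pdivrMr// mulrC ler_wpM2l ?(ltW e2)// lerDl.
lra.
Qed.

(** Let [psi] be a preimage of [f] and [q] an [s]-harmonic function close to
    [psi / ka]. Then [chi = psi / ka - q] is small and [ka symlap chi = f], so
    that the product with [chi] in place of [f] is small and solves the equation
    up to its derivatives in [x], which are right-hand sides of the same shape
    and are corrected by hypothesis. *)
Lemma small_solution_step k L h w (f : 'rV[R]_(n J) -> R) e : harmonics h ->
  good (s J) L.+1 4 f -> 0 < e ->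
  (forall i (chi : 'rV[R]_(n J) -> R) e', good (s J) L 4 chi -> 0 < e' ->
     exists2 v, sol v (pderiv (nseq (m i) (xcoord n i)) (mono_prod w (update h chi))) & ckb k B1 e' v) ->
  exists2 u, sol u (mono_prod w (update h f)) & ckb k B1 e u.
Proof.
move=> hh gf e0 hlow; have [rf sf [psi gpsi hpsi]] := gf.
have e2 : 0 < e / 2 by rewrite divr_gt0.
have [B B0 hB] : exists2 B, 0 <= B & ckb k B1 B (rest J w h).
  by apply: ckb_rest => l _; have [] := hh l.
pose C := 2 ^+ k * (B * (1 + `|1|) ^+ k) + 1 : R.
have C0 : 0 < C by rewrite ltr_wpDl// !mulr_ge0 ?exprn_ge0// addr_ge0.
pose eta := e / 2 / C; have eta0 : 0 < eta by rewrite divr_gt0.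
have [_ spsi] := good_base gpsi; have [M M0 hM] := spsi k.
have := ckb_lin ka^-1 hM (ckb_cst (n := n J) k (nball 4) (c := 0) (M := 0) _).
rewrite normr0 => /(_ (lexx _)) hM'.
have [q [gq lq] hq] := harmonic_density (hn J) (hs J) L hM' eta0.
pose chi X := -1 * q X + ka^-1 * psi X.
have gchi : good (s J) L 4 chi.
  by apply: good_lin => //; exact: good_scale.
have lchi X : nball 4 X -> symlap (s J) chi X = ka^-1 * f X.
  move=> X4; have [[_ _ m1 d1] _] := good_base gq.
  have [[_ _ m2 d2] _] := good_base (good_scale (hn J) (hs J) ka^-1 gpsi).
  have [C1 h3] := d1 X X4; have [C2 h4] := d2 X X4.
  rewrite (symlap_lin (hn J) (hs J) (-1) m1 m2 h3 h4) lq// mulr0 add0r -hpsi//.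
  have [[_ _ m3 d3] _] := good_base gpsi; have [C3 h5] := d3 X X4.
  exact: (symlapZ (hn J) (hs J) _ m3 h5).
have [rchi schi] := good_base gchi.
have cchi : ckb k (nball 1) eta chi.
  have := ckb_scale (-1) hq; rewrite normrN1 mul1r; congr ckb; apply/funext => X.
  by rewrite /chi; move: (q X) (psi X) => x y; ring.
have s0 := sol_update w hh rchi schi.
have c0 : ckb k B1 (e / 2) (cut_prod w (update h chi)).
  have := ckb_mul hB (ckb_block d (ltW eta0) cchi) => hc.
  have oN : open B1 by exact: open_nball.
  apply: (ckb_local oN (F := fun p => rest J w h p * chi (block J p))) => [p hp|].
    by rewrite -mono_prod_cut_prod// mono_prod_update.
  apply: (ckb_mono (leqnn k) (fun p Up => Up) _ hc).
  have -> : 2 ^+ k * (B * ((1 + `|1|) ^+ k * eta)) = (C - 1) * eta.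
    by rewrite /C; move: (2 ^+ k) ((1 + `|1|) ^+ k) => x y; ring.
  rewrite mulrBl mul1r /eta [C * _]mulrC divfK ?gt_eqF// gerBl divr_ge0 ?ltW//.
have [v sv cv] := sol_small_sum (fun i => a 0 i) (fun i e' => hlow i chi e' gchi) e2.
exists (fun p => -1 * v p + cut_prod w (update h chi) p).
  apply: (sol_eq (sol_lin (-1) sv s0)) => p hp; rewrite mulN1r addKr mono_prod_update.
  rewrite lchi; last exact: nball_block.
  by rewrite mulrCA; congr (_ * _); rewrite mulrA mulfV// mul1r.
have := ckb_lin (-1) cv c0; rewrite normrN1 mul1r (_ : e / 2 + e / 2 = e)//; by field.
Qed.

(** Induction on a bound [L] for the degree in [x]: as every [m i] is positive, the
    derivatives that remain in [small_solution_step] have smaller degree. Each step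
    uses one preimage of [f]. *)
Lemma small_solution k L h : harmonics h -> forall w (f : 'rV[R]_(n J) -> R) e, (size w <= L)%N ->
  good (s J) L.+1 4 f -> 0 < e -> exists2 u, sol u (mono_prod w (update h f)) & ckb k B1 e u.
Proof.
move=> hh; elim: L => [|L IH] w f e wL gf e0; apply: (small_solution_step hh gf e0) => i chi e' gchi e'0.
  have [[c w'] [/= sz ->]] := pderiv_mono_prod R n w (m i) i.
  have c0 : c = 0.
    by apply/eqP/negPn/negP => /sz; rewrite leqNgt (leq_ltn_trans wL)// addn_gt0 hm orbT.
  exists (fun=> 0); last by apply: ckb_cst; rewrite normr0 ltW.
  by apply: (sol_eq (sol_zero a m A hn hs)) => p _; rewrite c0 mul0r.
have [[c w'] [/= sz ->]] := pderiv_mono_prod R n w (m i) i.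
have [c0|c0] := eqVneq c 0.
  exists (fun=> 0); last by apply: ckb_cst; rewrite normr0 ltW.
  by apply: (sol_eq (sol_zero a m A hn hs)) => p _; rewrite c0 mul0r.
have w'L : (size w' <= L)%N.
  by rewrite -ltnS; apply: leq_trans wL; apply: leq_trans (sz c0); rewrite -addn1 leq_add2l.
have nc : 0 < `|c| by rewrite normr_gt0.
have [v sv cv] := IH w' chi (e' / `|c|) w'L gchi (divr_gt0 e'0 nc).
exists (fun p => c * v p + 0).
  by apply: (sol_eq (sol_lin c sv (sol_zero a m A hn hs))) => p _; rewrite addr0.
have := ckb_scale c cv; rewrite mulrC divfK ?gt_eqF//; under [X in _ -> ckb _ _ _ X]eq_fun do rewrite addr0.
by [].
Qed.

(** With harmonic factors only the derivatives in [x] of the product contribute to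
    [Lambda], and these are removed by a small solution. *)
Lemma sol_harmonics k L w h e : harmonics h -> good (s J) L.+1 4 (h J) -> (size w <= L.+1)%N -> 0 < e ->
  exists2 u, sol u (fun=> 0) & ckb k B1 e (fun p => u p - mono_prod w h p).
Proof.
move=> hh gJ wL e0.
have mono_prodJ w' : mono_prod w' (update h (h J)) = mono_prod w' h by apply/funext => p; rewrite mono_prod_update -mono_prod_rest.
have [rJ sJ lJ] := hh J; have s0 := sol_update w hh rJ sJ.
have low i e' : 0 < e' -> exists2 v, sol v (pderiv (nseq (m i) (xcoord n i)) (mono_prod w h)) & ckb k B1 e' v.
  move=> e'0; have [[c w'] [/= sz ->]] := pderiv_mono_prod R n w (m i) i.
  have [c0|c0] := eqVneq c 0.
    exists (fun=> 0); last by apply: ckb_cst; rewrite normr0 ltW.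
    by apply: (sol_eq (sol_zero a m A hn hs)) => p _; rewrite c0 mul0r.
  have w'L : (size w' <= L)%N.
    by rewrite -ltnS; apply: leq_trans wL; apply: leq_trans (sz c0); rewrite -addn1 leq_add2l.
  have nc : 0 < `|c| by rewrite normr_gt0.
  have [v sv cv] := small_solution k hh w'L gJ (divr_gt0 e'0 nc).
  exists (fun p => c * v p + 0).
    by apply: (sol_eq (sol_lin c sv (sol_zero a m A hn hs))) => p _; rewrite addr0 mono_prodJ.
  have := ckb_scale c cv; rewrite mulrC divfK ?gt_eqF//; under [X in _ -> ckb _ _ _ X]eq_fun do rewrite addr0.
  by [].
have [v sv cv] := sol_small_sum (fun i => a 0 i) low e0.
exists (fun p => -1 * v p + cut_prod w (update h (h J)) p).
  apply: (sol_eq (sol_lin (-1) sv s0)) => p hp; rewrite mono_prodJ mulN1r addKr lJ ?mulr0//.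
  exact: nball_block.
have oN : open B1 by exact: open_nball.
have := ckb_scale (-1) cv; rewrite normrN1 mul1r; apply: (ckb_local oN) => p hp.
by rewrite -mono_prod_cut_prod// mono_prodJ addrK.
Qed.

Lemma monomial_blocks (W : seq 'I_nun) : exists w (ws : forall j, seq 'I_(n j)), forall p,
  \prod_(q <- W) p 0 q = mono_prod w (fun j X => \prod_(i <- ws j) X 0 i) p.
Proof.
elim: W => [|q W [w [ws IH]]].
  exists [::], (fun j => [::]) => p; rewrite big_nil /mono_prod /mono big_nil mul1r big1// => j _.
  by rewrite big_nil.
case: (coordP q) => [[i ->]|[j [i ->]]].
  by exists (i :: w), ws => p; rewrite big_cons IH /mono_prod /mono big_cons mulrA.
exists w, (@eqtype.dfwith 'I_N (fun j => seq 'I_(n j)) ws j (i :: ws j)) => p; rewrite big_cons IH /mono_prod mulrCA; congr (_ * _).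
rewrite (bigD1 j)//= [RHS](bigD1 j)//= eqtype.dfwith_in big_cons mulrA mxE; congr (_ * _).
by apply: eq_bigr => l lj; rewrite eqtype.dfwith_out// eq_sym.
Qed.

(** The error is the sum of two: the factors of the monomial in each block are
    replaced by harmonic functions, then the product is corrected. *)
Lemma sol_monomial k (W : seq 'I_nun) e : 0 < e ->
  exists2 u, sol u (fun=> 0) & ckb k B1 e (fun p => u p - \prod_(q <- W) p 0 q).
Proof.
move=> e0; have e2 : 0 < e / 2 by rewrite divr_gt0.
have [w [ws hW]] := monomial_blocks W.
pose f j (X : 'rV[R]_(n j)) : R := \prod_(i <- ws j) X 0 i.
have hf j : exists2 M, 0 <= M & ckb k B1 M (fun p => f j (block j p)).
  apply: ckb_prod => i _; exists 1 => //.
  under eq_fun do rewrite mxE; apply: ckb_coord => // p hp.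
  rewrite -(@ler_pXn2r _ 2) ?nnegrE// -normrX ger0_norm ?sqr_ge0// expr1n.
  by rewrite (le_trans (nsq_coord p _))// ltW.
have [C C0 hC] := prod_close (index_enum 'I_N) hf.
have [Mm Mm0 hMm] := @ckb_mono_x R d N n k w.
pose D := 2 ^+ k * (Mm * C) + 1 : R; have D0 : 0 < D by rewrite ltr_wpDl// !mulr_ge0// exprn_ge0.
pose eta := Num.min 1 (e / 2 / D); have eta0 : 0 < eta by rewrite lt_min ltr01 divr_gt0.
have eta1 : eta <= 1 by rewrite ge_min lexx.
have etaD : eta * D <= e / 2 by rewrite -ler_pdivlMr// ge_min lexx orbT.
(* [c2] is the constant of [ckb_block] *)
pose c2 := (1 + `|1|) ^+ k : R; have c20 : 0 < c2 by rewrite exprn_gt0// ltr_wpDr.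
have eta20 : 0 < eta / c2 by rewrite divr_gt0.
have H j : {phi : 'rV[R]_(n j) -> R | harmonic (s j) (size w).+1 4 phi /\
    ckb k (nball 4) (eta / c2) (fun X => phi X - f j X)}.
  apply: cid; have [phi h1 h2] := harmonic_monomial_approx (hn j) (hs j) (size w).+1 k (ws j) eta20.
  by exists phi.
pose h j := projT1 (H j).
have hh : harmonics h.
  by move=> j; have [[/good_base[r1 r2] r3] _] := projT2 (H j); split.
have gJ : good (s J) (size w).+1 4 (h J) by have [[g _] _] := projT2 (H J).
have close j : ckb k B1 eta (fun p => h j (block j p) - f j (block j p)).
  have [_ hj] := projT2 (H j).
  have hj1 : ckb k (nball 1) (eta / c2) (fun X => h j X - f j X).
    by apply: ckb_mono hj => // X X1; have h2 : nsq X < 1 := X1; rewrite /nball/=; lra.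
  have := ckb_block d (ltW eta20) hj1; rewrite -/c2 mulrC divfK//.
  by rewrite gt_eqF.
have [u su cu] := sol_harmonics k hh gJ (leqnSn (size w)) e2.
exists u => //.
have he : 0 < eta <= 1 by rewrite eta0.
have := ckb_mul hMm (hC eta (fun j p => h j (block j p)) he close) => h1.
have h2 : ckb k B1 (e / 2) (fun p => mono w p * (\prod_j h j (block j p) - \prod_j f j (block j p))).
  apply: (ckb_mono (leqnn k) (fun p Up => Up) _ h1); apply: le_trans etaD.
  have -> : 2 ^+ k * (Mm * (C * eta)) = eta * (D - 1) by rewrite /D; move: (2 ^+ k) => x; ring.
  by rewrite ler_wpM2l ?(ltW eta0)// gerBl.
have := ckb_lin 1 h2 cu; rewrite normr1 mul1r (_ : e / 2 + e / 2 = e); last by field.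
have T (x y z t : R) : 1 * (z * (x - y)) + (t - z * x) = t - z * y by ring.
congr ckb; apply/funext => p; rewrite hW /mono_prod; exact: T.
Qed.

Lemma sol_polynomial k P e : 0 < e ->
  exists2 u, sol u (fun=> 0) & ckb k B1 e (fun p => u p - peval P p).
Proof.
elim: P e => [|[c W] P IH] e e0.
  exists (fun=> 0); first exact: sol_zero.
  by under eq_fun do rewrite /peval big_nil subrr; apply: ckb_cst; rewrite normr0 ltW.
have e2 : 0 < e / 2 by rewrite divr_gt0.
have c1 : 0 < `|c| + 1 by rewrite ltr_wpDl.
have [u s1 b1] := IH _ e2; have [v s2 b2] := sol_monomial k W (divr_gt0 e2 c1).
exists (fun p => c * v p + u p).
  by apply: (sol_eq (sol_lin c s2 s1)) => p _; rewrite mulr0 addr0.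
have := ckb_lin c b2 b1 => hl.
apply: (ckb_mono (leqnn k) (fun p Up => Up) (M := `|c| * (e / 2 / (`|c| + 1)) + e / 2)).
  have : `|c| * (e / 2 / (`|c| + 1)) <= e / 2.
    by rewrite mulrA ler_pdivrMr// mulrC ler_wpM2l ?(ltW e2)// lerDl.
  lra.
move: hl; congr ckb; apply/funext => p; rewrite /peval big_cons /=.
by move: (\sum_(_ <- _) _) (\prod_(_ <- _) _) => y1 y2; ring.
Qed.

End solution.

Lemma Ck_norm_le (R : realType) n (k : nat) (M : R) (g : 'rV[R]_n -> R) : 0 <= M ->
  ckb k (eball n 1) M g -> (Ck_norm (eball n 1) k g <= (#|{ffun 'I_n -> 'I_k.+1}|%:R * M)%:E)%E.
Proof.
move=> M0 hg; rewrite /Ck_norm.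
have oB : open (eball n 1 : set 'rV[R]_n) by rewrite eball_nball; exact: open_nball.
apply: (@le_trans _ _ (\sum_(al : {ffun 'I_n -> 'I_k.+1}) M%:E)%E); last first.
  by rewrite sumEFin sumr_const mulr_natl.
rewrite big_mkcond; apply: lee_sum => al _; case: ifP => [hal|_]; last by rewrite lee_fin.
apply: ub_ereal_sup => _ [p hp <-]; rewrite lee_fin /mpderiv.
have sz : (size (flatten [seq nseq (al i) i | i <- enum 'I_n]) <= k)%N.
  rewrite size_flatten /shape -map_comp sumnE big_map big_enum/=.
  by under eq_bigr do rewrite size_nseq.
by have [] := ckb_pderiv oB hg sz hp.
Qed.

Theorem theorem2 (R : realType) (d N : nat) (n : 'I_N -> nat)
    (m : 'I_d -> nat) (a : 'rV[R]_d) (s : 'I_N -> R) (A : 'rV[R]_N)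
    (hN : (1 <= N)%N)
    (hn : forall j, (1 <= n j)%N)
    (hm : forall j, (0 < m j)%N)
    (ha : (0 < d)%N -> a != 0)
    (hs : forall j, 0 < s j < 1)
    (hA : A != 0)
    (k : nat) (f : 'rV[R]_(nu d n) -> R)
    (hf : Ck_closure (eball (nu d n) 1) k f)
    (eps : R) (heps : 0 < eps) :
  exists (u : 'rV[R]_(nu d n) -> R) (r : R),
    [/\ Cinfty (eball (nu d n) 1) u, continuous u & 1 < r] /\
    [/\ forall p, eball (nu d n) 1 p ->
          (forall j, fracLap_defined j (s j) u p) /\ Lambda a m A s u p = 0,
        (Ck_norm (eball (nu d n) 1) k (u \- f)%R <= eps%:E)%E
      & forall p, ~ eball (nu d n) r p -> u p = 0].
Proof.
have /rV0Pn[J AJ] := hA.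
pose c : R := #|{ffun 'I_(nu d n) -> 'I_k.+1}|%:R.
have c0 : 0 <= c by exact: ler0n.
have c1 : 0 < c + 1 by rewrite ltr_wpDl.
pose e := eps / (c + 1); have e0 : 0 < e by rewrite divr_gt0.
have e2 : 0 < e / 2 by rewrite divr_gt0.
have [P hP] := polynomial_density_closure hf e2.
have [u [cu [r0 zu] su du lu] hu] := sol_polynomial a hn hs hm AJ k P e2.
have oB : open (eball (nu d n) 1 : set 'rV[R]_(nu d n)) by rewrite eball_nball; exact: open_nball.
(* [r0] bounds the square of the distance, hence the distance itself is at most
   [|r0| + 2] on the support *)
exists u, (`|r0| + 2); split.
  split => //; last by have := normr_ge0 r0; lra.
  by apply: ckb_Cinfty => // k'; rewrite eball_nball; have [M _ hM] := su k'; exists M.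
split => [p hp||p hp].
- by rewrite eball_nball in hp; split; [exact: du|exact: lu].
- have huf : ckb k (eball (nu d n) 1) e (u \- f)%R.
    have hu' : ckb k (eball (nu d n) 1) (e / 2) (fun p => u p - peval P p) by rewrite eball_nball.
    have := ckb_lin 1 hu' hP; rewrite normr1 mul1r (_ : e / 2 + e / 2 = e); last by field.
    by congr ckb; apply/funext => p /=; move: (peval P p) => y; ring.
  apply: (le_trans (Ck_norm_le (ltW e0) huf)); rewrite lee_fin -/c /e mulrA ler_pdivrMr// mulrC.
  by rewrite ler_wpM2l ?(ltW heps)// lerDl.
- apply: zu; have h : `|r0| + 2 <= enorm p by rewrite leNgt; exact/negP.
  rewrite -enorm_sq; have h0 := normr_ge0 r0; have h1 := ler_norm r0.
  rewrite (le_trans (y := enorm p))//; first lra.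
  by rewrite expr2 ler_peMl//; lra.
Qed.
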